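(* Suppose the feasibility assumption, the Lipschitz-gradient assumption, the variance assumption and the monotonicity assumption on $\{\theta_{1,k}\},\{\theta_{2,k}\}$ listed in the context hold. Let $\{(x_k,y_k,\lambda_k)\}$ be a sequence generated by the ZO-RMPDPG algorithm described in the context (with $\rho_k=0$, $\tilde\alpha_k=\tilde\alpha$, $\tilde\gamma_k=\tilde\gamma$ for all $k\ge1$). Set $\eta_k=\frac{A_3}{(k+2)^{1/3}}$, $\varrho_k=\frac{A_4}{(k+2)^{2/3}}$, $\iota_k=\frac{A_5}{(k+2)^{2/3}}$, $$\theta_{1,k}=\frac{\varepsilon}{L(k+2)^{1/3}}\sqrt{\frac{D_1}{d_x\left(3D_1+4\tilde\alpha+\frac{12A_1}{bA_3^2}\right)}},\qquad \theta_{2,k}=\frac{\varepsilon}{L(k+2)^{1/3}}\sqrt{\frac{D_1}{d_y\left(3D_1+\frac{12A_2}{bA_3^2}+\frac{320\tilde\alpha L^2}{\mu^2}\right)}},$$ with $$A_3\le\min\left\{1,\frac{\mu}{8\tilde\alpha L^2},\frac{\mu}{4\tilde\gamma L^2}\right\},\quad A_4\ge\frac{3A_3^2\tilde\alpha+A_1}{A_1},\quad A_5\ge\frac{480A_3^2\tilde\alpha L^2+A_2\mu^2}{A_2\mu^2},$$ $$A_1\le\min\left\{\frac{b}{72\tilde\alpha L^2},\frac{11\tilde\alpha b}{9\mu\tilde\beta},\frac{b}{144\tilde\gamma L^2}\right\},\qquad A_2\le\min\left\{\frac{b}{72\tilde\alpha L^2},\frac{11\tilde\alpha b}{9\mu\tilde\beta},\frac{b}{144\tilde\gamma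 L^2}\right\}.$$ If $0<\tilde\beta\le\frac1{6L}$, $0<\tilde\alpha\le\frac{\mu^2\tilde\beta}{64L^2}$ and $0<\tilde\gamma\le\min\left\{\frac{2\tilde\alpha L^2}{\|B\|^2},\frac{\mu^4\tilde\beta^2}{1280L^4\tilde\alpha}\right\}$, then for any given $\varepsilon>0$, $$\frac{\varepsilon^2}{4}\le\frac{C_1+C_2\ln(T_2(\varepsilon)+2)}{D_1A_3\left(\frac32(T_2(\varepsilon)+3)^{2/3}-\frac{3\cdot4^{2/3}}{2}\right)},$$ where $T_2(\varepsilon):=\min\{k:\mathbb E\|\nabla\mathcal G^{\tilde\alpha,\tilde\beta,\tilde\gamma}(x_k,y_k,\lambda_k)\|^2\le\varepsilon^2\}$, $C_1=S_2(x_2,y_2,\lambda_2)-\underline S+16\tilde\alpha L^2\eta_1\sigma_y^2$, $C_2=\frac{2\delta^2(A_4^2A_1+A_5^2A_2)}{bA_3}$, with $\underline S=\min_{\lambda\in\Lambda}\min_{x\in\mathcal X}\min_{y\in\mathcal Y}S_k(x,y,\lambda)$, $$D_1=\frac{\min\left\{\frac1{4\tilde\alpha},\frac{2\tilde\alpha L^2}{\mu\tilde\beta},\frac1{4\tilde\gamma},\frac{A_1A_4}{3A_3^2},\frac{A_2A_5}{3A_3^2}\right\}}{\max\left\{\frac3{\tilde\alpha^2}+3\|A\|^2,\frac3{\tilde\beta^2}+3\|B\|^2,\frac3{\tilde\gamma^2},3\right\}}$$ and $\sigma_y=\max\{\|y\|:y\in\mathcal Y\}$. Moreover, for any $i\in\{1,\dots,p\}$,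 when $k=T_2(\varepsilon)$, $$\max\{0,[Ax_k+By_k-c]_i\}\le\varepsilon.$$
   Context: Problem: $\min_{x\in\mathcal X}\max_{y\in\mathcal Y,\ Ax+By\unlhd c}g(x,y)$ with $g(x,y)=\mathbb E_{\zeta\sim D}[G(x,y,\zeta)]$, where $\unlhd$ denotes $\le$ or $=$; $\mathcal X\subseteq\mathbb R^{d_x}$ and $\mathcal Y\subseteq\mathbb R^{d_y}$ are nonempty, convex and compact; $A\in\mathbb R^{p\times d_x}$, $B\in\mathbb R^{p\times d_y}$, $c\in\mathbb R^p$; $G(x,y,\zeta):\mathcal X\times\mathcal Y\to\mathbb R$ is smooth, and $\zeta$ is a random variable with unknown distribution $D$. $\Lambda=\mathbb R^p_+$ if $\unlhd$ is $\le$, $\Lambda=\mathbb R^p$ if $\unlhd$ is $=$. $\|\cdot\|$ is the Euclidean norm and its induced matrix norm; $[\cdot]_i$ is the $i$th component; $\mathcal P_{\mathcal Z}$ is Euclidean projection onto $\mathcal Z$; $\mathbb E$ is expectation. Strong concavity: for any given $x\in\mathcal X$, $G(x,y,\zeta)$ is $\mu$-strongly concave in $y$, $\mu>0$ (a differentiable $h$ is $\mu$-strongly concave if $h(y')\le h(y)+\langle\nabla h(y),y'-y\rangle-\frac\mu2\|y'-y\|^2$ for all $y,y'$). Assumptions. Feasibility: when $\unlhd$ is $\le$, for every $x\in\mathcal X$ there exists $y$ in the relative interior of $\mathcal Y$ with $Ax+By-c\le0$. Lipschitz gradients: for any given $\zeta$ there is a constant $l>0$ such that for all $x,x_1,x_2\in\mathcal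 X$, $y,y_1,y_2\in\mathcal Y$: $\|\nabla_xG(x_1,y,\zeta)-\nabla_xG(x_2,y,\zeta)\|\le l\|x_1-x_2\|$, $\|\nabla_xG(x,y_1,\zeta)-\nabla_xG(x,y_2,\zeta)\|\le l\|y_1-y_2\|$, $\|\nabla_yG(x,y_1,\zeta)-\nabla_yG(x,y_2,\zeta)\|\le l\|y_1-y_2\|$, $\|\nabla_yG(x_1,y,\zeta)-\nabla_yG(x_2,y,\zeta)\|\le l\|x_1-x_2\|$. Put $L=\max\{l,\|A\|,\|B\|\}$. Variance: there is a constant $\delta>0$ such that for all $x,y$, $\mathbb E\|\widehat\nabla_xG_k(x,y;\zeta)-\widehat\nabla_xg_k(x,y)\|^2\le\delta^2$ and $\mathbb E\|\widehat\nabla_yG_k(x,y;\zeta)-\widehat\nabla_yg_k(x,y)\|^2\le\delta^2$ (estimators defined below). Monotonicity: $\{\theta_{1,k}\}$ and $\{\theta_{2,k}\}$ are nonnegative monotonically decreasing sequences. Notation: $\mathcal L_g(x,y,\lambda)=g(x,y)-\lambda^\top(Ax+By-c)$, $\Phi(x,\lambda)=\max_{y\in\mathcal Y}\mathcal L_g(x,y,\lambda)$, $y^*(x,\lambda)=\arg\max_{y\in\mathcal Y}\mathcal L_g(x,y,\lambda)$. Zeroth-order estimators with smoothing parameters $\theta_{1,k},\theta_{2,k}$: for $h=g$ or $h=G(\cdot,\cdot;\zeta)$, $\widehat\nabla_xh_k(x,y)=\sum_{i=1}^{d_x}\frac{h(x+\theta_{1,k}u_i,y)-h(x,y)}{\theta_{1,k}}u_i$,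 $\widehat\nabla_yh_k(x,y)=\sum_{i=1}^{d_y}\frac{h(x,y+\theta_{2,k}v_i)-h(x,y)}{\theta_{2,k}}v_i$, where $\{u_i\}$, $\{v_i\}$ are the standard bases of $\mathbb R^{d_x}$, $\mathbb R^{d_y}$. With $\rho_k=0$: $\widehat\nabla_x\tilde{\mathcal L}_{g,k}(x,y,\lambda)=\widehat\nabla_xg_k(x,y)-A^\top\lambda$, $\widehat\nabla_y\tilde{\mathcal L}_{g,k}(x,y,\lambda)=\widehat\nabla_yg_k(x,y)-B^\top\lambda$, and for $I=\{\zeta_1,\dots,\zeta_b\}$ drawn i.i.d., $\widehat\nabla_x\tilde{\mathcal L}_{G,k}(x,y,\lambda;I)=\frac1b\sum_{j=1}^b\widehat\nabla_xG_k(x,y;\zeta_j)-A^\top\lambda$, $\widehat\nabla_y\tilde{\mathcal L}_{G,k}(x,y,\lambda;I)=\frac1b\sum_{j=1}^b\widehat\nabla_yG_k(x,y;\zeta_j)-B^\top\lambda$. ZO-RMPDPG algorithm: inputs $x_1,y_1,\lambda_1$, step sizes $\tilde\alpha,\tilde\beta,\tilde\gamma$, $0<\eta_1\le1$, batch size $b$, $\varrho_0=\iota_0=1$; parameters $0<\varrho_k\le1$, $0<\iota_k\le1$. With mini-batch samples $I_k=\{\zeta^k_i\}_{i=1}^b$, for $k=1,2,\dots$ compute $v_k=\widehat\nabla_x\tilde{\mathcal L}_{G,k}(x_k,y_k,\lambda_k;I_k)+(1-\varrho_{k-1})[v_{k-1}-\widehat\nabla_x\tilde{\mathcal L}_{G,k-1}(x_{k-1},y_{k-1},\lambda_{k-1};I_k)]$,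 $w_k=\widehat\nabla_y\tilde{\mathcal L}_{G,k}(x_k,y_k,\lambda_k;I_k)+(1-\iota_{k-1})[w_{k-1}-\widehat\nabla_y\tilde{\mathcal L}_{G,k-1}(x_{k-1},y_{k-1},\lambda_{k-1};I_k)]$ (the bracketed terms drop out at $k=1$ because $\varrho_0=\iota_0=1$), then $\tilde x_{k+1}=\mathcal P_{\mathcal X}(x_k-\tilde\alpha v_k)$, $x_{k+1}=x_k+\eta_k(\tilde x_{k+1}-x_k)$; $\tilde y_{k+1}=\mathcal P_{\mathcal Y}(y_k+\tilde\beta w_k)$, $y_{k+1}=y_k+\eta_k(\tilde y_{k+1}-y_k)$; $\tilde\lambda_{k+1}=\mathcal P_\Lambda(\lambda_k+\tilde\gamma(Ax_{k+1}+By_{k+1}-c))$, $\lambda_{k+1}=\lambda_k+\eta_k(\tilde\lambda_{k+1}-\lambda_k)$. Potential function: $F_{k+1}(x_{k+1},y_{k+1},\lambda_{k+1})=\mathbb E\big[\Phi(x_{k+1},\lambda_{k+1})+\frac{32\tilde\alpha L^2}{\tilde\beta\mu}\|y_{k+1}-y^*(x_{k+1},\lambda_{k+1})\|^2+\frac{A_1}{\eta_k}\|\widehat\nabla_x\tilde{\mathcal L}_{g,k+1}(x_{k+1},y_{k+1},\lambda_{k+1})-v_{k+1}\|^2+\frac{A_2}{\eta_k}\|\widehat\nabla_y\tilde{\mathcal L}_{g,k+1}(x_{k+1},y_{k+1},\lambda_{k+1})-w_{k+1}\|^2\big]$, $S_{k+1}(x_{k+1},y_{k+1},\lambda_{k+1})=F_{k+1}(x_{k+1},y_{k+1},\lambda_{k+1})-4\eta_k\tilde\alpha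 L^2\,\mathbb E\|y_{k+1}-y^*(x_{k+1},\lambda_{k+1})\|^2$. Stationarity gap: for $\alpha,\beta,\gamma>0$, $\nabla\mathcal G^{\alpha,\beta,\gamma}(x,y,\lambda)$ is the vector with blocks $\frac1\alpha(x-\mathcal P_{\mathcal X}(x-\alpha\nabla_x\mathcal L_g(x,y,\lambda)))$, $\frac1\beta(y-\mathcal P_{\mathcal Y}(y+\beta\nabla_y\mathcal L_g(x,y,\lambda)))$, $\frac1\gamma(\lambda-\mathcal P_\Lambda(\lambda-\gamma\nabla_\lambda\mathcal L_g(x,y,\lambda)))$.
   Formalization: The final constraint bound is proved in expectation (pathwise it can fail); G and its smoothness, Lipschitz and strong-concavity assumptions live on an open set containing X×Y and all estimator query points; underline S is an infimum over k≥2 and over random points of X, Y, Λ. *)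

(* Defs.v *)
From HB Require Import structures.
From mathcomp Require Import all_boot all_order all_algebra.
From mathcomp Require Import all_classical all_reals all_analysis.

Set Implicit Arguments.
Unset Strict Implicit.
Unset Printing Implicit Defensive.

Import Order.TTheory GRing.Theory Num.Theory.
Import numFieldNormedType.Exports.

Local Open Scope classical_set_scope.
Local Open Scope ring_scope.

(* R^n is 'cV[R]_n. Its library norm `|x| is the sup norm, which gives the
   topology; the Euclidean norm is the separate function enorm. *)
Section Euclidean.
Variable R : realType.

Definition dotv n (u v : 'cV[R]_n) : R := \sum_i u i 0 * v i 0.

Definition enorm n (u : 'cV[R]_n) : R := Num.sqrt (\sum_i (u i 0) ^+ 2).

Definition opnorm m n (M : 'M[R]_(m, n)) : R :=
  sup [set enorm (M *m u) | u in [set u : 'cV[R]_n | enorm u <= 1]].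

Definition basis_vec n (i : 'I_n) : 'cV[R]_n := delta_mx i 0.

Definition gradient n (h : 'cV[R]_n -> R) (u : 'cV[R]_n) : 'cV[R]_n :=
  \col_i 'D_(basis_vec i) h u.

(* get returns an arbitrary point when there is no nearest one; for a nonempty
   closed convex set there is exactly one. *)
Definition proj n (S : set 'cV[R]_n) (u : 'cV[R]_n) : 'cV[R]_n :=
  get [set z | S z /\ forall z', S z' -> enorm (u - z) <= enorm (u - z')].

Definition aff_hull n (S : set 'cV[R]_n) : set 'cV[R]_n :=
  [set z | exists m (s : 'I_m -> 'cV[R]_n) (a : 'I_m -> R),
     [/\ forall i, S (s i), \sum_i a i = 1 & z = \sum_i a i *: s i]].

Definition relint n (S : set 'cV[R]_n) : set 'cV[R]_n :=
  [set y | S y /\ exists2 r : R, 0 < r &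
     forall z, aff_hull S z -> enorm (z - y) < r -> S z].

Definition strongly_concave_on n (V : set 'cV[R]_n) (mu : R)
    (h : 'cV[R]_n -> R) : Prop :=
  forall y y', V y -> V y' ->
    h y' <= h y + dotv (gradient h y) (y' - y) - mu / 2 * enorm (y' - y) ^+ 2.

End Euclidean.

Inductive constr_kind := Le_constr | Eq_constr.

Section Problem.
Variables (R : realType) (dx dy p : nat).
Implicit Types (x : 'cV[R]_dx) (y : 'cV[R]_dy) (lam : 'cV[R]_p).

Definition constr (kind : constr_kind) (u v : 'cV[R]_p) : Prop :=
  match kind with
  | Le_constr => forall i, u i 0 <= v i 0
  | Eq_constr => u = v
  end.

Definition multipliers (kind : constr_kind) : set 'cV[R]_p :=
  match kind with
  | Le_constr => [set lam | forall i, 0 <= lam i 0]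
  | Eq_constr => setT
  end.

Definition lagrangian (A : 'M[R]_(p, dx)) (B : 'M[R]_(p, dy)) (c : 'cV[R]_p)
    (g : 'cV[R]_dx -> 'cV[R]_dy -> R) x y lam : R :=
  g x y - dotv lam (A *m x + B *m y - c).

Section Lag.
Variables (X : set 'cV[R]_dx) (Y : set 'cV[R]_dy) (Lam : set 'cV[R]_p).
Variable Lg : 'cV[R]_dx -> 'cV[R]_dy -> 'cV[R]_p -> R.

Definition dual_val x lam : R := sup [set Lg x y lam | y in Y].

Definition dual_argmax x lam : 'cV[R]_dy :=
  get [set y | Y y /\ forall y', Y y' -> Lg x y' lam <= Lg x y lam].

Definition gap (alpha beta gamma : R) x y lam : 'cV[R]_(dx + dy + p) :=
  col_mx
    (col_mx
       (alpha^-1 *: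
          (x - proj X (x - alpha *: gradient (fun x' => Lg x' y lam) x)))
       (beta^-1 *:
          (y - proj Y (y + beta *: gradient (fun y' => Lg x y' lam) y))))
    (gamma^-1 *:
       (lam - proj Lam (lam - gamma *: gradient (fun lam' => Lg x y lam') lam))).

End Lag.

Definition lipschitz_gradients (U : set 'cV[R]_dx) (V : set 'cV[R]_dy) (l : R)
    (h : 'cV[R]_dx -> 'cV[R]_dy -> R) : Prop :=
  let gx x y := gradient (fun x' => h x' y) x in
  let gy x y := gradient (fun y' => h x y') y in
  forall x x1 x2 y y1 y2, U x -> U x1 -> U x2 -> V y -> V y1 -> V y2 ->
  [/\ enorm (gx x1 y - gx x2 y) <= l * enorm (x1 - x2),
      enorm (gx x y1 - gx x y2) <= l * enorm (y1 - y2),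
      enorm (gy x y1 - gy x y2) <= l * enorm (y1 - y2) &
      enorm (gy x1 y - gy x2 y) <= l * enorm (x1 - x2)].

End Problem.

Section ZerothOrder.
Variable R : realType.

Definition zo_grad n (theta : R) (h : 'cV[R]_n -> R) (u : 'cV[R]_n) :
    'cV[R]_n :=
  \sum_i ((h (u + theta *: basis_vec R i) - h u) / theta) *: basis_vec R i.

Variables (dx dy : nat).

Definition zo_gradx (theta : R) (h : 'cV[R]_dx -> 'cV[R]_dy -> R) x y :=
  zo_grad theta (fun x' => h x' y) x.

Definition zo_grady (theta : R) (h : 'cV[R]_dx -> 'cV[R]_dy -> R) x y :=
  zo_grad theta (fun y' => h x y') y.

(* The mean over a mini-batch I of the estimators for h = G(., ., I j). *)
Variables (Z : Type) (b : nat).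

Definition batch_gradx theta (G : 'cV[R]_dx -> 'cV[R]_dy -> Z -> R)
    x y (I : 'I_b -> Z) :=
  b%:R^-1 *: \sum_j zo_gradx theta (fun x' y' => G x' y' (I j)) x y.

Definition batch_grady theta (G : 'cV[R]_dx -> 'cV[R]_dy -> Z -> R)
    x y (I : 'I_b -> Z) :=
  b%:R^-1 *: \sum_j zo_grady theta (fun x' y' => G x' y' (I j)) x y.

End ZerothOrder.

Section Algorithm.
Context (R : realType) (dx dy p b : nat) (Z Omega : Type).
Variables (X : set 'cV[R]_dx) (Y : set 'cV[R]_dy) (Lam : set 'cV[R]_p).
Variables (A : 'M[R]_(p, dx)) (B : 'M[R]_(p, dy)) (c : 'cV[R]_p).
Variable G : 'cV[R]_dx -> 'cV[R]_dy -> Z -> R.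
Variables alpha beta gamma : R.
Variables eta varrho iota theta1 theta2 : nat -> R.
Variables (x1 : 'cV[R]_dx) (y1 : 'cV[R]_dy) (lam1 : 'cV[R]_p).
Variable zeta : nat -> 'I_b -> Omega -> Z.

(* Sequences are indexed from 1. Entries of index 0 occur in zo_v and zo_w for
   k = 0 only, where they are multiplied by 1 - varrho 0 = 1 - iota 0 = 0. *)
Record zo_rmpdpg (x xt : nat -> Omega -> 'cV[R]_dx)
    (y yt : nat -> Omega -> 'cV[R]_dy) (lam lamt : nat -> Omega -> 'cV[R]_p)
    (v : nat -> Omega -> 'cV[R]_dx) (w : nat -> Omega -> 'cV[R]_dy) : Prop := {
  zo_x1 : forall om, x 1%N om = x1;
  zo_y1 : forall om, y 1%N om = y1;
  zo_lam1 : forall om, lam 1%N om = lam1;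
  zo_varrho0 : varrho 0%N = 1;
  zo_iota0 : iota 0%N = 1;
  zo_v : forall k om, v k.+1 om =
    (batch_gradx (theta1 k.+1) G (x k.+1 om) (y k.+1 om)
       (fun j => zeta k.+1 j om) - A^T *m lam k.+1 om)
    + (1 - varrho k) *:
      (v k om - (batch_gradx (theta1 k) G (x k om) (y k om)
                   (fun j => zeta k.+1 j om) - A^T *m lam k om));
  zo_w : forall k om, w k.+1 om =
    (batch_grady (theta2 k.+1) G (x k.+1 om) (y k.+1 om)
       (fun j => zeta k.+1 j om) - B^T *m lam k.+1 om)
    + (1 - iota k) *:
      (w k om - (batch_grady (theta2 k) G (x k om) (y k om)
                   (fun j => zeta k.+1 j om) - B^T *m lam k om));
  zo_xt : forall k om, (0 < k)%N ->
    xt k.+1 om = proj X (x k om - alpha *: v k om);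
  zo_x : forall k om, (0 < k)%N ->
    x k.+1 om = x k om + eta k *: (xt k.+1 om - x k om);
  zo_yt : forall k om, (0 < k)%N ->
    yt k.+1 om = proj Y (y k om + beta *: w k om);
  zo_y : forall k om, (0 < k)%N ->
    y k.+1 om = y k om + eta k *: (yt k.+1 om - y k om);
  zo_lamt : forall k om, (0 < k)%N ->
    lamt k.+1 om = proj Lam (lam k om
      + gamma *: (A *m x k.+1 om + B *m y k.+1 om - c));
  zo_lam : forall k om, (0 < k)%N ->
    lam k.+1 om = lam k om + eta k *: (lamt k.+1 om - lam k om)
}.

End Algorithm.

Section Random.
Context (R : realType) (dO dZ : measure_display)
  (Omega : measurableType dO) (Z : measurableType dZ).

(* The samples zeta k j, k >= 1, are mutually independent with law D. *)
Definition iid_samples (P : probability Omega R) (D : probability Z R) b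
    (zeta : nat -> 'I_b -> Omega -> Z) : Prop :=
  [/\ forall k j, (0 < k)%N -> measurable_fun setT (zeta k j),
      forall k j E, (0 < k)%N -> measurable E -> P (zeta k j @^-1` E) = D E &
      forall (s : seq (nat * 'I_b)) (E : nat * 'I_b -> set Z),
        uniq s -> all (fun kj => 0 < kj.1)%N s ->
        (forall kj, measurable (E kj)) ->
        P (\big[setI/setT]_(kj <- s) (zeta kj.1 kj.2 @^-1` E kj)) =
        (\prod_(kj <- s) P (zeta kj.1 kj.2 @^-1` E kj))%E].

Definition random_vec_in n (S : set 'cV[R]_n) (u : Omega -> 'cV[R]_n) : Prop :=
  (forall i, measurable_fun setT (fun om => u om i 0)) /\ forall om, S (u om).

End Random.

(* T is the minimum of {k >= 1 | Q k}. *)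
Definition least_index (Q : nat -> Prop) (T : nat) : Prop :=
  [/\ (0 < T)%N, Q T & forall k, (0 < k)%N -> Q k -> (T <= k)%N].

(* Main.v *)
Require Import Defs.
From HB Require Import structures.
From mathcomp Require Import all_boot all_order all_algebra.
From mathcomp Require Import all_classical all_reals all_analysis.
From mathcomp Require Import measurable_realfun ring lra.

Set Implicit Arguments.
Unset Strict Implicit.
Unset Printing Implicit Defensive.

Import Order.TTheory GRing.Theory Num.Theory.
Import numFieldNormedType.Exports.

Local Open Scope classical_set_scope.
Local Open Scope ring_scope.

Local Notation proj := Defs.proj.

(** The proof follows a potential function along the algorithm. The potential
    adds to the mean of the dual function Phi(x, lambda) a multiple of the mean
    squared distance of y to the inner maximizer y*(x, lambda), and the mean
    squared errors of the two momentum estimators with weights A1/eta and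
    A2/eta.

    Pointwise, one step changes Phi by the decrease of a projected gradient step
    in x and lambda, plus cross terms that contain the distance of y to y* and
    the momentum error; the projected ascent step in y contracts that distance
    because the objective is strongly concave in y, and y* itself moves in a
    Lipschitz way with (x, lambda). The small ratios alpha/beta and
    alpha gamma/beta^2 make the contraction absorb all cross terms (one_step).

    In expectation, the recursive momentum estimator satisfies a linear
    recursion: its error is multiplied by 1 - rho, and a fresh mini-batch,
    independent of the past, adds a centred term whose second moment is that of
    an increment plus rho^2 times the variance bound (storm_step, err_step).
    Independence of the past is used through Fubini for the joint law of the
    history and the new sample (integral_fresh). The finite differences are
    Lipschitz in the iterates and differ from the true gradients by a bias of
    the order of theta.

    The weights turn these recursions into a decrease of the potential
    (potential_step): the potential loses D1 eta_k times the mean squared gap,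
    up to a bias of eps^2 D1 eta_k / 2 and a noise C2 / (k + 2)
    (potential_descent). Summing from k = 2 while the gap exceeds eps gives the
    bound, as the sum of (k + 2)^(-1/3) is at least half of the integral in the
    denominator and the sum of 1/(k + 2) is at most a logarithm (rate_ge3).

    The sum is empty when the second iterate is the first one with a small gap,
    although the bound still claims something. Then the descent from the second
    to the third potential is estimated more sharply, by comparing the second
    projected step with the residual of the first (rate_2). When the first
    iterate already has a small gap the denominator vanishes and the quotient is
    infinite. Such an iterate exists because the potential is bounded below if
    the constraints are feasible (exists_small_gap). The violation of a
    constraint is a component of the multiplier block of the gap
    (violation_le_gap), so Jensen's inequality bounds its mean. *)

(** * Euclidean geometry *)

Section EuclideanGeometry.
Variable R : realType.

Lemma dotvC n (u v : 'cV[R]_n) : dotv u v = dotv v u.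
Proof. by apply: eq_bigr => i _; rewrite mulrC. Qed.

Lemma dotvDl n (u v w : 'cV[R]_n) : dotv (u + v) w = dotv u w + dotv v w.
Proof. by rewrite -big_split; apply: eq_bigr => i _; rewrite mxE mulrDl. Qed.

Lemma dotvZl n a (u v : 'cV[R]_n) : dotv (a *: u) v = a * dotv u v.
Proof. by rewrite /dotv mulr_sumr; apply: eq_bigr => i _; rewrite mxE mulrA. Qed.

Lemma dotvNl n (u v : 'cV[R]_n) : dotv (- u) v = - dotv u v.
Proof. by rewrite -scaleN1r dotvZl mulN1r. Qed.

Lemma dotvBl n (u v w : 'cV[R]_n) : dotv (u - v) w = dotv u w - dotv v w.
Proof. by rewrite dotvDl dotvNl. Qed.

Lemma dotvDr n (u v w : 'cV[R]_n) : dotv w (u + v) = dotv w u + dotv w v.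
Proof. by rewrite dotvC dotvDl !(dotvC w). Qed.

Lemma dotvZr n a (u v : 'cV[R]_n) : dotv v (a *: u) = a * dotv v u.
Proof. by rewrite dotvC dotvZl dotvC. Qed.

Lemma dotvNr n (u v : 'cV[R]_n) : dotv v (- u) = - dotv v u.
Proof. by rewrite dotvC dotvNl dotvC. Qed.

Lemma dotvBr n (u v w : 'cV[R]_n) : dotv w (u - v) = dotv w u - dotv w v.
Proof. by rewrite dotvDr dotvNr. Qed.

Lemma dot0v n (u : 'cV[R]_n) : dotv 0 u = 0.
Proof. by rewrite -(scale0r u) dotvZl mul0r. Qed.

Lemma dotv0 n (u : 'cV[R]_n) : dotv u 0 = 0.
Proof. by rewrite dotvC dot0v. Qed.

Lemma dotv_ge0 n (u : 'cV[R]_n) : 0 <= dotv u u.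
Proof. by apply: sumr_ge0 => i _; rewrite -expr2 sqr_ge0. Qed.

Lemma enormE n (u : 'cV[R]_n) : enorm u = Num.sqrt (dotv u u).
Proof. by congr Num.sqrt; apply: eq_bigr => i _; rewrite expr2. Qed.

Lemma enorm_ge0 n (u : 'cV[R]_n) : 0 <= enorm u.
Proof. exact: sqrtr_ge0. Qed.

Lemma sqr_enorm n (u : 'cV[R]_n) : enorm u ^+ 2 = dotv u u.
Proof. by rewrite enormE sqr_sqrtr ?dotv_ge0. Qed.

Lemma enorm0 n : enorm (0 : 'cV[R]_n) = 0.
Proof. by rewrite enormE dot0v sqrtr0. Qed.

Lemma enormZ n a (u : 'cV[R]_n) : enorm (a *: u) = `|a| * enorm u.
Proof.
by rewrite !enormE dotvZl dotvZr mulrA -expr2 sqrtrM ?sqr_ge0// sqrtr_sqr.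
Qed.

Lemma enormN n (u : 'cV[R]_n) : enorm (- u) = enorm u.
Proof. by rewrite -scaleN1r enormZ normrN1 mul1r. Qed.

Lemma enormC n (u v : 'cV[R]_n) : enorm (u - v) = enorm (v - u).
Proof. by rewrite -opprB enormN. Qed.

Lemma enorm_coord n (u : 'cV[R]_n) i : `|u i 0| <= enorm u.
Proof.
rewrite -sqrtr_sqr ler_sqrt; last by apply: sumr_ge0 => j _; rewrite sqr_ge0.
by rewrite (bigD1 i)//= lerDl sumr_ge0// => j _; rewrite sqr_ge0.
Qed.

Lemma enorm_eq0 n (u : 'cV[R]_n) : enorm u = 0 -> u = 0.
Proof.
move=> u0; apply/colP => i; rewrite mxE; apply/eqP.
by rewrite -normr_le0 -u0 enorm_coord.
Qed.

Lemma dotv_le n (u v : 'cV[R]_n) : dotv u v <= enorm u * enorm v.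
Proof.
have [v0|v0] := eqVneq (enorm v) 0.
  by rewrite (enorm_eq0 v0) dotv0 enorm0 mulr0.
have vp : 0 < enorm v by rewrite lt_neqAle eq_sym v0 enorm_ge0.
have [u0|u0] := eqVneq (enorm u) 0.
  by rewrite (enorm_eq0 u0) dot0v enorm0 mul0r.
have up : 0 < enorm u by rewrite lt_neqAle eq_sym u0 enorm_ge0.
have := dotv_ge0 (enorm v *: u - enorm u *: v).
rewrite !(dotvBl, dotvBr, dotvZl, dotvZr) -!sqr_enorm (dotvC v u).
set a := enorm v in vp *; set b := enorm u in up *; set d := dotv u v.
move=> h; have {h} : 0 <= a * b * (a * b - d) by nra.
by rewrite pmulr_rge0 ?mulr_gt0// subr_ge0 mulrC.
Qed.

Lemma dotv_ge n (u v : 'cV[R]_n) : - (enorm u * enorm v) <= dotv u v.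
Proof. by rewrite lerNl -dotvNl -(enormN u); exact: dotv_le. Qed.

Lemma enormD n (u v : 'cV[R]_n) : enorm (u + v) <= enorm u + enorm v.
Proof.
rewrite -(ler_pXn2r (n := 2)) ?nnegrE ?addr_ge0 ?enorm_ge0//.
rewrite sqr_enorm !(dotvDl, dotvDr) (dotvC v u) sqrrD !sqr_enorm.
by have := dotv_le u v; lra.
Qed.

Lemma enormB n (u v : 'cV[R]_n) : enorm (u - v) <= enorm u + enorm v.
Proof. by rewrite -(enormN v) enormD. Qed.

Lemma enorm_dist n (u v : 'cV[R]_n) : `|enorm u - enorm v| <= enorm (u - v).
Proof.
rewrite ler_norml -(enormC v u); apply/andP; split.
  rewrite lerNl opprB lerBlDr; apply: le_trans (enormD _ _).
  by rewrite subrK.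
by rewrite enormC lerBlDr; apply: le_trans (enormD _ _); rewrite subrK.
Qed.

Lemma enorm_sum n (I : finType) (P : pred I) (F : I -> 'cV[R]_n) :
  enorm (\sum_(i | P i) F i) <= \sum_(i | P i) enorm (F i).
Proof.
elim/big_ind2 : _ => [|a b u v ab uv|//]; first by rewrite enorm0.
exact: le_trans (enormD _ _) (lerD ab uv).
Qed.

Lemma sqr_enormD n (u v : 'cV[R]_n) :
  enorm (u + v) ^+ 2 = enorm u ^+ 2 + 2 * dotv u v + enorm v ^+ 2.
Proof. by rewrite !sqr_enorm !(dotvDl, dotvDr) (dotvC v u); lra. Qed.

Lemma sqr_enormB n (u v : 'cV[R]_n) :
  enorm (u - v) ^+ 2 = enorm u ^+ 2 - 2 * dotv u v + enorm v ^+ 2.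
Proof. by rewrite sqr_enormD dotvNr enormN; lra. Qed.

Lemma sqr_enormZ n a (u : 'cV[R]_n) : enorm (a *: u) ^+ 2 = a ^+ 2 * enorm u ^+ 2.
Proof. by rewrite enormZ exprMn real_normK ?num_real. Qed.

Lemma dotv_mulmx m n (M : 'M[R]_(m, n)) u v :
  dotv (M *m u) v = dotv u (M^T *m v).
Proof.
rewrite /dotv; under eq_bigr do rewrite mxE mulr_suml.
rewrite exchange_big; apply: eq_bigr => j _ /=.
rewrite [in RHS]mxE mulr_sumr; apply: eq_bigr => i _.
by rewrite mxE; ring.
Qed.

Lemma dotv_basis n (u : 'cV[R]_n) i : dotv u (basis_vec R i) = u i 0.
Proof.
rewrite /dotv (bigD1 i)//= big1 ?addr0 => [|j ji]; first by rewrite mxE !eqxx mulr1.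
by rewrite mxE (negbTE ji) mulr0.
Qed.

Lemma enorm_basis n (i : 'I_n) : enorm (basis_vec R i) = 1.
Proof. by rewrite enormE dotv_basis mxE !eqxx sqrtr1. Qed.

Lemma sum_basis n (u : 'cV[R]_n) : u = \sum_i u i 0 *: basis_vec R i.
Proof.
apply/colP => j; rewrite summxE (bigD1 j)//= !mxE !eqxx mulr1 big1 ?addr0// => i ij.
by rewrite !mxE eq_sym (negbTE ij) mulr0.
Qed.

Lemma sqr_enorm_coord_le n (u : 'cV[R]_n) a : 0 <= a ->
  (forall i, `|u i 0| <= a) -> enorm u ^+ 2 <= n%:R * a ^+ 2.
Proof.
move=> a0 ua; rewrite sqr_enorm /dotv.
apply: (le_trans (y := \sum_(i < n) a ^+ 2)); last first.
  by rewrite sumr_const card_ord mulr_natl.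
apply: ler_sum => i _; rewrite -expr2 -real_normK ?num_real//.
by rewrite ler_pXn2r ?nnegrE.
Qed.

Lemma sqr_enorm_col_mx m n (u : 'cV[R]_m) (v : 'cV[R]_n) :
  enorm (col_mx u v) ^+ 2 = enorm u ^+ 2 + enorm v ^+ 2.
Proof.
rewrite !sqr_enorm /dotv big_split_ord/=; congr (_ + _); apply: eq_bigr => i _.
- by rewrite col_mxEu.
- by rewrite col_mxEd.
Qed.

Lemma le_norm_enorm n (u : 'cV[R]_n) : `|u| <= enorm u.
Proof.
rewrite [leLHS]/Num.norm/= mx_normrE; apply/bigmax_leP; split; first exact: enorm_ge0.
by move=> [i j] _ /=; rewrite ord1 enorm_coord.
Qed.

Lemma enorm_le_norm n (u : 'cV[R]_n) : enorm u <= n%:R * `|u|.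
Proof.
rewrite (sum_basis u); apply: le_trans (enorm_sum _ _) _; rewrite -sum_basis.
apply: (le_trans (y := \sum_(i < n) `|u|)); last first.
  by rewrite sumr_const card_ord mulr_natl.
apply: ler_sum => i _; rewrite enormZ enorm_basis mulr1.
by rewrite [leRHS]/Num.norm/= mx_normrE; apply: (le_bigmax _ _ (i, 0)).
Qed.

Lemma opnorm_bounded m n (M : 'M[R]_(m, n)) :
  has_sup [set enorm (M *m u) | u in [set u : 'cV[R]_n | enorm u <= 1]].
Proof.
split; first by exists (enorm (M *m 0)), 0 => //=; rewrite enorm0.
exists (\sum_i enorm (M *m basis_vec R i)) => _ [u /= u1 <-].
rewrite {1}(sum_basis u) mulmx_sumr; apply: le_trans (enorm_sum _ _) _.
apply: ler_sum => i _; rewrite -scalemxAr enormZ ler_piMl ?enorm_ge0//.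
exact: le_trans (enorm_coord u i) u1.
Qed.

Lemma opnorm_ge0 m n (M : 'M[R]_(m, n)) : 0 <= opnorm M.
Proof.
apply: (ub_le_sup (opnorm_bounded M).2); exists 0 => /=; first by rewrite enorm0.
by rewrite mulmx0 enorm0.
Qed.

Lemma enorm_mulmx m n (M : 'M[R]_(m, n)) u : enorm (M *m u) <= opnorm M * enorm u.
Proof.
have [u0|u0] := eqVneq (enorm u) 0.
  by rewrite (enorm_eq0 u0) mulmx0 !enorm0 mulr0.
have up : 0 < enorm u by rewrite lt_neqAle eq_sym u0 enorm_ge0.
rewrite -ler_pdivrMr//; apply: (ub_le_sup (opnorm_bounded M).2).
exists ((enorm u)^-1 *: u) => /=.
  by rewrite enormZ ger0_norm ?invr_ge0 ?enorm_ge0// mulVf.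
by rewrite -scalemxAr enormZ ger0_norm ?invr_ge0 ?enorm_ge0// mulrC.
Qed.

(** A matrix and its transpose have the same operator norm, by duality: test
    the transpose against its own image. *)
Lemma enorm_trmulmx m n (M : 'M[R]_(m, n)) u :
  enorm (M^T *m u) <= opnorm M * enorm u.
Proof.
have [u0|u0] := eqVneq (enorm (M^T *m u)) 0.
  by rewrite u0 mulr_ge0 ?enorm_ge0 ?opnorm_ge0.
have up : 0 < enorm (M^T *m u) by rewrite lt_neqAle eq_sym u0 enorm_ge0.
rewrite -(ler_pM2l up) -expr2 sqr_enorm -dotv_mulmx.
apply: le_trans (dotv_le _ _) _; rewrite mulrA.
by rewrite ler_wpM2r ?enorm_ge0// mulrC enorm_mulmx.
Qed.

End EuclideanGeometry.

(** Linear arithmetic over inner products and norms taken as atoms; only the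
    hypotheses moved to the goal are used. *)
Ltac dlra := repeat match goal with
  | H : context [dotv _ _] |- _ => clear H
  | H : context [enorm _] |- _ => clear H
  end; repeat match goal with
  | |- context [dotv ?u ?v] => move: (dotv u v) => ?
  | |- context [enorm ?u] => move: (enorm u) => ?
  end; lra.

(** Linear arithmetic from the hypotheses moved to the goal only. *)
Ltac glra := repeat match goal with H : is_true _ |- _ => clear H end; lra.

(** * Topology of the Euclidean norm, projections *)

Section Topology.
Variable R : realType.

(** The Euclidean norm and the sup norm are equivalent, so Euclidean balls
    generate the neighbourhoods. *)
Lemma nbhs_enorm n (u : 'cV[R]_n) (P : set 'cV[R]_n) :
  nbhs u P <-> exists2 r, 0 < r & forall u', enorm (u' - u) < r -> P u'.
Proof.
rewrite nbhs_ballP; split.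
  move=> [r /= r0 uP]; exists r => // u' u'r; apply: uP.
  rewrite -ball_normE /ball_ /= distrC; exact: le_lt_trans (le_norm_enorm _) u'r.
move=> [r r0 uP]; exists (r / n.+1%:R) => /=; first by rewrite divr_gt0.
move=> u'; rewrite -ball_normE /ball_ /= distrC ltr_pdivlMr// => u'r.
apply: uP; apply: le_lt_trans (enorm_le_norm _) _; apply: le_lt_trans u'r.
by rewrite mulrC ler_wpM2l// ler_nat.
Qed.

Lemma open_enorm n (U : set 'cV[R]_n) u : open U -> U u ->
  exists2 r, 0 < r & forall u', enorm (u' - u) < r -> U u'.
Proof. by move=> oU Uu; apply/nbhs_enorm/open_nbhs_nbhs. Qed.

Lemma continuous_enorm_at n (f : 'cV[R]_n -> R) u :
  (forall e, 0 < e -> exists2 r, 0 < r &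
     forall u', enorm (u' - u) < r -> `|f u' - f u| < e) ->
  {for u, continuous f}.
Proof.
move=> fu.
apply: (proj2 (@cvgrPdist_lt _ _ _ (nbhs u) (nbhs_filter u) f (f u))) => e e0.
apply/nbhs_enorm.
by have [r r0 ur] := fu _ e0; exists r => // u' /ur; rewrite distrC.
Qed.

Lemma compact_enorm_bounded n (S : set 'cV[R]_n) : compact S ->
  exists M, 0 <= M /\ forall u, S u -> enorm u <= M.
Proof.
move=> /compact_bounded [M [_ SM]]; exists (n%:R * (`|M| + 1)); split.
  by rewrite mulr_ge0// addr_ge0.
move=> u Su; apply: le_trans (enorm_le_norm u) _; rewrite ler_wpM2l//.
by apply: SM => //; apply: le_lt_trans (ler_norm M) _; rewrite ltrDl.
Qed.

(** A convex set in which every point has a nearest point; the feasible sets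
    of the algorithm, including the unbounded multiplier cone, are of this kind. *)
Record proximinal n (S : set 'cV[R]_n) : Prop := {
  prox_convex : forall u u' t, S u -> S u' -> 0 <= t <= 1 -> S (u + t *: (u' - u));
  prox_nearest : forall u, exists z, S z /\
     forall z', S z' -> enorm (u - z) <= enorm (u - z') }.

Lemma convex_segment n (S : set 'cV[R]_n) u u' t : convex_set S ->
  S u -> S u' -> 0 <= t <= 1 -> S (u + t *: (u' - u)).
Proof.
move=> cS Su Su' /andP[t0 t1].
have := cS u' u (Itv01 t0 t1) (mem_set Su') (mem_set Su) => /set_mem.
rewrite /conv/= /unstable.onem; congr S.
by rewrite scalerBl scale1r scalerBr [LHS]addrC -addrA [X in _ + X]addrC.
Qed.

(** A continuous function attains its minimum on a compact set. *)
Lemma compact_proximinal n (S : set 'cV[R]_n) : S !=set0 -> convex_set S ->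
  compact S -> proximinal S.
Proof.
move=> S0 cvS cS; split=> [u u' t Su Su' t01|u]; first exact: convex_segment.
have cu : {within S, continuous (fun z => enorm (u - z))}.
  apply: continuous_subspaceT => z; apply: continuous_enorm_at => e e0.
  exists e => // z' z'z; apply: le_lt_trans (enorm_dist _ _) _.
  by rewrite opprB addrC addrA subrK enormC.
have [z /set_mem Sz zS] := compact_EVT_min S0 cS cu.
by exists z; split=> // z' Sz'; apply: zS; rewrite inE.
Qed.

Section Projection.
Variables (n : nat) (S : set 'cV[R]_n).
Hypothesis pS : proximinal S.

Lemma proj_spec u : S (proj S u) /\
  forall z, S z -> enorm (u - proj S u) <= enorm (u - z).
Proof.
exact: (@getPex _ [set z | S z /\ forall z', S z' -> enorm (u - z) <= enorm (u - z')]
          (prox_nearest pS u)).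
Qed.

Lemma proj_in u : S (proj S u).
Proof. by have [] := proj_spec u. Qed.

(** Moving from the projection towards z cannot decrease the distance to u;
    the first-order term in the step length gives the obtuse angle. *)
Lemma proj_obtuse u z : S z -> dotv (u - proj S u) (z - proj S u) <= 0.
Proof.
have [Sp near_p] := proj_spec u; set q := proj S u in Sp near_p *.
move=> Sz; rewrite leNgt; apply/negP => d0.
set d := dotv _ _ in d0; set m := enorm (z - q) ^+ 2.
have m0 : 0 <= m by rewrite sqr_ge0.
pose t := d / (d + m).
have dm : 0 < d + m by rewrite ltr_wpDr.
have t0 : 0 < t by rewrite divr_gt0.
have t1 : t <= 1 by rewrite ler_pdivrMr// mul1r lerDl.
have /near_p : S (q + t *: (z - q)) by apply: prox_convex => //; rewrite (ltW t0).
rewrite -(ler_pXn2r (n := 2)) ?nnegrE ?enorm_ge0// opprD addrA [leRHS]sqr_enormB.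
rewrite dotvZr sqr_enormZ -/d -/m => h.
have td : t * (d + m) = d by rewrite /t divfK// gt_eqF.
nra.
Qed.

(** The two obtuse angles at the projections, added, bound the squared distance
    by an inner product. *)
Lemma proj_nonexpansive u u' : enorm (proj S u - proj S u') <= enorm (u - u').
Proof.
have h1 := proj_obtuse u (proj_in u'); have h2 := proj_obtuse u' (proj_in u).
set q := proj S u in h1 h2 *; set q' := proj S u' in h1 h2 *.
have h : enorm (q - q') ^+ 2 <= dotv (u - u') (q - q').
  rewrite sqr_enorm; move: h1 h2; rewrite !(dotvBl, dotvBr) (dotvC q' q); lra.
have := le_trans h (dotv_le _ _); rewrite expr2.
have [->|q0] := eqVneq (enorm (q - q')) 0; first by rewrite enorm_ge0.
by rewrite mulrC ler_pM2r// lt_neqAle eq_sym q0 enorm_ge0.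
Qed.

Lemma proj_id u : S u -> proj S u = u.
Proof.
move=> Su; have [_ /(_ u Su)] := proj_spec u; rewrite subrr enorm0 => h.
apply/eqP; rewrite eq_sym -subr_eq0; apply/eqP/enorm_eq0/eqP.
by rewrite eq_le h enorm_ge0.
Qed.

End Projection.

Lemma enorm_le_coord n (u v : 'cV[R]_n) :
  (forall i, `|u i 0| <= `|v i 0|) -> enorm u <= enorm v.
Proof.
move=> uv; rewrite ler_sqrt; last by apply: sumr_ge0 => i _; rewrite sqr_ge0.
apply: ler_sum => i _; rewrite -[leLHS]real_normK ?num_real//.
by rewrite -[leRHS]real_normK ?num_real// ler_pXn2r ?nnegrE.
Qed.

(** Nearest points in the cone are found coordinate by coordinate, so its lack
    of compactness does no harm. *)
Lemma multipliers_proximinal p kind : proximinal (@multipliers R p kind).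
Proof.
split=> [u u' t|u]; case: kind => //=.
- move=> u0 u'0 /andP[t0 t1] i; rewrite !mxE.
  by have := u0 i; have := u'0 i; nra.
- exists (\col_i Num.max 0 (u i 0)); split=> [i|z z0]; first by rewrite mxE le_max lexx.
  apply: enorm_le_coord => i; rewrite !mxE.
  have := z0 i; case: (lerP 0 (u i 0)) => ui zi; first by rewrite subrr normr0.
  by rewrite subr0 !ltr0_norm//; lra.
- by exists u; split=> // z _; rewrite subrr enorm0 enorm_ge0.
Qed.

Lemma proj_unique n (S : set 'cV[R]_n) u z : proximinal S -> S z ->
  (forall z', S z' -> dotv (u - z) (z' - z) <= 0) -> proj S u = z.
Proof.
move=> pS Sz h; have h1 := h _ (proj_in pS u); have h2 := proj_obtuse pS u Sz.
apply/eqP; rewrite -subr_eq0; apply/eqP/enorm_eq0/eqP.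
rewrite -sqrf_eq0 eq_le sqr_ge0 andbT sqr_enorm.
move: h1 h2; rewrite !(dotvBl, dotvBr); rewrite (dotvC z (proj S u)); lra.
Qed.

Lemma proj_multipliersE p kind (u : 'cV[R]_p) i :
  proj (@multipliers R p kind) u i 0 =
  if kind is Le_constr then Num.max 0 (u i 0) else u i 0.
Proof.
have pS := multipliers_proximinal p kind.
case: kind pS => pS; last by rewrite proj_id.
rewrite (@proj_unique _ _ _ (\col_i Num.max 0 (u i 0)) pS) ?mxE//=.
  by move=> j; rewrite mxE le_max lexx.
move=> z z0; rewrite /dotv; apply: sumr_le0 => j _; rewrite !mxE.
have := z0 j; case: (lerP 0 (u j 0)) => uj zj; first by rewrite subrr mul0r.
by rewrite !subr0; nra.
Qed.

End Topology.

(** * Gradients and their expectations *)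

Section Calculus.
Variable R : realType.

(** An expansion with a quadratic remainder is differentiable along the line;
    differentiation under the expectation and the partial derivatives of the
    Lagrangian are reduced to this form. *)
Lemma is_derive_quadratic n (F : 'cV[R]_n -> R) u d a C r : 0 < r ->
  (forall t, `|t| < r -> `|F (u + t *: d) - F u - t * a| <= C * t ^+ 2) ->
  is_derive u d F a.
Proof.
move=> r0 Fu.
suff h : h^-1 *: ((F \o shift u) (h *: d) - F u) @[h --> 0^'] --> a.
  by apply: DeriveDef; [exact: cvgP h | exact: cvg_lim h].
apply/cvgrPdist_lt => e e0; near=> h.
have h0 : h != 0 by near: h; exact: nbhs_dnbhs_neq.
have hr : `|h| < r by near: h; apply: dnbhs0_lt.
have he : `|h| < e / (`|C| + 1) by near: h; apply: dnbhs0_lt; rewrite divr_gt0.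
have hp : 0 < `|h| by rewrite normr_gt0.
rewrite -(ltr_pM2l hp) -normrM mulrBr.
have -> : h * (h^-1 *: ((F \o shift u) (h *: d) - F u)) = F (u + h *: d) - F u.
  by rewrite /= [h *: d + u]addrC -[_ *: _]/(_ * _) mulrA mulfV// mul1r.
rewrite distrC; apply: le_lt_trans (Fu _ hr) _.
rewrite -[h ^+ 2]real_normK ?num_real// expr2 mulrA [ltRHS]mulrC ltr_pM2r//.
move: he; rewrite ltr_pdivlMr// => he; apply: le_lt_trans he.
rewrite mulrC ler_wpM2l//; apply: le_trans (ler_norm _) _.
by rewrite lerDl.
Unshelve. all: by end_near. Qed.

(** Directional derivatives given by an inner product: weaker than
    differentiability, stable under expectation, and sufficient for the descent
    lemma. *)
Definition has_gradient n (f : 'cV[R]_n -> R) u :=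
  forall d, is_derive u d f (dotv (gradient f u) d).

Lemma differentiable_has_gradient n (f : 'cV[R]_n -> R) u :
  differentiable f u -> has_gradient f u.
Proof.
move=> df d; apply: DeriveDef; first exact: diff_derivable.
rewrite deriveE// [in LHS](sum_basis d) linear_sum /dotv; apply: eq_bigr => i _.
by rewrite linearZ/= mxE deriveE// mulrC.
Qed.

Lemma differentiable_partials m n (f : 'cV[R]_m -> 'cV[R]_n -> R) x y :
  differentiable (fun q : 'cV[R]_m * 'cV[R]_n => f q.1 q.2) (x, y) ->
  has_gradient (fun x' => f x' y) x /\ has_gradient (fun y' => f x y') y.
Proof.
move=> df; split; apply: differentiable_has_gradient.
- have -> : (fun x' => f x' y) =
    (fun q : 'cV[R]_m * 'cV[R]_n => f q.1 q.2) \o (fun x' => (x', y)) by [].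
  by apply: differentiable_comp => //; apply: differentiable_pair.
- have -> : (fun y' => f x y') =
    (fun q : 'cV[R]_m * 'cV[R]_n => f q.1 q.2) \o (fun y' => (x, y')) by [].
  by apply: differentiable_comp => //; apply: differentiable_pair.
Qed.

Lemma is_derive_segment n (f : 'cV[R]_n -> R) u d t : has_gradient f (u + t *: d) ->
  is_derive t 1 (fun t => f (u + t *: d)) (dotv (gradient f (u + t *: d)) d).
Proof.
move=> /(_ d) [dv <-].
have E : (fun h : R => h^-1 *: (((fun t => f (u + t *: d)) \o shift t) (h *: 1)
             - f (u + t *: d))) =
         (fun h : R => h^-1 *: ((f \o shift (u + t *: d)) (h *: d) - f (u + t *: d))).
  apply/funext => h /=; congr (_ *: (f _ - _)).
  by rewrite -[h *: 1]/(h * 1) mulr1 scalerDl addrCA.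
by apply: DeriveDef; rewrite ?/derivable ?/derive E.
Qed.

(** The descent lemma: along a segment the derivative of the error grows at
    most linearly, by the Lipschitz property of the gradient. *)
Lemma quadratic_bound n (S : set 'cV[R]_n) (f : 'cV[R]_n -> R) l u u' : 0 <= l ->
  (forall t, 0 <= t <= 1 -> S (u + t *: (u' - u))) ->
  (forall z, S z -> has_gradient f z) ->
  (forall z z', S z -> S z' ->
     enorm (gradient f z - gradient f z') <= l * enorm (z - z')) ->
  `|f u' - f u - dotv (gradient f u) (u' - u)| <= l / 2 * enorm (u' - u) ^+ 2.
Proof.
move=> l0 Suu' df lip; set d := u' - u.
have Su : S u by have := Suu' 0; rewrite scale0r addr0; apply; rewrite lexx ler01.
have key (s : R) : `|s| = 1 ->
    s * (f u' - f u - dotv (gradient f u) d) <= l / 2 * enorm d ^+ 2.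
  move=> s1.
  pose a := dotv (gradient f u) d; pose m := l / 2 * enorm d ^+ 2.
  pose phi (t : R) : R := s *: (f (u + t *: d) - t * a) - t ^+ 2 * m.
  pose dphi (t : R) : R := s * (dotv (gradient f (u + t *: d)) d - a) - 2 * t * m.
  have dphiE (t : R) : 0 <= t <= 1 -> is_derive t 1 phi (dphi t).
    move=> t01; have := is_derive_segment (df _ (Suu' _ t01)) => h.
    rewrite /phi/=; apply: is_derive_eq.
    rewrite /dphi -/d /GRing.scale /=; ring.
  have : {within `[0, 1], continuous phi}.
    apply: derivable_within_continuous => t; rewrite in_itv/= => t01.
    by have [] := dphiE t t01.
  move=> /(MVT ltr01 (df := dphi)) [t|c].
    by rewrite in_itv/= => /andP[/ltW ? /ltW ?]; apply: dphiE; apply/andP.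
  rewrite in_itv/= => /andP[c0 c1]; rewrite subr0 mulr1 /phi.
  rewrite scale1r scale0r addr0 mul1r mul0r expr1n mul1r expr0n/= mul0r !subr0.
  have -> : u + d = u' by rewrite /d addrC subrK.
  rewrite -[s *: _]/(s * _) -[s *: (f u)]/(s * f u) -/a => h.
  have h1 : dphi c <= 0.
    rewrite /dphi -dotvBl.
    apply: (@le_trans _ _ (enorm (gradient f (u + c *: d) - gradient f u) * enorm d
                             - 2 * c * m)).
      rewrite lerD2r; apply: le_trans (ler_norm _) _; rewrite normrM s1 mul1r.
      by rewrite ler_norml dotv_ge dotv_le.
    have /lip /(_ Su) : S (u + c *: d) by apply: Suu'; rewrite !ltW.
    rewrite [u + _ - u]addrC addKr enormZ gtr0_norm// => h1.
    rewrite subr_le0 /m; have := ler_wpM2r (enorm_ge0 d) h1; lra.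
  rewrite -/a -/m; lra.
rewrite ler_norml; apply/andP; split.
  by have := key (-1); rewrite normrN1 mulN1r => /(_ erefl); rewrite lerNl.
by have := key 1; rewrite normr1 mul1r; apply.
Qed.

End Calculus.

(** * Real-valued expectations *)

Section Expectation.
Context d (T : measurableType d) (R : realType) (P : probability T R).
Implicit Types f g : T -> R.

Definition L1 f := P.-integrable setT (EFin \o f).
(** Unlike the extended-real expectation, this one is additive without side
    conditions on infinite values, for integrable functions. *)
Definition Ex f : R := \int[P]_t f t.

Lemma L1_measurable f : L1 f -> measurable_fun setT f.
Proof. by move=> /measurable_int /measurable_EFinP. Qed.

Lemma L1D f g : L1 f -> L1 g -> L1 (fun t => f t + g t).
Proof. by move=> hf hg; exact: (integrableD measurableT hf hg). Qed.

Lemma L1Z a f : L1 f -> L1 (fun t => a * f t).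
Proof. by move=> hf; exact: (integrableZl measurableT a hf). Qed.

Lemma L1N f : L1 f -> L1 (fun t => - f t).
Proof.
by move=> /(L1Z (-1)); rewrite /L1; congr integrable; apply/funext => t /=; rewrite mulN1r.
Qed.

Lemma L1B f g : L1 f -> L1 g -> L1 (fun t => f t - g t).
Proof. by move=> hf /L1N; exact: L1D. Qed.

Lemma L1_cst a : L1 (fun=> a).
Proof. exact: finite_measure_integrable_cst. Qed.

Lemma L1_le f g : measurable_fun setT f -> (forall t, `|f t| <= g t) -> L1 g -> L1 f.
Proof.
move=> mf fg hg; apply: le_integrable hg => //; first exact/measurable_EFinP.
by move=> t _ /=; rewrite lee_fin (le_trans (fg t))// ler_norm.
Qed.

Lemma L1_bounded f M : measurable_fun setT f -> (forall t, `|f t| <= M) -> L1 f.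
Proof. by move=> mf fM; apply: L1_le mf fM (L1_cst M). Qed.

Lemma L1_abs f : L1 f -> L1 (fun t => `|f t|).
Proof.
move=> hf; apply: le_integrable (hf) => //.
  by apply/measurable_EFinP; apply: measurableT_comp (L1_measurable hf).
by move=> t _ /=; rewrite normr_id.
Qed.

Lemma L1_sum (I : Type) (r : seq I) (F : I -> T -> R) :
  (forall i, L1 (F i)) -> L1 (fun t => \sum_(i <- r) F i t).
Proof.
move=> hF; elim: r => [|i r IH].
  by under [fun _ => _]funext do rewrite big_nil; exact: L1_cst.
by under [fun _ => _]funext do rewrite big_cons; exact: L1D.
Qed.

Lemma ExD f g : L1 f -> L1 g -> Ex (fun t => f t + g t) = Ex f + Ex g.
Proof. by move=> hf hg; rewrite /Ex RintegralD. Qed.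

Lemma ExB f g : L1 f -> L1 g -> Ex (fun t => f t - g t) = Ex f - Ex g.
Proof. by move=> hf hg; rewrite /Ex RintegralB. Qed.

Lemma ExZ a f : L1 f -> Ex (fun t => a * f t) = a * Ex f.
Proof. by move=> hf; rewrite /Ex RintegralZl. Qed.

Lemma Ex_cst a : Ex (fun=> a) = a.
Proof.
rewrite /Ex Rintegral_cst; last exact: measurableT.
by rewrite [X in fine X](_ : _ = 1%E) ?mulr1//; exact: probability_setT.
Qed.

Lemma Ex_sum (I : Type) (r : seq I) (F : I -> T -> R) :
  (forall i, L1 (F i)) -> Ex (fun t => \sum_(i <- r) F i t) = \sum_(i <- r) Ex (F i).
Proof.
move=> hF; elim: r => [|i r IH].
  by under [fun _ => _]funext do rewrite big_nil; rewrite Ex_cst big_nil.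
under [fun _ => _]funext do rewrite big_cons.
by rewrite big_cons -IH ExD//; exact: L1_sum.
Qed.

Lemma Ex_le f g : L1 f -> L1 g -> (forall t, f t <= g t) -> Ex f <= Ex g.
Proof. by move=> hf hg fg; apply: le_Rintegral => // t _; exact: fg. Qed.

Lemma Ex_ge0 f : (forall t, 0 <= f t) -> 0 <= Ex f.
Proof. by move=> f0; exact: Rintegral_ge0. Qed.

Lemma Ex_abs_le f g : L1 f -> L1 g -> (forall t, `|f t| <= g t) -> `|Ex f| <= Ex g.
Proof.
move=> hf hg fg; rewrite ler_norml -mulN1r -ExZ//; apply/andP.
by split; apply: Ex_le => //; try exact: L1Z; move=> t; have := fg t;
  rewrite ler_norml => /andP[h1 h2]; rewrite ?mulN1r.
Qed.

Lemma expectation_Ex f : L1 f -> ('E_P[f] = (Ex f)%:E)%E.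
Proof. by move=> hf; rewrite unlock /Ex /Rintegral fineK//; exact: integrable_fin_num. Qed.

(** A nonnegative function whose expectation is dominated by a real number is
    integrable. *)
Lemma L1_expectation f M : measurable_fun setT f -> (forall t, 0 <= f t) ->
  ('E_P[f] <= M%:E)%E -> L1 f /\ Ex f <= M.
Proof.
move=> mf f0 fM.
have hf : L1 f.
  apply/integrableP; split; first exact/measurable_EFinP.
  apply: le_lt_trans (ltry M); apply: le_trans fM; rewrite unlock.
  by rewrite le_eqVlt; apply/orP; left; apply/eqP; apply: eq_integral => t _ /=; rewrite ger0_norm.
by split=> //; rewrite -lee_fin -expectation_Ex.
Qed.

(** Jensen's inequality, from the nonnegativity of the variance. *)
Lemma sqr_Ex_le f : L1 f -> L1 (fun t => f t ^+ 2) -> Ex f ^+ 2 <= Ex (fun t => f t ^+ 2).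
Proof.
move=> hf hf2; set m := Ex f.
have : 0 <= Ex (fun t => (f t - m) ^+ 2) by apply: Ex_ge0 => t; exact: sqr_ge0.
have -> : (fun t => (f t - m) ^+ 2) = (fun t => f t ^+ 2 + (- (2 * m) * f t + m ^+ 2)).
  by apply/funext => t; rewrite sqrrB; ring.
rewrite ExD ?ExD ?ExZ ?Ex_cst//; first by rewrite -/m; nra.
all: by repeat (apply: L1D || apply: L1Z || exact: L1_cst).
Qed.

Definition Exv n (F : T -> 'cV[R]_n) : 'cV[R]_n := \col_i Ex (fun t => F t i 0).

Lemma L1_dotv n (F : T -> 'cV[R]_n) u : (forall i, L1 (fun t => F t i 0)) ->
  L1 (fun t => dotv (F t) u).
Proof.
move=> hF; apply: L1_sum => i.
by under [fun _ => _]funext do rewrite mulrC; exact: L1Z.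
Qed.

Lemma Ex_dotv n (F : T -> 'cV[R]_n) u : (forall i, L1 (fun t => F t i 0)) ->
  Ex (fun t => dotv (F t) u) = dotv (Exv F) u.
Proof.
move=> hF; rewrite Ex_sum => [|i]; last first.
  by under [fun _ => _]funext do rewrite mulrC; exact: L1Z.
apply: eq_bigr => i _; rewrite mxE mulrC -ExZ//; congr Ex; apply/funext => t.
by rewrite mulrC.
Qed.

(** Testing the mean vector against itself reduces the bound to the scalar
    Cauchy-Schwarz inequality. *)
Lemma enorm_Exv_le n (F : T -> 'cV[R]_n) M : (forall i, L1 (fun t => F t i 0)) ->
  (forall t, enorm (F t) <= M) -> enorm (Exv F) <= M.
Proof.
move=> hF FM; have := enorm_ge0 (Exv F); rewrite le_eqVlt => /predU1P[<-|e0].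
  by apply: le_trans (FM point); exact: enorm_ge0.
rewrite -(ler_pM2r e0) -expr2 sqr_enorm -Ex_dotv// -[leRHS]Ex_cst.
apply: Ex_le; [exact: L1_dotv | exact: L1_cst |] => t.
by apply: le_trans (dotv_le _ _) _; rewrite ler_wpM2r ?enorm_ge0.
Qed.

End Expectation.

(** * Differentiation under the expectation *)

Section ExpectedGradient.
Context (R : realType) (dZ : measure_display) (Z : measurableType dZ).
Variable D : probability Z R.

Lemma cvg_harmonic_bound (h : nat -> R) (a C : R) :
  (forall m, `|h m - a| <= C * m.+1%:R^-1) -> h m @[m --> \oo] --> a.
Proof.
move=> ha; apply/cvgrPdist_le => e e0; near=> m.
rewrite distrC; apply: le_trans (ha m) _; rewrite ler_pdivrMr//.
have : `|C| / e <= m%:R by near: m; exact: nbhs_infty_ger.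
rewrite ler_pdivrMr// => h1; apply: le_trans (ler_norm _) _; apply: le_trans h1 _.
by rewrite mulrC ler_wpM2l ?(ltW e0)// ler_nat.
Unshelve. all: by end_near. Qed.

Variables (n : nat) (U : set 'cV[R]_n) (f : 'cV[R]_n -> Z -> R) (l : R).
Hypotheses (U_open : open U) (l_ge0 : 0 <= l)
  (f_L1 : forall u, U u -> L1 D (f u))
  (f_grad : forall z u, U u -> has_gradient (fun u' => f u' z) u)
  (f_lip : forall z u u', U u -> U u' ->
     enorm (gradient (fun u => f u z) u - gradient (fun u => f u z) u')
       <= l * enorm (u - u')).

Let grad z u := gradient (fun u => f u z) u.
Let F u := Ex D (f u).

Lemma small_segment u d : U u -> exists2 r, 0 < r &
  forall t s, `|t| < r -> 0 <= s <= 1 -> U (u + s *: (u + t *: d - u)).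
Proof.
move=> /(open_enorm U_open)[r r0 ur]; exists (r / (enorm d + 1)).
  by rewrite divr_gt0// ltr_wpDl// enorm_ge0.
move=> t s tr /andP[s0 s1]; apply: ur; rewrite addrC addKr addrC addKr !enormZ.
rewrite (ger0_norm s0); apply: le_lt_trans (_ : `|t| * (enorm d + 1) < r); last first.
  by rewrite -ltr_pdivlMr// ltr_wpDl// enorm_ge0.
have := enorm_ge0 d; have := normr_ge0 t => t0 d0.
apply: le_trans (_ : 1 * (`|t| * enorm d) <= _); first by rewrite ler_wpM2r// mulr_ge0.
by rewrite mul1r ler_wpM2l// lerDl.
Qed.

Lemma increment_bound u d r : U u ->
  (forall t s, `|t| < r -> 0 <= s <= 1 -> U (u + s *: (u + t *: d - u))) ->
  forall t z, `|t| < r ->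
  `|f (u + t *: d) z - f u z - t * dotv (grad z u) d| <= l / 2 * enorm d ^+ 2 * t ^+ 2.
Proof.
move=> Uu ur t z tr.
have := @quadratic_bound R n U (fun u => f u z) l u (u + t *: d) l_ge0
  (fun s => ur t s tr) (f_grad z) (@f_lip z).
rewrite [u + t *: d - u]addrC addKr dotvZr sqr_enormZ => h.
by apply: le_trans h _; rewrite -[leRHS]mulrA [enorm d ^+ 2 * _]mulrC.
Qed.

(** The directional derivative is a limit of difference quotients, hence
    measurable, and by the quadratic bound it differs from one of these
    integrable quotients by a constant. *)
Lemma L1_directional u d : U u -> L1 D (fun z => dotv (grad z u) d).
Proof.
move=> Uu; have [r r0 ur] := small_segment d Uu.
have bnd := increment_bound Uu ur; set C := _ * _ in bnd.
have C0 : 0 <= C by rewrite mulr_ge0 ?sqr_ge0 ?divr_ge0.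
have inU t : `|t| < r -> U (u + t *: d).
  by move=> tr; have := ur t 1 tr; rewrite scale1r addrC subrK; apply; rewrite ler01 lexx.
pose tt m : R := r / m.+2%:R.
have tt0 m : 0 < tt m by rewrite divr_gt0.
have ttr m : `|tt m| < r.
  by rewrite gtr0_norm// ltr_pdivrMr// ltr_pMr// ltr1n.
pose q m z := (tt m)^-1 * (f (u + tt m *: d) z - f u z).
have qL1 m : L1 D (q m) by apply: L1Z; apply: L1B; apply: f_L1 => //; exact: inU.
have qbnd m z : `|q m z - dotv (grad z u) d| <= C * tt m.
  have := bnd _ z (ttr m).
  have -> : f (u + tt m *: d) z - f u z - tt m * dotv (grad z u) d =
            tt m * (q m z - dotv (grad z u) d).
    by rewrite /q mulrBr mulrA mulfV ?gt_eqF// mul1r.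
  by rewrite normrM gtr0_norm// expr2 mulrCA ler_pM2l.
have mg : measurable_fun setT (fun z => dotv (grad z u) d).
  apply: (measurable_fun_cvg (h := q)) => [m|z _]; first exact: L1_measurable.
  apply: (cvg_harmonic_bound (C := C * r)) => m; apply: le_trans (qbnd m z) _.
  rewrite /tt mulrA; apply: ler_wpM2l; first by rewrite mulr_ge0// ltW.
  by rewrite lef_pV2 ?posrE ?ltr0n// ler_nat.
apply: (L1_le mg (g := fun z => `|q 0%N z| + C * tt 0%N)) => [z|].
  rewrite -lerBlDl; apply: le_trans (qbnd 0%N z).
  by apply: le_trans (lerB_dist _ _) _; rewrite distrC.
by apply: L1D; [exact: L1_abs | exact: L1_cst].
Qed.

Lemma L1_gradient u i : U u -> L1 D (fun z => grad z u i 0).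
Proof.
by move=> /(L1_directional (basis_vec R i)); under [fun _ => _]funext do rewrite dotv_basis.
Qed.

(** The quadratic remainder is uniform in the sample, so it survives the
    expectation. *)
Lemma is_derive_expectation u d : U u ->
  is_derive u d F (dotv (Exv D (fun z => grad z u)) d).
Proof.
move=> Uu; have [r r0 ur] := small_segment d Uu.
have bnd := increment_bound Uu ur; set C := _ * _ in bnd.
have inU t : `|t| < r -> U (u + t *: d).
  by move=> tr; have := ur t 1 tr; rewrite scale1r addrC subrK; apply; rewrite ler01 lexx.
apply: (is_derive_quadratic (C := C) r0) => t tr.
have L := L1_directional d Uu.
rewrite -Ex_dotv => [|i]; last exact: L1_gradient.
have h1 := f_L1 Uu; have h2 := f_L1 (inU _ tr); have h3 := L1Z t L.
have h4 := L1B h2 h1.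
rewrite /F -ExB// -ExZ// -ExB// -[leRHS](Ex_cst D).
by apply: Ex_abs_le => [||z]; [exact: L1B | exact: L1_cst | exact: bnd].
Qed.

Lemma gradient_expectation u : U u -> gradient F u = Exv D (fun z => grad z u).
Proof.
move=> Uu; apply/colP => i; rewrite mxE.
by have [_ ->] := is_derive_expectation (basis_vec R i) Uu; rewrite dotv_basis.
Qed.

Lemma has_gradient_expectation u : U u -> has_gradient F u.
Proof. by move=> Uu d; rewrite gradient_expectation//; exact: is_derive_expectation. Qed.

(** A bound that holds for every sample holds for the difference of the means.
    *)
Lemma lipschitz_expectation n' (H : Z -> 'cV[R]_n') (H' : Z -> 'cV[R]_n') M :
  (forall i, L1 D (fun z => H z i 0)) -> (forall i, L1 D (fun z => H' z i 0)) ->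
  (forall z, enorm (H z - H' z) <= M) -> enorm (Exv D H - Exv D H') <= M.
Proof.
move=> hH hH' HM; have -> : Exv D H - Exv D H' = Exv D (fun z => H z - H' z).
  apply/colP => i; rewrite !mxE -ExB//; congr Ex; apply/funext => z.
  by rewrite !mxE.
apply: enorm_Exv_le => // i.
by under [fun _ => _]funext do rewrite !mxE; exact: L1B.
Qed.

End ExpectedGradient.

(** * Smooth functions of two variables and their finite-difference gradients *)

Section Smooth.
Variable R : realType.

Lemma ball_segment n (U : set 'cV[R]_n) u u' r :
  (forall v, enorm (v - u) < r -> U v) -> enorm (u' - u) < r ->
  forall t, 0 <= t <= 1 -> U (u + t *: (u' - u)).
Proof.
move=> uU u'r t /andP[t0 t1]; apply: uU; rewrite addrC addKr enormZ ger0_norm//.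
by apply: le_lt_trans u'r; rewrite ler_piMl ?enorm_ge0.
Qed.

Lemma zo_gradE n theta (h : 'cV[R]_n -> R) u i :
  zo_grad theta h u i 0 = (h (u + theta *: basis_vec R i) - h u) / theta.
Proof.
rewrite /zo_grad summxE (bigD1 i)//= !mxE !eqxx mulr1 big1 ?addr0// => j ji.
by rewrite !mxE eq_sym (negbTE ji) mulr0.
Qed.

Section Pair.
Variables (m n : nat).
Implicit Types (f : 'cV[R]_m -> 'cV[R]_n -> R) (x : 'cV[R]_m) (y : 'cV[R]_n).

Definition gradx f x y := gradient (fun x' => f x' y) x.
Definition grady f x y := gradient (fun y' => f x y') y.

(** What the argument uses of a smooth function on U x V: partial gradients and
    their four Lipschitz bounds. It is symmetric in the two blocks and
    inherited by the mean of a random function. *)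
Record smooth_pair (U : set 'cV[R]_m) (V : set 'cV[R]_n) l f : Prop := {
  smooth_gradx : forall x y, U x -> V y -> has_gradient (fun x' => f x' y) x;
  smooth_grady : forall x y, U x -> V y -> has_gradient (fun y' => f x y') y;
  smooth_lip : lipschitz_gradients U V l f }.

(** Continuity in the Euclidean norm at one point, all that measurability of a
    composition needs. *)
Definition continuous_pair f x y := forall e, 0 < e -> exists2 r, 0 < r &
  forall x' y', enorm (x' - x) < r -> enorm (y' - y) < r -> `|f x' y' - f x y| < e.

End Pair.

(** Every fact about the first block is obtained for the second by exchanging
    the arguments. *)
Lemma smooth_swap m n U V l (f : 'cV[R]_m -> 'cV[R]_n -> R) :
  smooth_pair U V l f -> smooth_pair V U l (fun y x => f x y).
Proof.
case=> gx gy lip; split=> [y x Vy Ux|y x Vy Ux|]; [exact: gy|exact: gx|].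
by move=> x x1 x2 y y1 y2 *; have [] := lip y y1 y2 x x1 x2.
Qed.

Section Consequences.
Variables (m n : nat) (U : set 'cV[R]_m) (V : set 'cV[R]_n) (l : R).
Hypotheses (oU : open U) (oV : open V) (l0 : 0 <= l).
Variable f : 'cV[R]_m -> 'cV[R]_n -> R.
Hypothesis sf : smooth_pair U V l f.

Lemma gradx_lip x x' y y' : U x -> U x' -> V y -> V y' ->
  enorm (gradx f x' y' - gradx f x y) <= l * (enorm (x' - x) + enorm (y' - y)).
Proof.
move=> Ux Ux' Vy Vy'; have [h1 _ _ _] := smooth_lip sf Ux Ux' Ux Vy' Vy' Vy.
have [_ h2 _ _] := smooth_lip sf Ux Ux' Ux Vy' Vy' Vy.
rewrite mulrDr; apply: le_trans (lerD h1 h2); apply: le_trans (enormD _ _).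
by rewrite addrA subrK.
Qed.

Lemma smooth_boundx x x' y : (forall t, 0 <= t <= 1 -> U (x + t *: (x' - x))) -> V y ->
  `|f x' y - f x y - dotv (gradx f x y) (x' - x)| <= l / 2 * enorm (x' - x) ^+ 2.
Proof.
move=> Uxx' Vy; apply: quadratic_bound l0 Uxx' _ _ => [z Uz|z z' Uz Uz'].
  exact: smooth_gradx sf _ _ Uz Vy.
by have [] := smooth_lip sf Uz Uz Uz' Vy Vy Vy.
Qed.

(** Along a coordinate a difference quotient differs from the derivative by the
    quadratic remainder over theta. *)
Lemma zo_gradx_error theta x y : 0 < theta -> V y ->
  (forall i t, 0 <= t <= 1 -> U (x + (t * theta) *: basis_vec R i)) ->
  enorm (zo_gradx theta f x y - gradx f x y) ^+ 2 <= m%:R * (l * theta / 2) ^+ 2.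
Proof.
move=> t0 Vy Ut; apply: sqr_enorm_coord_le; first by rewrite divr_ge0// mulr_ge0// ltW.
move=> i; rewrite 2!mxE /zo_gradx zo_gradE -/(gradx f x y).
have seg t : 0 <= t <= 1 -> U (x + t *: (x + theta *: basis_vec R i - x)).
  by move=> t01; rewrite [x + _ - x]addrC addKr scalerA; exact: Ut.
have := smooth_boundx seg Vy.
rewrite [x + _ - x]addrC addKr dotvZr dotv_basis enormZ enorm_basis mulr1.
rewrite (gtr0_norm t0) => h.
have -> : (f (x + theta *: basis_vec R i) y - f x y) / theta - gradx f x y i 0 =
  theta^-1 * (f (x + theta *: basis_vec R i) y - f x y - theta * gradx f x y i 0).
  by field; rewrite gt_eqF.
rewrite normrM gtr0_norm ?invr_gt0// -(ler_pM2l t0) mulrA mulfV ?gt_eqF// mul1r.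
by apply: le_trans h _; lra.
Qed.

End Consequences.

Section SecondBlock.
Variables (m n : nat) (U : set 'cV[R]_m) (V : set 'cV[R]_n) (l : R).
Hypotheses (oU : open U) (oV : open V) (l0 : 0 <= l).
Variable f : 'cV[R]_m -> 'cV[R]_n -> R.
Hypothesis sf : smooth_pair U V l f.

Lemma grady_lip x x' y y' : U x -> U x' -> V y -> V y' ->
  enorm (grady f x' y' - grady f x y) <= l * (enorm (x' - x) + enorm (y' - y)).
Proof.
move=> Ux Ux' Vy Vy'; rewrite [enorm _ + _]addrC.
exact: (gradx_lip (smooth_swap sf) Vy Vy' Ux Ux').
Qed.

Lemma smooth_boundy x y y' : (forall t, 0 <= t <= 1 -> V (y + t *: (y' - y))) -> U x ->
  `|f x y' - f x y - dotv (grady f x y) (y' - y)| <= l / 2 * enorm (y' - y) ^+ 2.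
Proof. exact: (smooth_boundx l0 (smooth_swap sf)). Qed.

Lemma zo_grady_error theta x y : 0 < theta -> U x ->
  (forall i t, 0 <= t <= 1 -> V (y + (t * theta) *: basis_vec R i)) ->
  enorm (zo_grady theta f x y - grady f x y) ^+ 2 <= n%:R * (l * theta / 2) ^+ 2.
Proof. exact: (zo_gradx_error l0 (smooth_swap sf)). Qed.

(** Near a point the two quadratic bounds control first the change in x, then
    the change in y. *)
Lemma smooth_continuous x y : U x -> V y -> continuous_pair f x y.
Proof.
move=> Ux Vy e e0.
have [r1 r10 xU] := open_enorm oU Ux; have [r2 r20 yV] := open_enorm oV Vy.
set M := enorm (gradx f x y) + enorm (grady f x y).
have M0 : 0 <= M by rewrite addr_ge0 ?enorm_ge0.
have C0 : 0 < M + 2 * l + 1 by move: l0; lra.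
pose r := Num.min (Num.min r1 r2) (Num.min 1 (e / (M + 2 * l + 1))).
have r0 : 0 < r by rewrite !lt_min r10 r20 ltr01 divr_gt0.
exists r => // x' y'; set a := enorm (x' - x); set b := enorm (y' - y).
move=> ar br; have a0 : 0 <= a := enorm_ge0 _; have b0 : 0 <= b := enorm_ge0 _.
move: (ar) (br); rewrite !lt_min => /andP[/andP[ar1 _] /andP[a1 ae]].
move=> /andP[/andP[_ br2] /andP[b1 be]].
have hx := smooth_boundx l0 sf (ball_segment xU ar1) (yV _ br2).
have hy := smooth_boundy (ball_segment yV br2) Ux.
have hg : enorm (gradx f x y') <= enorm (gradx f x y) + l * b.
  have := gradx_lip sf Ux Ux Vy (yV _ br2); rewrite subrr enorm0 add0r -/b => h.
  rewrite -lerBlDl; apply: le_trans h.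
  by apply: le_trans (ler_norm _) _; exact: enorm_dist.
have h1 := dotv_le (gradx f x y') (x' - x); have h1' := dotv_ge (gradx f x y') (x' - x).
have h2 := dotv_le (grady f x y) (y' - y); have h2' := dotv_ge (grady f x y) (y' - y).
move: hx hy; rewrite -/a -/b in h1 h1' h2 h2' *; rewrite !ler_norml => /andP[k1 k2] /andP[k3 k4].
have g0 := enorm_ge0 (gradx f x y); have g0' := enorm_ge0 (grady f x y).
have bound : (M + 2 * l + 1) * Num.max a b < e.
  by rewrite mulrC -ltr_pdivlMr// gt_max ae be.
set c := Num.max a b in bound.
have ac : a <= c by rewrite le_max lexx.
have bc : b <= c by rewrite le_max lexx orbT.
have c1 : c < 1 by rewrite gt_max a1 b1.
have q1 : enorm (gradx f x y') * a <= (enorm (gradx f x y) + l) * c.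
  apply: ler_pM => //; first exact: enorm_ge0.
  by apply: le_trans hg _; rewrite lerD2l ler_piMr// ltW.
have q2 : enorm (grady f x y) * b <= enorm (grady f x y) * c by rewrite ler_wpM2l.
have q3 : l / 2 * a ^+ 2 <= l / 2 * c.
  apply: ler_wpM2l; first by rewrite divr_ge0.
  by apply: le_trans ac; rewrite expr2 ler_piMr// ltW.
have q4 : l / 2 * b ^+ 2 <= l / 2 * c.
  apply: ler_wpM2l; first by rewrite divr_ge0.
  by apply: le_trans bc; rewrite expr2 ler_piMr// ltW.
have c0 : 0 <= c by apply: le_trans ac.
have lc : l * c <= l * 1 by rewrite ler_wpM2l// ltW.
move: bound q1; rewrite !mulrDl mul1r => bound q1.
by rewrite ltr_norml; apply/andP; split; lra.
Qed.

End SecondBlock.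

Lemma continuous_pair_comb m n (f g : 'cV[R]_m -> 'cV[R]_n -> R) a x y :
  continuous_pair f x y -> continuous_pair g x y ->
  continuous_pair (fun x y => (f x y - g x y) / a) x y.
Proof.
move=> cf cg e e0; have [->|a0] := eqVneq a 0.
  by exists 1 => // x' y' _ _; rewrite invr0 !mulr0 subrr normr0.
have ea : 0 < e / 2 * `|a| by rewrite mulr_gt0 ?divr_gt0 ?normr_gt0.
have [r r0 h] := cf _ ea; have [s s0 k] := cg _ ea.
exists (Num.min r s) => [|x' y']; first by rewrite lt_min r0.
rewrite !lt_min => /andP[xr xs] /andP[yr ys].
rewrite -mulrBl normrM normfV ltr_pdivrMr ?normr_gt0//.
have -> : f x' y' - g x' y' - (f x y - g x y) = (f x' y' - f x y) - (g x' y' - g x y).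
  by ring.
apply: le_lt_trans (ler_normB _ _) _.
by have := ltrD (h _ _ xr yr) (k _ _ xs ys); lra.
Qed.

Lemma continuous_pair_shift m n (f : 'cV[R]_m -> 'cV[R]_n -> R) d x y :
  continuous_pair f (x + d) y -> continuous_pair (fun x y => f (x + d) y) x y.
Proof.
move=> cf e e0; have [r r0 h] := cf _ e0; exists r => // x' y' xr yr.
by apply: h => //; rewrite opprD addrACA subrr addr0.
Qed.

Lemma zo_gradx_continuous m n U V l (f : 'cV[R]_m -> 'cV[R]_n -> R) theta x y i :
  open U -> open V -> 0 <= l ->
  smooth_pair U V l f -> U x -> U (x + theta *: basis_vec R i) -> V y ->
  continuous_pair (fun x y => zo_gradx theta f x y i 0) x y.
Proof.
move=> oU oV l0 sf Ux Ux' Vy.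
rewrite [X in continuous_pair X](_ : _ =
    (fun x y => (f (x + theta *: basis_vec R i) y - f x y) / theta)); last first.
  by apply/funext => x'; apply/funext => y'; rewrite /zo_gradx zo_gradE.
apply: (continuous_pair_comb (f := fun x y => f (x + _) y)).
  by apply: continuous_pair_shift; exact: (smooth_continuous oU oV l0 sf).
exact: (smooth_continuous oU oV l0 sf).
Qed.

End Smooth.

(** * Measurability of continuous functions of random vectors *)

Section Measurability.
Variable R : realType.

Lemma enorm_le_sum n (u : 'cV[R]_n) a : (forall i, `|u i 0| <= a) -> enorm u <= n%:R * a.
Proof.
move=> ua; rewrite {1}(sum_basis u); apply: le_trans (enorm_sum _ _) _.
apply: (le_trans (y := \sum_(i < n) a)); last by rewrite sumr_const card_ord mulr_natl.
by apply: ler_sum => i _; rewrite enormZ enorm_basis mulr1.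
Qed.

(** Measurability of the coordinates; the source may be Omega with any of the
    histories as sigma-algebra. *)
Definition measurable_vec d (T : measurableType d) n (u : T -> 'cV[R]_n) :=
  forall i, measurable_fun setT (fun t => u t i 0).

Section Caratheodory.
Context d1 d2 (T : measurableType d1) (Z : measurableType d2).
Variables (n : nat) (u : T -> 'cV[R]_n) (K : T -> Z -> R).
Hypotheses (mu : measurable_vec u) (mK : forall t, measurable_fun setT (K t))
  (cK : forall z t e, 0 < e -> exists2 r, 0 < r &
     forall t', enorm (u t' - u t) < r -> `|K t' z - K t z| < e).

Let cell m t : {ffun 'I_n -> int} := [ffun i => Num.floor (m.+1%:R * u t i 0)].
Let rep m c : T := get [set t | cell m t = c].

Lemma measurable_cell m c : measurable [set t | cell m t = c].
Proof.
have -> : [set t | cell m t = c] = \bigcap_(i in [set: 'I_n])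
    ((fun t => m.+1%:R * u t i 0) @^-1` `[(c i)%:~R, (c i)%:~R + 1[%classic).
  apply/seteqP; split=> [t <- i _|t ht].
    by have := floor_itv (m.+1%:R * u t i 0); rewrite /= in_itv/= ffunE intrD.
  apply/ffunP => i; rewrite ffunE; apply/eqP; have := ht i I.
  by rewrite /= in_itv/= floor_eq intrD.
apply: fin_bigcap_measurable; first exact: finite_finset.
move=> i _; rewrite -[X in measurable X]setTI.
by apply: (measurable_funM (measurable_cst _) (mu i)) => //; exact: measurable_itv.
Qed.

Lemma cell_rep m t : cell m (rep m (cell m t)) = cell m t.
Proof. by apply: (@getPex _ [set t' | cell m t' = cell m t]); exists t. Qed.

Lemma cell_close m t t' : cell m t = cell m t' ->
  enorm (u t - u t') <= n%:R * m.+1%:R^-1.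
Proof.
move=> tt'; apply: enorm_le_sum => i; rewrite !mxE.
have m0 : 0 < m.+1%:R :> R by rewrite ltr0n.
have := congr1 (fun c : {ffun 'I_n -> int} => c i) tt'; rewrite !ffunE => E.
have := floor_itv (m.+1%:R * u t i 0); have := floor_itv (m.+1%:R * u t' i 0).
rewrite E !intrD => /andP[a1 a2] /andP[a3 a4]; rewrite -(ler_pM2l m0) mulfV ?gt_eqF//.
rewrite -{1}(gtr0_norm m0) -normrM mulrBr ltW// ltr_norml.
by apply/andP; split; lra.
Qed.

(** On the cells of a grid of mesh 1/m the first argument is frozen at a
    representative of the cell, so these step functions are measurable; they
    converge by continuity. *)
Lemma caratheodory_measurable : measurable_fun setT (fun q : T * Z => K q.1 q.2).
Proof.
apply: (measurable_fun_cvg (h := fun m q => K (rep m (cell m q.1)) q.2)) => [m|[t z] _].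
  pose E k := if unpickle k is Some c then [set q : T * Z | cell m q.1 = c] else set0.
  have -> : [set: T * Z] = \bigcup_k E k.
    apply/seteqP; split=> // q _; exists (pickle (cell m q.1)) => //.
    by rewrite /E pickleK.
  have mE k : measurable (E k).
    rewrite /E; case: unpickle => [c|]; last exact: measurable0.
    rewrite -[X in measurable X]setTI.
    exact: (@measurable_fst _ _ T Z measurableT _ (measurable_cell m c)).
  apply/measurable_fun_bigcup => // k; have := mE k; rewrite /E.
  case: unpickle => [c|] mEk; last exact: measurable_fun_set0.
  apply: (eq_measurable_fun (K (rep m c) \o snd)) => [q /set_mem/= ->//|].
  apply: measurable_funTS; apply: measurableT_comp; [exact: mK | exact: measurable_snd].
apply/cvgrPdist_lt => e e0; have [r r0 tr] := cK z t e0.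
near=> m; rewrite distrC; apply: tr; apply: le_lt_trans (cell_close (cell_rep m t)) _.
rewrite ltr_pdivrMr// mulrC -ltr_pdivrMr//.
have : n%:R / r <= m%:R by near: m; exact: nbhs_infty_ger.
by move=> /le_lt_trans; apply; rewrite ltr_nat.
Unshelve. all: by end_near. Qed.

End Caratheodory.

Context d (T : measurableType d).

Lemma continuous_measurable n (u : T -> 'cV[R]_n) (h : T -> R) : measurable_vec u ->
  (forall t e, 0 < e -> exists2 r, 0 < r &
     forall t', enorm (u t' - u t) < r -> `|h t' - h t| < e) ->
  measurable_fun setT h.
Proof.
move=> mu ch; have := @caratheodory_measurable _ _ T unit n u (fun t _ => h t) mu.
move=> /(_ (fun t => measurable_cst _) (fun _ => ch)) mh.
by apply: (measurableT_comp mh (g := fun t => (t, tt))); exact: measurable_fun_pair.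
Qed.

Lemma lipschitz_measurable n (u : T -> 'cV[R]_n) (h : T -> R) C : measurable_vec u ->
  (forall t t', `|h t' - h t| <= C * enorm (u t' - u t)) -> measurable_fun setT h.
Proof.
move=> mu hC; apply: (continuous_measurable mu) => t e e0.
have C0 : 0 < `|C| + 1 by rewrite ltr_wpDl.
exists (e / (`|C| + 1)) => [|t' tt']; first by rewrite divr_gt0.
apply: le_lt_trans (hC t t') _; move: tt'; rewrite ltr_pdivlMr// => h1.
apply: le_lt_trans h1; rewrite mulrC ler_wpM2l ?enorm_ge0//.
by apply: le_trans (ler_norm _) _; rewrite lerDl.
Qed.

Lemma measurable_col_mx m n (x : T -> 'cV[R]_m) (y : T -> 'cV[R]_n) :
  measurable_vec x -> measurable_vec y -> measurable_vec (fun t => col_mx (x t) (y t)).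
Proof.
move=> mx my i; case: (split_ordP i) => j ->.
- by under [fun _ => _]funext do rewrite col_mxEu; exact: mx.
- by under [fun _ => _]funext do rewrite col_mxEd; exact: my.
Qed.

Lemma enorm_col_mxl m n (u : 'cV[R]_m) (v : 'cV[R]_n) : enorm u <= enorm (col_mx u v).
Proof.
rewrite -(ler_pXn2r (n := 2)) ?nnegrE ?enorm_ge0//.
by rewrite sqr_enorm_col_mx lerDl sqr_ge0.
Qed.

Lemma enorm_col_mxr m n (u : 'cV[R]_m) (v : 'cV[R]_n) : enorm v <= enorm (col_mx u v).
Proof.
rewrite -(ler_pXn2r (n := 2)) ?nnegrE ?enorm_ge0//.
by rewrite sqr_enorm_col_mx lerDr sqr_ge0.
Qed.

Lemma pair_measurable_joint d' (Z : measurableType d') m n (f : Z -> 'cV[R]_m -> 'cV[R]_n -> R)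
    (x : T -> 'cV[R]_m) (y : T -> 'cV[R]_n) :
  measurable_vec x -> measurable_vec y ->
  (forall t, measurable_fun setT (fun z => f z (x t) (y t))) ->
  (forall z t, continuous_pair (f z) (x t) (y t)) ->
  measurable_fun setT (fun q : T * Z => f q.2 (x q.1) (y q.1)).
Proof.
move=> mx my mf cf.
apply: (@caratheodory_measurable _ _ T Z _ (fun t => col_mx (x t) (y t))
  (fun t z => f z (x t) (y t)) (measurable_col_mx mx my) mf) => z t e e0.
have [r r0 h] := cf z t e e0; exists r => // t'; rewrite opp_col_mx add_col_mx => tt'.
apply: h; apply: le_lt_trans tt'; [exact: enorm_col_mxl | exact: enorm_col_mxr].
Qed.

Lemma pair_measurable m n (f : 'cV[R]_m -> 'cV[R]_n -> R)
    (x : T -> 'cV[R]_m) (y : T -> 'cV[R]_n) :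
  measurable_vec x -> measurable_vec y ->
  (forall t, continuous_pair f (x t) (y t)) ->
  measurable_fun setT (fun t => f (x t) (y t)).
Proof.
move=> mx my cf.
apply: (continuous_measurable (measurable_col_mx mx my)) => t e e0.
have [r r0 h] := cf t e e0; exists r => // t'; rewrite opp_col_mx add_col_mx => tt'.
apply: h; apply: le_lt_trans tt'; [exact: enorm_col_mxl | exact: enorm_col_mxr].
Qed.

Lemma measurable_vecD n (u v : T -> 'cV[R]_n) : measurable_vec u -> measurable_vec v ->
  measurable_vec (fun t => u t + v t).
Proof.
by move=> mu mv i; under [fun _ => _]funext do rewrite mxE; exact: measurable_funD.
Qed.

Lemma measurable_vecZ n a (u : T -> 'cV[R]_n) : measurable_vec u ->
  measurable_vec (fun t => a *: u t).
Proof.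
by move=> mu i; under [fun _ => _]funext do rewrite mxE; exact: measurable_funM.
Qed.

Lemma measurable_vecN n (u : T -> 'cV[R]_n) : measurable_vec u ->
  measurable_vec (fun t => - u t).
Proof.
by move=> /(measurable_vecZ (-1)); under [fun _ => _]funext do rewrite scaleN1r.
Qed.

Lemma measurable_vecB n (u v : T -> 'cV[R]_n) : measurable_vec u -> measurable_vec v ->
  measurable_vec (fun t => u t - v t).
Proof. by move=> mu mv; apply: measurable_vecD => //; exact: measurable_vecN. Qed.

Lemma measurable_vec_cst n (u : 'cV[R]_n) : measurable_vec (fun _ : T => u).
Proof. by move=> i; exact: measurable_cst. Qed.

Lemma measurable_vec_sum n (I : Type) (r : seq I) (u : I -> T -> 'cV[R]_n) :
  (forall i, measurable_vec (u i)) -> measurable_vec (fun t => \sum_(i <- r) u i t).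
Proof.
move=> mu; elim: r => [|i r IH].
  by under [fun _ => _]funext do rewrite big_nil; exact: measurable_vec_cst.
by under [fun _ => _]funext do rewrite big_cons; exact: measurable_vecD.
Qed.

Lemma lipschitz_measurable_vec m n (F : 'cV[R]_m -> 'cV[R]_n) (u : T -> 'cV[R]_m) C :
  measurable_vec u -> (forall t t', enorm (F (u t') - F (u t)) <= C * enorm (u t' - u t)) ->
  measurable_vec (fun t => F (u t)).
Proof.
move=> mu lF i; apply: (lipschitz_measurable mu (C := C)) => t t'.
apply: le_trans (lF t t'); have := enorm_coord (F (u t') - F (u t)) i.
by rewrite !mxE.
Qed.

Lemma measurable_vec_mulmx m n (M : 'M[R]_(m, n)) (u : T -> 'cV[R]_n) :
  measurable_vec u -> measurable_vec (fun t => M *m u t).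
Proof.
move=> mu; apply: (lipschitz_measurable_vec (F := mulmx M) (C := opnorm M)) => // t t'.
by rewrite -mulmxBr enorm_mulmx.
Qed.

Lemma measurable_dotv n (u v : T -> 'cV[R]_n) : measurable_vec u -> measurable_vec v ->
  measurable_fun setT (fun t => dotv (u t) (v t)).
Proof. by move=> mu mv; apply: measurable_sum => i; exact: measurable_funM. Qed.

Lemma measurable_sqr_enorm n (u : T -> 'cV[R]_n) : measurable_vec u ->
  measurable_fun setT (fun t => enorm (u t) ^+ 2).
Proof.
by move=> mu; under [fun _ => _]funext do rewrite sqr_enorm; exact: measurable_dotv.
Qed.

End Measurability.

(** * Independence and integration over a fresh sample *)

Section FreshSample.
Local Open Scope ereal_scope.
Context (R : realType) d d' dZ (Om : measurableType d) (T : measurableType d')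
  (Z : measurableType dZ).
Variables (P : probability Om R) (D : probability Z R).

(** If zeta has law D and is independent of H, the joint law of (H, zeta) is the
    product of the marginals, so a nonnegative function of both may be
    integrated over a fresh copy of zeta. *)
Lemma integral_fresh (H : Om -> T) (zeta : Om -> Z) (f : T * Z -> \bar R) :
  measurable_fun setT H -> measurable_fun setT zeta ->
  (forall A B, measurable A -> measurable B ->
     P (H @^-1` A `&` zeta @^-1` B) = P (H @^-1` A) * D B) ->
  measurable_fun setT f -> (forall q, 0 <= f q) ->
  \int[P]_w f (H w, zeta w) = \int[P]_w \int[D]_z f (H w, z).
Proof.
move=> mH mzeta indep mf f0.
pose X : {mfun Om >-> T} := HB.pack H (isMeasurableFun.Build _ _ _ _ H mH).
pose phi w := (H w, zeta w).
have mphi : measurable_fun setT phi by exact: measurable_fun_pair.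
pose Y : {mfun Om >-> (T * Z)%type} :=
  HB.pack phi (isMeasurableFun.Build _ _ _ _ phi mphi).
have joint A : measurable A -> (distribution P X \x D) A = distribution P Y A.
  by apply: product_measure_unique => {}A B mA mB; rewrite -indep.
transitivity (\int[distribution P Y]_q f q).
  by rewrite /distribution ge0_integral_pushforward.
rewrite (@eq_measure_integral _ _ _ _ (distribution P X \x D)) => [|A mA _]; last first.
  by symmetry; exact: joint.
rewrite fubini_tonelli1// /distribution ge0_integral_pushforward//.
  exact: (measurable_fun_fubini_tonelli_F (m2 := D) _ mf f0).
by move=> t _; apply: integral_ge0.
Qed.

End FreshSample.

Section History.
Context (R : realType) dO dZ (Om : measurableType dO) (Z : measurableType dZ).
Variables (P : probability Om R) (D : probability Z R) (b : nat).
Variable zeta : nat -> 'I_b -> Om -> Z.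
Hypothesis iid : iid_samples P D zeta.
Implicit Types (J : set (nat * 'I_b)) (kj : nat * 'I_b).

(** The cylinder sets of single samples; they generate the history. *)
Definition sample_event J : set (set Om) := [set A | exists kj E,
  [/\ J kj, (0 < kj.1)%N, measurable E & A = zeta kj.1 kj.2 @^-1` E]].

(** Omega with the sigma-algebra generated by the samples whose index is in J. *)
Definition history J := g_sigma_algebraType (sample_event J).

Lemma measurable_sample kj : (0 < kj.1)%N -> measurable_fun setT (zeta kj.1 kj.2).
Proof. by case: iid => h _ _; exact: h. Qed.

Lemma history_measurable J (A : set Om) :
  measurable (A : set (history J)) -> measurable A.
Proof.
apply: smallest_sub => [|B [kj [E [_ k0 mE ->]]]]; first exact: sigma_algebra_measurable.
by rewrite -[X in measurable X]setTI; apply: (measurable_sample k0).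
Qed.

Lemma history_mono J J' : J `<=` J' -> forall A : set Om,
  measurable (A : set (history J)) -> measurable (A : set (history J')).
Proof.
move=> JJ' A; apply: smallest_sub; first exact: smallest_sigma_algebra.
move=> B [kj [E [Jk k0 mE BE]]]; apply: sub_sigma_algebra.
by exists kj, E; split=> //; exact: JJ'.
Qed.

Lemma measurable_id_history J : @measurable_fun _ _ Om (history J) setT id.
Proof. by move=> _ A mA; rewrite setTI; exact: history_measurable mA. Qed.

Lemma measurable_id_mono J J' : J `<=` J' ->
  @measurable_fun _ _ (history J') (history J) setT id.
Proof. by move=> JJ' _ A mA; rewrite setTI; exact: history_mono mA. Qed.

Lemma measurable_history_sample J kj : J kj -> (0 < kj.1)%N ->
  @measurable_fun _ _ (history J) Z setT (zeta kj.1 kj.2).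
Proof.
move=> Jk k0 _ E mE; rewrite setTI; apply: sub_sigma_algebra.
by exists kj, E.
Qed.

(** Finite intersections of sample events are stable under intersection, so
    independence of the cylinders extends to the history that they generate. *)
Definition cylinder J : set (set Om) := [set A | exists s E,
  [/\ uniq s, forall kj, kj \in s -> J kj /\ (0 < kj.1)%N,
      forall kj, measurable (E kj) &
      A = \bigcap_(kj in [set` s]) (zeta kj.1 kj.2 @^-1` E kj)]].

Lemma cylinder_setI J : setI_closed (cylinder J).
Proof.
move=> _ _ [s1 [E1 [u1 J1 m1 ->]]] [s2 [E2 [u2 J2 m2 ->]]].
exists (undup (s1 ++ s2)), (fun kj => (if kj \in s1 then E1 kj else setT) `&`
                                     (if kj \in s2 then E2 kj else setT)).
split.
- exact: undup_uniq.
- by move=> kj; rewrite mem_undup mem_cat => /orP[/J1|/J2].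
- by move=> kj; apply: measurableI; case: ifP.
apply/seteqP; split=> [w [h1 h2] kj _ /=|w h].
  by split; case: ifP => // ks; [exact: h1 | exact: h2].
split=> kj /= ks; have := h kj; rewrite /= mem_undup mem_cat ks ?orbT => /(_ isT).
- by case.
- by case.
Qed.

Lemma history_cylinder J : (@measurable _ (history J)) = <<s cylinder J >>.
Proof.
apply/seteqP; split; apply: smallest_sub; do ?exact: smallest_sigma_algebra.
- move=> A [kj [E [Jk k0 mE ->]]]; apply: sub_sigma_algebra.
  exists [:: kj], (fun=> E); split=> //.
    by move=> kj'; rewrite inE => /eqP ->.
  apply/seteqP; split=> [w h kj' /=|w /(_ kj) h].
    by rewrite inE => /eqP ->.
  by apply: h; rewrite /= inE.
- move=> A [s [E [_ Js mE ->]]].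
  apply: (@fin_bigcap_measurable _ (history J)) => // kj /= ks.
  have [Jk k0] := Js _ ks; apply: sub_sigma_algebra.
  by exists kj, (E kj).
Qed.

(** The product rule for the finite family of samples of the cylinder with one
    more sample added. *)
Lemma cylinder_indep J kj A B : ~ J kj -> (0 < kj.1)%N -> cylinder J A -> measurable B ->
  (P (A `&` zeta kj.1 kj.2 @^-1` B) = P A * D B)%E.
Proof.
move=> Jk k0 [s [E [us Js mE ->]]] mB; case: iid => _ law mutual.
have ks : kj \notin s by apply/negP => /Js[].
pose E' i := if i == kj then B else E i.
have mE' i : measurable (E' i) by rewrite /E'; case: ifP.
have pos : all (fun kj => 0 < kj.1)%N s by apply/allP => i /Js[].
have := mutual (kj :: s) E'; rewrite /= ks us k0 pos => /(_ isT isT mE').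
have eqE : forall i, i \in s -> E' i = E i.
  by move=> i i_s; rewrite /E'; case: eqP => // ik; rewrite -ik i_s in ks.
have eS : \big[setI/setT]_(i <- s) (zeta i.1 i.2 @^-1` E' i) =
          \big[setI/setT]_(i <- s) (zeta i.1 i.2 @^-1` E i).
  by apply: eq_big_seq => i /eqE ->.
have eP : (\prod_(i <- s) P (zeta i.1 i.2 @^-1` E' i))%E =
          P (\big[setI/setT]_(i <- s) (zeta i.1 i.2 @^-1` E i)).
  by rewrite mutual//; apply: eq_big_seq => i /eqE ->.
rewrite !big_cons eS eP {1 2}/E' eqxx law// => h.
by rewrite bigcap_seq setIC h muleC.
Qed.

(** Sets independent of a fixed event form a lambda-system; it contains the pi-
    system of cylinders. *)
Lemma history_indep J kj A B : ~ J kj -> (0 < kj.1)%N ->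
  measurable (A : set (history J)) -> measurable B ->
  (P (A `&` zeta kj.1 kj.2 @^-1` B) = P A * D B)%E.
Proof.
move=> Jk k0 mA mB.
have mzB : measurable (zeta kj.1 kj.2 @^-1` B).
  by rewrite -[X in measurable X]setTI; apply: (measurable_sample k0).
pose X : {mfun Om >-> history J} :=
  HB.pack (id : Om -> history J) (isMeasurableFun.Build _ _ _ _ _ (@measurable_id_history J)).
have mX := @measurable_id_history J.
pose m1' : {measure set (history J) -> \bar R} := pushforward (mrestr P mzB) X.
pose m1 : {measure set (history J) -> \bar R} := m1' mX.
have DB0 : 0 <= fine (D B) by rewrite fine_ge0.
pose m2 : {measure set (history J) -> \bar R} := mscale (NngNum DB0) (distribution P X).
have m1E C : m1 C = P (C `&` zeta kj.1 kj.2 @^-1` B) by [].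
have m2E C : m2 C = (D B * P C)%E.
  transitivity ((fine (D B))%:E * P C)%E => //.
  by rewrite fineK// fin_num_measure.
suff : m1 A = m2 A by rewrite m1E m2E muleC.
apply: (@measure_unique _ R (history J) (cylinder J) (fun=> setT)
  (history_cylinder J) _ _ _ m1 m2) => //.
- exact: cylinder_setI.
- move=> _; exists [::], (fun=> setT); split=> //.
  by apply/seteqP; split.
- by rewrite bigcup_const//; exists 0%N.
- by move=> C cC; rewrite m1E m2E (cylinder_indep Jk k0 cC mB) muleC.
- by move=> k; rewrite m1E; apply: le_lt_trans (probability_le1 P _) (ltry _);
    rewrite setTI.
Qed.

End History.

(** * Second moments of mini-batch estimators *)

Section MiniBatch.
Context (R : realType) dO dZ (Om : measurableType dO) (Z : measurableType dZ).
Variables (P : probability Om R) (D : probability Z R) (b : nat).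
Variable zeta : nat -> 'I_b -> Om -> Z.
Hypothesis iid : iid_samples P D zeta.
Implicit Types (J : set (nat * 'I_b)) (kj : nat * 'I_b).
Local Notation history := (history zeta).

Lemma measurable_vec_mono J J' n (u : Om -> 'cV[R]_n) : J `<=` J' ->
  measurable_vec (u : history J -> _) -> measurable_vec (u : history J' -> _).
Proof. by move=> JJ' mu i; apply: (measurableT_comp (mu i) (measurable_id_mono JJ')). Qed.

Lemma history_measurable_vec J n (u : Om -> 'cV[R]_n) :
  measurable_vec (u : history J -> _) -> measurable_vec u.
Proof. by move=> mu i; apply: (measurableT_comp (mu i) (measurable_id_history iid (J := J))). Qed.

Section OneSample.
Variables (n : nat) (h : Om -> Z -> 'cV[R]_n) (B : Om -> R).
Hypotheses (h_mean : forall w i, L1 D (fun z => h w z i 0) /\ Ex D (fun z => h w z i 0) = 0)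
  (h_sqr : forall w, L1 D (fun z => enorm (h w z) ^+ 2) /\
                     Ex D (fun z => enorm (h w z) ^+ 2) <= B w)
  (B_L1 : L1 P B).

(** The random field h depends on omega through the history J only; this is
    what allows a sample outside J to be integrated out. *)
Definition jointly_measurable J :=
  forall i, measurable_fun setT (fun q : history J * Z => h q.1 q.2 i 0).

Lemma jointly_measurable_mono J J' : J `<=` J' ->
  jointly_measurable J -> jointly_measurable J'.
Proof.
move=> JJ' mh i.
apply: (measurableT_comp (mh i) (g := fun q : history J' * Z => (q.1 : history J, q.2))).
apply: measurable_fun_pair; last exact: measurable_snd.
move=> _ A mA.
exact: (@measurable_fst _ _ (history J') Z measurableT A (history_mono JJ' mA)).
Qed.

Lemma jointly_measurable_sample J J' kj : J `<=` J' -> J' kj -> (0 < kj.1)%N ->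
  jointly_measurable J ->
  measurable_vec ((fun w => h w (zeta kj.1 kj.2 w)) : history J' -> 'cV[R]_n).
Proof.
move=> JJ' Jk k0 /(jointly_measurable_mono JJ') mh i.
apply: (measurableT_comp (mh i) (g := fun w : history J' => (w, zeta kj.1 kj.2 w))).
apply: measurable_fun_pair; first exact: measurable_id.
exact: measurable_history_sample.
Qed.

(** Given the history the new term has mean zero, so no cross term survives. *)
Lemma second_moment_add_sample J kj (S : Om -> 'cV[R]_n) a : ~ J kj -> (0 < kj.1)%N ->
  measurable_vec (S : history J -> _) -> jointly_measurable J ->
  L1 P (fun w => enorm (S w) ^+ 2) ->
  L1 P (fun w => enorm (S w + a *: h w (zeta kj.1 kj.2 w)) ^+ 2) /\
  Ex P (fun w => enorm (S w + a *: h w (zeta kj.1 kj.2 w)) ^+ 2)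
    <= Ex P (fun w => enorm (S w) ^+ 2) + a ^+ 2 * Ex P B.
Proof.
move=> Jk k0 mS mh S_L1.
have mJ : measurable_vec (fun q : history J * Z => S q.1 + a *: h q.1 q.2).
  apply: measurable_vecD => [i|]; first exact: (measurableT_comp (mS i) measurable_fst).
  exact: measurable_vecZ.
have mf := measurable_sqr_enorm mJ.
have inner w : L1 D (fun z => enorm (S w + a *: h w z) ^+ 2) /\
    Ex D (fun z => enorm (S w + a *: h w z) ^+ 2) <= enorm (S w) ^+ 2 + a ^+ 2 * B w.
  have [h2 h2B] := h_sqr w; have hL1 i := (h_mean w i).1.
  have E : (fun z => enorm (S w + a *: h w z) ^+ 2) =
      (fun z => enorm (S w) ^+ 2 + (2 * a * dotv (h w z) (S w) + a ^+ 2 * enorm (h w z) ^+ 2)).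
    apply/funext => z; rewrite sqr_enormD sqr_enormZ dotvZr (dotvC (S w)); ring.
  have l1 := L1Z (2 * a) (L1_dotv (S w) hL1); have l2 := L1Z (a ^+ 2) h2.
  rewrite E; split; first exact: L1D (L1_cst _ _) (L1D l1 l2).
  rewrite ExD ?ExD//; [|exact: L1_cst|exact: L1D]; rewrite Ex_cst !ExZ//; last exact: L1_dotv.
  rewrite Ex_dotv// [X in dotv X _](_ : _ = 0) ?dot0v ?mulr0 ?add0r; last first.
    by apply/colP => i; rewrite !mxE (h_mean w i).2.
  by rewrite lerD2l ler_wpM2l ?sqr_ge0.
have bnd : L1 P (fun w => enorm (S w) ^+ 2 + a ^+ 2 * B w) by apply: L1D => //; exact: L1Z.
rewrite -ExZ// -ExD//; last exact: L1Z.
apply: L1_expectation => [||].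
- have mz := measurable_sample iid k0.
  apply: (measurableT_comp mf (g := fun w : Om => (w : history J, zeta kj.1 kj.2 w))).
  by apply: measurable_fun_pair; [exact: (measurable_id_history iid) | exact: mz].
- by move=> w; exact: sqr_ge0.
rewrite unlock.
have := @integral_fresh R _ _ _ Om (history J) Z P D id (zeta kj.1 kj.2)
  (fun q => (enorm (S q.1 + a *: h q.1 q.2) ^+ 2)%:E).
move=> ->; first last.
- by move=> q; rewrite lee_fin sqr_ge0.
- exact/measurable_EFinP.
- by move=> A0 B0 mA mB; exact: (history_indep iid Jk k0).
- exact: (measurable_sample iid k0).
- exact: (measurable_id_history iid).
rewrite -expectation_Ex// unlock.
apply: ge0_le_integral => //=.
- by move=> w _; apply: integral_ge0 => z _; rewrite lee_fin sqr_ge0.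
- have mF : measurable_fun setT (fubini_F D
      (fun q : history J * Z => (enorm (S q.1 + a *: h q.1 q.2) ^+ 2)%:E)).
    apply: measurable_fun_fubini_tonelli_F => [|q]; first exact/measurable_EFinP.
    by rewrite lee_fin sqr_ge0.
  exact: (measurableT_comp mF (measurable_id_history iid (J := J))).
- exact: measurable_int bnd.
move=> w _; have [w1 w2] := inner w.
have := expectation_Ex w1; rewrite unlock => ->.
by rewrite lee_fin.
Qed.

(** The samples of a mini-batch are added one at a time, each being fresh with
    respect to the history enlarged by the preceding ones. *)
Lemma second_moment_minibatch J k (S : Om -> 'cV[R]_n) : (0 < k)%N -> (0 < b)%N ->
  (forall j, ~ J (k, j)) ->
  measurable_vec (S : history J -> _) -> jointly_measurable J ->
  L1 P (fun w => enorm (S w) ^+ 2) ->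
  let S' w := S w + b%:R^-1 *: \sum_(j < b) h w (zeta k j w) in
  L1 P (fun w => enorm (S' w) ^+ 2) /\
  Ex P (fun w => enorm (S' w) ^+ 2)
    <= Ex P (fun w => enorm (S w) ^+ 2) + b%:R^-1 * Ex P B.
Proof.
move=> k0 b0 Jk mS mh S_L1.
pose Jm m := J `|` [set kj : nat * 'I_b | kj.1 = k /\ (kj.2 < m)%N].
pose Sm m w := S w + b%:R^-1 *: \sum_(j < b | (j < m)%N) h w (zeta k j w).
have JJm m : J `<=` Jm m by move=> ?; left.
have mSm m : measurable_vec (Sm m : history (Jm m) -> _).
  apply: measurable_vecD; first exact: measurable_vec_mono mS.
  apply: measurable_vecZ.
  have E : (fun w : Om => \sum_(j < b | (j < m)%N) h w (zeta k j w)) =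
      (fun w => \sum_(j < b) (if (j < m)%N then h w (zeta k j w) else 0)).
    by apply/funext => w; rewrite big_mkcond.
  rewrite [X in measurable_vec X]E.
  apply: measurable_vec_sum => j; case jm: (j < m)%N; last exact: measurable_vec_cst.
  by apply: (@jointly_measurable_sample J (Jm m) (k, j)) => //; right.
have step m : (m <= b)%N -> L1 P (fun w => enorm (Sm m w) ^+ 2) /\
    Ex P (fun w => enorm (Sm m w) ^+ 2)
      <= Ex P (fun w => enorm (S w) ^+ 2) + m%:R * (b%:R^-1 ^+ 2 * Ex P B).
  elim: m => [_|m IH mb].
    have -> : (fun w => enorm (Sm 0%N w) ^+ 2) = (fun w => enorm (S w) ^+ 2).
      by apply/funext => w; rewrite /Sm big_pred0 ?scaler0 ?addr0.
    by rewrite mul0r addr0.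
  have [IH1 IH2] := IH (ltnW mb).
  pose j0 : 'I_b := Ordinal mb.
  have E : Sm m.+1 = (fun w => Sm m w + b%:R^-1 *: h w (zeta k j0 w)).
    apply/funext => w; rewrite /Sm (bigD1 j0)//= scalerDr [X in S w + X]addrC addrA.
    congr (S w + _ *: _ + _); apply: eq_bigl => j.
    by rewrite ltnS ltn_neqAle andbC -(inj_eq val_inj).
  have [] := @second_moment_add_sample (Jm m) (k, j0) (Sm m) b%:R^-1 _ _ (mSm m) _ IH1.
  - by case=> [/Jk//|[_ /=]]; rewrite ltnn.
  - by [].
  - exact: jointly_measurable_mono mh.
  rewrite E => h1 h2; split=> //; apply: le_trans h2 _.
  by rewrite -[m.+1]addn1 natrD mulrDl mul1r addrA lerD2r.
have := step b (leqnn b).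
have -> : Sm b = (fun w => S w + b%:R^-1 *: \sum_(j < b) h w (zeta k j w)).
  apply/funext => w; congr (_ + _ *: _); apply: eq_bigl => j; exact: ltn_ord.
have b1 : b%:R != 0 :> R by rewrite pnatr_eq0 -lt0n.
by rewrite mulrA expr2 mulrA mulfV// mul1r.
Qed.

End OneSample.
End MiniBatch.

(** * One step of the algorithm *)

Section OneStepScalar.
Variable R : realFieldType.
Implicit Types a b t : R.

(** The weight 1/4 on the first square is the sharp constant; t is chosen in
    each use to give the term to the square that can pay for it. *)
Lemma young t a b : 0 < t -> a * b <= t^-1 * a ^+ 2 / 4 + t * b ^+ 2.
Proof.
move=> t0; rewrite -(ler_pM2l t0) mulrDr !mulrA mulfV ?gt_eqF// mul1r.
have := sqr_ge0 (a - 2 * t * b); nra.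
Qed.

(** The conditions on the step sizes cleared of denominators; nB stands for the
    norm of B. *)
Record step_sizes (L mu alpha beta gamma nB : R) : Prop := {
  ss_mu : 0 < mu; ss_muL : mu <= L; ss_beta : 0 < beta; ss_betaL : beta * L <= 1 / 6;
  ss_alpha : 0 < alpha; ss_alpha_le : 64 * L ^+ 2 * alpha <= mu ^+ 2 * beta;
  ss_gamma : 0 < gamma; ss_gamma_B : gamma * nB ^+ 2 <= 2 * alpha * L ^+ 2;
  ss_gamma_le : 1280 * L ^+ 4 * alpha * gamma <= mu ^+ 4 * beta ^+ 2;
  ss_nB : 0 <= nB; ss_nBL : nB <= L }.

Variables (L mu alpha beta gamma eta nB : R).
Hypothesis sizes : step_sizes L mu alpha beta gamma nB.

Let W := 32 * alpha * L ^+ 2 / (beta * mu).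

Ltac sizes := case: sizes => mu0 muL beta0 betaL alpha0 alpha_le gamma0 gamma_le1
  gamma_le2 nB0 nBL; have L0 : 0 < L := lt_le_trans mu0 muL.

Lemma mubeta_le : 0 < mu * beta /\ mu * beta <= 1 / 6.
Proof.
sizes.
split; first exact: mulr_gt0.
by apply: le_trans betaL; rewrite mulrC ler_wpM2l// ltW.
Qed.

(** Young's inequality splits the gradient error between the distance d, where
    it costs half of the contraction, and the step sy. The term in sy^2 that
    survives pays for the increments of the y-iterates. *)
Lemma contraction_scalar d dt sy err : 0 < eta -> 0 <= d -> 0 <= sy -> 0 <= err ->
  dt ^+ 2 <= (1 - mu * beta) * d ^+ 2 - (1 - beta * L) * sy ^+ 2
             + 2 * beta * err * (d + sy) ->
  (1 - eta) * d ^+ 2 + eta * dt ^+ 2 - eta * (1 - eta) * sy ^+ 2 <=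
  (1 - mu * beta * eta / 2) * d ^+ 2 - eta * (7 / 4 - eta) * sy ^+ 2
   + eta * (4 * beta / mu) * err ^+ 2.
Proof.
sizes; move=> eta0 d0 sy0 err0 h.
have [m0 m6] := mubeta_le.
have y1 : d * err <= mu / 4 * d ^+ 2 + mu^-1 * err ^+ 2.
  have mi : 0 < mu^-1 by rewrite invr_gt0.
  by have := young d err mi; rewrite invrK; glra.
have y2 : sy * err <= (24 * beta)^-1 * sy ^+ 2 + 6 * beta * err ^+ 2.
  have b6 : 0 < 6 * beta by rewrite mulr_gt0.
  have -> : (24 * beta)^-1 * sy ^+ 2 = (6 * beta)^-1 * sy ^+ 2 / 4.
    by field; rewrite gt_eqF.
  exact: young.
have z1 : 2 * beta * (d * err) <= mu * beta / 2 * d ^+ 2 + 2 * beta / mu * err ^+ 2.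
  by have := ler_wpM2l (ltW beta0) y1; glra.
have z2 : 2 * beta * (sy * err) <= sy ^+ 2 / 12 + 12 * beta ^+ 2 * err ^+ 2.
  have := ler_wpM2l (ltW beta0) y2.
  have -> : beta * ((24 * beta)^-1 * sy ^+ 2 + 6 * beta * err ^+ 2) =
      sy ^+ 2 / 24 + 6 * beta ^+ 2 * err ^+ 2 by field; rewrite gt_eqF.
  glra.
have z3 : 12 * beta ^+ 2 * err ^+ 2 <= 2 * beta / mu * err ^+ 2.
  rewrite ler_wpM2r ?sqr_ge0// ler_pdivlMr//.
  have := ler_wpM2l (ltW beta0) m6; glra.
have z4 : beta * L * sy ^+ 2 <= sy ^+ 2 / 6.
  by have := ler_wpM2r (sqr_ge0 sy) betaL; glra.
have k : dt ^+ 2 <= (1 - mu * beta / 2) * d ^+ 2 - 3 / 4 * sy ^+ 2 + 4 * beta / mu * err ^+ 2.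
  by move: h z1 z2 z3 z4; glra.
have := ler_wpM2l (ltW eta0) k; glra.
Qed.

(** The maximizer moves by s. Half of the remaining contraction is spent on d1
    <= d + s, and the resulting factor 1/eta on s^2 is compensated by the
    factor eta^2 in the squared move; the conditions on alpha and gamma make
    the constants small. *)
Lemma drift_scalar d1 d2 s sx sl : 0 < eta -> eta <= 1 -> 0 <= d1 -> 0 <= d2 -> 0 <= s -> 0 <= sx -> 0 <= sl ->
  d2 <= d1 + s -> mu * s <= L * (eta * sx) + nB * (eta * sl) ->
  W * d2 ^+ 2 <= W * (1 + mu * beta * eta / 4) * d1 ^+ 2
    + eta * (1 / 15 * (alpha^-1 * sx ^+ 2) + 5 / 24 * (gamma^-1 * sl ^+ 2)).
Proof.
sizes; move=> eta0 eta1 d10 d20 s0 sx0 sl0 d2le sle; have [m0 m6] := mubeta_le.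
set t := mu * beta * eta / 4.
have t0 : 0 < t by rewrite divr_gt0// mulr_gt0.
have t24 : t <= 1 / 24.
  rewrite /t; have : mu * beta * eta <= 1 / 6 * 1 by apply: ler_pM => //; exact: ltW.
  glra.
have W0 : 0 < W by rewrite divr_gt0 ?mulr_gt0 ?exprn_gt0.
have e1 : d2 ^+ 2 <= (1 + t) * d1 ^+ 2 + (1 + t^-1) * s ^+ 2.
  have h1 : d2 ^+ 2 <= (d1 + s) ^+ 2 by rewrite ler_pXn2r ?nnegrE ?addr_ge0.
  have := young (2 * d1) s (t := t^-1); rewrite invr_gt0 invrK => /(_ t0).
  move: h1; glra.
have e2 : (1 + t^-1) * s ^+ 2 <= 25 / 24 * t^-1 * s ^+ 2.
  rewrite ler_wpM2r ?sqr_ge0//; have : 24 <= t^-1.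
    by rewrite -[24]invrK lef_pV2 ?posrE ?invr_gt0//; move: t24; glra.
  glra.
have e3 : (mu * s) ^+ 2 <= 2 * eta ^+ 2 * (L ^+ 2 * sx ^+ 2 + nB ^+ 2 * sl ^+ 2).
  have : (mu * s) ^+ 2 <= (L * (eta * sx) + nB * (eta * sl)) ^+ 2.
    have ms : 0 <= mu * s by rewrite mulr_ge0// ltW.
    by rewrite ler_pXn2r ?nnegrE//; exact: le_trans sle.
  have := sqr_ge0 (L * (eta * sx) - nB * (eta * sl)); glra.
pose C := 25 / 24 * W / (t * mu ^+ 2).
have C0 : 0 <= C.
  by apply: ltW; apply: divr_gt0; apply: mulr_gt0; rewrite ?exprn_gt0// divr_gt0.
have e4 : W * (25 / 24 * t^-1 * s ^+ 2) = C * (mu * s) ^+ 2.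
  by rewrite /C; field; rewrite !gt_eqF.
have Cx : C * (2 * eta ^+ 2 * L ^+ 2) <= eta * (1 / 15 * alpha^-1).
  pose z := alpha * L ^+ 2 / (mu ^+ 2 * beta).
  have z0 : 0 <= z by rewrite divr_ge0 ?mulr_ge0 ?sqr_ge0 ?ltW.
  have z64 : z <= 1 / 64.
    rewrite ler_pdivrMr ?mulr_gt0 ?exprn_gt0//; move: alpha_le; glra.
  have -> : C * (2 * eta ^+ 2 * L ^+ 2) = eta * (800 / 3 * z ^+ 2 * alpha^-1).
    by rewrite /C /W /t /z; field; rewrite !gt_eqF.
  rewrite ler_pM2l// ler_pM2r ?invr_gt0//.
  have : z ^+ 2 <= (1 / 64) ^+ 2 by rewrite ler_pXn2r ?nnegrE// divr_ge0.
  glra.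
have Cl : C * (2 * eta ^+ 2 * nB ^+ 2) <= eta * (5 / 24 * gamma^-1).
  pose z := alpha * L ^+ 4 * gamma / (mu ^+ 4 * beta ^+ 2).
  have z1280 : z <= 1 / 1280.
    rewrite ler_pdivrMr ?mulr_gt0 ?exprn_gt0//; move: gamma_le2; glra.
  apply: (@le_trans _ _ (C * (2 * eta ^+ 2 * L ^+ 2))).
    apply: ler_wpM2l => //; apply: ler_wpM2l; first by rewrite mulr_ge0 ?sqr_ge0.
    by rewrite ler_pXn2r ?nnegrE// ltW.
  have -> : C * (2 * eta ^+ 2 * L ^+ 2) = eta * (800 / 3 * z * gamma^-1).
    by rewrite /C /W /t /z; field; rewrite !gt_eqF.
  rewrite ler_pM2l// ler_pM2r ?invr_gt0//; move: z1280; glra.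
have e5 := ler_wpM2l (ltW W0) (le_trans e1 (lerD (lexx _) e2)).
have e6 := ler_wpM2l C0 e3.
have e7 := ler_wpM2r (sqr_ge0 sx) Cx; have e8 := ler_wpM2r (sqr_ge0 sl) Cl.
move: e5; rewrite mulrDr e4 => e5; move: e5 e6 e7 e8; glra.
Qed.

(** The combined decrease of the dual function and of the distance to the inner
    maximizer. Every cross term is split by Young's inequality; the weight of
    the distance is chosen so that its contraction absorbs what the dual
    function spends. *)
Lemma one_step_scalar Phi0 Phi1 Phi2 vs rs d d1 d2 dt s sx sy sl ex bx ey by_ :
  0 < eta -> eta <= 2 / 3 ->
  0 <= d -> 0 <= d1 -> 0 <= d2 -> 0 <= s -> 0 <= sx -> 0 <= sy -> 0 <= sl ->
  0 <= ex -> 0 <= bx -> 0 <= ey -> 0 <= by_ ->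
  Phi1 - Phi0 <= eta * vs + (L * d + (ex + bx) + L * (L * (eta * sx) / mu)) * (eta * sx)
                 + L / 2 * (eta * sx) ^+ 2 ->
  Phi2 - Phi1 <= - (eta * rs) + nB * d2 * (eta * sl) ->
  dt ^+ 2 <= (1 - mu * beta) * d ^+ 2 - (1 - beta * L) * sy ^+ 2
             + 2 * beta * (ey + by_) * (d + sy) ->
  d1 ^+ 2 <= (1 - eta) * d ^+ 2 + eta * dt ^+ 2 - eta * (1 - eta) * sy ^+ 2 ->
  d2 <= d1 + s -> mu * s <= L * (eta * sx) + nB * (eta * sl) ->
  Phi2 + (W - 4 * eta * alpha * L ^+ 2) * d2 ^+ 2 <=
  Phi0 + (W - 5 * eta * alpha * L ^+ 2) * d ^+ 2
  + eta * (vs - rs + 3 / 8 * (alpha^-1 * sx ^+ 2) + 3 / 8 * (gamma^-1 * sl ^+ 2)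
     - 34 * (alpha * L ^+ 2 / (mu * beta)) * sy ^+ 2
     + 2 * alpha * ex ^+ 2 + 4 * alpha * bx ^+ 2
     + 320 * (alpha * L ^+ 2 / mu ^+ 2) * (ey ^+ 2 + by_ ^+ 2)).
Proof.
sizes; move=> eta0 eta23 d0 d10 d20 s0 sx0 sy0 sl0 ex0 bx0 ey0 by0 H1 H2 H3 H4 H5 H6.
have eta1 : eta <= 1 by move: eta23; glra.
have [m0 m6] := mubeta_le.
have W0 : 0 < W by rewrite divr_gt0 ?mulr_gt0 ?exprn_gt0.
have err0 : 0 <= ey + by_ by rewrite addr_ge0.
have c1 := le_trans H4 (contraction_scalar eta0 d0 sy0 err0 H3).
have c2 := drift_scalar eta0 eta1 d10 d20 s0 sx0 sl0 H5 H6.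
set t := mu * beta * eta / 4 in c2.
have t0 : 0 < t by rewrite divr_gt0// mulr_gt0.
have t24 : t <= 1 / 24.
  rewrite /t; have : mu * beta * eta <= 1 / 6 * 1 by apply: ler_pM => //; exact: ltW.
  glra.
have cx : W * (1 + t) * d1 ^+ 2 <= (W - 8 * eta * alpha * L ^+ 2) * d ^+ 2
    - eta * (34 * (alpha * L ^+ 2 / (mu * beta))) * sy ^+ 2
    + eta * (320 * (alpha * L ^+ 2 / mu ^+ 2) * (ey ^+ 2 + by_ ^+ 2)).
  have Wt0 : 0 <= W * (1 + t) by rewrite mulr_ge0 ?ltW//; move: t0; glra.
  apply: le_trans (ler_wpM2l Wt0 c1) _.
  have q1 : W * (1 + t) * ((1 - mu * beta * eta / 2) * d ^+ 2)
      <= (W - 8 * eta * alpha * L ^+ 2) * d ^+ 2.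
    rewrite mulrA ler_wpM2r ?sqr_ge0//.
    have -> : mu * beta * eta / 2 = 2 * t by rewrite /t; field.
    have -> : 8 * eta * alpha * L ^+ 2 = W * t by rewrite /W /t; field; rewrite !gt_eqF.
    have := mulr_ge0 (ltW W0) (sqr_ge0 t); glra.
  have q2 : eta * (34 * (alpha * L ^+ 2 / (mu * beta))) * sy ^+ 2
      <= W * (1 + t) * (eta * (7 / 4 - eta) * sy ^+ 2).
    rewrite [leLHS](_ : _ = eta * (W * (34 / 32)) * sy ^+ 2); last first.
      by rewrite /W; field; rewrite !gt_eqF.
    rewrite [leRHS](_ : _ = eta * (W * ((1 + t) * (7 / 4 - eta))) * sy ^+ 2); last by ring.
    rewrite ler_wpM2r ?sqr_ge0// ler_pM2l// ler_pM2l//.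
    have : 0 <= t * (7 / 4 - eta) by rewrite mulr_ge0 ?(ltW t0)//; move: eta1; glra.
    move: eta23; glra.
  have q3 : W * (1 + t) * (eta * (4 * beta / mu) * (ey + by_) ^+ 2)
      <= eta * (320 * (alpha * L ^+ 2 / mu ^+ 2) * (ey ^+ 2 + by_ ^+ 2)).
    have -> : W * (1 + t) * (eta * (4 * beta / mu) * (ey + by_) ^+ 2) =
       eta * (alpha * L ^+ 2 / mu ^+ 2) * (128 * (1 + t) * (ey + by_) ^+ 2).
      by rewrite /W; field; rewrite !gt_eqF.
    rewrite [leRHS](_ : _ = eta * (alpha * L ^+ 2 / mu ^+ 2) * (320 * (ey ^+ 2 + by_ ^+ 2)));
      last by ring.
    rewrite ler_wpM2l//.
      apply: mulr_ge0; first exact: ltW.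
      by apply: divr_ge0; rewrite ?sqr_ge0// mulr_ge0 ?sqr_ge0// ltW.
    have e2 : (ey + by_) ^+ 2 <= 2 * (ey ^+ 2 + by_ ^+ 2).
      have := sqr_ge0 (ey - by_); glra.
    have t160 : 128 * (1 + t) <= 160 by move: t24; glra.
    have e0 : 0 <= ey ^+ 2 + by_ ^+ 2 by rewrite addr_ge0 ?sqr_ge0.
    have := ler_pM (_ : 0 <= 128 * (1 + t)) (sqr_ge0 (ey + by_)) t160 e2.
    have -> : 160 * (2 * (ey ^+ 2 + by_ ^+ 2)) = 320 * (ey ^+ 2 + by_ ^+ 2) by ring.
    by apply; move: t0; glra.
  move: q1 q2 q3; glra.
have a0 : 0 < alpha^-1 by rewrite invr_gt0.
have k1 : L * d * sx <= 1 / 12 * (alpha^-1 * sx ^+ 2) + 3 * alpha * L ^+ 2 * d ^+ 2.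
  have a3 : 0 < 3 * alpha by rewrite mulr_gt0.
  by have := young sx (L * d) a3; rewrite invfM exprMn; glra.
have k2 : ex * sx <= 1 / 8 * (alpha^-1 * sx ^+ 2) + 2 * alpha * ex ^+ 2.
  have a3 : 0 < 2 * alpha by rewrite mulr_gt0.
  by have := young sx ex a3; rewrite invfM; glra.
have k3 : bx * sx <= 1 / 16 * (alpha^-1 * sx ^+ 2) + 4 * alpha * bx ^+ 2.
  have a3 : 0 < 4 * alpha by rewrite mulr_gt0.
  by have := young sx bx a3; rewrite invfM; glra.
have k4 : L * (L * (eta * sx) / mu) * sx + L / 2 * eta * sx ^+ 2
    <= 1 / 256 * (alpha^-1 * sx ^+ 2).
  have h : eta * (L ^+ 2 / mu + L / 2) <= 1 / 256 * alpha^-1.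
    have h1 : L / 2 <= 1 / 2 * (L ^+ 2 / mu).
      by rewrite mulrA ler_pdivlMr//; have := ler_wpM2l (ltW L0) muL; glra.
    have h2 : L ^+ 2 / mu <= 1 / 384 * alpha^-1.
      rewrite ler_pdivrMr// mulrAC ler_pdivlMr//.
      have : mu * (mu * beta) <= mu * (1 / 6) by rewrite ler_pM2l.
      move: alpha_le; glra.
    have h3 : 0 <= L ^+ 2 / mu + L / 2 by rewrite addr_ge0// ltW// divr_gt0 ?exprn_gt0.
    apply: (@le_trans _ _ (1 * (L ^+ 2 / mu + L / 2))); first by rewrite ler_wpM2r.
    move: h1 h2; glra.
  have := ler_wpM2r (sqr_ge0 sx) h; glra.
have k5 : nB * d2 * sl <= 1 / 8 * (gamma^-1 * sl ^+ 2) + 4 * alpha * L ^+ 2 * d2 ^+ 2.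
  have g3 : 0 < 2 * gamma by rewrite mulr_gt0.
  have := young sl (nB * d2) g3; rewrite invfM exprMn.
  have := ler_wpM2r (sqr_ge0 d2) gamma_le1; glra.
have sx2 : 0 <= alpha^-1 * sx ^+ 2 by rewrite mulr_ge0 ?sqr_ge0 ?ltW.
have sl2 : 0 <= gamma^-1 * sl ^+ 2 by rewrite mulr_ge0 ?sqr_ge0// invr_ge0 ltW.
have K : eta * (L * d * sx + ex * sx + bx * sx
    + (L * (L * (eta * sx) / mu) * sx + L / 2 * eta * sx ^+ 2) + nB * d2 * sl
    + 1 / 15 * (alpha^-1 * sx ^+ 2) + 5 / 24 * (gamma^-1 * sl ^+ 2))
  <= eta * (3 / 8 * (alpha^-1 * sx ^+ 2) + 3 / 8 * (gamma^-1 * sl ^+ 2)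
     + 3 * alpha * L ^+ 2 * d ^+ 2 + 4 * alpha * L ^+ 2 * d2 ^+ 2
     + 2 * alpha * ex ^+ 2 + 4 * alpha * bx ^+ 2).
  rewrite ler_pM2l//; move: k1 k2 k3 k4 k5 sx2 sl2; glra.
move: H1 H2 c2 cx K; glra.
Qed.

End OneStepScalar.

(** * The saddle problem and its dual function *)

Section Saddle.
Variables (R : realType) (dx dy p : nat).
Variables (X U : set 'cV[R]_dx) (Y V : set 'cV[R]_dy).
Hypotheses (X_prox : proximinal X) (XU : X `<=` U) (U_open : open U).
Hypotheses (Y_prox : proximinal Y) (YV : Y `<=` V) (V_open : open V).
Hypotheses (Y_neq0 : Y !=set0) (Y_compact : compact Y).
Variables (A : 'M[R]_(p, dx)) (B : 'M[R]_(p, dy)) (c : 'cV[R]_p).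
Variables (g : 'cV[R]_dx -> 'cV[R]_dy -> R) (l mu : R).
Hypotheses (l_ge0 : 0 <= l) (mu_gt0 : 0 < mu) (g_smooth : smooth_pair U V l g).
Hypothesis g_concave : forall x, X x -> strongly_concave_on V mu (g x).

Local Notation Lg := (lagrangian A B c g).
Local Notation ys := (dual_argmax Y Lg).
Local Notation Phi := (dual_val Y Lg).

Definition residual x y : 'cV[R]_p := A *m x + B *m y - c.

Lemma X_segment x x' t : X x -> X x' -> 0 <= t <= 1 -> U (x + t *: (x' - x)).
Proof. by move=> Xx Xx' t01; apply: XU; apply: (prox_convex X_prox). Qed.

Lemma Y_segment y y' t : Y y -> Y y' -> 0 <= t <= 1 -> V (y + t *: (y' - y)).
Proof. by move=> Yy Yy' t01; apply: YV; apply: (prox_convex Y_prox). Qed.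

Lemma lagrangianBx x x' y lam :
  Lg x' y lam - Lg x y lam = g x' y - g x y - dotv (A^T *m lam) (x' - x).
Proof.
rewrite /lagrangian -[in RHS](trmxK A) [in RHS]trmxK (dotvC (A^T *m lam)) -dotv_mulmx.
by rewrite mulmxBr dotvBl !(dotvBr, dotvDr) !(dotvC lam); ring.
Qed.

Lemma lagrangianBy x y y' lam :
  Lg x y' lam - Lg x y lam = g x y' - g x y - dotv (B^T *m lam) (y' - y).
Proof.
rewrite /lagrangian (dotvC (B^T *m lam)) -dotv_mulmx.
by rewrite mulmxBr dotvBl !(dotvBr, dotvDr) !(dotvC lam); ring.
Qed.

Lemma lagrangianBl x y lam lam' :
  Lg x y lam' - Lg x y lam = - dotv (residual x y) (lam' - lam).
Proof. by rewrite /lagrangian -/(residual x y) !(dotvC _ (residual x y)) dotvBr; ring. Qed.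

Section Argmax.
Variables (x : 'cV[R]_dx) (lam : 'cV[R]_p).
Hypothesis Xx : X x.

(** The inner maximum over the compact set Y is attained. *)
Lemma argmax_spec : Y (ys x lam) /\ forall y, Y y -> Lg x y lam <= Lg x (ys x lam) lam.
Proof.
have cL : {within Y, continuous (fun y => Lg x y lam)}.
  apply: continuous_in_subspaceT => y /set_mem Yy; apply: continuous_enorm_at => e e0.
  have e2 : 0 < e / 2 by rewrite divr_gt0.
  have [r r0 h] := smooth_continuous U_open V_open l_ge0 g_smooth (XU Xx) (YV Yy) e2.
  set m := enorm (B^T *m lam) + 1.
  have m0 : 0 < m by rewrite ltr_wpDl ?enorm_ge0.
  exists (Num.min r (e / 2 / m)) => [|y']; first by rewrite lt_min r0 divr_gt0.
  rewrite lt_min => /andP[yr]; rewrite ltr_pdivlMr// => ye.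
  have xr : enorm (x - x) < r by rewrite subrr enorm0.
  rewrite lagrangianBy; apply: le_lt_trans (ler_normB _ _) _.
  have := h _ _ xr yr; set a := `|g x y' - g x y|; move=> ae.
  suff : `|dotv (B^T *m lam) (y' - y)| < e / 2 by lra.
  apply: le_lt_trans ye; rewrite ler_norml mulrC.
  have := dotv_le (B^T *m lam) (y' - y); have := dotv_ge (B^T *m lam) (y' - y).
  by have := enorm_ge0 (y' - y); rewrite /m mulrDl mul1r => *; apply/andP; split; lra.
have [y0 /set_mem Yy0 y0max] := compact_EVT_max Y_neq0 Y_compact cL.
apply: (@getPex _ [set y | Y y /\ forall y', Y y' -> Lg x y' lam <= Lg x y lam]).
by exists y0; split=> // y' Yy'; apply: y0max; rewrite inE.
Qed.

Lemma dual_valE : Phi x lam = Lg x (ys x lam) lam.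
Proof.
have [Yys ysmax] := argmax_spec.
have ub : ubound [set Lg x y lam | y in Y] (Lg x (ys x lam) lam).
  by move=> _ [y Yy <-]; exact: ysmax.
apply/eqP; rewrite eq_le; apply/andP; split.
  by apply: ge_sup => //; exists (Lg x (ys x lam) lam); exists (ys x lam).
by apply: ub_le_sup; [exists (Lg x (ys x lam) lam) | exists (ys x lam)].
Qed.

Lemma dual_val_ge y : Y y -> Lg x y lam <= Phi x lam.
Proof. by rewrite dual_valE; exact: argmax_spec.2. Qed.

(** The derivative of the Lagrangian at its maximum is nonpositive along every
    segment into Y. *)
Lemma argmax_obtuse y : Y y ->
  dotv (grady g x (ys x lam) - B^T *m lam) (y - ys x lam) <= 0.
Proof.
have [Yys ysmax] := argmax_spec; set z := ys x lam in Yys ysmax *; move=> Yy.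
set a := dotv _ _; set C := l / 2 * enorm (y - z) ^+ 2.
have C0 : 0 <= C by rewrite mulr_ge0 ?sqr_ge0 ?divr_ge0.
have key t : 0 < t <= 1 -> a <= C * t.
  move=> /andP[t0 t1]; have t01 : 0 <= t <= 1 by rewrite ltW.
  have Yt : Y (z + t *: (y - z)) by apply: (prox_convex Y_prox).
  have := ysmax _ Yt; rewrite -subr_le0 lagrangianBy.
  have := smooth_boundy l_ge0 g_smooth (fun s => Y_segment Yys Yt) (XU Xx).
  rewrite [z + _ - z]addrC addKr.
  rewrite ler_norml sqr_enormZ => /andP[h1 _] h2; rewrite -(ler_pM2l t0).
  move: h1 h2; rewrite !dotvZr /a dotvBl /C; dlra.
rewrite leNgt; apply/negP => a0.
pose t := a / (a + 2 * C).
have aC : 0 < a + 2 * C by rewrite ltr_wpDr// mulr_ge0.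
have t0 : 0 < t by rewrite divr_gt0.
have t1 : t <= 1 by rewrite ler_pdivrMr// mul1r lerDl mulr_ge0.
have := key t; rewrite t0 t1 => /(_ isT).
have E : t * (a + 2 * C) = a by rewrite /t divfK// gt_eqF.
nra.
Qed.

End Argmax.

(** Add the two strong concavity inequalities between y and y'. *)
Lemma grady_monotone x y y' : X x -> V y -> V y' ->
  dotv (grady g x y' - grady g x y) (y' - y) <= - mu * enorm (y' - y) ^+ 2.
Proof.
move=> Xx Vy Vy'; have := g_concave Xx Vy Vy'; have := g_concave Xx Vy' Vy.
rewrite -/(grady g x y) -/(grady g x y') (enormC y) -(opprB y' y) dotvNr dotvBl; dlra.
Qed.

(** Add the two optimality conditions; strong monotonicity of the gradient
    leaves the change of the partial gradient caused by x and lambda. *)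
Lemma argmax_lipschitz x x' lam lam' : X x -> X x' ->
  mu * enorm (ys x' lam' - ys x lam) <= l * enorm (x' - x) + opnorm B * enorm (lam' - lam).
Proof.
move=> Xx Xx'; have [Y1 _] := argmax_spec lam Xx; have [Y2 _] := argmax_spec lam' Xx'.
have h1 := argmax_obtuse lam Xx Y2; have h2 := argmax_obtuse lam' Xx' Y1.
move: (ys x lam) (ys x' lam') Y1 Y2 h1 h2 => y y' Y1 Y2 h1 h2.
set a := enorm (y' - y); have a0 : 0 <= a := enorm_ge0 _.
have h3 := grady_monotone Xx' (YV Y1) (YV Y2).
have h4 := dotv_le (grady g x' y - grady g x y) (y' - y).
have h5 := dotv_le (B^T *m (lam - lam')) (y' - y).
have h6 := grady_lip g_smooth (XU Xx) (XU Xx') (YV Y1) (YV Y1).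
rewrite subrr enorm0 addr0 in h6.
have h7 := enorm_trmulmx B (lam - lam'); rewrite (enormC lam) in h7.
rewrite -/a in h3 h4 h5.
have h8 : mu * a ^+ 2 <= (l * enorm (x' - x) + opnorm B * enorm (lam' - lam)) * a.
  have k4 := le_trans h4 (ler_wpM2r a0 h6); have k5 := le_trans h5 (ler_wpM2r a0 h7).
  move: h1 h2 h3 k4 k5; rewrite -(opprB y' y) dotvNr mulmxBr !dotvBl mulrDl; dlra.
have [->|an0] := eqVneq a 0.
  by rewrite mulr0 addr_ge0// mulr_ge0 ?enorm_ge0 ?opnorm_ge0.
by move: h8; rewrite expr2 mulrA ler_pM2r// lt_neqAle eq_sym an0.
Qed.

(** Increments of the dual function, compared with the gradient at the current
    primal iterate; the maximizer is taken at the new point, where it can only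
    help. *)
Lemma dual_val_incr_x x x' y lam v e1 e2 : X x -> X x' -> Y y ->
  enorm (gradx g x y - A^T *m lam - v) <= e1 ->
  mu * e2 = l * enorm (x' - x) ->
  Phi x' lam - Phi x lam <= dotv v (x' - x)
    + (l * enorm (y - ys x lam) + e1 + l * e2) * enorm (x' - x)
    + l / 2 * enorm (x' - x) ^+ 2.
Proof.
move=> Xx Xx' Yy he1 he2; have [Y1 _] := argmax_spec lam Xx.
have [Y2 _] := argmax_spec lam Xx'.
set z := ys x lam in Y1 *; set z' := ys x' lam in Y2.
have h1 : Phi x' lam - Phi x lam <= g x' z' - g x z' - dotv (A^T *m lam) (x' - x).
  by rewrite -lagrangianBx (dual_valE lam Xx') lerD2l lerN2 dual_val_ge.
have := smooth_boundx l_ge0 g_smooth (fun t => X_segment Xx Xx') (YV Y2).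
 rewrite ler_norml => /andP[_ h2].
apply: le_trans h1 _.
have h3 : enorm (z' - z) <= e2.
  rewrite -(ler_pM2l mu_gt0) he2; have := argmax_lipschitz lam lam Xx Xx'.
  by rewrite subrr enorm0 mulr0 addr0.
clearbody z z'.
have h4 := gradx_lip g_smooth (XU Xx) (XU Xx) (YV Y1) (YV Y2).
have h5 := gradx_lip g_smooth (XU Xx) (XU Xx) (YV Yy) (YV Y1).
rewrite subrr enorm0 add0r in h4 h5; rewrite (enormC z) in h5.
have k4 := le_trans h4 (ler_wpM2l l_ge0 h3).
have n0 := enorm_ge0 (x' - x).
have q1 := le_trans (dotv_le (gradx g x z' - gradx g x z) (x' - x)) (ler_wpM2r n0 k4).
have q2 := le_trans (dotv_le (gradx g x z - gradx g x y) (x' - x)) (ler_wpM2r n0 h5).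
have q3 := le_trans (dotv_le (gradx g x y - A^T *m lam - v) (x' - x)) (ler_wpM2r n0 he1).
move: h2 q1 q2 q3; rewrite !dotvBl !mulrDl; dlra.
Qed.

(** The Lagrangian is linear in lambda, so the increment is exact at the new
    maximizer; replacing it by y costs the norm of B times the distance. *)
Lemma dual_val_incr_l x y lam lam' : X x -> Y y ->
  Phi x lam' - Phi x lam <= - dotv (residual x y) (lam' - lam)
    + opnorm B * enorm (y - ys x lam') * enorm (lam' - lam).
Proof.
move=> Xx Yy; have [Y1 _] := argmax_spec lam' Xx.
have : Phi x lam' - Phi x lam <= - dotv (residual x (ys x lam')) (lam' - lam).
  by rewrite -lagrangianBl (dual_valE lam' Xx) lerD2l lerN2 dual_val_ge.
move=> /le_trans; apply.
move: (ys x lam') => z; have -> : residual x z = residual x y - B *m (y - z).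
  by rewrite /residual mulmxBr; apply/colP => i; rewrite !mxE; ring.
rewrite dotvBl opprB addrC lerD2l.
apply: le_trans (dotv_le _ _) _; rewrite ler_wpM2r ?enorm_ge0//; exact: enorm_mulmx.
Qed.

(** One projected ascent step with an inexact gradient contracts the distance
    to the inner maximizer. *)
Lemma ascent_step x y lam w beta L yt z err : X x -> Y y -> 0 < beta -> l <= L ->
  yt = proj Y (y + beta *: w) -> z = ys x lam ->
  enorm (grady g x y - B^T *m lam - w) <= err ->
  enorm (yt - z) ^+ 2 <= (1 - mu * beta) * enorm (y - z) ^+ 2
     - (1 - beta * L) * enorm (yt - y) ^+ 2
     + 2 * beta * err * (enorm (y - z) + enorm (yt - y)).
Proof.
move=> Xx Yy b0 lL ytE zE herr; have [] := argmax_spec lam Xx; rewrite -zE => Yz zmax.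
have Yyt : Y yt by rewrite ytE; exact: proj_in.
have h1 := proj_obtuse Y_prox (y + beta *: w) Yz; rewrite -ytE in h1.
have h2 := g_concave Xx (YV Yy) (YV Yz); rewrite -/(grady g x y) in h2.
have := smooth_boundy l_ge0 g_smooth (fun t => Y_segment Yy Yyt) (XU Xx).
 rewrite ler_norml => /andP[h3 _].
have h4 : 0 <= Lg x z lam - Lg x yt lam by rewrite subr_ge0; exact: zmax.
have E4 : Lg x z lam - Lg x yt lam =
    g x z - g x yt - dotv (B^T *m lam) (z - yt) by rewrite lagrangianBy.
clear ytE zE; have h5 := dotv_le (grady g x y - B^T *m lam - w) (z - yt).
have h6 : enorm (z - yt) <= enorm (y - z) + enorm (yt - y).
  rewrite -[z - yt](_ : (z - y) + (y - yt) = _); last by rewrite addrA subrK.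
  by apply: le_trans (enormD _ _) _; rewrite (enormC z) (enormC y yt).
have h7 := le_trans h5 (ler_pM (enorm_ge0 _) (enorm_ge0 _) herr h6).
have q : l / 2 * enorm (yt - y) ^+ 2 <= L / 2 * enorm (yt - y) ^+ 2.
  by rewrite ler_wpM2r ?sqr_ge0// ler_wpM2r.
have E1 : enorm (yt - z) ^+ 2 =
   enorm (y - z) ^+ 2 - enorm (yt - y) ^+ 2 - 2 * dotv (y - yt) (yt - z).
  rewrite -[y - z](_ : (y - yt) + (yt - z) = _); last by rewrite addrA subrK.
  by rewrite (sqr_enormD (y - yt)) (enormC y yt); ring.
rewrite E1; move: h1 h2 h3 h4 h7 q; rewrite E4 (enormC z y).
have -> : y + beta *: w - yt = (y - yt) + beta *: w by rewrite addrAC.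
rewrite !(dotvDl, dotvNl, dotvDr, dotvNr, dotvZl).
set aa := enorm (y - z); set bb := enorm (yt - y).
move=> h1 h2 h3 h4 h7 q.
have := ler_wpM2l (ltW b0) (lerD (lerD (lerD h2 h3) (lerD h4 h7)) q).
move: h1; dlra.
Qed.

(** The scalar estimate applied to the norms of the steps; x moves before
    lambda, so the distance to the maximizer is followed through the
    intermediate point. *)
Lemma one_step L alpha beta gamma eta x y lam v w gxh gyh lt :
  step_sizes L mu alpha beta gamma (opnorm B) -> l <= L -> 0 < eta -> eta <= 2 / 3 ->
  X x -> Y y ->
  let xt := proj X (x - alpha *: v) in let yt := proj Y (y + beta *: w) in
  let x' := x + eta *: (xt - x) in let y' := y + eta *: (yt - y) in
  let lam' := lam + eta *: (lt - lam) in
  let W := 32 * alpha * L ^+ 2 / (beta * mu) in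
  (Phi x' lam' + (W - 4 * eta * alpha * L ^+ 2) * enorm (y' - ys x' lam') ^+ 2 <=
  Phi x lam + (W - 5 * eta * alpha * L ^+ 2) * enorm (y - ys x lam) ^+ 2
  + eta * (dotv v (xt - x) - dotv (residual x' y') (lt - lam)
     + 3 / 8 * (alpha^-1 * enorm (xt - x) ^+ 2)
     + 3 / 8 * (gamma^-1 * enorm (lt - lam) ^+ 2)
     - 34 * (alpha * L ^+ 2 / (mu * beta)) * enorm (yt - y) ^+ 2
     + 2 * alpha * enorm (gxh - A^T *m lam - v) ^+ 2
     + 4 * alpha * enorm (gradx g x y - gxh) ^+ 2
     + 320 * (alpha * L ^+ 2 / mu ^+ 2) *
         (enorm (gyh - B^T *m lam - w) ^+ 2 + enorm (grady g x y - gyh) ^+ 2)))%R : Prop.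
Proof.
move=> sizes lL eta0 eta23 Xx Yy xt yt x' y' lam' W.
have eta1 : eta <= 1 by apply: le_trans eta23 _; lra.
have eta01 : 0 <= eta <= 1 by rewrite ltW.
have L0 : 0 <= L := le_trans l_ge0 lL.
have Xx' : X x' by apply: (prox_convex X_prox) => //; exact: proj_in.
have Yy' : Y y' by apply: (prox_convex Y_prox) => //; exact: proj_in.
have dxE : x' - x = eta *: (xt - x) by rewrite /x' addrC addKr.
have dlE : lam' - lam = eta *: (lt - lam) by rewrite /lam' addrC addKr.
have nx : enorm (x' - x) = eta * enorm (xt - x) by rewrite dxE enormZ gtr0_norm.
have nl : enorm (lam' - lam) = eta * enorm (lt - lam) by rewrite dlE enormZ gtr0_norm.
have split_norm n (q q' u r : 'cV[R]_n) :
    enorm (q - u - r) <= enorm (q' - u - r) + enorm (q - q').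
  rewrite (_ : q - u - r = (q' - u - r) + (q - q')) ?enormD//.
  by apply/colP => i; rewrite !mxE; ring.
have ascent := @ascent_step x y lam w beta L yt (ys x lam) _ Xx Yy (ss_beta sizes) lL
  erefl erefl (split_norm _ _ gyh _ _).
have e2E : mu * (l * enorm (x' - x) / mu) = l * enorm (x' - x).
  by rewrite mulrCA mulfV ?mulr1// gt_eqF.
have incr_x := @dual_val_incr_x x x' y lam v _ _ Xx Xx' Yy
  (split_norm _ _ gxh _ _) e2E.
have incr_l := dual_val_incr_l lam lam' Xx' Yy'.
have drift := argmax_lipschitz lam lam' Xx Xx'.
move: incr_x incr_l drift ascent; rewrite dxE dlE dotvZr (dotvZr _ _ (residual _ _)) -dxE -dlE nx nl.
move=> incr_x incr_l drift ascent.
apply: (@one_step_scalar R L mu alpha beta gamma eta (opnorm B) sizes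
  (Phi x lam) (Phi x' lam) (Phi x' lam') (dotv v (xt - x))
  (dotv (residual x' y') (lt - lam)) (enorm (y - ys x lam)) (enorm (y' - ys x lam))
  (enorm (y' - ys x' lam')) (enorm (yt - ys x lam)) (enorm (ys x' lam' - ys x lam))
  (enorm (xt - x)) (enorm (yt - y)) (enorm (lt - lam))
  (enorm (gxh - A^T *m lam - v)) (enorm (gradx g x y - gxh))
  (enorm (gyh - B^T *m lam - w)) (enorm (grady g x y - gyh))); rewrite ?enorm_ge0//.
- apply: le_trans incr_x _; rewrite -!addrA lerD2l; apply: lerD.
    rewrite ler_wpM2r ?mulr_ge0 ?enorm_ge0 ?(ltW eta0)// !addrA.
    apply: lerD; [do 2 (apply: lerD => //)|].
      by rewrite ler_wpM2r ?enorm_ge0.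
    have sx0 : 0 <= eta * enorm (xt - x) by rewrite mulr_ge0 ?enorm_ge0 ?(ltW eta0).
    apply: ler_pM => //; first by rewrite divr_ge0 ?(ltW mu_gt0)// mulr_ge0.
    by rewrite ler_pM2r ?invr_gt0// ler_wpM2r.
  by rewrite ler_wpM2r ?sqr_ge0// ler_pM2r.
- have -> : y' - ys x lam = (1 - eta) *: (y - ys x lam) + eta *: (yt - ys x lam).
    by rewrite /y'; apply/colP => i; rewrite !mxE; ring.
  rewrite [leLHS]sqr_enormD !sqr_enormZ dotvZl dotvZr.
  have -> : yt - y = (yt - ys x lam) - (y - ys x lam) by rewrite opprB addrA subrK.
  rewrite (sqr_enormB (yt - ys x lam)) (dotvC (yt - ys x lam)) le_eqVlt; by apply/orP; left; apply/eqP; ring.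
- by apply: le_trans (enormB _ _); rewrite opprB addrA subrK.
- by apply: le_trans drift _; rewrite lerD2r ler_wpM2r// mulr_ge0 ?enorm_ge0 ?(ltW eta0).
Qed.

End Saddle.

(** * Variance-reduced finite-difference estimators *)

Section Storm.
Context (R : realType) dO dZ (Om : measurableType dO) (Z : measurableType dZ).
Variables (P : probability Om R) (D : probability Z R) (b : nat).
Variable zeta : nat -> 'I_b -> Om -> Z.
Hypothesis iid : iid_samples P D zeta.
Local Notation history := (history zeta).

Lemma L1_sqr_enorm d (T : measurableType d) (Q : probability T R) n
    (F : T -> 'cV[R]_n) M : measurable_vec F -> (forall t, enorm (F t) <= M) ->
  L1 Q (fun t => enorm (F t) ^+ 2).
Proof.
move=> mF FM; apply: (@L1_bounded _ _ _ _ _ (M ^+ 2)); first exact: measurable_sqr_enorm.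
move=> t; rewrite ger0_norm ?sqr_ge0// ler_pXn2r ?nnegrE ?enorm_ge0//.
exact: le_trans (enorm_ge0 _) (FM t).
Qed.

(** The momentum noise is rho u + (1 - rho) v, with u of full variance and v an
    increment; the bound keeps the factor rho^2 on the former. *)
Lemma sqr_enorm_comb n (r : R) (u v : 'cV[R]_n) :
  enorm (r *: u + (1 - r) *: v) ^+ 2
    <= 2 * r ^+ 2 * enorm u ^+ 2 + 2 * (1 - r) ^+ 2 * enorm v ^+ 2.
Proof.
have := sqr_ge0 (enorm (r *: u - (1 - r) *: v)).
rewrite sqr_enormB sqr_enormD !sqr_enormZ; dlra.
Qed.

(** The centred estimator of the new point, corrected by the centred estimator
    of the old point: the first part has the full variance but a small weight,
    the second has the variance of an increment. *)
Lemma storm_step n J k (e : Om -> 'cV[R]_n) (H H' : Om -> Z -> 'cV[R]_n) r q M delta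
    (Inc : Om -> R) :
  let N w z := H w z - Exv D (H w) in let N' w z := H' w z - Exv D (H' w) in
  let e' w := (1 - r) *: e w + b%:R^-1 *: \sum_(j < b)
                 ((1 - r) *: N w (zeta k j w) - N' w (zeta k j w)) in
  (0 < k)%N -> (0 < b)%N -> (forall j, ~ J (k, j)) -> (1 - r) ^+ 2 <= q ->
  measurable_vec (e : history J -> _) -> L1 P (fun w => enorm (e w) ^+ 2) ->
  jointly_measurable zeta H J -> jointly_measurable zeta H' J ->
  measurable_vec ((fun w => Exv D (H w)) : history J -> _) ->
  measurable_vec ((fun w => Exv D (H' w)) : history J -> _) ->
  (forall w i, L1 D (fun z => H w z i 0)) -> (forall w i, L1 D (fun z => H' w z i 0)) ->
  (forall w, L1 D (fun z => enorm (N' w z) ^+ 2) /\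
             Ex D (fun z => enorm (N' w z) ^+ 2) <= delta ^+ 2) ->
  (forall w z, enorm (H' w z - H w z) ^+ 2 <= Inc w) ->
  (forall w, Inc w <= M) -> measurable_fun setT Inc ->
  L1 P (fun w => enorm (e' w) ^+ 2) /\
  Ex P (fun w => enorm (e' w) ^+ 2) <= (1 - r) ^+ 2 * Ex P (fun w => enorm (e w) ^+ 2)
    + b%:R^-1 * (2 * r ^+ 2 * delta ^+ 2 + 2 * q * Ex P Inc).
Proof.
move=> N N' e' k0 b0 Jk rq me eL1 mH mH' mEH mEH' H1 H1' hN' hInc IncM mInc.
pose h w z := (1 - r) *: N w z - N' w z.
have Inc0 w : 0 <= Inc w by apply: le_trans (hInc w point); exact: sqr_ge0.
have IncL1 : L1 P Inc.
  by apply: (@L1_bounded _ _ _ _ _ (M)) => // w; rewrite ger0_norm.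
pose B w := 2 * r ^+ 2 * delta ^+ 2 + 2 * q * Inc w.
have BL1 : L1 P B by apply: L1D; [exact: L1_cst | exact: L1Z].
have q0 : 0 <= q by apply: le_trans rq; exact: sqr_ge0.
have N1 w i : L1 D (fun z => N w z i 0).
  by rewrite /N; under [fun _ => _]funext do rewrite !mxE; apply: L1B; [exact: H1|exact: L1_cst].
have N1' w i : L1 D (fun z => N' w z i 0).
  by rewrite /N'; under [fun _ => _]funext do rewrite !mxE; apply: L1B; [exact: H1'|exact: L1_cst].
have mean0 (F : Z -> 'cV[R]_n) i : (forall i, L1 D (fun z => F z i 0)) ->
    Ex D (fun z => (F z - Exv D F) i 0) = 0.
  move=> F1; under [fun _ => _]funext do rewrite !mxE.
  by rewrite ExB// ?Ex_cst ?subrr//; exact: L1_cst.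
have h1 w i : L1 D (fun z => h w z i 0) /\ Ex D (fun z => h w z i 0) = 0.
  have cE (u v : 'cV[R]_n) : ((1 - r) *: u - v) i 0 = (1 - r) * u i 0 - v i 0.
    by rewrite !mxE.
  rewrite (_ : (fun z => h w z i 0) = (fun z => (1 - r) * N w z i 0 - N' w z i 0));
    last by apply/funext => z; exact: cE.
  have l1 := L1Z (1 - r) (N1 w i).
  split; first exact: (L1B l1 (N1' w i)).
  by rewrite (ExB l1 (N1' w i)) (ExZ _ (N1 w i)) /N /N' !mean0// mulr0 subrr.
have mz w : measurable_vec (fun z => H' w z - H w z).
  by apply: measurable_vecB => i; apply: L1_measurable; [exact: H1'|exact: H1].
have WE w z : N' w z - N w z = (H' w z - H w z) - Exv D (fun z => H' w z - H w z).
  apply/colP => i; rewrite !mxE.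
  have -> : Ex D (fun z => (H' w z - H w z) i 0) =
     Ex D (fun z => H' w z i 0) - Ex D (fun z => H w z i 0).
    by rewrite -ExB//; congr Ex; apply/funext => z'; rewrite !mxE.
  ring.
have W1 w : forall i, L1 D (fun z => (H' w z - H w z) i 0).
  move=> i; under [fun _ => _]funext do rewrite !mxE.
  by apply: L1B; [exact: H1'|exact: H1].
have Wsq w : L1 D (fun z => enorm (H' w z - H w z) ^+ 2).
  apply: (@L1_bounded _ _ _ _ _ (Inc w)); first exact: measurable_sqr_enorm.
  by move=> z; rewrite ger0_norm ?sqr_ge0.
have var w : L1 D (fun z => enorm (N' w z - N w z) ^+ 2) /\
    Ex D (fun z => enorm (N' w z - N w z) ^+ 2) <= Inc w.
  set m := Exv D (fun z => H' w z - H w z).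
  have E : (fun z => enorm (N' w z - N w z) ^+ 2) =
     (fun z => enorm (H' w z - H w z) ^+ 2 + (-2 * dotv (H' w z - H w z) m + enorm m ^+ 2)).
    by apply/funext => z; rewrite WE -/m sqr_enormB; ring.
  have l2 := L1Z (-2) (L1_dotv m (W1 w)); have l3 := L1D l2 (L1_cst D (enorm m ^+ 2)).
  rewrite E; split; first exact: L1D (Wsq w) l3.
  rewrite (ExD (Wsq w) l3) (ExD l2 (L1_cst _ _)) (ExZ _ (L1_dotv m (W1 w))) Ex_cst.
  rewrite (Ex_dotv m (W1 w)) -/m -sqr_enorm.
  have : Ex D (fun z => enorm (H' w z - H w z) ^+ 2) <= Inc w.
    by rewrite -[leRHS](Ex_cst D); apply: Ex_le => //; exact: L1_cst.
  have := sqr_ge0 (enorm m); lra.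
have h2 w : L1 D (fun z => enorm (h w z) ^+ 2) /\
    Ex D (fun z => enorm (h w z) ^+ 2) <= B w.
  have bnd z : enorm (h w z) ^+ 2 <= 2 * r ^+ 2 * enorm (N' w z) ^+ 2
      + 2 * (1 - r) ^+ 2 * enorm (N' w z - N w z) ^+ 2.
    have -> : h w z = - (r *: N' w z + (1 - r) *: (N' w z - N w z)).
      by apply/colP => i; rewrite !mxE; ring.
    by rewrite enormN; exact: sqr_enorm_comb.
  have l1 := L1Z (2 * r ^+ 2) (hN' w).1; have l2 := L1Z (2 * (1 - r) ^+ 2) (var w).1.
  have hL : L1 D (fun z => enorm (h w z) ^+ 2).
    apply: L1_le (L1D l1 l2).
      by apply: measurable_sqr_enorm => i; exact: L1_measurable (h1 w i).1.
    by move=> z; rewrite ger0_norm ?sqr_ge0.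
  split=> //; apply: le_trans (Ex_le hL (L1D l1 l2) bnd) _.
  rewrite (ExD l1 l2) (ExZ _ (hN' w).1) (ExZ _ (var w).1) /B; apply: lerD.
    by apply: ler_wpM2l; [rewrite mulr_ge0 ?sqr_ge0 | exact: (hN' w).2].
  have k1 := ler_wpM2l (sqr_ge0 (1 - r)) (var w).2; have k2 := ler_wpM2r (Inc0 w) rq.
  by have := ler_wpM2l (ler0n R 2) (le_trans k1 k2); rewrite !mulrA.
have mh : jointly_measurable zeta h J.
  have mfst (u : Om -> 'cV[R]_n) : measurable_vec (u : history J -> _) ->
      measurable_vec (fun q : history J * Z => u q.1).
    by move=> mu i; exact: (measurableT_comp (mu i) measurable_fst).
  apply: (measurable_vecB (u := fun q : history J * Z => (1 - r) *: N q.1 q.2)).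
    by apply: measurable_vecZ; apply: (measurable_vecB mH (mfst _ mEH)).
  exact: (measurable_vecB mH' (mfst _ mEH')).
have me1 : measurable_vec ((fun w => (1 - r) *: e w) : history J -> _).
  exact: measurable_vecZ.
have eE : (fun w => enorm ((1 - r) *: e w) ^+ 2) = (fun w => (1 - r) ^+ 2 * enorm (e w) ^+ 2).
  by apply/funext => w; rewrite sqr_enormZ.
have e1L : L1 P (fun w => enorm ((1 - r) *: e w) ^+ 2) by rewrite eE; exact: L1Z.
have [r1 r2] := second_moment_minibatch iid h1 h2 BL1 k0 b0 Jk me1 mh e1L.
split=> //; apply: le_trans r2 _; rewrite eE (ExZ _ eL1) lerD2l ler_wpM2l ?invr_ge0//.
by rewrite /B ExD ?Ex_cst ?ExZ//; [exact: L1_cst | exact: L1Z].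
Qed.

End Storm.

Section Estimator.
Context (R : realType) dZ (Z : measurableType dZ) (D : probability Z R).
Variables (m n : nat) (U : set 'cV[R]_m) (V : set 'cV[R]_n) (l : R).
Variable f : 'cV[R]_m -> 'cV[R]_n -> Z -> R.
Hypotheses (oU : open U) (oV : open V) (l_ge0 : 0 <= l).
Hypothesis f_smooth : forall z, smooth_pair U V l (fun x y => f x y z).
Hypothesis f_L1 : forall x y, U x -> V y -> L1 D (f x y).

Let F x y := Ex D (f x y).

Lemma L1_zo_gradx theta x y i : U x -> V y -> U (x + theta *: basis_vec R i) ->
  L1 D (fun z => zo_gradx theta (fun x y => f x y z) x y i 0).
Proof.
move=> Ux Vy Ui; rewrite /zo_gradx; under [fun _ => _]funext do rewrite zo_gradE mulrC.
by apply: L1Z; apply: L1B; exact: f_L1.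
Qed.

(** The finite-difference estimator is unbiased for the finite difference of
    the expectation. *)
Lemma zo_gradx_expectation theta x y : U x -> V y ->
  (forall i, U (x + theta *: basis_vec R i)) ->
  zo_gradx theta F x y = Exv D (fun z => zo_gradx theta (fun x y => f x y z) x y).
Proof.
move=> Ux Vy Ui; apply/colP => i; rewrite [RHS]mxE /zo_gradx zo_gradE.
under [in RHS]eq_fun do rewrite zo_gradE mulrC.
have h1 := f_L1 (Ui i) Vy; have h2 := f_L1 Ux Vy.
by rewrite (ExZ _ (L1B h1 h2)) (ExB h1 h2) mulrC.
Qed.

(** Both finite differences are compared with true gradients at nearby points;
    the factor 6 l^2 and the bias collect the three errors, and theta
    decreases. *)
Lemma zo_gradx_increment theta theta' x x' y y' z : 0 < theta' -> theta' <= theta ->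
  U x -> U x' -> V y -> V y' ->
  (forall i t, 0 <= t <= 1 -> U (x + (t * theta) *: basis_vec R i)) ->
  (forall i t, 0 <= t <= 1 -> U (x' + (t * theta') *: basis_vec R i)) ->
  enorm (zo_gradx theta' (fun x y => f x y z) x' y'
         - zo_gradx theta (fun x y => f x y z) x y) ^+ 2
  <= 6 * l ^+ 2 * (enorm (x' - x) ^+ 2 + enorm (y' - y) ^+ 2)
     + 3 / 2 * (m%:R * l ^+ 2 * theta ^+ 2).
Proof.
move=> t0 tt Ux Ux' Vy Vy' Ut Ut'; have sf := f_smooth z.
set h := fun x y => f x y z.
have e1 := zo_gradx_error l_ge0 sf (lt_le_trans t0 tt) Vy Ut.
have e2 := zo_gradx_error l_ge0 sf t0 Vy' Ut'; rewrite -/h in e1 e2.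
have e3 := gradx_lip sf Ux Ux' Vy Vy'; rewrite -/h in e3.
have e2' : m%:R * (l * theta' / 2) ^+ 2 <= m%:R * (l * theta / 2) ^+ 2.
  have tp : 0 <= theta := le_trans (ltW t0) tt.
  rewrite ler_wpM2l// ler_pXn2r// ?nnegrE; first by rewrite ler_wpM2r// ler_wpM2l.
    by rewrite divr_ge0// mulr_ge0// ltW.
  by rewrite divr_ge0// mulr_ge0.
have -> : zo_gradx theta' h x' y' - zo_gradx theta h x y =
   (zo_gradx theta' h x' y' - gradx h x' y') - (zo_gradx theta h x y - gradx h x y)
   + (gradx h x' y' - gradx h x y).
  by apply/colP => i; rewrite !mxE; ring.
move: (zo_gradx theta' h x' y' - gradx h x' y') (zo_gradx theta h x y - gradx h x y)
  (gradx h x' y' - gradx h x y) e1 e2 e3 => u1 u2 u3 e1 e2 e3.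
have e4 : enorm u3 ^+ 2 <= 2 * l ^+ 2 * (enorm (x' - x) ^+ 2 + enorm (y' - y) ^+ 2).
  have : enorm u3 ^+ 2 <= (l * (enorm (x' - x) + enorm (y' - y))) ^+ 2.
    by rewrite ler_pXn2r ?nnegrE ?enorm_ge0 ?mulr_ge0 ?addr_ge0 ?enorm_ge0.
  have := mulr_ge0 (sqr_ge0 l) (sqr_ge0 (enorm (x' - x) - enorm (y' - y))); dlra.
have h1 : enorm (u1 - u2) ^+ 2 <= 2 * enorm u1 ^+ 2 + 2 * enorm u2 ^+ 2.
  by have := sqr_ge0 (enorm (u1 + u2)); rewrite (sqr_enormD u1 u2) (sqr_enormB u1 u2); dlra.
have h2 : enorm (u1 - u2 + u3) ^+ 2 <= 3 / 2 * enorm (u1 - u2) ^+ 2 + 3 * enorm u3 ^+ 2.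
  have := sqr_ge0 (enorm ((1 / 2) *: (u1 - u2) - u3)).
  rewrite (sqr_enormB ((1 / 2) *: (u1 - u2)) u3) (sqr_enormD (u1 - u2) u3) sqr_enormZ dotvZl.
  move: (u1 - u2) => u; dlra.
have h3 := le_trans e2 e2'; move: h1 h2 h3 e1 e4; dlra.
Qed.

(** Continuous in the iterate and measurable in the sample, hence jointly
    measurable. *)
Lemma zo_gradx_jointly_measurable d (T : measurableType d) theta
    (x : T -> 'cV[R]_m) (y : T -> 'cV[R]_n) i :
  measurable_vec x -> measurable_vec y ->
  (forall t, U (x t)) -> (forall t, V (y t)) ->
  (forall t, U (x t + theta *: basis_vec R i)) ->
  measurable_fun setT
    (fun q : T * Z => zo_gradx theta (fun x y => f x y q.2) (x q.1) (y q.1) i 0).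
Proof.
move=> mx my Ux Vy Ui.
apply: (pair_measurable_joint (f := fun z x y => zo_gradx theta (fun x y => f x y z) x y i 0)
  mx my) => [t|z t].
  by apply: L1_measurable; exact: L1_zo_gradx.
exact: (zo_gradx_continuous oU oV l_ge0 (f_smooth z)).
Qed.

End Estimator.

(** * The expected objective *)

Section ExpectedObjective.
Context (R : realType) dZ (Z : measurableType dZ) (D : probability Z R).
Variables (m n : nat) (U : set 'cV[R]_m) (V : set 'cV[R]_n) (l : R).
Variable f : 'cV[R]_m -> 'cV[R]_n -> Z -> R.
Hypotheses (oU : open U) (oV : open V) (l_ge0 : 0 <= l).
Hypothesis f_smooth : forall z, smooth_pair U V l (fun x y => f x y z).
Hypothesis f_L1 : forall x y, U x -> V y -> L1 D (f x y).

Let F x y := Ex D (f x y).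

Lemma gradx_expectation x y : U x -> V y ->
  has_gradient (fun x' => F x' y) x /\
  gradx F x y = Exv D (fun z => gradx (fun x y => f x y z) x y) /\
  forall i, L1 D (fun z => gradx (fun x y => f x y z) x y i 0).
Proof.
move=> Ux Vy.
have h1 u : U u -> L1 D (f u y) by move=> Uu; exact: f_L1.
have h2 z u : U u -> has_gradient (fun u' => f u' y z) u.
  by move=> Uu; exact: smooth_gradx (f_smooth z) _ _ Uu Vy.
have h3 z u u' : U u -> U u' -> enorm (gradient (fun u => f u y z) u
    - gradient (fun u => f u y z) u') <= l * enorm (u - u').
  by move=> Uu Uu'; have [] := smooth_lip (f_smooth z) Uu Uu Uu' Vy Vy Vy.
split; first exact: (has_gradient_expectation oU l_ge0 h1 h2 h3 Ux).
split; first exact: (gradient_expectation oU l_ge0 h1 h2 h3 Ux).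
by move=> i; exact: (L1_gradient oU l_ge0 h1 h2 h3 i Ux).
Qed.

End ExpectedObjective.

Section ExpectedConcavity.
Context (R : realType) dZ (Z : measurableType dZ) (D : probability Z R).
Variables (m n : nat) (U : set 'cV[R]_m) (V : set 'cV[R]_n) (l : R).
Variable f : 'cV[R]_m -> 'cV[R]_n -> Z -> R.
Hypotheses (oU : open U) (oV : open V) (l_ge0 : 0 <= l).
Hypothesis f_smooth : forall z, smooth_pair U V l (fun x y => f x y z).
Hypothesis f_L1 : forall x y, U x -> V y -> L1 D (f x y).

Let F x y := Ex D (f x y).

Lemma grady_expectation x y : U x -> V y ->
  has_gradient (fun y' => F x y') y /\
  grady F x y = Exv D (fun z => grady (fun x y => f x y z) x y) /\
  forall i, L1 D (fun z => grady (fun x y => f x y z) x y i 0).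
Proof.
move=> Ux Vy.
exact: (@gradx_expectation R dZ Z D n m V U l (fun y x => f x y) oV l_ge0
  (fun z => smooth_swap (f_smooth z)) (fun y x Vy Ux => f_L1 Ux Vy) y x Vy Ux).
Qed.

Lemma expectation_smooth : smooth_pair U V l F.
Proof.
split=> [x y Ux Vy|x y Ux Vy|p q x x1 x2 y y1 y2 Ux Ux1 Ux2 Vy Vy1 Vy2].
- by have [] := gradx_expectation oU l_ge0 f_smooth f_L1 Ux Vy.
- by have [] := grady_expectation Ux Vy.
have gx u v (Uu : U u) (Vv : V v) := (gradx_expectation oU l_ge0 f_smooth f_L1 Uu Vv).2.
have gy u v (Uu : U u) (Vv : V v) := (grady_expectation Uu Vv).2.
split; rewrite ?/p ?/q.
- rewrite -/(gradx F x1 y) -/(gradx F x2 y) (gx _ _ Ux1 Vy).1 (gx _ _ Ux2 Vy).1.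
  apply: lipschitz_expectation; [exact: (gx _ _ Ux1 Vy).2|exact: (gx _ _ Ux2 Vy).2|].
  by move=> z; have [] := smooth_lip (f_smooth z) Ux Ux1 Ux2 Vy Vy1 Vy2.
- rewrite -/(gradx F x y1) -/(gradx F x y2) (gx _ _ Ux Vy1).1 (gx _ _ Ux Vy2).1.
  apply: lipschitz_expectation; [exact: (gx _ _ Ux Vy1).2|exact: (gx _ _ Ux Vy2).2|].
  by move=> z; have [] := smooth_lip (f_smooth z) Ux Ux1 Ux2 Vy Vy1 Vy2.
- rewrite -/(grady F x y1) -/(grady F x y2) (gy _ _ Ux Vy1).1 (gy _ _ Ux Vy2).1.
  apply: lipschitz_expectation; [exact: (gy _ _ Ux Vy1).2|exact: (gy _ _ Ux Vy2).2|].
  by move=> z; have [] := smooth_lip (f_smooth z) Ux Ux1 Ux2 Vy Vy1 Vy2.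
- rewrite -/(grady F x1 y) -/(grady F x2 y) (gy _ _ Ux1 Vy).1 (gy _ _ Ux2 Vy).1.
  apply: lipschitz_expectation; [exact: (gy _ _ Ux1 Vy).2|exact: (gy _ _ Ux2 Vy).2|].
  by move=> z; have [] := smooth_lip (f_smooth z) Ux Ux1 Ux2 Vy Vy1 Vy2.
Qed.

(** The defining inequality is affine in the function and its gradient, and
    both commute with the expectation. *)
Lemma expectation_concave x mu : U x ->
  (forall z, strongly_concave_on V mu (fun y => f x y z)) ->
  strongly_concave_on V mu (F x).
Proof.
move=> Ux fc y y' Vy Vy'; have [_ [gyE gL1]] := grady_expectation Ux Vy.
rewrite -/(grady F x y) gyE -(Ex_dotv _ gL1).
have h1 := f_L1 Ux Vy; have h2 := f_L1 Ux Vy'; have h3 := L1_dotv (y' - y) gL1.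
have h4 := L1_cst D (mu / 2 * enorm (y' - y) ^+ 2).
rewrite -(Ex_cst D (mu / 2 * _)) /F -(ExD h1 h3) -(ExB (L1D h1 h3) h4).
by apply: Ex_le => // [|z]; [exact: L1B (L1D h1 h3) h4 | exact: fc].
Qed.

End ExpectedConcavity.

(** On a short segment the gradient varies at least mu and at most l times the
    length. *)
Lemma strong_concavity_le_lipschitz (R : realType) n (V : set 'cV[R]_n) (h : 'cV[R]_n -> R)
    mu l : (0 < n)%N -> open V -> V !=set0 -> strongly_concave_on V mu h ->
  (forall y y', V y -> V y' -> enorm (gradient h y - gradient h y') <= l * enorm (y - y')) ->
  mu <= l.
Proof.
case: n V h => [//|n] V h _ oV [y Vy] hc hl; have [r r0 yr] := open_enorm oV Vy.
set d := (r / 2) *: basis_vec R (@ord0 n).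
have nd : enorm d = r / 2 by rewrite enormZ enorm_basis mulr1 gtr0_norm// divr_gt0.
have Vd : V (y + d).
  by apply: yr; rewrite addrC addKr nd ltr_pdivrMr// ltr_pMr// ltr1n.
have := hc _ _ Vy Vd; have := hc _ _ Vd Vy; have := hl _ _ Vy Vd.
have -> : y + d - y = d by rewrite addrC addKr.
have -> : y - (y + d) = - d by rewrite opprD addNKr.
rewrite enormN dotvNr => h1 h2 h3.
have h4 := dotv_le (gradient h y - gradient h (y + d)) d; rewrite dotvBl in h4.
have h5 := le_trans h4 (ler_wpM2r (enorm_ge0 d) h1).
have d0 : 0 < enorm d ^+ 2 by rewrite nd exprn_gt0// divr_gt0.
rewrite -(ler_pM2r d0) [leRHS](_ : _ = l * enorm d * enorm d); last by ring.
move: h2 h3 h5; dlra.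
Qed.

Lemma differentiable_smooth_pair (R : realType) m n (U : set 'cV[R]_m) (V : set 'cV[R]_n) l f :
  (forall x y, U x -> V y ->
     differentiable (fun q : 'cV[R]_m * 'cV[R]_n => f q.1 q.2) (x, y)) ->
  lipschitz_gradients U V l f -> smooth_pair U V l f.
Proof.
move=> fd fl; split=> // x y Ux Vy; by have [] := differentiable_partials (fd _ _ Ux Vy).
Qed.

(** * The recursive momentum estimator along a trajectory *)

Section Momentum.
Context (R : realType) dO dZ (Om : measurableType dO) (Z : measurableType dZ).
Variables (P : probability Om R) (D : probability Z R) (b : nat).
Variable zeta : nat -> 'I_b -> Om -> Z.
Hypotheses (iid : iid_samples P D zeta) (b_gt0 : (0 < b)%N).
Local Notation history := (history zeta).

(** The samples drawn up to step k: the iterate k + 1 depends on these only,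
    the direction computed there on one batch more. *)
Definition past k : set (nat * 'I_b) := [set kj | (kj.1 <= k)%N].

Lemma past_mono k : past k `<=` past k.+1.
Proof. by move=> kj /= /leq_trans; apply. Qed.

Lemma past_next k j : ~ past k (k.+1, j).
Proof. by rewrite /past /= ltnn. Qed.

Variables (m n : nat) (U : set 'cV[R]_m) (V : set 'cV[R]_n) (l : R).
Variable f : 'cV[R]_m -> 'cV[R]_n -> Z -> R.
Hypotheses (oU : open U) (oV : open V) (l_ge0 : 0 <= l).
Hypothesis f_smooth : forall z, smooth_pair U V l (fun x y => f x y z).
Hypothesis f_L1 : forall x y, U x -> V y -> L1 D (f x y).

(** s collects the part of the gradient that does not depend on the samples. *)
Variables (a : nat -> Om -> 'cV[R]_m) (c : nat -> Om -> 'cV[R]_n)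
  (s v : nat -> Om -> 'cV[R]_m) (theta rho : nat -> R).

Definition est k w z := zo_gradx (theta k) (fun x y => f x y z) (a k w) (c k w).

Hypothesis rho0 : rho 0%N = 1.
Hypothesis vE : forall k w, v k.+1 w =
  (b%:R^-1 *: \sum_j est k.+1 w (zeta k.+1 j w) - s k.+1 w)
  + (1 - rho k) *: (v k w - (b%:R^-1 *: \sum_j est k w (zeta k.+1 j w) - s k w)).

(** The estimator is queried inside the domain of the objective. *)
Definition admissible k := forall w, [/\ U (a k w), V (c k w) &
  forall i t, 0 <= t <= 1 -> U (a k w + (t * theta k) *: basis_vec R i)].

Lemma admissible_query k w i : admissible k -> U (a k w + theta k *: basis_vec R i).
Proof. by move=> /(_ w)[_ _ h]; have := h i 1; rewrite mul1r ler01 lexx; exact. Qed.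

Definition adapted k := [/\ measurable_vec (a k.+1 : history (past k) -> _),
  measurable_vec (c k.+1 : history (past k) -> _) &
  measurable_vec (s k.+1 : history (past k) -> _)].

Lemma est_jointly_measurable k : admissible k.+1 -> adapted k ->
  jointly_measurable zeta (est k.+1) (past k).
Proof.
move=> ad [ma mc _] i.
apply: (zo_gradx_jointly_measurable oU oV l_ge0 f_smooth f_L1) => //.
- by move=> w; case: (ad w).
- by move=> w; case: (ad w).
- by move=> w; exact: admissible_query.
Qed.

(** The momentum uses the old direction, the old and the new iterate, all known
    at step k, and the batch of step k + 1. *)
Lemma momentum_adapted k : admissible k.+1 -> adapted k ->
  ((0 < k)%N -> [/\ admissible k, adapted k.-1 &
     measurable_vec (v k : history (past k) -> _)]) ->
  measurable_vec (v k.+1 : history (past k.+1) -> _).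
Proof.
move=> ad1 mk IH.
have batch k' : (k' <= k)%N -> admissible k'.+1 -> adapted k' ->
   measurable_vec ((fun w => b%:R^-1 *: \sum_j est k'.+1 w (zeta k.+1 j w) - s k'.+1 w)
     : history (past k.+1) -> _).
  move=> k'k ad mk'.
  have sub : past k' `<=` past k.+1.
    by move=> kj /= h; apply: leq_trans (leqW k'k).
  apply: measurable_vecB; last by apply: (measurable_vec_mono sub); case: mk'.
  apply: measurable_vecZ; apply: measurable_vec_sum => j.
  exact: (jointly_measurable_sample (kj := (k.+1, j)) sub (leqnn _) _
    (est_jointly_measurable ad mk')).
have -> : v k.+1 = (fun w => (b%:R^-1 *: \sum_j est k.+1 w (zeta k.+1 j w) - s k.+1 w)
  + (1 - rho k) *: (v k w - (b%:R^-1 *: \sum_j est k w (zeta k.+1 j w) - s k w))).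
  by apply/funext => w; exact: vE.
apply: measurable_vecD; first exact: batch.
case: k mk IH batch {ad1} => [|k] mk IH batch.
  by under [fun _ => _]funext do rewrite rho0 subrr scale0r; exact: measurable_vec_cst.
have [adk mk' mv] := IH isT.
apply: measurable_vecZ; apply: measurable_vecB; last exact: batch.
exact: (measurable_vec_mono (@past_mono _)).
Qed.

Let F x y := Ex D (f x y).

Definition err k w := zo_gradx (theta k) F (a k w) (c k w) - s k w - v k w.

Lemma est_mean k w : admissible k -> zo_gradx (theta k) F (a k w) (c k w) = Exv D (est k w).
Proof.
move=> ad; have [Ua Vc _] := ad w; apply: (zo_gradx_expectation f_L1) => // i.
exact: admissible_query.
Qed.

Lemma est_L1 k w i : admissible k -> L1 D (fun z => est k w z i 0).
Proof.
move=> ad; have [Ua Vc _] := ad w.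
by apply: (L1_zo_gradx f_L1) => //; exact: admissible_query.
Qed.

Lemma sum_ord_cst (u : 'cV[R]_m) : b%:R^-1 *: \sum_(j < b) u = u.
Proof.
rewrite sumr_const card_ord -(scaler_nat b u) scalerA mulVf ?scale1r//.
by rewrite pnatr_eq0 -lt0n.
Qed.

(** Subtracting the mean estimator from the recursion leaves the old error,
    damped, and centred terms of the fresh batch. At k = 0 the factor 1 - rho
    vanishes, so nothing is asked of the iterate 0. *)
Lemma err_rec k w : admissible k.+1 -> ((0 < k)%N -> admissible k) ->
  err k.+1 w = (1 - rho k) *: err k w + b%:R^-1 *: \sum_(j < b)
    ((1 - rho k) *: (est k w (zeta k.+1 j w) - Exv D (est k w))
     - (est k.+1 w (zeta k.+1 j w) - Exv D (est k.+1 w))).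
Proof.
move=> ad1 ad; rewrite /err vE est_mean//.
have -> : (1 - rho k) *: (zo_gradx (theta k) F (a k w) (c k w) - s k w - v k w) =
    (1 - rho k) *: (Exv D (est k w) - s k w - v k w).
  case: k ad {ad1} => [|k] ad; first by rewrite rho0 subrr !scale0r.
  by rewrite est_mean//; exact: ad.
have avg (u : 'I_b -> 'cV[R]_m) u0 :
    b%:R^-1 *: \sum_j (u j - u0) = b%:R^-1 *: \sum_j u j - u0.
  by rewrite sumrB scalerBr sum_ord_cst.
have comb (u u' : 'I_b -> 'cV[R]_m) u0 u0' r :
    b%:R^-1 *: \sum_j (r *: (u j - u0) - (u' j - u0')) =
    r *: (b%:R^-1 *: \sum_j u j - u0) - (b%:R^-1 *: \sum_j u' j - u0').
  by rewrite sumrB scalerBr -scaler_sumr scalerA [b%:R^-1 * _]mulrC -scalerA !avg.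
rewrite comb.
move: (b%:R^-1 *: \sum_j est k.+1 w _) (b%:R^-1 *: \sum_j est k w _) => u1 u2.
apply/colP => i; rewrite !mxE; ring.
Qed.

Variable delta : R.
Hypothesis variance : forall k w, admissible k.+1 ->
  L1 D (fun z => enorm (est k.+1 w z - Exv D (est k.+1 w)) ^+ 2) /\
  Ex D (fun z => enorm (est k.+1 w z - Exv D (est k.+1 w)) ^+ 2) <= delta ^+ 2.

Lemma mean_adapted k : admissible k.+1 -> adapted k ->
  measurable_vec ((fun w => Exv D (est k.+1 w)) : history (past k) -> _).
Proof.
move=> ad [ma mc _] i.
have sF := expectation_smooth oU oV l_ge0 f_smooth f_L1.
have -> : (fun w => Exv D (est k.+1 w) i 0) =
    (fun w => zo_gradx (theta k.+1) F (a k.+1 w) (c k.+1 w) i 0).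
  by apply/funext => w; rewrite est_mean.
apply: (pair_measurable (f := fun x y => zo_gradx (theta k.+1) F x y i 0)) => // w.
have [Ua Vc _] := ad w.
apply: (zo_gradx_continuous oU oV l_ge0 sF) => //; exact: admissible_query.
Qed.

(** The first direction is a plain mini-batch mean. *)
Lemma err_first : admissible 1 -> adapted 0 ->
  L1 P (fun w => enorm (err 1 w) ^+ 2) /\
  Ex P (fun w => enorm (err 1 w) ^+ 2) <= b%:R^-1 * (2 * delta ^+ 2).
Proof.
move=> ad1 m1.
pose Inc w : R := 0; pose H0 (_ : Om) (_ : Z) : 'cV[R]_m := 0.
have := @storm_step R dO dZ Om Z P D b zeta iid m (past 0) 1 (fun=> 0) (est 1) (est 1) 1 0 0
  delta (fun=> 0).
move=> /(_ isT b_gt0 (@past_next 0)); rewrite subrr expr0n/= => /(_ (lexx 0)).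
move=> /(_ (measurable_vec_cst _)).
have z0 : (fun w : Om => enorm (0 : 'cV[R]_m) ^+ 2) = (fun=> 0).
  by apply/funext => w; rewrite enorm0 expr0n.
rewrite z0 => /(_ (L1_cst _ _)).
have mj := est_jointly_measurable ad1 m1; have mm := mean_adapted ad1 m1.
move=> /(_ mj mj mm mm (fun w i => est_L1 w i ad1) (fun w i => est_L1 w i ad1)).
move=> /(_ (fun w => variance w ad1)).
have h0 w z : enorm (est 1 w z - est 1 w z) ^+ 2 <= 0 by rewrite subrr enorm0 expr0n.
move=> /(_ h0 (fun=> lexx 0) (measurable_cst _)).
have -> : (fun w => enorm ((0 : R) *: (0 : 'cV[R]_m) + b%:R^-1 *: \sum_(j < b)
    ((0 : R) *: (est 1 w (zeta 1 j w) - Exv D (est 1 w))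
      - (est 1 w (zeta 1 j w) - Exv D (est 1 w)))) ^+ 2) = (fun w => enorm (err 1 w) ^+ 2).
  have ad0 : (0 < 0)%N -> admissible 0 by [].
  apply/funext => w; rewrite (err_rec w ad1 ad0) rho0 subrr.
  move: (est 0) (est 1) (err 0 w) => E0 E1 e0; rewrite !scale0r.
  suff -> : \sum_j ((0 : R) *: (E0 w (zeta 1 j w) - Exv D (E0 w))
               - (E1 w (zeta 1 j w) - Exv D (E1 w))) =
            \sum_j ((0 : R) *: (E1 w (zeta 1 j w) - Exv D (E1 w))
               - (E1 w (zeta 1 j w) - Exv D (E1 w))) by [].
  by apply: eq_bigr => j _; rewrite !scale0r.
by rewrite mul0r add0r expr1n mulr1 mulr0 mul0r addr0.
Qed.

Lemma err_step k q M (Inc : Om -> R) :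
  admissible k.+1 -> adapted k -> admissible k.+2 -> adapted k.+1 ->
  measurable_vec (v k.+1 : history (past k.+1) -> _) ->
  L1 P (fun w => enorm (err k.+1 w) ^+ 2) -> (1 - rho k.+1) ^+ 2 <= q ->
  0 < theta k.+2 -> theta k.+2 <= theta k.+1 ->
  (forall w, Inc w = 6 * l ^+ 2 * (enorm (a k.+2 w - a k.+1 w) ^+ 2
       + enorm (c k.+2 w - c k.+1 w) ^+ 2) + 3 / 2 * (m%:R * l ^+ 2 * theta k.+1 ^+ 2)) ->
  (forall w, Inc w <= M) ->
  L1 P (fun w => enorm (err k.+2 w) ^+ 2) /\
  Ex P (fun w => enorm (err k.+2 w) ^+ 2)
    <= (1 - rho k.+1) ^+ 2 * Ex P (fun w => enorm (err k.+1 w) ^+ 2)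
       + b%:R^-1 * (2 * rho k.+1 ^+ 2 * delta ^+ 2 + 2 * q * Ex P Inc).
Proof.
move=> ad1 m1 ad2 m2 mv eL1 rq t0 tt IncE IncM.
have sub := @past_mono k.
have mono N (u : Om -> 'cV[R]_N) : measurable_vec (u : history (past k) -> _) ->
    measurable_vec (u : history (past k.+1) -> _) by exact: measurable_vec_mono.
have [ma1 mc1 ms1] := m1; have [ma2 mc2 ms2] := m2.
have mE1 := mono _ _ (mean_adapted ad1 m1).
have merr : measurable_vec (err k.+1 : history (past k.+1) -> _).
  apply: measurable_vecB => //; apply: measurable_vecB; last exact: mono.
  by under [fun _ => _]funext do rewrite est_mean//.
have mInc : measurable_fun setT Inc.
  have mo N (u : Om -> 'cV[R]_N) : measurable_vec (u : history (past k.+1) -> _) ->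
     measurable_vec u by exact: (history_measurable_vec iid).
  have -> : Inc = (fun w => 6 * l ^+ 2 * (enorm (a k.+2 w - a k.+1 w) ^+ 2
       + enorm (c k.+2 w - c k.+1 w) ^+ 2) + 3 / 2 * (m%:R * l ^+ 2 * theta k.+1 ^+ 2)).
    exact/funext.
  apply: measurable_funD; last exact: measurable_cst.
  apply: measurable_funM; first exact: measurable_cst.
  apply: measurable_funD; apply: measurable_sqr_enorm; apply: measurable_vecB; apply: mo => //.
    exact: mono.
  exact: mono.
have := @storm_step R dO dZ Om Z P D b zeta iid m (past k.+1) k.+2 (err k.+1)
  (est k.+1) (est k.+2) (rho k.+1) q M delta Inc.
move=> /(_ isT b_gt0 (@past_next k.+1) rq).
have -> : (fun w => enorm ((1 - rho k.+1) *: err k.+1 w + b%:R^-1 *: \sum_(j < b)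
    ((1 - rho k.+1) *: (est k.+1 w (zeta k.+2 j w) - Exv D (est k.+1 w))
     - (est k.+2 w (zeta k.+2 j w) - Exv D (est k.+2 w)))) ^+ 2)
  = (fun w => enorm (err k.+2 w) ^+ 2).
  by apply/funext => w; rewrite (err_rec w ad2 (fun=> ad1)).
apply=> //.
- exact: (jointly_measurable_mono sub (est_jointly_measurable ad1 m1)).
- exact: est_jointly_measurable.
- exact: mean_adapted.
- by move=> w i; exact: est_L1.
- by move=> w i; exact: est_L1.
- by move=> w; exact: variance.
move=> w z; rewrite IncE; have [Ua1 Vc1 q1] := ad1 w; have [Ua2 Vc2 q2] := ad2 w.
exact: (zo_gradx_increment l_ge0 f_smooth z t0 tt Ua1 Ua2 Vc1 Vc2 q1 q2).
Qed.

End Momentum.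

(** * Rates of the step sizes *)

Section Rates.
Variable R : realType.
Implicit Types a c q u v : R.

(** All rates are powers of this cube root, which turns them into polynomial
    inequalities. *)
Definition crt a := a `^ (1 / 3).

Lemma crt_gt0 a : 0 < a -> 0 < crt a. Proof. exact: powR_gt0. Qed.

Lemma crt3 a : 0 <= a -> crt a ^+ 3 = a.
Proof.
move=> a0; rewrite -powR_mulrn ?powR_ge0// -powRrM.
have -> : 1 / 3 * 3%:R = 1 :> R by field.
by rewrite powRr1.
Qed.

Lemma powR23 a : a `^ (2 / 3) = crt a ^+ 2.
Proof.
rewrite -powR_mulrn ?powR_ge0// -powRrM; congr (_ `^ _); by field.
Qed.

Lemma crt_lt u v : 0 <= u -> 0 <= v -> u ^+ 3 < v -> u < crt v.
Proof.
move=> u0 v0; rewrite -{1}(crt3 v0) ltr_pXn2r// nnegrE; exact: powR_ge0.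
Qed.

Lemma lt_crt u v : 0 <= u -> 0 <= v -> v < u ^+ 3 -> crt v < u.
Proof.
move=> u0 v0; rewrite -{1}(crt3 v0) ltr_pXn2r// nnegrE; exact: powR_ge0.
Qed.

Lemma crt_le u v : 0 <= u -> u <= v -> crt u <= crt v.
Proof. by move=> u0 uv; apply: ge0_ler_powR; rewrite ?nnegrE// (le_trans u0). Qed.

(** The indices 3, 4, 5 occur in the estimate for the second iterate, where the
    constants leave little room. *)
Lemma crt_numeric : [/\ 144 / 100 <= crt 3 <= 14425 / 10000,
  1587 / 1000 <= crt 4 <= 15875 / 10000 & crt 5 <= 171 / 100].
Proof.
have frac m n : 0 <= m%:R / n%:R :> R by rewrite divr_ge0.
split; [apply/andP; split|apply/andP; split|]; apply: ltW;
  first [apply: crt_lt|apply: lt_crt]; rewrite ?frac// ?ler0n//; lra.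
Qed.

(** A difference of squares of cube roots against the inverse root at the left
    end. The increment of the argument may be as large as 2, so one term can
    cover two unit steps. *)
Lemma rate_diff (d e : R) : 0 < d -> d <= e -> e ^+ 3 - d ^+ 3 <= 2 ->
  3 / 4 * (e ^+ 2 - d ^+ 2) <= d^-1.
Proof.
move=> d0 de h; rewrite -[d^-1]mul1r ler_pdivlMr//.
have e0 : 0 < e := lt_le_trans d0 de.
have h2 : 0 <= (e - d) ^+ 2 * (2 * e + d).
  by rewrite mulr_ge0 ?sqr_ge0// addr_ge0 ?mulr_ge0// ltW.
move: h h2; glra.
Qed.

(** Term by term, against the telescoped increments of the squared cube root.
    The first term has to cover the two unit increments from 4 to 6. *)
Lemma sum_rate T : (2 < T)%N ->
  3 / 4 * (crt (T%:R + 3) ^+ 2 - crt 4 ^+ 2) <= \sum_(2 <= k < T) (crt k.+2%:R)^-1.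
Proof.
case: T => // T; rewrite ltnS; elim: T => // T IH; rewrite leq_eqVlt => /predU1P[<-|T2].
  rewrite big_nat1; have -> : 3%:R + 3 = 6 :> R by ring.
  apply: rate_diff; [by apply: crt_gt0; rewrite ltr0n|by apply: crt_le; rewrite ?ler_nat|].
  by rewrite !crt3// lerBlDr -natrD.
rewrite big_nat_recr/=; last exact: leqW.
have {}IH := IH T2.
set u := T.+1%:R + 3 in IH *.
have -> : T.+2%:R + 3 = u + 1 :> R by rewrite /u -natr1; ring.
have u0 : 3 <= u by rewrite lerDr.
have -> : T.+3%:R = u - 1 :> R by rewrite /u -!natr1; ring.
set c := crt (u - 1); set d := crt u in IH *; set e := crt (u + 1).
have c0 : 0 < c by apply: crt_gt0; lra.
have d0 : 0 < d by apply: crt_gt0; lra.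
have e0 : 0 < e by apply: crt_gt0; lra.
have cd : c <= d by apply: crt_le; lra.
have k : 3 / 4 * (e ^+ 2 - d ^+ 2) <= c^-1.
  apply: (@le_trans _ _ d^-1); last by rewrite lef_pV2.
  by apply: rate_diff => //; [apply: crt_le; lra | rewrite !crt3; lra].
move: IH k; glra.
Qed.

(** Each 1/j is at most ln j - ln (j - 1). *)
Lemma sum_inv_ln T : (2 <= T)%N ->
  \sum_(2 <= k < T) (k.+2%:R)^-1 <= ln (T%:R + 1) - ln 3 :> R.
Proof.
case: T => // T; rewrite ltnS; elim: T => // T IH; rewrite leq_eqVlt => /predU1P[<-|T1].
  by rewrite big_geq// natr1 subrr.
rewrite big_nat_recr/=; last by [].
have {}IH := IH T1; apply: le_trans (lerD IH (lexx _)) _.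
rewrite !natr1; set j : R := T.+3%:R.
have j0 : 0 < j by rewrite ltr0n.
have k0 : 0 < T.+2%:R :> R by rewrite ltr0n.
have kE : T.+2%:R = (1 - j^-1) * j :> R.
  by rewrite mulrBl mul1r mulVf ?gt_eqF// /j -[in RHS]natr1 addrK.
have p0 : 0 < 1 - j^-1 by move: k0; rewrite kE pmulr_lgt0.
have := le_ln1Dx (_ : -1 < - j^-1); rewrite ltrN2 => /(_ _) h.
have {}h : ln (1 - j^-1) <= - j^-1 by apply: h; rewrite -subr_gt0.
rewrite kE lnM ?posrE//; move: h; move: (ln (1 - j^-1)) (ln j) j^-1 => u v s; glra.
Qed.

Lemma ln4_ge1 : 1 <= ln 4 :> R.
Proof.
have h : ln (1 + - (1 / 2)) <= - (1 / 2) :> R by apply: le_ln1Dx; lra.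
have e : 1 + - (1 / 2) = 2^-1 :> R by field.
rewrite e lnV ?posrE// in h.
have -> : 4 = 2 * 2 :> R by rewrite -natrM.
rewrite lnM ?posrE//; move: h; move: (ln 2) => q; lra.
Qed.

End Rates.

(** * The budget of the potential function *)

Section Budget.
Variable R : realFieldType.

(** The growth of 1/eta costs (c - c')/A3, which is at most 2/(3 A3 c) for
    consecutive cube roots; the contraction factor (1 - rho)^2 <= 1 - rho pays
    for it and leaves a third of A A' for the gap. *)
Lemma error_budget (a a' A3 kap c' c : R) : 0 < a -> 0 < A3 ->
  1 <= c' -> 1 <= c -> c ^+ 3 = c' ^+ 3 + 1 -> 0 < a' / c ^+ 2 <= 1 ->
  a + 3 / 2 * A3 ^+ 2 * kap <= a * a' ->
  a / (A3 / c) * (1 - a' / c ^+ 2) ^+ 2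
   + A3 / c * (kap + a * a' / (3 * A3 ^+ 2)) <= a / (A3 / c').
Proof.
move=> a0 A30 c'1 c1 c3 /andP[r0 r1] h.
have c0 : 0 < c by apply: lt_le_trans c1.
have c'0 : 0 < c' by apply: lt_le_trans c'1.
set rho := a' / c ^+ 2 in r0 r1 *.
have h1 : (1 - rho) ^+ 2 <= 1 - rho.
  have := mulr_ge0 (ltW r0) (_ : 0 <= 1 - rho); rewrite subr_ge0 => /(_ r1); glra.
have acA : 0 <= a / (A3 / c) by rewrite ltW// !divr_gt0.
apply: le_trans (lerD (ler_wpM2l acA h1) (lexx _)) _.
have h2 : c * (c - c') <= 2 / 3.
  pose s := c ^+ 2 + c * c' + c' ^+ 2.
  have s0 : 0 < s by rewrite !addr_gt0 ?mulr_gt0 ?exprn_gt0.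
  have cs : (c - c') * s = 1 by rewrite /s; move: c3; glra.
  have sc : 3 * c <= 2 * s.
    have q1 : c * 1 <= c * c by rewrite ler_pM2l.
    have q2 : c * 1 <= c * c' by rewrite ler_pM2l.
    have q3 := sqr_ge0 c'.
    rewrite /s; move: c0 q1 q2 q3; glra.
  have d0 : 0 <= c - c' by rewrite -(pmulr_lge0 _ s0) cs.
  have := ler_wpM2l d0 sc; move: cs; glra.
have E : a / (A3 / c') - (a / (A3 / c) * (1 - rho) + A3 / c * (kap + a * a' / (3 * A3 ^+ 2)))
  = (A3 * c)^-1 * (2 / 3 * (a * a' - 3 / 2 * A3 ^+ 2 * kap) - a * (c * (c - c'))).
  by rewrite /rho; field; rewrite !gt_eqF.
rewrite -subr_ge0 E; apply: mulr_ge0; first by rewrite invr_ge0 ltW// mulr_gt0.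
have := ler_wpM2l (ltW a0) h2; move: h; glra.
Qed.

Variables (L l mu alpha beta gamma nB : R) (A1 A2 A3 A4 A5 D1 delta eps b : R).
Hypothesis sizes : step_sizes L mu alpha beta gamma nB.

(** The conditions on A1, ..., A5 cleared of denominators. *)
Record weights : Prop := {
  wt_A1 : 0 < A1; wt_A2 : 0 < A2; wt_A3 : 0 < A3; wt_A31 : A3 <= 1; wt_b : 0 < b;
  wt_D1 : 0 < D1;
  wt_A1x : 72 * alpha * L ^+ 2 * A1 <= b; wt_A2x : 72 * alpha * L ^+ 2 * A2 <= b;
  wt_A1y : 9 * mu * beta * A1 <= 11 * alpha * b; wt_A2y : 9 * mu * beta * A2 <= 11 * alpha * b;
  wt_A4 : A1 + 3 * A3 ^+ 2 * alpha <= A1 * A4;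
  wt_A5 : A2 + 480 * A3 ^+ 2 * (alpha * L ^+ 2 / mu ^+ 2) <= A2 * A5 }.

Hypothesis wts : weights.
Let W := 32 * alpha * L ^+ 2 / (beta * mu).
Let ky := alpha * L ^+ 2 / (mu * beta).
Let km := alpha * L ^+ 2 / mu ^+ 2.

(** The x- and the y-block enter the potential in the same way; kap is what the
    descent of the dual function spends on the momentum error of the block, kb
    on its bias. *)
Lemma block_step (a a' kap kb c' c q r n et et' rho mx my ex ex' bx : R) :
  0 < a -> 72 * alpha * L ^+ 2 * a <= b -> 9 * mu * beta * a <= 11 * alpha * b ->
  a + 3 / 2 * A3 ^+ 2 * kap <= a * a' -> 0 <= kb ->
  0 <= l -> l <= L -> 1 <= c' -> 1 <= c -> c ^+ 3 = n -> c ^+ 3 = c' ^+ 3 + 1 ->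
  et = A3 / c -> et' = A3 / c' -> rho = a' / c ^+ 2 -> 0 < rho <= 1 ->
  (1 - rho) ^+ 2 <= q -> (c ^+ 2)^-1 <= r -> q <= r ->
  0 <= mx -> 0 <= my -> 0 <= ex -> 0 <= bx ->
  4 * c ^+ 2 * (3 * D1 + kb + 12 * a / (b * A3 ^+ 2)) * bx <= eps ^+ 2 * D1 ->
  ex' <= (1 - rho) ^+ 2 * ex
    + b^-1 * (2 * rho ^+ 2 * delta ^+ 2 + 2 * q * (6 * l ^+ 2 * et ^+ 2 * (mx + my) + 6 * bx)) ->
  et * (kap * ex + kb * bx) + a / et * ex' <= a / et' * ex
    + et * (q / 6 * (alpha^-1 * mx) + 44 / 3 * q * (ky * my) - a * a' / (3 * A3 ^+ 2) * ex
            + r * (eps ^+ 2 * D1 / 4) - 3 * D1 * bx)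
    + 2 * delta ^+ 2 * (a' ^+ 2 * a) / (b * A3) / n.
Proof.
case: sizes => mu0 muL be0 betaL al0 alpha_le ga0 gamma_le1 gamma_le2 nB0 nBL.
have L0 : 0 < L := lt_le_trans mu0 muL.
case: wts => _ _ A30 A31 b0 D10 _ _ _ _ _ _.
move=> a0 ax ay ha' kb0 l0 lL c'1 c1 c3n c3 etE et'E rhoE rho01 hq cr qr.
move=> mx0 my0 ex0 bx0 Bx H.
have c0 : 0 < c by apply: lt_le_trans c1.
have c'0 : 0 < c' by apply: lt_le_trans c'1.
have et0 : 0 < et by rewrite etE divr_gt0.
have q0 : 0 <= q by apply: le_trans hq; exact: sqr_ge0.
have aet : 0 <= a / et by rewrite ltW// divr_gt0.
have k1 : a / et * (1 - rho) ^+ 2 + et * (kap + a * a' / (3 * A3 ^+ 2)) <= a / et'.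
  by rewrite etE et'E rhoE; apply: error_budget => //; rewrite -rhoE.
have k2 : a / et * (b^-1 * (2 * rho ^+ 2 * delta ^+ 2)) = 2 * delta ^+ 2 * (a' ^+ 2 * a) / (b * A3) / n.
  by rewrite -c3n rhoE etE; field; rewrite !gt_eqF.
have l2 : l ^+ 2 <= L ^+ 2 by rewrite ler_pXn2r ?nnegrE// ltW.
have k3 : a / et * (b^-1 * (12 * q * l ^+ 2 * et ^+ 2)) * mx <= et * (q / 6 * (alpha^-1 * mx)).
  rewrite [leRHS](_ : _ = et * (q / 6 * alpha^-1) * mx); last by ring.
  rewrite ler_wpM2r//.
  have -> : a / et * (b^-1 * (12 * q * l ^+ 2 * et ^+ 2)) = et * (12 * q * (a * l ^+ 2 / b)).
    by field; rewrite !gt_eqF.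
  rewrite ler_pM2l//.
  have h : a * l ^+ 2 / b <= (72 * alpha)^-1.
    rewrite ler_pdivrMr// [leRHS]mulrC ler_pdivlMr ?mulr_gt0//; apply: le_trans ax.
    rewrite [leRHS](_ : _ = a * L ^+ 2 * (72 * alpha)); last by ring.
    by rewrite ler_wpM2r ?mulr_ge0 ?(ltW al0)// ler_pM2l.
  have q12 : 0 <= 12 * q by rewrite mulr_ge0.
  apply: le_trans (ler_wpM2l q12 h) _; rewrite invfM.
  by rewrite [leLHS](_ : _ = q / 6 * alpha^-1)//; field; rewrite gt_eqF.
have k4 : a / et * (b^-1 * (12 * q * l ^+ 2 * et ^+ 2)) * my <= et * (44 / 3 * q * (ky * my)).
  rewrite [leRHS](_ : _ = et * (44 / 3 * q * ky) * my); last by ring.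
  rewrite ler_wpM2r//.
  have -> : a / et * (b^-1 * (12 * q * l ^+ 2 * et ^+ 2)) = et * (12 * q * (a * l ^+ 2 / b)).
    by field; rewrite !gt_eqF.
  rewrite ler_pM2l//.
  have h : a * l ^+ 2 / b <= 11 / 9 * ky.
    rewrite ler_pdivrMr// /ky.
    rewrite [leRHS](_ : _ = 11 * alpha * b / (9 * mu * beta) * L ^+ 2); last first.
      by field; rewrite !gt_eqF.
    apply: ler_pM => //; [exact: ltW|exact: sqr_ge0|].
    by rewrite ler_pdivlMr ?mulr_gt0// mulrC.
  have q12 : 0 <= 12 * q by rewrite mulr_ge0.
  by have := ler_wpM2l q12 h; glra.
have k5 : et * (kb * bx) + a / et * (b^-1 * (12 * q * bx)) + et * (3 * D1 * bx)
    <= et * (r * (eps ^+ 2 * D1 / 4)).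
  have rc : 1 <= r * c ^+ 2 by rewrite -ler_pdivrMr ?exprn_gt0// div1r.
  have r0 : 0 <= r := le_trans q0 qr.
  have -> : et * (kb * bx) + a / et * (b^-1 * (12 * q * bx)) + et * (3 * D1 * bx)
    = et * ((kb + 3 * D1) * bx + q * c ^+ 2 * (12 * a / (b * A3 ^+ 2)) * bx).
    by rewrite etE; field; rewrite !gt_eqF.
  rewrite ler_pM2l//.
  have t0 : 0 <= 12 * a / (b * A3 ^+ 2).
    by rewrite divr_ge0 ?mulr_ge0 ?sqr_ge0 ?ltW.
  have s0 : 0 <= (kb + 3 * D1) * bx by rewrite mulr_ge0// addr_ge0// mulr_ge0// ltW.
  have u1 := ler_wpM2r s0 rc.
  have u2 : q * c ^+ 2 * (12 * a / (b * A3 ^+ 2)) * bx <= r * c ^+ 2 * (12 * a / (b * A3 ^+ 2)) * bx.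
    by rewrite ler_wpM2r// ler_wpM2r// ler_wpM2r ?sqr_ge0.
  have u3 := ler_wpM2l r0 Bx.
  move: u1 u2 u3; set t := 12 * a / _; glra.
have k6 := ler_wpM2r ex0 k1.
have k7 := ler_wpM2l aet H.
apply: le_trans (lerD (lexx _) k7) _; rewrite -k2.
move: k3 k4 k5 k6; set t := a * a' / _; set ae := a / et; set ae' := a / et'; glra.
Qed.

(** The decrease of the potential. The momentum errors enter the potential with
    weights A1/eta, A2/eta, which turns their recursion into a decrease, at the
    price of the increments of the iterates (a fraction q/3 of alpha^-1 |s_x|^2
    and 88q/3 of the y-term), of the noise and of the bias. *)
Lemma potential_step (c' c q r n et et' rho iota md md' gy gy' mx my ex ex' ey ey' T bx by_ : R) :
  0 <= l -> l <= L -> 1 <= c' -> 1 <= c -> c ^+ 3 = n -> c ^+ 3 = c' ^+ 3 + 1 -> c <= 5 / 4 * c' ->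
  et = A3 / c -> et' = A3 / c' -> rho = A4 / c ^+ 2 -> iota = A5 / c ^+ 2 ->
  0 < rho <= 1 -> 0 < iota <= 1 ->
  (1 - rho) ^+ 2 <= q -> (1 - iota) ^+ 2 <= q -> (c ^+ 2)^-1 <= r -> q <= r ->
  0 <= gy -> 0 <= mx -> 0 <= my -> 0 <= ex -> 0 <= ey -> 0 <= bx -> 0 <= by_ ->
  4 * c ^+ 2 * (3 * D1 + 4 * alpha + 12 * A1 / (b * A3 ^+ 2)) * bx <= eps ^+ 2 * D1 ->
  4 * c ^+ 2 * (3 * D1 + 12 * A2 / (b * A3 ^+ 2) + 320 * km) * by_ <= eps ^+ 2 * D1 ->
  md' + (W - 4 * et * alpha * L ^+ 2) * gy' <=
     md + (W - 5 * et * alpha * L ^+ 2) * gy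
     + et * (T - 34 * ky * my + 2 * alpha * ex + 4 * alpha * bx + 320 * km * (ey + by_)) ->
  ex' <= (1 - rho) ^+ 2 * ex
    + b^-1 * (2 * rho ^+ 2 * delta ^+ 2 + 2 * q * (6 * l ^+ 2 * et ^+ 2 * (mx + my) + 6 * bx)) ->
  ey' <= (1 - iota) ^+ 2 * ey
    + b^-1 * (2 * iota ^+ 2 * delta ^+ 2 + 2 * q * (6 * l ^+ 2 * et ^+ 2 * (mx + my) + 6 * by_)) ->
  md' + (W - 4 * et * alpha * L ^+ 2) * gy' + A1 / et * ex' + A2 / et * ey'
  <= md + (W - 4 * et' * alpha * L ^+ 2) * gy + A1 / et' * ex + A2 / et' * ey
    + et * (T + q / 3 * (alpha^-1 * mx) - (34 - 88 / 3 * q) * (ky * my)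
       - A1 * A4 / (3 * A3 ^+ 2) * ex - A2 * A5 / (3 * A3 ^+ 2) * ey
       + r * (eps ^+ 2 * D1 / 2) - 3 * D1 * (bx + by_))
    + 2 * delta ^+ 2 * (A4 ^+ 2 * A1 + A5 ^+ 2 * A2) / (b * A3) / n.
Proof.
case: sizes => mu0 muL be0 betaL al0 alpha_le ga0 gamma_le1 gamma_le2 nB0 nBL.
have L0 : 0 < L := lt_le_trans mu0 muL.
case: wts => A10 A20 A30 A31 b0 D10 A1x A2x A1y A2y hA4 hA5.
move=> l0 lL c'1 c1 c3n c3 cc' etE et'E rhoE iotaE rho01 iota01 hq1 hq2 cr qr.
move=> gy0 mx0 my0 ex0 ey0 bx0 by0 Bx By H1 H2 H3.
have c0 : 0 < c by apply: lt_le_trans c1.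
have c'0 : 0 < c' by apply: lt_le_trans c'1.
have km0 : 0 <= km by rewrite ltW// divr_gt0 ?mulr_gt0 ?exprn_gt0.
have al2 : 0 <= alpha * L ^+ 2 by rewrite ltW// mulr_gt0 ?exprn_gt0.
have kx : A1 + 3 / 2 * A3 ^+ 2 * (2 * alpha) <= A1 * A4.
  by rewrite [leLHS](_ : _ = A1 + 3 * A3 ^+ 2 * alpha)//; field.
have kyy : A2 + 3 / 2 * A3 ^+ 2 * (320 * km) <= A2 * A5.
  by rewrite [leLHS](_ : _ = A2 + 480 * A3 ^+ 2 * km)//; field.
have Bx' : 4 * c ^+ 2 * (3 * D1 + 4 * alpha + 12 * A1 / (b * A3 ^+ 2)) * bx <= eps ^+ 2 * D1 by [].
have By' : 4 * c ^+ 2 * (3 * D1 + 320 * km + 12 * A2 / (b * A3 ^+ 2)) * by_ <= eps ^+ 2 * D1.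
  by rewrite [3 * D1 + 320 * km + _]addrAC.
have al4 : 0 <= 4 * alpha by rewrite mulr_ge0// ltW.
have km4 : 0 <= 320 * km := mulr_ge0 (ler0n R 320) km0.
have hx := block_step A10 A1x A1y kx al4 l0 lL c'1 c1 c3n c3 etE et'E rhoE
  rho01 hq1 cr qr mx0 my0 ex0 bx0 Bx' H2.
have hy := block_step A20 A2x A2y kyy km4 l0 lL c'1 c1 c3n c3 etE et'E iotaE
  iota01 hq2 cr qr mx0 my0 ey0 by0 By' H3.
have hg : 4 * et' <= 5 * et.
  have h : c'^-1 <= 5 / 4 * c^-1.
    by rewrite ler_pdivlMr// mulrC ler_pdivrMr// mulrC.
  by rewrite etE et'E; have := ler_wpM2l (ltW A30) h; glra.
have hg' := ler_wpM2r gy0 (ler_wpM2r al2 hg).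
have nE : 2 * delta ^+ 2 * (A4 ^+ 2 * A1 + A5 ^+ 2 * A2) / (b * A3) / n =
  2 * delta ^+ 2 * (A4 ^+ 2 * A1) / (b * A3) / n + 2 * delta ^+ 2 * (A5 ^+ 2 * A2) / (b * A3) / n.
  by rewrite mulrDr !mulrDl.
rewrite nE; move: hx hy hg' H1.
move: (2 * delta ^+ 2 * (A4 ^+ 2 * A1) / (b * A3) / n) (2 * delta ^+ 2 * (A5 ^+ 2 * A2) / (b * A3) / n) => n1 n2.
move: (A1 / et) (A2 / et) (A1 / et') (A2 / et') (A1 * A4 / (3 * A3 ^+ 2)) (A2 * A5 / (3 * A3 ^+ 2)) => a1 a2 a3 a4 a5 a6.
move: (alpha^-1 * mx) ky W km => a7 ky' W' km'.
glra.
Qed.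

End Budget.

(** * The second step against the first residual *)

Lemma sqr_le_sum3 (R : realFieldType) (r r1 r2 r3 : R) : 0 <= r -> r <= r1 + r2 + r3 ->
  r ^+ 2 <= 3 * (r1 ^+ 2 + r2 ^+ 2 + r3 ^+ 2).
Proof.
move=> r0 h; have : r ^+ 2 <= (r1 + r2 + r3) ^+ 2.
  by rewrite ler_pXn2r ?nnegrE// (le_trans r0).
by move: (sqr_ge0 (r1 - r2)) (sqr_ge0 (r1 - r3)) (sqr_ge0 (r2 - r3)); glra.
Qed.

Section Prox.
Context (R : realType) (n : nat) (S : set 'cV[R]_n).
Hypothesis pS : proximinal S.
Implicit Types (x v t w : 'cV[R]_n).

(** A projection minimizes the quadratic model of the step over the set; the
    distance to u, expanded, is this model up to a constant. *)
Lemma prox_le a x v t : 0 < a -> S t ->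
  dotv v (proj S (x - a *: v) - x) + enorm (proj S (x - a *: v) - x) ^+ 2 / (2 * a)
  <= dotv v (t - x) + enorm (t - x) ^+ 2 / (2 * a).
Proof.
move=> a0 St; have [_ /(_ _ St)] := proj_spec pS (x - a *: v).
set q := proj S _; rewrite -(ler_pXn2r (n := 2)) ?nnegrE ?enorm_ge0//.
have e z : enorm (x - a *: v - z) ^+ 2 =
    2 * a * (dotv v (z - x) + enorm (z - x) ^+ 2 / (2 * a)) + a ^+ 2 * enorm v ^+ 2.
  have -> : x - a *: v - z = - ((z - x) + a *: v).
    by apply/colP => i; rewrite !mxE; ring.
  rewrite enormN.
  by rewrite sqr_enormD dotvZr sqr_enormZ (dotvC v); field; rewrite gt_eqF.
by rewrite !e lerD2r ler_pM2l// mulr_gt0.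
Qed.

(** The obtuse angle at the projection, with z the starting point. *)
Lemma prox_descent a x v : 0 < a -> S x ->
  dotv v (proj S (x - a *: v) - x) <= - (a^-1 * enorm (proj S (x - a *: v) - x) ^+ 2).
Proof.
move=> a0 Sx; have := proj_obtuse pS (x - a *: v) Sx.
set t := proj S _; have -> : x - a *: v - t = - ((t - x) + a *: v).
  by apply/colP => i; rewrite !mxE; ring.
rewrite -[x - t]opprB dotvNl dotvNr opprK dotvDl dotvZl -sqr_enorm => h.
by rewrite -mulrN mulrC ler_pdivlMr// mulrC; move: h; dlra.
Qed.

(** Moving a fraction 1 - z along a projected step leaves at least the fraction
    z of the residual; only the part of the change of direction that grows with
    the move is allowed here. *)
Lemma residual_le a x w r z u : 0 < a -> 0 <= z < 1 -> r = proj S (x + a *: w) - x ->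
  enorm (proj S (x + (1 - z) *: r + a *: (w + (1 - z) *: u)) - (x + (1 - z) *: r)) ^+ 2
  >= z ^+ 2 * enorm r ^+ 2 - z ^+ 2 * a ^+ 2 * enorm u ^+ 2.
Proof.
move=> a0 /andP[z0 z1]; set t := proj S (x + _) => rE; set q := proj S _.
set h := 1 - z; have h0 : 0 < h by rewrite subr_gt0.
have o1 := proj_obtuse pS (x + a *: w) (proj_in pS _ : S q).
have o2 := proj_obtuse pS (x + h *: r + a *: (w + h *: u)) (proj_in pS _ : S t).
rewrite -/q -/t in o1 o2.
set d := q - t in o1 *.
have dr : q - (x + h *: r) = d + z *: r.
  by apply/colP => i; rewrite /d /h rE !mxE; ring.
have key (r1 r2 r3 : R) : r1 <= 0 -> - (r1 - r2 + r3) <= 0 -> r2 <= r3 by clear; lra.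
have m : enorm d ^+ 2 <= h * dotv r d + a * h * dotv u d.
  rewrite sqr_enorm; have tq : t - q = - d by rewrite opprB.
  rewrite tq dotvNr in o2.
  have e : dotv (x + h *: r + a *: (w + h *: u) - q) d =
     dotv (x + a *: w - t) d - dotv d d + (h * dotv r d + a * h * dotv u d).
    rewrite -!dotvZl -dotvBl -!dotvDl; congr dotv.
    by apply/colP => i; rewrite /d !mxE; ring.
  rewrite e in o2; exact: key o1 o2.
have c := dotv_le u d; rewrite dr sqr_enormD dotvZr sqr_enormZ (dotvC d).
have m1 : enorm d ^+ 2 / h <= dotv r d + a * dotv u d.
  by rewrite ler_pdivrMr//; move: m; move: (enorm d ^+ 2) (dotv r d) (dotv u d) => m1 m2 m3; glra.
have m2 : 0 <= enorm d ^+ 2 / h by rewrite divr_ge0 ?sqr_ge0// ltW.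
have m3 := ler_wpM2l z0 (le_trans m2 m1).
have m4 := ler_wpM2l (mulr_ge0 z0 (ltW a0)) c.
have := sqr_ge0 (enorm d - z * a * enorm u); move: m3 m4; dlra.
Qed.

End Prox.

Section SecondStep.
Variable R : realFieldType.
Variables (L mu alpha beta gamma nB z : R).
Hypothesis sizes : step_sizes L mu alpha beta gamma nB.
Let ky := alpha * L ^+ 2 / (mu * beta).
Let km := alpha * L ^+ 2 / mu ^+ 2.

(** Numerical consequences of the step-size conditions that make the cross
    terms between different blocks nearly negligible. *)
Lemma step_sizes_small :
  [/\ alpha * L <= 1 / 384, 1280 * 36 * (alpha * gamma * L ^+ 2) <= 1,
      alpha * L ^+ 2 <= ky / 6, ky * beta ^+ 2 <= km / 6 & alpha <= km].
Proof.
have [m0 m6] := mubeta_le sizes.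
case: sizes => mu0 muL be0 betaL al0 alpha_le ga0 gamma_le1 gamma_le2 nB0 nBL.
have L0 : 0 < L := lt_le_trans mu0 muL.
have L2 : 0 < L ^+ 2 by rewrite exprn_gt0.
have mL2 : mu ^+ 2 <= L ^+ 2 by rewrite ler_pXn2r ?nnegrE// ltW.
have al2 : 0 < alpha * L ^+ 2 by rewrite mulr_gt0.
split.
- rewrite -(ler_pM2l (_ : 0 < 64 * L)) ?mulr_gt0//.
  apply: (@le_trans _ _ (mu ^+ 2 * beta)); first by move: alpha_le; glra.
  have := ler_pM (ltW mu0) (ltW m0) muL m6; glra.
- rewrite -(ler_pM2l L2) mulr1.
  apply: (@le_trans _ _ (36 * (mu ^+ 4 * beta ^+ 2))).
    by move: gamma_le2; glra.
  have h : (mu * beta) ^+ 2 <= (1 / 6) ^+ 2.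
    by rewrite ler_pXn2r ?nnegrE// ltW.
  have := ler_pM (sqr_ge0 mu) (sqr_ge0 (mu * beta)) mL2 h; glra.
- rewrite /ky [leRHS]mulrAC ler_pdivlMr//; have := ler_wpM2l (ltW al2) m6; glra.
- rewrite [leLHS](_ : _ = km * (mu * beta)); last by rewrite /ky /km; field; rewrite !gt_eqF.
  have km0 : 0 <= km by rewrite divr_ge0 ?sqr_ge0 ?(ltW al2).
  by have := ler_wpM2l km0 m6; glra.
- by rewrite /km ler_pdivlMr ?exprn_gt0// ler_pM2l.
Qed.

(** The residual a of the first step, scaled by z = 1 - eta_1, is a competitor
    in the second proximal problem. Changing the direction costs the errors e1,
    e2, the biases b1, b2 and the drift (1 - z)(L a + L s + nA b). The error e2
    gets the large constant 19/10 because the potential leaves that much; e1 is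
    paid by the noise term and may cost 25. *)
Lemma second_x (nA a s b e1 e2 b1 b2 m vr vs s2 : R) :
  0 <= z <= 1 -> 0 <= nA -> nA <= L ->
  0 <= a -> 0 <= s -> 0 <= b ->
  vs + s2 ^+ 2 / (2 * alpha) <= z * vr + z ^+ 2 * a ^+ 2 / (2 * alpha) ->
  vr <= - (a ^+ 2 / alpha) + a * m ->
  m <= e2 + e1 + (b1 + b2) + (1 - z) * (L * a + L * s + nA * b) ->
  vs + 3 / 8 * (alpha^-1 * s2 ^+ 2) <=
    - (1 / 8 * (alpha^-1 * s2 ^+ 2))
    - (z * (2 - z) / 2 - 2416 / 10000 * z - 278 / 10000) * (alpha^-1 * a ^+ 2)
    + 1 / 10 * (ky * s ^+ 2) + 6 / 10000 * (gamma^-1 * b ^+ 2)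
    + 19 / 10 * (alpha * e2 ^+ 2) + 25 * (alpha * e1 ^+ 2)
    + 5 * z * (alpha * (b1 ^+ 2 + b2 ^+ 2)).
Proof.
have [aL agL aky _ _] := step_sizes_small.
have : 0 < alpha := ss_alpha sizes. have : 0 < gamma := ss_gamma sizes.
move=> ga0 al0 /andP[z0 z1] nA0 nAL a0 s0 b0 H1 H2 H3.
have ai0 : 0 < alpha^-1 by rewrite invr_gt0.
have ka : alpha * alpha^-1 = 1 by rewrite mulfV ?gt_eqF.
have kg : gamma * gamma^-1 = 1 by rewrite mulfV ?gt_eqF.
set a2 := alpha^-1 * a ^+ 2.
have a20 : 0 <= a2 by rewrite mulr_ge0 ?sqr_ge0 ?ltW.
have y t (u v : R) : 0 < t -> u * v <= t^-1 * (alpha^-1 * u ^+ 2) / 4 + t * (alpha * v ^+ 2).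
  by move=> t0; have := young u v (mulr_gt0 t0 al0); rewrite invfM !mulrA.
have k1 := y (19 / 10) a e2 (ltac:(glra)).
have k2 := y 25 a e1 (ltac:(glra)).
have k3 := y (5 / 2) a (b1 + b2) (ltac:(glra)).
have k3' : (b1 + b2) ^+ 2 <= 2 * (b1 ^+ 2 + b2 ^+ 2) by have := sqr_ge0 (b1 - b2); glra.
have k3'' := ler_wpM2l (ltW al0) k3'.
have k4 : L * a ^+ 2 <= a2 / 384.
  have -> : L * a ^+ 2 = alpha * L * a2 by rewrite /a2; field; rewrite gt_eqF.
  by have := ler_wpM2r a20 aL; glra.
have k5 : L * (a * s) <= 105 / 1000 * a2 + 4 / 10 * (ky * s ^+ 2).
  have := y (24 / 10) a (L * s) (ltac:(glra)); rewrite exprMn.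
  have := ler_wpM2r (sqr_ge0 s) aky; move: a20; rewrite -/a2; glra.
have k6 : nA * (a * b) <= 24 / 10000 * a2 + 23 / 10000 * (gamma^-1 * b ^+ 2).
  have h := y 105 a (L * b) (ltac:(glra)); rewrite exprMn -/a2 in h.
  have hL : nA * (a * b) <= a * (L * b) by rewrite mulrCA ler_wpM2l// ler_wpM2r.
  have g2 : 0 <= gamma^-1 * b ^+ 2 by rewrite mulr_ge0 ?sqr_ge0// invr_ge0 ltW.
  have hg := ler_wpM2r g2 agL.
  have e : 1280 * 36 * (alpha * gamma * L ^+ 2) * (gamma^-1 * b ^+ 2)
    = 1280 * 36 * (alpha * (L ^+ 2 * b ^+ 2)) by field; rewrite gt_eqF.
  rewrite e mul1r in hg; apply: (le_trans hL); move: h hg a20 g2; glra.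
have zz : z * (1 - z) <= 1 / 4 by have := sqr_ge0 (z - 1 / 2); glra.
have zz0 : 0 <= z * (1 - z) by rewrite mulr_ge0// subr_ge0.
have cr0 : 0 <= L * a ^+ 2 + L * (a * s) + nA * (a * b).
  have L0 : 0 <= L by apply: le_trans nAL.
  by rewrite !addr_ge0 ?mulr_ge0 ?sqr_ge0.
have k7 := ler_wpM2r cr0 zz.
have k8 := ler_wpM2l z0 H2.
have k9 := ler_wpM2l (mulr_ge0 z0 a0) H3.
have [[k1z k2z] k3z] := (ler_wpM2l z0 k1, ler_wpM2l z0 k2, ler_wpM2l z0 k3).
have k3zz := ler_wpM2l z0 k3''.
have z1' : 0 <= 1 - z by rewrite subr_ge0.
have e2z := mulr_ge0 z1' (mulr_ge0 (ltW al0) (sqr_ge0 e2)).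
have e1z := mulr_ge0 z1' (mulr_ge0 (ltW al0) (sqr_ge0 e1)).
have E1 : s2 ^+ 2 / (2 * alpha) = 1 / 2 * (alpha^-1 * s2 ^+ 2) by field; rewrite gt_eqF.
have E2 : z ^+ 2 * a ^+ 2 / (2 * alpha) = z ^+ 2 / 2 * a2 by rewrite /a2; field; rewrite gt_eqF.
have E3 : a ^+ 2 / alpha = a2 by rewrite /a2 mulrC.
rewrite E1 E2 in H1; rewrite E3 in k8.
rewrite -!/a2 in k1z k2z k3z.
have za2 : 0 <= z * a2 by rewrite mulr_ge0.
have g2 : 0 <= gamma^-1 * b ^+ 2 by rewrite mulr_ge0 ?sqr_ge0// invr_ge0 ltW.
move: H1 k8 k9 k7 k4 k5 k6 k1z k2z k3z k3zz e2z e1z a20 za2 g2.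
move: (alpha^-1 * s2 ^+ 2) (ky * s ^+ 2) (gamma^-1 * b ^+ 2) => q1 q2 q3.
clearbody a2; glra.
Qed.

(** The same comparison for the multiplier; here the direction is exact, and
    its change is the move of the primal variables in the second step. *)
Lemma second_l (nA eta b s2x s2y l2 m rr rs : R) :
  0 <= z <= 1 -> 0 <= nA -> nA <= L -> 0 <= eta <= 1 - z ->
  0 <= b -> 0 <= s2x -> 0 <= s2y ->
  - rs + l2 ^+ 2 / (2 * gamma) <= - (z * rr) + z ^+ 2 * b ^+ 2 / (2 * gamma) ->
  b ^+ 2 / gamma - b * m <= rr -> m <= eta * (nA * s2x + nB * s2y) ->
  - rs + 3 / 8 * (gamma^-1 * l2 ^+ 2) <=
    - (1 / 8 * (gamma^-1 * l2 ^+ 2))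
    - (z * (2 - z) / 2 - 102 / 10000) * (gamma^-1 * b ^+ 2)
    + 3 / 1000 * (alpha^-1 * s2x ^+ 2) + 53 / 100 * (ky * s2y ^+ 2).
Proof.
have [_ agL aky _ _] := step_sizes_small.
have : 0 < alpha := ss_alpha sizes. have : 0 < gamma := ss_gamma sizes.
have : 0 <= nB := ss_nB sizes. have : gamma * nB ^+ 2 <= 2 * alpha * L ^+ 2 := ss_gamma_B sizes.
move=> gB nB0 ga0 al0 /andP[z0 z1] nA0 nAL /andP[e0 ez] b0 x0 y0 H1 H2 H3.
have L0 : 0 <= L by apply: le_trans nAL.
set b2 := gamma^-1 * b ^+ 2.
have b20 : 0 <= b2 by rewrite mulr_ge0 ?sqr_ge0// invr_ge0 ltW.
have a20 : 0 <= alpha^-1 * s2x ^+ 2 by rewrite mulr_ge0 ?sqr_ge0// invr_ge0 ltW.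
have k1 : nA * (b * s2x) <= 12 / 1000 * (alpha^-1 * s2x ^+ 2) + 5 / 10000 * b2.
  have h := young s2x (L * b) (mulr_gt0 (ltr0n R 21) al0).
  rewrite invfM exprMn in h.
  have hL : nA * (b * s2x) <= s2x * (L * b).
    by rewrite [b * s2x]mulrC mulrCA ler_wpM2l// ler_wpM2r.
  have hg := ler_wpM2r b20 agL.
  have e : 1280 * 36 * (alpha * gamma * L ^+ 2) * b2 = 1280 * 36 * (alpha * (L ^+ 2 * b ^+ 2)).
    by rewrite /b2; field; rewrite gt_eqF.
  rewrite e mul1r in hg; apply: (le_trans hL); move: h hg a20 b20; clearbody b2; glra.
have k2 : nB * (b * s2y) <= 402 / 10000 * b2 + 21 / 10 * (ky * s2y ^+ 2).
  have h := young b (nB * s2y) (mulr_gt0 (_ : 0 < 63 / 10) ga0).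
  have {}h := h (ltac:(glra)).
  have e : (63 / 10 * gamma)^-1 * b ^+ 2 = 10 / 63 * b2 by rewrite /b2; field; rewrite gt_eqF.
  rewrite e exprMn in h.
  have h1 := ler_wpM2r (sqr_ge0 s2y) gB; have h2 := ler_wpM2r (sqr_ge0 s2y) aky.
  move: h h1 h2 b20; clearbody b2; glra.
have zz : z * eta <= 1 / 4.
  by apply: le_trans (ler_wpM2l z0 ez) _; have := sqr_ge0 (z - 1 / 2); glra.
have cr0 : 0 <= nA * (b * s2x) + nB * (b * s2y) by rewrite addr_ge0 ?mulr_ge0.
have k7 := ler_wpM2r cr0 zz.
have k8 := ler_wpM2l z0 H2.
have k9 := ler_wpM2l (mulr_ge0 z0 b0) H3.
have E1 : l2 ^+ 2 / (2 * gamma) = 1 / 2 * (gamma^-1 * l2 ^+ 2) by field; rewrite gt_eqF.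
have E2 : z ^+ 2 * b ^+ 2 / (2 * gamma) = z ^+ 2 / 2 * b2 by rewrite /b2; field; rewrite gt_eqF.
have E3 : b ^+ 2 / gamma = b2 by rewrite /b2 mulrC.
have [m0 _] := mubeta_le sizes.
have ky0 : 0 <= ky * s2y ^+ 2.
  by rewrite mulr_ge0 ?sqr_ge0// divr_ge0 ?(ltW m0)// mulr_ge0 ?sqr_ge0 ?ltW.
rewrite E1 E2 in H1; rewrite E3 in k8.
move: H1 k8 k9 k7 k1 k2 b20 a20 ky0.
move: (gamma^-1 * l2 ^+ 2) (ky * s2y ^+ 2) (alpha^-1 * s2x ^+ 2) => q1 q2 q3.
clearbody b2; glra.
Qed.

(** The residual in y is compared first with a direction without noise, where
    only the drift u counts, then with the actual one, by non-expansiveness. *)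
Lemma second_y (s a b e1 e2 b1 b2 sy s' D u : R) :
  0 <= z <= 1 -> 0 <= s -> 0 <= a -> 0 <= b -> 0 <= sy -> 0 <= s' -> 0 <= D -> 0 <= u ->
  s' <= sy + beta * D -> D <= e2 + e1 + (b1 + b2) -> u <= L * s + L * a + nB * b ->
  z ^+ 2 * s ^+ 2 - z ^+ 2 * beta ^+ 2 * u ^+ 2 <= s' ^+ 2 ->
  121 / 8 * z ^+ 2 * (ky * s ^+ 2) <= 22 * (ky * sy ^+ 2)
    + 1 / 10000 * (alpha^-1 * a ^+ 2) + 2 / 10000 * (gamma^-1 * b ^+ 2)
    + 44 * (km * (e2 ^+ 2 + e1 ^+ 2 + b1 ^+ 2 + b2 ^+ 2)).
Proof.
have [_ _ _ kb _] := step_sizes_small; have [m0 m6] := mubeta_le sizes.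
case: sizes => mu0 muL be0 betaL al0 alpha_le ga0 gamma_le1 gamma_le2 nB0 nBL.
have L0 : 0 < L := lt_le_trans mu0 muL.
move=> /andP[z0 z1] s0 a0 b0 sy0 s'0 D0 u0 H1 H2 H3 H4.
have ky0 : 0 <= ky by rewrite divr_ge0 ?(ltW m0)// mulr_ge0 ?sqr_ge0 ?ltW.
have kb0 : 0 <= ky * beta ^+ 2 by rewrite mulr_ge0 ?sqr_ge0.
have j1 : s' ^+ 2 <= 4 / 3 * sy ^+ 2 + 4 * (beta ^+ 2 * D ^+ 2).
  have h : s' ^+ 2 <= (sy + beta * D) ^+ 2.
    by rewrite ler_pXn2r ?nnegrE// addr_ge0// mulr_ge0// ltW.
  by have := sqr_ge0 (sy - 3 * beta * D); move: h; glra.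
have j2 : D ^+ 2 <= 4 * (e2 ^+ 2 + e1 ^+ 2 + b1 ^+ 2 + b2 ^+ 2).
  have h : D ^+ 2 <= (e2 + e1 + (b1 + b2)) ^+ 2.
    by rewrite ler_pXn2r ?nnegrE// (le_trans D0).
  have := sqr_ge0 (e2 - e1); have := sqr_ge0 (b1 - b2).
  by have := sqr_ge0 (e2 + e1 - (b1 + b2)); move: h; glra.
have j3 : u ^+ 2 <= 3 * (L ^+ 2 * s ^+ 2 + L ^+ 2 * a ^+ 2 + nB ^+ 2 * b ^+ 2).
  have h : u ^+ 2 <= (L * s + L * a + nB * b) ^+ 2.
    by rewrite ler_pXn2r ?nnegrE// (le_trans u0).
  have := sqr_ge0 (L * s - L * a); have := sqr_ge0 (L * s - nB * b).
  by have := sqr_ge0 (L * a - nB * b); move: h; glra.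
set a2 := alpha^-1 * a ^+ 2; set b2' := gamma^-1 * b ^+ 2.
have a20 : 0 <= a2 by rewrite mulr_ge0 ?sqr_ge0// invr_ge0 ltW.
have b20 : 0 <= b2' by rewrite mulr_ge0 ?sqr_ge0// invr_ge0 ltW.
pose Q := ky * beta ^+ 2 * L ^+ 2 * alpha.
have Q0 : 0 <= Q := mulr_ge0 (mulr_ge0 kb0 (sqr_ge0 L)) (ltW al0).
have X1 : 64 * 64 * 216 * Q <= 1.
  have h : (64 * L ^+ 2 * alpha) ^+ 2 <= (mu ^+ 2 * beta) ^+ 2.
    by rewrite ler_pXn2r ?nnegrE// mulr_ge0 ?sqr_ge0 ?mulr_ge0 ?sqr_ge0 ?ltW.
  have h' : (mu * beta) ^+ 3 <= (1 / 6) ^+ 3 by rewrite ler_pXn2r ?nnegrE// ltW.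
  have bm0 : 0 <= beta / mu by rewrite divr_ge0 ?ltW.
  have e1' : (64 * L ^+ 2 * alpha) ^+ 2 * (beta / mu) = 64 * 64 * Q.
    by rewrite /Q /ky; field; rewrite !gt_eqF.
  have e2' : (mu ^+ 2 * beta) ^+ 2 * (beta / mu) = (mu * beta) ^+ 3.
    by field; rewrite !gt_eqF.
  have := ler_wpM2r bm0 h; rewrite e1' e2'; move: h'; move: (mu * beta) => q; clearbody Q; glra.
have t1 : ky * beta ^+ 2 * (L ^+ 2 * s ^+ 2) <= ky * s ^+ 2 / 36.
  have h : (beta * L) ^+ 2 <= (1 / 6) ^+ 2.
    by rewrite ler_pXn2r ?nnegrE// mulr_ge0// ltW.
  have ks0 : 0 <= ky * s ^+ 2 by rewrite mulr_ge0 ?sqr_ge0.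
  by have := ler_wpM2r ks0 h; glra.
have t2 : ky * beta ^+ 2 * (L ^+ 2 * a ^+ 2) = Q * a2.
  by rewrite /Q /a2; field; rewrite gt_eqF.
have t3 : ky * beta ^+ 2 * (nB ^+ 2 * b ^+ 2) <= 2 * Q * b2'.
  have -> : ky * beta ^+ 2 * (nB ^+ 2 * b ^+ 2) = ky * beta ^+ 2 * (gamma * nB ^+ 2) * b2'.
    by rewrite /b2'; field; rewrite gt_eqF.
  rewrite ler_wpM2r//; have := ler_wpM2l kb0 gamma_le1; rewrite /Q; glra.
have z2 : z ^+ 2 <= 1 by rewrite expr_le1.
have k1 := ler_wpM2l ky0 H4.
have k2 := ler_wpM2l ky0 j1.
have k3 := ler_wpM2l kb0 j2.
have S0 : 0 <= e2 ^+ 2 + e1 ^+ 2 + b1 ^+ 2 + b2 ^+ 2 by rewrite !addr_ge0 ?sqr_ge0.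
have k4 := ler_wpM2r S0 kb.
have k5 := ler_wpM2l kb0 j3.
have k6 := ler_wpM2l (sqr_ge0 z) (le_trans k5 (_ : _ <= 3 * (ky * s ^+ 2 / 36 + Q * a2 + 2 * Q * b2'))).
have {}k6 := k6 (ltac:(move: t1 t3; rewrite -t2; glra)).
have k7 : z ^+ 2 * (Q * a2) <= 1 * (a2 / (64 * 64 * 216)).
  apply: ler_pM => //; [exact: sqr_ge0|exact: mulr_ge0|].
  by rewrite ler_pdivlMr ?mulr_gt0//; have := ler_wpM2r a20 X1; glra.
have k8 : z ^+ 2 * (Q * b2') <= 1 * (b2' / (64 * 64 * 216)).
  apply: ler_pM => //; [exact: sqr_ge0|exact: mulr_ge0|].
  by rewrite ler_pdivlMr ?mulr_gt0//; have := ler_wpM2r b20 X1; glra.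
move: k1 k2 k3 k4 k6 k7 k8 a20 b20.
clearbody Q a2 b2'; glra.
Qed.

End SecondStep.

(** * The complexity bound *)

Section Complexity.
Variable R : realType.
Variables (L l mu alpha beta gamma nA nB A1 A2 A3 A4 A5 D1 delta eps b : R).
Variables (eta varrho iota b1 b2 md gy mx my ml ex ey gp : nat -> R).
Let W := 32 * alpha * L ^+ 2 / (beta * mu).
Let ky := alpha * L ^+ 2 / (mu * beta).
Let km := alpha * L ^+ 2 / mu ^+ 2.
Local Notation cr k := (crt (k.+2%:R : R)).

(** What remains of the squared first residuals after the cross terms, as
    functions of z = 1 - eta_1, for the x-block, the multiplier and y. *)
Definition keep_x (z : R) := z * (2 - z) / 2 - 2416 / 10000 * z - 282 / 10000.
Definition keep_l (z : R) := z * (2 - z) / 2 - 112 / 10000.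
Definition keep_y (z : R) := 121 / 8 * z ^+ 2 - 1 / 10.

(** The facts about the expectations along the algorithm that the rate depends
    on: md is the mean of the dual function, gy that of the squared distance to
    the inner maximizer, mx, my, ml those of the squared steps, ex, ey those of
    the squared momentum errors, gp that of the squared gap. *)
Record expected_run : Prop := {
  er_l : 0 <= l <= L; er_nA : 0 <= nA <= L; er_eps : 0 < eps; er_delta : 0 < delta;
  er_eta : forall k, eta k.+1 = A3 / cr k.+1;
  er_varrho : forall k, varrho k.+1 = A4 / cr k.+1 ^+ 2;
  er_iota : forall k, iota k.+1 = A5 / cr k.+1 ^+ 2;
  er_varrho01 : forall k, 0 < varrho k.+1 <= 1;
  er_iota01 : forall k, 0 < iota k.+1 <= 1;
  er_ge0 : forall k, [/\ 0 <= gy k, 0 <= mx k, 0 <= my k, 0 <= ml k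
    & [/\ 0 <= ex k, 0 <= ey k, 0 <= b1 k & 0 <= b2 k]];
  er_b1 : forall k, 4 * cr k.+1 ^+ 2 * (3 * D1 + 4 * alpha + 12 * A1 / (b * A3 ^+ 2)) * b1 k.+1
            <= eps ^+ 2 * D1;
  er_b2 : forall k, 4 * cr k.+1 ^+ 2 * (3 * D1 + 12 * A2 / (b * A3 ^+ 2) + 320 * km) * b2 k.+1
            <= eps ^+ 2 * D1;
  er_plain : forall k, eta k.+1 <= 2 / 3 ->
    md k.+2 + (W - 4 * eta k.+1 * alpha * L ^+ 2) * gy k.+2 <=
    md k.+1 + (W - 5 * eta k.+1 * alpha * L ^+ 2) * gy k.+1
    + eta k.+1 * (0 + - (5 / 8 * alpha^-1) * mx k.+1 + - (5 / 8 * gamma^-1) * ml k.+1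
      - 34 * ky * my k.+1 + 2 * alpha * ex k.+1 + 4 * alpha * b1 k.+1
      + 320 * km * (ey k.+1 + b2 k.+1));
  er_second : eta 2 <= 2 / 3 -> eta 2 <= eta 1 -> let z := 1 - eta 1 in
    (md 3 + (W - 4 * eta 2 * alpha * L ^+ 2) * gy 3 <=
    md 2 + (W - 5 * eta 2 * alpha * L ^+ 2) * gy 2
    + eta 2 * (5 * z * (alpha * (b1 1 + b1 2)) + 44 * (km * (b2 1 + b2 2))
      + - (122 / 1000 * alpha^-1) * mx 2 + 226 / 10 * ky * my 2
      + - (keep_x z * alpha^-1) * mx 1 + - (keep_y z * ky) * my 1
      + - (keep_l z * gamma^-1) * ml 1
      + 19 / 10 * alpha * ex 2 + 25 * alpha * ex 1 + 44 * km * ey 2 + 44 * km * ey 1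
      - 34 * ky * my 2 + 2 * alpha * ex 2 + 4 * alpha * b1 2
      + 320 * km * (ey 2 + b2 2)))%R : Prop;
  er_ex : forall k q, (1 - varrho k.+1) ^+ 2 <= q ->
    ex k.+2 <= (1 - varrho k.+1) ^+ 2 * ex k.+1 + b^-1 * (2 * varrho k.+1 ^+ 2 * delta ^+ 2
      + 2 * q * (6 * l ^+ 2 * eta k.+1 ^+ 2 * (mx k.+1 + my k.+1) + 6 * b1 k.+1));
  er_ey : forall k q, (1 - iota k.+1) ^+ 2 <= q ->
    ey k.+2 <= (1 - iota k.+1) ^+ 2 * ey k.+1 + b^-1 * (2 * iota k.+1 ^+ 2 * delta ^+ 2
      + 2 * q * (6 * l ^+ 2 * eta k.+1 ^+ 2 * (mx k.+1 + my k.+1) + 6 * b2 k.+1));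
  er_first : ex 1 <= b^-1 * (2 * delta ^+ 2) /\ ey 1 <= b^-1 * (2 * delta ^+ 2);
  er_gap : forall k, gp k.+1 <= 3 * (b1 k.+1 + b2 k.+1)
    + (3 / alpha ^+ 2 + 3 * nA ^+ 2) * mx k.+1 + (3 / beta ^+ 2 + 3 * nB ^+ 2) * my k.+1
    + 3 / gamma ^+ 2 * ml k.+1 + 3 * ex k.+1 + 3 * ey k.+1;
  er_D1 : [/\ D1 * (3 / alpha ^+ 2 + 3 * nA ^+ 2) <= 1 / 4 * alpha^-1,
    D1 * (3 / beta ^+ 2 + 3 * nB ^+ 2) <= 2 * ky, D1 * (3 / gamma ^+ 2) <= 1 / 4 * gamma^-1,
    D1 * 3 <= A1 * A4 / (3 * A3 ^+ 2) & D1 * 3 <= A2 * A5 / (3 * A3 ^+ 2)] }.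

Hypothesis sizes : step_sizes L mu alpha beta gamma nB.
Hypothesis wts : weights L mu alpha beta A1 A2 A3 A4 A5 D1 b.
Hypothesis run : expected_run.

Definition potential k := md k + (W - 4 * eta k.-1 * alpha * L ^+ 2) * gy k
  + A1 / eta k.-1 * ex k + A2 / eta k.-1 * ey k.
Let C2 := 2 * delta ^+ 2 * (A4 ^+ 2 * A1 + A5 ^+ 2 * A2) / (b * A3).

(** Consecutive cube roots differ little: the ratio 5/4 is what lets the weight
    of the squared distance change with eta. *)
Lemma cr_facts k : [/\ 1 <= cr k.+1, cr k.+2 ^+ 3 = cr k.+1 ^+ 3 + 1, cr k.+1 <= cr k.+2,
  cr k.+2 <= 5 / 4 * cr k.+1 & 3 / 2 <= cr k.+2].
Proof.
have cE j : cr j ^+ 3 = j.+2%:R by rewrite crt3.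
have c0 j : 0 < cr j by rewrite crt_gt0.
have E : cr k.+2 ^+ 3 = cr k.+1 ^+ 3 + 1 by rewrite !cE natr1.
have c3 : 3 <= cr k.+1 ^+ 3 by rewrite cE ler_nat.
have c4 : 4 <= cr k.+2 ^+ 3 by rewrite cE ler_nat.
have le3 (u v : R) : 0 <= u -> 0 <= v -> u ^+ 3 <= v ^+ 3 -> u <= v.
  by move=> u0 v0; rewrite ler_pXn2r ?nnegrE.
split=> //.
- apply: le3; rewrite ?(ltW (c0 _))// expr1n; move: c3; glra.
- by apply: crt_le; rewrite ?ler_nat.
- have := ltW (c0 k.+2); have := ltW (c0 k.+1); move=> u0 v0.
  apply: le3; rewrite ?mulr_ge0 ?divr_ge0//.
  by rewrite E exprMn; move: c3; move: (cr k.+1 ^+ 3) => q; glra.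
- apply: le3; rewrite ?(ltW (c0 _)) ?divr_ge0//.
  by move: c4; move: (cr k.+2 ^+ 3) => q; glra.
Qed.

Lemma eta_le k : eta k.+2 <= 2 / 3 /\ eta k.+2 <= eta k.+1.
Proof.
have [c1 _ cc _ c32] := cr_facts k; have A30 := wt_A3 wts; have A31 := wt_A31 wts.
have c'0 : 0 < cr k.+1 by apply: lt_le_trans c1.
have c0 : 0 < cr k.+2 by apply: lt_le_trans cc.
rewrite !(er_eta run); split; last by rewrite ler_pM2l// lef_pV2.
by rewrite ler_pdivrMr//; move: A31 c32; glra.
Qed.

(** With q = r = 1, for every step from the second on. *)
Lemma potential_descent k : D1 * eta k.+2 * gp k.+2 + potential k.+3 <=
  potential k.+2 + 1 / 2 * (eps ^+ 2 * D1) * eta k.+2 + C2 / k.+4%:R.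
Proof.
have [c1 cE cc c54 c32] := cr_facts k; have [e23 ee] := eta_le k.
have c2 : 1 <= cr k.+2 by apply: le_trans cc.
have c0 : 0 < cr k.+2 by apply: lt_le_trans c2.
have e0 : 0 < eta k.+2 by rewrite (er_eta run) divr_gt0// (wt_A3 wts).
have sq1 (r : R) : 0 < r <= 1 -> (1 - r) ^+ 2 <= 1.
  by case/andP=> r0 r1; rewrite expr_le1// ?subr_ge0// lerBlDr lerDl ltW.
have [/andP[l0 lL] ci1] : 0 <= l <= L /\ (cr k.+2 ^+ 2)^-1 <= 1.
  by split; [exact: er_l run | rewrite invf_le1 ?exprn_gt0// expr_ge1// ltW].
have [gy0 mx0 my0 ml0 [ex0 ey0 b10 b20]] := er_ge0 run k.+2.
have n3 : cr k.+2 ^+ 3 = k.+4%:R by rewrite crt3.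
have v1 := sq1 _ (er_varrho01 run k.+1); have i1 := sq1 _ (er_iota01 run k.+1).
have := potential_step sizes wts l0 lL c1 c2 n3 cE c54 (er_eta run k.+1) (er_eta run k)
  (er_varrho run k.+1) (er_iota run k.+1) (er_varrho01 run k.+1) (er_iota01 run k.+1)
  v1 i1 ci1 (lexx 1) gy0 mx0 my0 ex0 ey0 b10 b20 (er_b1 run k.+1) (er_b2 run k.+1)
  (er_plain run e23) (er_ex run v1) (er_ey run i1).
rewrite -/W -/ky -/C2 /potential /=.
have [d1 d2 d3 d4 d5] := er_D1 run.
have D10 : 0 <= D1 := ltW (wt_D1 wts).
have gp' := ler_wpM2l D10 (er_gap run k.+1).
have := ler_wpM2r mx0 d1; have := ler_wpM2r my0 d2; have := ler_wpM2r ml0 d3.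
have := ler_wpM2r ex0 d4; have := ler_wpM2r ey0 d5 => h5 h4 h3 h2 h1.
have n1 : 0 <= alpha^-1 * mx k.+2 by rewrite mulr_ge0// invr_ge0 (ltW (ss_alpha sizes)).
have n2 : 0 <= gamma^-1 * ml k.+2 by rewrite mulr_ge0// invr_ge0 (ltW (ss_gamma sizes)).
have n4 : 0 <= ky * my k.+2.
  rewrite mulr_ge0// divr_ge0// mulr_ge0 ?sqr_ge0//; first exact: ltW (ss_alpha sizes).
    exact: ltW (ss_mu sizes).
  exact: ltW (ss_beta sizes).
have key : D1 * gp k.+2 <= - (0 + - (5 / 8 * alpha^-1) * mx k.+2 + - (5 / 8 * gamma^-1) * ml k.+2
  + 1 / 3 * (alpha^-1 * mx k.+2) - (34 - 88 / 3 * 1) * (ky * my k.+2)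
  - A1 * A4 / (3 * A3 ^+ 2) * ex k.+2 - A2 * A5 / (3 * A3 ^+ 2) * ey k.+2
  + 1 * (eps ^+ 2 * D1 / 2) - 3 * D1 * (b1 k.+2 + b2 k.+2)) + 1 / 2 * (eps ^+ 2 * D1).
  apply: (le_trans gp'); move: h1 h2 h3 h4 h5 n1 n2 n4.
  move: (A1 * A4 / _) (A2 * A5 / _) alpha^-1 gamma^-1 ky => q1 q2 q3 q4 q5.
  move: (3 / alpha ^+ 2 + _) (3 / beta ^+ 2 + _) (3 / gamma ^+ 2) => q6 q7 q8.
  glra.
have {}key := ler_wpM2l (ltW e0) key; move: key.
set X := (0 + _ + _ + _ - _ - _ - _ + _ - _); move: X => X h; move: h.
move: (md _ + _ + _ + _) (md _ + _ + _ + _) (C2 / _) => p1 p2 p3; glra.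
Qed.

Lemma C2_ge0 : 0 <= C2.
Proof.
have [A10 A20 A30 b0] : [/\ 0 < A1, 0 < A2, 0 < A3 & 0 < b] by case: wts.
apply: divr_ge0; last by rewrite mulr_ge0// ltW.
apply: mulr_ge0; first by rewrite mulr_ge0 ?sqr_ge0.
by apply: addr_ge0; apply: mulr_ge0; rewrite ?sqr_ge0// ltW.
Qed.

Lemma potential_sum T : (forall k, (1 < k < T.+2)%N -> eps ^+ 2 < gp k) ->
  1 / 2 * (eps ^+ 2 * D1) * A3 * (\sum_(2 <= k < T.+2) (cr k)^-1) + potential T.+2
  <= potential 2 + C2 * \sum_(2 <= k < T.+2) (k.+2%:R)^-1.
Proof.
elim: T => [|T IH] hT; first by rewrite !big_geq// !mulr0 add0r addr0.
rewrite !(big_nat_recr T.+2)//=.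
have {}IH := IH (fun k hk => hT k (ltac:(by case/andP: hk => -> /ltnW))).
have g2 : eps ^+ 2 < gp T.+2 by apply: hT; rewrite /= ltnSn.
have De : 0 <= D1 * eta T.+2.
  have c0 : 0 < cr T.+2 by rewrite crt_gt0.
  by rewrite (er_eta run) mulr_ge0 ?divr_ge0 ?ltW ?(wt_D1 wts) ?(wt_A3 wts).
have h1 := ler_wpM2l De (ltW g2).
have h2 := potential_descent T.
have eE : eta T.+2 = A3 * (cr T.+2)^-1 by rewrite (er_eta run).
move: IH h1 h2; rewrite eE.
move: (\sum_(2 <= k < T.+2) _) (\sum_(2 <= k < T.+2) _) (cr T.+2)^-1 (T.+4%:R^-1) => s1 s2 c n.
move: (potential T.+2) (potential T.+3) (potential 2) C2 (gp _) => p2 p3 p1 C2' g; glra.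
Qed.

(** The bias takes half of eps^2 and the comparison of sum and integral another
    half, whence the factor 1/4. *)
Lemma rate_ge3 T : (2 < T)%N -> (forall k, (1 < k < T)%N -> eps ^+ 2 < gp k) ->
  eps ^+ 2 / 4 * (D1 * A3 * (3 / 2 * crt (T%:R + 3) ^+ 2 - 3 * crt 4 ^+ 2 / 2))
  <= potential 2 - potential T + C2 * ln (T%:R + 2).
Proof.
move=> T2 hT; have h1 := sum_rate R T2; have h2 := @sum_inv_ln R T (ltnW T2).
have [j Tj] : exists j, T = j.+2 by case: (T) T2 => [|[|j]] // _; exists j.
have h3 : 1 / 2 * (eps ^+ 2 * D1) * A3 * (\sum_(2 <= k < T) (cr k)^-1) + potential T
  <= potential 2 + C2 * \sum_(2 <= k < T) (k.+2%:R)^-1.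
  by rewrite Tj; apply: potential_sum; rewrite -Tj.
have l3 : 0 <= ln 3 :> R by apply: ln_ge0; rewrite ler1n.
have l4 : ln (T%:R + 1) <= ln (T%:R + 2) :> R.
  by rewrite ler_ln ?posrE ?ltr_wpDl ?ltr0n// lerD2l ler1n.
have c : 0 <= 1 / 2 * (eps ^+ 2 * D1) * A3.
  rewrite mulr_ge0 ?(ltW (wt_A3 wts))// mulr_ge0 ?divr_ge0// mulr_ge0 ?sqr_ge0//.
  exact: ltW (wt_D1 wts).
have h4 := ler_wpM2l c h1.
have h5 := ler_wpM2l C2_ge0 (le_trans h2 (_ : _ <= ln (T%:R + 2))).
have {}h5 := h5 (ltac:(move: l3 l4; move: (ln _) (ln _) (ln _) => q1 q2 q3; glra)).
move: h3 h4 h5; move: (\sum_(2 <= k < T) _) (\sum_(2 <= k < T) _) => s1 s2.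
move: (potential T) (potential 2) C2 (ln _) (crt _ ^+ 2) (crt 4 ^+ 2) => p2 p3 C2' q1 q2 q3; glra.
Qed.

(** The noise constant dominates the initial momentum errors; it contains A5^2
    A2, and A5^2 is at least 4 (A5 - 1). *)
Lemma C2_ge : 284 * (A3 * (km * (b^-1 * (2 * delta ^+ 2)))) <= C2.
Proof.
have [A10 A20 A30 b0] : [/\ 0 < A1, 0 < A2, 0 < A3 & 0 < b] by case: wts.
have A5h := wt_A5 wts; rewrite -/km in A5h.
have km0 : 0 <= A3 * km.
  rewrite mulr_ge0 ?(ltW A30)// divr_ge0 ?sqr_ge0// mulr_ge0 ?sqr_ge0//.
  exact: ltW (ss_alpha sizes).
have h : 284 * (A3 ^+ 2 * km) <= A4 ^+ 2 * A1 + A5 ^+ 2 * A2.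
  have h1 : 0 <= A3 ^+ 2 * km by rewrite expr2 -mulrA mulr_ge0// ltW.
  have h2 := mulr_ge0 (ltW A20) (sqr_ge0 (A5 - 2)).
  have h3 := mulr_ge0 (sqr_ge0 A4) (ltW A10).
  by move: A5h h1 h2 h3; glra.
have n : 0 <= 2 * delta ^+ 2 / (b * A3) :=
  divr_ge0 (mulr_ge0 (ler0n R 2) (sqr_ge0 delta)) (mulr_ge0 (ltW b0) (ltW A30)).
have -> : C2 = 2 * delta ^+ 2 / (b * A3) * (A4 ^+ 2 * A1 + A5 ^+ 2 * A2) by rewrite mulrAC.
apply: le_trans (ler_wpM2l n h); rewrite le_eqVlt; apply/orP; left; apply/eqP.
by move: km (284 : R) => k q; field; rewrite !gt_eqF.
Qed.

(** The multiple of eps^2 D1 that the remaining squares have to pay: the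
    target, the biases of the potential, and those of the comparison with the
    first residual, which grow with z. *)
Definition penalty (z : R) := 4722 / 10000 + 2766 / 10000 * z.

(** Here 3055/10000 bounds z = 1 - eta_1 from below, as eta_1 is at most
    3^(-1/3). *)
Lemma keep_ge (z : R) : 3055 / 10000 <= z -> z <= 1 ->
  [/\ 0 <= penalty z, penalty z <= 3 / 4, 252 / 1000 * penalty z <= keep_x z,
      252 / 1000 * penalty z <= keep_l z & 2016 / 1000 * penalty z <= keep_y z].
Proof.
move=> z0 z1; rewrite /penalty /keep_x /keep_l /keep_y.
have zz : 0 <= (z - 3055 / 10000) * (1 - z) by rewrite mulr_ge0 ?subr_ge0.
have zp : 0 <= z by move: z0; glra.
have zz' := ler_wpM2l zp z0.
by split; move: zz zz' z0 z1; glra.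
Qed.

(** If already the second iterate has a small gap, the descent from the second
    to the third potential has to pay for the gap of the first iterate. The
    second step is compared with the first residual, and the factor q = 73/200
    bounds (1 - rho)^2 at this index. *)
Lemma rate_2 : eps ^+ 2 < gp 1 ->
  eps ^+ 2 / 4 * (D1 * A3 * (3 / 2 * crt 5 ^+ 2 - 3 * crt 4 ^+ 2 / 2))
  <= potential 2 - potential 3 + C2 * ln 4.
Proof.
move=> hg; have [c1 cE cc c54 c32] := cr_facts 0; have [e23 ee] := eta_le 0.
have [/andP[c3l c3u] /andP[c4l c4u] c5u] := crt_numeric R.
have [A10 A20 A30 b0] : [/\ 0 < A1, 0 < A2, 0 < A3 & 0 < b] by case: wts.
have A31 := wt_A31 wts; have D10 := wt_D1 wts.
have al0 := ss_alpha sizes; have ga0 := ss_gamma sizes; have mu0 := ss_mu sizes.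
have be0 := ss_beta sizes.
have [_ _ _ _ akm] := step_sizes_small sizes; rewrite -/km in akm.
have km0 : 0 < km := lt_le_trans al0 akm.
have c30 : 0 < crt 3 :> R by rewrite crt_gt0.
have c40 : 0 < crt 4 :> R by rewrite crt_gt0.
have c2 : 1 <= crt 4 :> R by apply: le_trans cc.
have sq_le (u v : R) : 0 <= u -> u <= v -> u ^+ 2 <= v ^+ 2.
  by move=> u0 uv; rewrite ler_pXn2r ?nnegrE// (le_trans u0).
have frac m n : 0 <= m%:R / n%:R :> R by rewrite divr_ge0.
have c3sq : crt 3 ^+ 2 <= (14425 / 10000) ^+ 2 :> R := sq_le _ _ (ltW c30) c3u.
have c3sq' : (144 / 100) ^+ 2 <= crt 3 ^+ 2 :> R := sq_le _ _ (frac 144%N 100%N) c3l.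
have c4sq : crt 4 ^+ 2 <= (15875 / 10000) ^+ 2 :> R := sq_le _ _ (ltW c40) c4u.
have c4sq' : (1587 / 1000) ^+ 2 <= crt 4 ^+ 2 :> R := sq_le _ _ (frac 1587%N 1000%N) c4l.
have c5sq : crt 5 ^+ 2 <= (171 / 100) ^+ 2 :> R.
  by apply: sq_le => //; exact: powR_ge0.
have small (a a' : R) kap : 0 < a -> 0 <= kap -> a + kap <= a * a' -> 1 <= a'.
  move=> a0 k0 h; rewrite -(ler_pM2l a0) mulr1; apply: le_trans h; by rewrite lerDl.
have A4h := wt_A4 wts; have A5h := wt_A5 wts; rewrite -/km in A5h.
have A41 : 1 <= A4.
  exact: small A10 (mulr_ge0 (mulr_ge0 (ler0n R 3) (sqr_ge0 A3)) (ltW al0)) A4h.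
have A51 : 1 <= A5.
  exact: small A20 (mulr_ge0 (mulr_ge0 (ler0n R 480) (sqr_ge0 A3)) (ltW km0)) A5h.
have q_le (a : R) : 1 <= a -> 0 < a / crt 4 ^+ 2 <= 1 -> (1 - a / crt 4 ^+ 2) ^+ 2 <= 73 / 200.
  move=> a1 /andP[r0 r1].
  have h : 1 - a / crt 4 ^+ 2 <= 604 / 1000.
    have : 396 / 1000 <= a / crt 4 ^+ 2.
      by rewrite ler_pdivlMr ?exprn_gt0//; move: a1 c4sq; glra.
    glra.
  apply: le_trans (sq_le _ _ (_ : 0 <= 1 - a / crt 4 ^+ 2) h) _; first by rewrite subr_ge0.
  glra.
have q1 : (1 - varrho 2) ^+ 2 <= 73 / 200.
  by have := er_varrho01 run 1; rewrite (er_varrho run); exact: q_le.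
have q2 : (1 - iota 2) ^+ 2 <= 73 / 200.
  by have := er_iota01 run 1; rewrite (er_iota run); exact: q_le.
have ci : (crt 4 ^+ 2)^-1 <= 2 / 5 :> R.
  by rewrite invf_ple ?posrE ?exprn_gt0// invf_div; move: c4sq'; glra.
have q25 : 73 / 200 <= 2 / 5 :> R by glra.
have [_ mx10 my10 ml10 [ex10 ey10 b110 b210]] := er_ge0 run 1.
have [gy0 mx0 my0 ml0 [ex0 ey0 b10 b20]] := er_ge0 run 2.
have n3 : crt 4 ^+ 3 = 4 :> R by rewrite crt3.
have /andP[l0 lL] := er_l run.
have step := potential_step sizes wts l0 lL c1 c2 n3 cE c54 (er_eta run 1) (er_eta run 0)
  (er_varrho run 1) (er_iota run 1) (er_varrho01 run 1) (er_iota01 run 1)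
  q1 q2 ci q25 gy0 mx0 my0 ex0 ey0 b10 b20 (er_b1 run 1) (er_b2 run 1)
  (er_second run e23 ee) (er_ex run q1) (er_ey run q2).
rewrite -/W -/ky -/km -/C2 in step.
set z := 1 - eta 1 in step; set E := eps ^+ 2 * D1 in step.
have E0 : 0 < E by rewrite mulr_gt0// exprn_gt0// (er_eps run).
have A30' : 0 < 3 * A3 ^+ 2 by rewrite mulr_gt0// exprn_gt0.
have A42 : A4 <= crt 3 ^+ 2.
  have /andP[_] := er_varrho01 run 0; rewrite (er_varrho run) ler_pdivrMr ?exprn_gt0//.
  by rewrite mul1r.
set Pw := A1 * A4 / (3 * A3 ^+ 2) in step; set Qw := A2 * A5 / (3 * A3 ^+ 2) in step.
have Pge : 19 / 10 * alpha <= Pw.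
  rewrite /Pw ler_pdivlMr//.
  have h1 : A1 * A4 <= A1 * (2081 / 1000).
    by rewrite ler_pM2l//; apply: le_trans A42 _; move: c3sq; glra.
  have n : 0 <= A3 ^+ 2 * alpha by rewrite mulr_ge0 ?sqr_ge0// ltW.
  by move: A4h h1 n; glra.
have Qge : 44 * km <= Qw.
  rewrite /Qw ler_pdivlMr//.
  have n : 0 <= A3 ^+ 2 * km by rewrite mulr_ge0 ?sqr_ge0// ltW.
  by move: A5h n A20; rewrite -/km; glra.
have bias (B kb Q0 bb cc' : R) : 0 <= Q0 -> 0 <= bb -> 0 <= kb -> B <= cc' ^+ 2 ->
    4 * cc' ^+ 2 * (Q0 + kb) * bb <= E -> 4 * B * (kb * bb) <= E.
  move=> Q00 bb0 kb0 Bc h; apply: le_trans h.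
  have n1 : 0 <= kb * bb by rewrite mulr_ge0.
  have n2 : 0 <= cc' ^+ 2 * (Q0 * bb) := mulr_ge0 (sqr_ge0 _) (mulr_ge0 Q00 bb0).
  by have := ler_wpM2r n1 Bc; move: n2; glra.
have wA1 : 0 <= 3 * D1 + 12 * A1 / (b * A3 ^+ 2) :=
  addr_ge0 (mulr_ge0 (ler0n R 3) (ltW D10))
    (divr_ge0 (mulr_ge0 (ler0n R 12) (ltW A10)) (mulr_ge0 (ltW b0) (sqr_ge0 A3))).
have wA2 : 0 <= 3 * D1 + 12 * A2 / (b * A3 ^+ 2) :=
  addr_ge0 (mulr_ge0 (ler0n R 3) (ltW D10))
    (divr_ge0 (mulr_ge0 (ler0n R 12) (ltW A20)) (mulr_ge0 (ltW b0) (sqr_ge0 A3))).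
have ka : 0 <= 4 * alpha := mulr_ge0 (ler0n R 4) (ltW al0).
have kk : 0 <= 320 * km := mulr_ge0 (ler0n R 320) (ltW km0).
have B11 := er_b1 run 0; have B12 := er_b1 run 1; rewrite addrAC in B11; rewrite addrAC in B12.
have {}B11 := bias _ _ _ _ _ wA1 b110 ka c3sq' B11.
have {}B12 := bias _ _ _ _ _ wA1 b10 ka c4sq' B12.
have B21 := bias _ _ _ _ _ wA2 b210 kk c3sq' (er_b2 run 0).
have B22 := bias _ _ _ _ _ wA2 b20 kk c4sq' (er_b2 run 1).
have x11 : alpha * b1 1 <= E / 33 by move: B11 E0; glra.
have x12 : alpha * b1 2 <= E / 40 by move: B12 E0; glra.
have x21 : km * b2 1 <= E / 2600 by move: B21 E0; glra.
have x22 : km * b2 2 <= E / 3200 by move: B22 E0; glra.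
have [d1 d2 d3 d4 d5] := er_D1 run.
have Da : D1 <= alpha / 12.
  have h : D1 * (3 / alpha ^+ 2) <= 1 / 4 * alpha^-1.
    apply: le_trans d1; rewrite ler_pM2l// lerDl mulr_ge0 ?sqr_ge0//.
  rewrite mulrA ler_pdivrMr ?exprn_gt0// in h.
  have e : 1 / 4 * alpha^-1 * alpha ^+ 2 = alpha / 4 by field; rewrite gt_eqF.
  by rewrite e in h; move: h; glra.
have gapE : E <= 1008 / 1000 * (1 / 4 * (alpha^-1 * mx 1) + 2 * (ky * my 1)
    + 1 / 4 * (gamma^-1 * ml 1) + alpha / 4 * ex 1 + km / 4 * ey 1).
  have h := ler_wpM2l (ltW D10) (er_gap run 0).
  have h0 : E <= D1 * gp 1 by rewrite /E mulrC ler_wpM2l ?(ltW D10)// ltW.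
  have h1 := ler_wpM2r mx10 d1; have h2 := ler_wpM2r my10 d2; have h3 := ler_wpM2r ml10 d3.
  have h4 := ler_wpM2r ex10 Da; have h5 := ler_wpM2r ey10 (le_trans Da (_ : _ <= km / 12)).
  have {}h5 := h5 (ltac:(by rewrite ler_pM2r// invr_gt0)).
  have h6 := ler_wpM2r b110 Da; have h7 := ler_wpM2r b210 (le_trans Da (_ : _ <= km / 12)).
  have {}h7 := h7 (ltac:(by rewrite ler_pM2r// invr_gt0)).
  move: h h0 h1 h2 h3 h4 h5 h6 h7 x11 x21 E0; rewrite -/ky.
  move: (3 / alpha ^+ 2 + _) (3 / beta ^+ 2 + _) (3 / gamma ^+ 2) => r1 r2 r3.
  clearbody E; move: alpha^-1 gamma^-1 ky km => r4 r5 r6 r7; glra.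
have z1 : z <= 1 by rewrite /z lerBlDr lerDl ltW// (er_eta run) divr_gt0.
have z0 : 3055 / 10000 <= z.
  have : eta 1 <= 100 / 144.
    by rewrite (er_eta run) ler_pdivrMr//; move: A31 c3l; glra.
  by rewrite /z; glra.
clearbody z.
have [Ez0 Ez1 pA pB pS] := keep_ge z0 z1.
pose Ez := penalty z.
rewrite -/Ez in Ez0 Ez1 pA pB pS.
have nA0 : 0 <= alpha^-1 * mx 1 by rewrite mulr_ge0// invr_ge0 ltW.
have nB0 : 0 <= gamma^-1 * ml 1 by rewrite mulr_ge0// invr_ge0 ltW.
have ky0 : 0 <= ky :=
  divr_ge0 (mulr_ge0 (ltW al0) (sqr_ge0 L)) (mulr_ge0 (ltW mu0) (ltW be0)).
have nS0 : 0 <= ky * my 1 by rewrite mulr_ge0.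
have nA2 : 0 <= alpha^-1 * mx 2 by rewrite mulr_ge0// invr_ge0 ltW.
have nS2 : 0 <= ky * my 2 by rewrite mulr_ge0.
have [ex1 ey1] := er_first run; set N := b^-1 * _ in ex1 ey1.
have N0 : 0 <= N.
  by apply: mulr_ge0; [rewrite invr_ge0 ltW | exact: mulr_ge0 (ler0n R 2) (sqr_ge0 delta)].
have key : 5 * z * (alpha * (b1 1 + b1 2)) + 44 * (km * (b2 1 + b2 2))
      + - (122 / 1000 * alpha^-1) * mx 2 + 226 / 10 * ky * my 2
      + - (keep_x z * alpha^-1) * mx 1 + - (keep_y z * ky) * my 1
      + - (keep_l z * gamma^-1) * ml 1
      + 19 / 10 * alpha * ex 2 + 25 * alpha * ex 1 + 44 * km * ey 2 + 44 * km * ey 1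
      + 73 / 200 / 3 * (alpha^-1 * mx 2) - (34 - 88 / 3 * (73 / 200)) * (ky * my 2)
      - Pw * ex 2 - Qw * ey 2 + 2 / 5 * (E / 2) - 3 * D1 * (b1 2 + b2 2)
   <= - (2415 / 10000 * E) + 71 * (km * N).
  have zp : 0 <= z by move: z0; glra.
  have k1 := ler_wpM2l zp x11; have k2 := ler_wpM2l zp x12.
  have k3 := ler_wpM2l Ez0 gapE.
  have k4 := ler_wpM2r nA0 pA; have k5 := ler_wpM2r nB0 pB; have k6 := ler_wpM2r nS0 pS.
  have k7 := ler_wpM2r ex0 Pge; have k8 := ler_wpM2r ey0 Qge.
  have k9 := ler_wpM2r (mulr_ge0 (ltW al0) ex10) Ez1.
  have k10 := ler_wpM2r (mulr_ge0 (ltW km0) ey10) Ez1.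
  have k11 := ler_wpM2l (ltW km0) ex1; have k12 := ler_wpM2l (ltW km0) ey1.
  have k13 := ler_wpM2r ex10 akm.
  have k14 : 0 <= D1 * (b1 2 + b2 2) by rewrite mulr_ge0 ?addr_ge0// ltW.
  have k15 : 0 <= km * N by rewrite mulr_ge0// ltW.
  have k16 : 0 <= z * E by rewrite mulr_ge0// ltW.
  have k17 : Ez * E = 4722 / 10000 * E + 2766 / 10000 * (z * E) by rewrite /Ez /penalty; ring.
  rewrite k17 in k3; clear k17.
  move: k1 k2 k3 k4 k5 k6 k7 k8 k9 k10 k11 k12 k13 k14 k15 k16 x21 x22 E0 nA2 nS2.
  move: (keep_x z) (keep_y z) (keep_l z) => Kx Ky Kl; clearbody Ez E N Pw Qw.
  move: alpha^-1 gamma^-1 ky km => r4 r5 r6 r7; glra.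
have e0 : 0 < eta 2 by rewrite (er_eta run) divr_gt0.
have eA : eta 2 <= A3 by rewrite (er_eta run) ler_pdivrMr// ler_peMr// ltW.
have eA' : A3 <= eta 2 * (15875 / 10000).
  apply: le_trans (ler_wpM2l (ltW e0) c4u).
  by rewrite (er_eta run) divfK ?gt_eqF.
have kmN : 0 <= km * N := mulr_ge0 (ltW km0) N0.
have C2N := C2_ge; rewrite -/N in C2N.
have l4 := ler_wpM2l C2_ge0 (ln4_ge1 R).
set Tot := (X in X <= _) in key; have k1 := ler_wpM2l (ltW e0) key.
have k2 := ler_wpM2r kmN eA; have k3 := ler_wpM2r (ltW E0) eA'.
have k4 : A3 * E * (3 / 8 * (crt 5 ^+ 2 - crt 4 ^+ 2)) <= A3 * E * (1521 / 10000).
  apply: ler_wpM2l; first exact: ltW (mulr_gt0 A30 E0).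
  move: c5sq c4sq'; move: (crt 5 ^+ 2) (crt 4 ^+ 2) => r5 r4; glra.
have k5 : 0 <= A3 * E := ltW (mulr_gt0 A30 E0).
have -> : eps ^+ 2 / 4 * (D1 * A3 * (3 / 2 * crt 5 ^+ 2 - 3 * crt 4 ^+ 2 / 2)) =
   A3 * E * (3 / 8 * (crt 5 ^+ 2 - crt 4 ^+ 2)) by rewrite /E; field.
apply: (le_trans k4).
move: k1 => {}k1; clear key.
have {}step : potential 3 <= potential 2 + eta 2 * Tot + C2 / 4 := step.
move: Tot (potential 2) (potential 3) step k1 => Tot P2 P3 step k1.
have C20 := C2_ge0.
move: step k1 k2 k3 k5 l4 C2N C20; clearbody E N.
move: (km * N) (ln 4) C2 => r1 r2 r3; glra.
Qed.

(** All the terms added to the mean dual value are nonnegative. *)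
Lemma potential_ge M k : (forall k, M <= md k.+1) -> M <= potential k.+2.
Proof.
move=> hM; have [m0 m6] := mubeta_le sizes.
have [A10 A20 A30] : [/\ 0 < A1, 0 < A2 & 0 < A3] by case: wts.
have [gy0 _ _ _ [ex0 ey0 _ _]] := er_ge0 run k.+2.
have [c1 _ _ _ _] := cr_facts k; have c0 : 0 < cr k.+1 by apply: lt_le_trans c1.
have e0 : 0 < eta k.+1 by rewrite (er_eta run) divr_gt0.
have e1 : eta k.+1 <= 1.
  by rewrite (er_eta run) ler_pdivrMr// mul1r (le_trans (wt_A31 wts)).
have aL : 0 <= alpha * L ^+ 2 by rewrite mulr_ge0 ?sqr_ge0// (ltW (ss_alpha sizes)).
have W0 : 0 <= W - 4 * eta k.+1 * alpha * L ^+ 2.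
  have -> : W = 32 * (alpha * L ^+ 2) * (mu * beta)^-1 by rewrite /W (mulrC beta) !mulrA.
  have i6 : 6 <= (mu * beta)^-1.
    by rewrite -[6]invrK lef_pV2 ?posrE ?invr_gt0//; apply: le_trans m6 _; rewrite div1r.
  have := ler_wpM2l aL i6; have := ler_wpM2l aL e1; move: aL.
  move: (mu * beta)^-1 => r; glra.
rewrite /potential /=; apply: le_trans (hM k.+1) _.
have n1 := mulr_ge0 W0 gy0.
have n2 : 0 <= A1 / eta k.+1 * ex k.+2 by rewrite mulr_ge0// ltW// divr_gt0.
have n3 : 0 <= A2 / eta k.+1 * ey k.+2 by rewrite mulr_ge0// ltW// divr_gt0.
by move: n1 n2 n3; move: (_ * gy _) (_ * ex _) (_ * ey _) => r1 r2 r3; glra.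
Qed.

(** Without a small gap the potential, which is bounded below, would decrease
    like the sum of the step sizes, against a merely logarithmic noise. *)
Lemma exists_small_gap M : (forall k, M <= md k.+1) ->
  exists2 T, (0 < T)%N & gp T <= eps ^+ 2.
Proof.
move=> hM; apply: contrapT => none.
have big k : (0 < k)%N -> eps ^+ 2 < gp k.
  by move=> k0; rewrite ltNge; apply/negP => h; apply: none; exists k.
have [A30 D10] := (wt_A3 wts, wt_D1 wts).
pose K := eps ^+ 2 / 4 * (D1 * A3 * (3 / 2)).
have K0 : 0 < K.
  have e2 : 0 < eps ^+ 2 by rewrite exprn_gt0// (er_eps run).
  by apply: mulr_gt0; [exact: divr_gt0|apply: mulr_gt0; [exact: mulr_gt0|exact: divr_gt0]].
pose Q := `|potential 2 - M + K * crt 4 ^+ 2| + 3 * C2.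
have Q0 : 0 <= Q by rewrite addr_ge0// mulr_ge0// C2_ge0.
have grow T : (2 < T)%N -> K * crt (T%:R + 3) <= Q.
  move=> T2; have h := rate_ge3 T2 (fun k hk => big k (ltnW (andP hk).1)).
  have [j Tj] : exists j, T = j.+2 by case: (T) T2 => [|[|j]] // _; exists j.
  have hP : M <= potential T by rewrite Tj; exact: potential_ge.
  set c := crt (T%:R + 3) in h *.
  have T3 : 0 <= T%:R + 3 :> R by rewrite addr_ge0.
  have c3 : c ^+ 3 = T%:R + 3 by exact: crt3.
  have c1 : 1 <= c.
    rewrite -(ler_pXn2r (n := 3))// ?nnegrE ?powR_ge0// expr1n c3.
    by rewrite -natrD ler1n addnS.
  have c0 : 0 < c by apply: lt_le_trans c1.
  have hl : ln (T%:R + 2) <= 3 * c.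
    have l1 : ln (T%:R + 2) <= ln (c ^+ 3).
      by rewrite ler_ln ?posrE ?exprn_gt0// c3 -!natrD ?ltr0n ?ler_nat ?addnS.
    have l2 : ln c <= c.
      have := @le_ln1Dx R (c - 1); rewrite addrCA subrr addr0 => /(_ _) l2.
      apply: le_trans (l2 _) _; first by move: c0; glra.
      by rewrite lerBlDr lerDl.
    apply: le_trans l1 _; rewrite lnXn// mulr_natl.
    by rewrite lerMn2r l2 orbT.
  have hC := ler_wpM2l C2_ge0 hl.
  have cc : c <= c ^+ 2 by rewrite expr2 ler_peMl// ltW.
  rewrite -(ler_pM2r c0).
  have hQ : potential 2 - M + K * crt 4 ^+ 2 <= `|potential 2 - M + K * crt 4 ^+ 2| * c.
    by apply: le_trans (ler_norm _) _; rewrite ler_peMr.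
  have eK : eps ^+ 2 / 4 * (D1 * A3 * (3 / 2 * c ^+ 2 - 3 * crt 4 ^+ 2 / 2)) =
    K * c ^+ 2 - K * crt 4 ^+ 2 by rewrite /K; field.
  rewrite eK in h; rewrite /Q mulrDl; move: h hP hC hQ.
  clearbody K; move: (`|potential 2 - M + K * crt 4 ^+ 2| * c) => r1.
  move: (K * crt 4 ^+ 2) (potential 2) (potential T) => r2 r3 r4; glra.
pose X := Q / K; have X0 : 0 <= X by rewrite divr_ge0// ltW.
have [n hn] : exists n : nat, X ^+ 3 < n%:R.
  by exists (Num.bound (X ^+ 3)); apply: archi_boundP; rewrite exprn_ge0.
have h3 : X < crt (n.+3%:R + 3).
  apply: crt_lt => //; apply: lt_trans hn _; rewrite -natrD ltr_nat.
  exact: leq_trans (leqW (leqnSn _)) (leq_addr _ _).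
have := grow n.+3 isT; rewrite leNgt => /negP; apply.
by rewrite mulrC -ltr_pdivrMr.
Qed.

End Complexity.

(** * The trajectory of the algorithm *)

Section Trajectory.
Context (R : realType) dO dZ (Om : measurableType dO) (Z : measurableType dZ).
Variables (P : probability Om R) (D : probability Z R) (b : nat).
Variable zeta : nat -> 'I_b -> Om -> Z.
Hypotheses (iid : iid_samples P D zeta) (b_gt0 : (0 < b)%N).
Local Notation history := (history zeta).
Variables (dx dy p : nat).
Variables (X U : set 'cV[R]_dx) (Y V : set 'cV[R]_dy) (Lam : set 'cV[R]_p).
Hypotheses (X_prox : proximinal X) (XU : X `<=` U) (U_open : open U) (X_compact : compact X).
Hypotheses (Y_prox : proximinal Y) (YV : Y `<=` V) (V_open : open V).
Hypotheses (Y_neq0 : Y !=set0) (Y_compact : compact Y) (Lam_prox : proximinal Lam).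
Variables (A : 'M[R]_(p, dx)) (B : 'M[R]_(p, dy)) (c : 'cV[R]_p).
Variable G : 'cV[R]_dx -> 'cV[R]_dy -> Z -> R.
Variables (l mu : R).
Hypotheses (l_ge0 : 0 <= l) (mu_gt0 : 0 < mu).
Hypothesis G_smooth : forall z, smooth_pair U V l (fun x y => G x y z).
Hypothesis G_L1 : forall x y, U x -> V y -> L1 D (G x y).

Definition mean_objective x y := Ex D (G x y).
Local Notation g := mean_objective.
Hypothesis g_concave : forall x, X x -> strongly_concave_on V mu (g x).

Variables (alpha beta gamma L : R) (eta varrho iota theta1 theta2 : nat -> R).
Hypothesis sizes : step_sizes L mu alpha beta gamma (opnorm B).
Hypothesis lL : l <= L.
Hypothesis eta01 : forall k, (0 < k)%N -> 0 < eta k <= 1.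
Hypothesis theta1_pos : forall k, (0 < k)%N -> 0 < theta1 k /\ theta1 k.+1 <= theta1 k.
Hypothesis theta2_pos : forall k, (0 < k)%N -> 0 < theta2 k /\ theta2 k.+1 <= theta2 k.
Hypothesis query : forall k (t : R), (0 < k)%N -> 0 <= t <= 1 ->
     (forall x i, X x -> U (x + (t * theta1 k) *: basis_vec R i)) /\
     (forall y i, Y y -> V (y + (t * theta2 k) *: basis_vec R i)).
Variable delta : R.
Hypothesis variance : forall k x y, (0 < k)%N -> X x -> Y y ->
     ('E_D[fun z => (enorm (zo_gradx (theta1 k) (fun x' y' => G x' y' z) x y
                           - zo_gradx (theta1 k) g x y) ^+ 2)%R]
        <= (delta ^+ 2)%:E)%E /\
     ('E_D[fun z => (enorm (zo_grady (theta2 k) (fun x' y' => G x' y' z) x y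
                           - zo_grady (theta2 k) g x y) ^+ 2)%R]
        <= (delta ^+ 2)%:E)%E.
Variables (x1 : 'cV[R]_dx) (y1 : 'cV[R]_dy) (lam1 : 'cV[R]_p).
Hypotheses (x1_in : X x1) (y1_in : Y y1) (lam1_in : Lam lam1).
Variables (x xt : nat -> Om -> 'cV[R]_dx) (y yt : nat -> Om -> 'cV[R]_dy)
  (lam lamt : nat -> Om -> 'cV[R]_p) (v : nat -> Om -> 'cV[R]_dx)
  (w : nat -> Om -> 'cV[R]_dy).
Hypothesis algo : zo_rmpdpg X Y Lam A B c G alpha beta gamma
              eta varrho iota theta1 theta2 x1 y1 lam1 zeta
              x xt y yt lam lamt v w.

Local Notation Lg := (lagrangian A B c g).
Local Notation ys := (dual_argmax Y Lg).
Local Notation Phi := (dual_val Y Lg).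
Local Notation res := (residual A B c).

Lemma g_smooth : smooth_pair U V l g.
Proof. exact: (expectation_smooth U_open V_open l_ge0 G_smooth G_L1). Qed.

(** The momentum recursion of the x-block, and of the y-block with the roles of
    the two variables exchanged. *)
Let adm_x := admissible (Om := Om) U V x y theta1.
Let adm_y := admissible (Om := Om) V U y x theta2.
Let adp_x := adapted zeta x y (fun k om => A^T *m lam k om).
Let adp_y := adapted zeta y x (fun k om => B^T *m lam k om).

(** The induction hypothesis along the trajectory: measurability with respect
    to the past, feasibility and boundedness. *)
Record state k : Prop := {
  st_x : measurable_vec (x k.+1 : history (past k) -> _);
  st_y : measurable_vec (y k.+1 : history (past k) -> _);
  st_lam : measurable_vec (lam k.+1 : history (past k) -> _);
  st_v : measurable_vec (v k.+1 : history (past k.+1) -> _);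
  st_w : measurable_vec (w k.+1 : history (past k.+1) -> _);
  st_X : forall om, X (x k.+1 om); st_Y : forall om, Y (y k.+1 om);
  st_Lam : forall om, Lam (lam k.+1 om);
  st_bnd : exists M, forall om, enorm (lam k.+1 om) <= M }.

Lemma admissible_state k : (forall om, X (x k.+1 om)) -> (forall om, Y (y k.+1 om)) ->
  adm_x k.+1 /\ adm_y k.+1.
Proof.
move=> Xx Yy; split=> om; split; do ?[by apply: XU|by apply: YV].
- by move=> i t t01; apply: (query (ltn0Sn k) t01).1.
- by move=> i t t01; apply: (query (ltn0Sn k) t01).2.
Qed.

Lemma adapted_state k : measurable_vec (x k.+1 : history (past k) -> _) ->
  measurable_vec (y k.+1 : history (past k) -> _) ->
  measurable_vec (lam k.+1 : history (past k) -> _) -> adp_x k /\ adp_y k.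
Proof. by move=> mx my ml; split; split=> //; exact: measurable_vec_mulmx. Qed.

Lemma residual_bounded : exists M, 0 <= M /\ forall x y, X x -> Y y -> enorm (res x y) <= M.
Proof.
have [Mx [Mx0 hx]] := compact_enorm_bounded X_compact.
have [My [My0 hy]] := compact_enorm_bounded Y_compact.
exists (opnorm A * Mx + opnorm B * My + enorm c); split=> [|x' y' Xx Yy].
  by rewrite !addr_ge0 ?mulr_ge0 ?opnorm_ge0 ?enorm_ge0.
apply: le_trans (enormB _ _) _; rewrite lerD2r; apply: le_trans (enormD _ _) _.
apply: lerD; apply: le_trans (enorm_mulmx _ _) _; rewrite ler_wpM2l ?opnorm_ge0//.
  exact: hx.
exact: hy.
Qed.

(** The multipliers are unbounded as a set, but each step moves them by at most
    gamma times the residual. *)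
Lemma multiplier_step lam' r : Lam lam' ->
  enorm (proj Lam (lam' + gamma *: r) - lam') <= gamma * enorm r.
Proof.
move=> Ll; rewrite -{2}(proj_id Lam_prox Ll).
apply: le_trans (proj_nonexpansive Lam_prox _ _) _.
by rewrite addrC addKr enormZ gtr0_norm ?(ss_gamma sizes).
Qed.

Lemma measurable_proj d (T : measurableType d) n (S : set 'cV[R]_n) (u : T -> 'cV[R]_n) :
  proximinal S -> measurable_vec u -> measurable_vec (fun t => proj S (u t)).
Proof.
move=> pS m_u; apply: (lipschitz_measurable_vec (F := proj S) (C := 1) m_u) => t t'.
by rewrite mul1r; exact: proj_nonexpansive.
Qed.

(** One statement for all steps; the previous state is asked for only if there
    is one. *)
Lemma momentum_state k : measurable_vec (x k.+1 : history (past k) -> _) ->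
  measurable_vec (y k.+1 : history (past k) -> _) ->
  measurable_vec (lam k.+1 : history (past k) -> _) ->
  (forall om, X (x k.+1 om)) -> (forall om, Y (y k.+1 om)) ->
  ((0 < k)%N -> state k.-1) ->
  measurable_vec (v k.+1 : history (past k.+1) -> _) /\
  measurable_vec (w k.+1 : history (past k.+1) -> _).
Proof.
move=> mx my ml Xx Yy prev.
have [ax ay] := admissible_state Xx Yy; have [dx' dy'] := adapted_state mx my ml.
split.
- apply: (momentum_adapted (s := fun k om => A^T *m lam k om) (theta := theta1)
    (rho := varrho) U_open V_open l_ge0 G_smooth G_L1 (zo_varrho0 algo)) => //.
    by move=> k' om; exact: (zo_v algo k' om).
  case: k prev {mx my ml Xx Yy ax ay dx' dy'} => // k /(_ isT) S _.
  have [] := admissible_state (st_X S) (st_Y S).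
  have [] := adapted_state (st_x S) (st_y S) (st_lam S).
  by split=> //; exact: st_v.
- apply: (@momentum_adapted R dO dZ Om Z D b zeta dy dx V U l (fun y x => G x y)
    V_open U_open l_ge0 (fun z => smooth_swap (G_smooth z)) (fun y x Vy Ux => G_L1 Ux Vy)
    y x (fun k om => B^T *m lam k om) w theta2 iota (zo_iota0 algo)) => //.
    by move=> k' om; exact: (zo_w algo k' om).
  case: k prev {mx my ml Xx Yy ax ay dx' dy'} => // k /(_ isT) S _.
  have [] := admissible_state (st_X S) (st_Y S).
  have [] := adapted_state (st_x S) (st_y S) (st_lam S).
  by split=> //; exact: st_w.
Qed.

Lemma trajectory_state k : state k.
Proof.
elim: k => [|k S].
  have mc n (u : nat -> Om -> 'cV[R]_n) u1 : (forall om, u 1%N om = u1) ->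
      measurable_vec (u 1%N : history (past 0) -> _).
    by move=> uE i; under [fun _ => _]funext do rewrite uE; exact: measurable_cst.
  have mx := mc _ _ _ (zo_x1 algo); have my := mc _ _ _ (zo_y1 algo).
  have ml := mc _ _ _ (zo_lam1 algo).
  have Xx om : X (x 1%N om) by rewrite (zo_x1 algo).
  have Yy om : Y (y 1%N om) by rewrite (zo_y1 algo).
  have [mv mw] := momentum_state mx my ml Xx Yy (fun h => False_ind _ (notF h)).
  split=> //; first by move=> om; rewrite (zo_lam1 algo).
  by exists (enorm lam1) => om; rewrite (zo_lam1 algo).
have mono n (u : Om -> 'cV[R]_n) : measurable_vec (u : history (past k) -> _) ->
    measurable_vec (u : history (past k.+1) -> _).
  by apply: measurable_vec_mono; exact: past_mono.
have mx0 := mono _ _ (st_x S); have my0 := mono _ _ (st_y S); have ml0 := mono _ _ (st_lam S).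
have e01 := eta01 (ltn0Sn k); have e01' : 0 <= eta k.+1 <= 1.
  by case/andP: e01 => /ltW -> ->.
have xE : x k.+2 = (fun om => x k.+1 om + eta k.+1 *:
    (proj X (x k.+1 om - alpha *: v k.+1 om) - x k.+1 om)).
  by apply/funext => om; rewrite (zo_x algo)// (zo_xt algo).
have yE : y k.+2 = (fun om => y k.+1 om + eta k.+1 *:
    (proj Y (y k.+1 om + beta *: w k.+1 om) - y k.+1 om)).
  by apply/funext => om; rewrite (zo_y algo)// (zo_yt algo).
have lE : lam k.+2 = (fun om => lam k.+1 om + eta k.+1 *:
    (proj Lam (lam k.+1 om + gamma *: res (x k.+2 om) (y k.+2 om)) - lam k.+1 om)).
  by apply/funext => om; rewrite (zo_lam algo)// (zo_lamt algo).
have mx : measurable_vec (x k.+2 : history (past k.+1) -> _).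
  rewrite xE; apply: measurable_vecD => //; apply: measurable_vecZ; apply: measurable_vecB => //.
  apply: measurable_proj => //; apply: measurable_vecB => //; apply: measurable_vecZ; exact: st_v.
have my : measurable_vec (y k.+2 : history (past k.+1) -> _).
  rewrite yE; apply: measurable_vecD => //; apply: measurable_vecZ; apply: measurable_vecB => //.
  apply: measurable_proj => //; apply: measurable_vecD => //; apply: measurable_vecZ; exact: st_w.
have Xx om : X (x k.+2 om).
  by rewrite xE; apply: (prox_convex X_prox) => //; [exact: st_X | exact: proj_in].
have Yy om : Y (y k.+2 om).
  by rewrite yE; apply: (prox_convex Y_prox) => //; [exact: st_Y | exact: proj_in].
have ml : measurable_vec (lam k.+2 : history (past k.+1) -> _).
  rewrite lE; apply: measurable_vecD => //; apply: measurable_vecZ; apply: measurable_vecB => //.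
  apply: measurable_proj => //; apply: measurable_vecD => //; apply: measurable_vecZ.
  apply: measurable_vecB; last exact: measurable_vec_cst.
  by apply: measurable_vecD; exact: measurable_vec_mulmx.
have [mv mw] := momentum_state mx my ml Xx Yy (fun=> S).
split=> //.
  by move=> om; rewrite lE; apply: (prox_convex Lam_prox) => //; [exact: st_Lam | exact: proj_in].
have [M hM] := st_bnd S; have [Mr [Mr0 hMr]] := residual_bounded.
exists (M + gamma * Mr) => om; rewrite lE; apply: le_trans (enormD _ _) _.
apply: lerD => //; rewrite enormZ ger0_norm; last by case/andP: e01'.
apply: le_trans (_ : 1 * (gamma * Mr) <= _); last by rewrite mul1r.
have g0 := ltW (ss_gamma sizes).
apply: ler_pM; rewrite ?enorm_ge0//; do ?by case/andP: e01'.
apply: le_trans (multiplier_step _ (st_Lam S om)) _; rewrite ler_wpM2l//.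
exact: hMr.
Qed.

Definition ex k om := zo_gradx (theta1 k) g (x k om) (y k om) - A^T *m lam k om - v k om.
Definition ey k om := zo_grady (theta2 k) g (x k om) (y k om) - B^T *m lam k om - w k om.
Definition sx k om := xt k.+1 om - x k om.
Definition sy k om := yt k.+1 om - y k om.
Definition sl k om := lamt k.+1 om - lam k om.
Definition gapy k om := y k om - ys (x k om) (lam k om).

Lemma state_measurable k : [/\ measurable_vec (x k.+1), measurable_vec (y k.+1),
  measurable_vec (lam k.+1), measurable_vec (v k.+1) & measurable_vec (w k.+1)].
Proof.
have S := trajectory_state k; have h := fun J n u => @history_measurable_vec R dO dZ Om Z P D b zeta iid J n u.
split; [exact: h (st_x S)|exact: h (st_y S)|exact: h (st_lam S)|exact: h (st_v S)|exact: h (st_w S)].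
Qed.

Lemma x_in k om : X (x k.+1 om). Proof. exact: (st_X (trajectory_state k)). Qed.
Lemma y_in k om : Y (y k.+1 om). Proof. exact: (st_Y (trajectory_state k)). Qed.
Lemma lam_in k om : Lam (lam k.+1 om). Proof. exact: (st_Lam (trajectory_state k)). Qed.

Lemma xtE k om : xt k.+2 om = proj X (x k.+1 om - alpha *: v k.+1 om).
Proof. exact: (zo_xt algo). Qed.
Lemma ytE k om : yt k.+2 om = proj Y (y k.+1 om + beta *: w k.+1 om).
Proof. exact: (zo_yt algo). Qed.
Lemma lamtE k om :
  lamt k.+2 om = proj Lam (lam k.+1 om + gamma *: res (x k.+2 om) (y k.+2 om)).
Proof. exact: (zo_lamt algo). Qed.

Lemma incr_x k om : x k.+2 om - x k.+1 om = eta k.+1 *: sx k.+1 om.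
Proof. by rewrite (zo_x algo)// addrC addKr. Qed.
Lemma incr_y k om : y k.+2 om - y k.+1 om = eta k.+1 *: sy k.+1 om.
Proof. by rewrite (zo_y algo)// addrC addKr. Qed.

Lemma L1_sqr n (u : Om -> 'cV[R]_n) M : measurable_vec u -> (forall om, enorm (u om) <= M) ->
  L1 P (fun om => enorm (u om) ^+ 2).
Proof. exact: L1_sqr_enorm. Qed.

Lemma L1_sx k : L1 P (fun om => enorm (sx k.+1 om) ^+ 2).
Proof.
have [mx _ _ mv _] := state_measurable k; have [M [_ hM]] := compact_enorm_bounded X_compact.
apply: (@L1_sqr _ _ (M + M)) => [|om].
  apply: measurable_vecB => //; have -> : xt k.+2 = (fun om => proj X (x k.+1 om - alpha *: v k.+1 om))
    by apply/funext => om; exact: xtE.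
  by apply: measurable_proj => //; apply: measurable_vecB => //; exact: measurable_vecZ.
apply: le_trans (enormB _ _) _; apply: lerD; apply: hM; last exact: x_in.
by rewrite xtE; exact: proj_in.
Qed.

Lemma L1_sy k : L1 P (fun om => enorm (sy k.+1 om) ^+ 2).
Proof.
have [_ my _ _ mw] := state_measurable k; have [M [_ hM]] := compact_enorm_bounded Y_compact.
apply: (@L1_sqr _ _ (M + M)) => [|om].
  apply: measurable_vecB => //; have -> : yt k.+2 = (fun om => proj Y (y k.+1 om + beta *: w k.+1 om))
    by apply/funext => om; exact: ytE.
  by apply: measurable_proj => //; apply: measurable_vecD => //; exact: measurable_vecZ.
apply: le_trans (enormB _ _) _; apply: lerD; apply: hM; last exact: y_in.
by rewrite ytE; exact: proj_in.
Qed.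

Lemma L1_sl k : L1 P (fun om => enorm (sl k.+1 om) ^+ 2).
Proof.
have [mx my ml _ _] := state_measurable k; have [mx' my' _ _ _] := state_measurable k.+1.
have [M [_ hM]] := residual_bounded.
apply: (@L1_sqr _ _ (gamma * M)) => [|om].
  apply: measurable_vecB => //; have -> : lamt k.+2 = (fun om => proj Lam (lam k.+1 om + gamma *: res (x k.+2 om) (y k.+2 om)))
    by apply/funext => om; exact: lamtE.
  apply: measurable_proj => //; apply: measurable_vecD => //; apply: measurable_vecZ.
  apply: measurable_vecB; last exact: measurable_vec_cst.
  by apply: measurable_vecD; exact: measurable_vec_mulmx.
rewrite /sl lamtE; apply: le_trans (multiplier_step _ (lam_in k om)) _.
rewrite ler_wpM2l ?(ltW (ss_gamma sizes))//; apply: hM; [exact: x_in | exact: y_in].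
Qed.

(** The maximizer is a Lipschitz function of (x, lambda). *)
Lemma measurable_argmax k : measurable_vec (fun om => ys (x k.+1 om) (lam k.+1 om)).
Proof.
have [mx _ ml _ _] := state_measurable k; move=> i.
apply: (lipschitz_measurable (measurable_col_mx mx ml) (C := mu^-1 * (l + opnorm B))).
move=> om om'; rewrite opp_col_mx add_col_mx.
have h := argmax_lipschitz XU U_open Y_prox YV V_open Y_neq0 Y_compact A B c l_ge0
  g_smooth g_concave (lam k.+1 om) (lam k.+1 om') (x_in k om) (x_in k om').
set u := ys (x k.+1 om') _ in h *; set u' := ys _ _ in h *.
have := enorm_coord (u - u') i; rewrite !mxE => /le_trans; apply.
rewrite -(ler_pM2l mu_gt0) mulrA mulrA mulfV ?gt_eqF// mul1r; apply: le_trans h _.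
rewrite mulrDl; apply: lerD; apply: ler_wpM2l; rewrite ?opnorm_ge0//.
  exact: enorm_col_mxl.
exact: enorm_col_mxr.
Qed.

Lemma argmax_in k om : Y (ys (x k.+1 om) (lam k.+1 om)).
Proof.
exact: (argmax_spec XU U_open YV V_open Y_neq0 Y_compact A B c l_ge0 g_smooth
  (lam k.+1 om) (x_in k om)).1.
Qed.

Lemma L1_gapy k : L1 P (fun om => enorm (gapy k.+1 om) ^+ 2).
Proof.
have [_ my _ _ _] := state_measurable k; have [M [_ hM]] := compact_enorm_bounded Y_compact.
apply: (@L1_sqr _ _ (M + M)) => [|om].
  by apply: measurable_vecB => //; exact: measurable_argmax.
apply: le_trans (enormB _ _) _; apply: lerD; apply: hM; [exact: y_in | exact: argmax_in].
Qed.

(** Along segments from a fixed point the objective changes by at most a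
    quadratic polynomial in the diameter. *)
Lemma g_bounded : exists M, forall x y, X x -> Y y -> `|g x y| <= M.
Proof.
have [Mx [Mx0 hx]] := compact_enorm_bounded X_compact.
have [My [My0 hy]] := compact_enorm_bounded Y_compact.
have [y0 Yy0] := Y_neq0; have x0X := x1_in.
set a := enorm (gradx g x1 y0) + l * (My + My).
set a' := enorm (grady g x1 y0).
exists (`|g x1 y0| + (a * (Mx + Mx) + l / 2 * (Mx + Mx) ^+ 2)
  + (a' * (My + My) + l / 2 * (My + My) ^+ 2)) => x' y' Xx Yy.
have hb1 := smooth_boundx l_ge0 g_smooth (fun t => X_segment X_prox XU x0X Xx) (YV Yy).
have hb2 := smooth_boundy l_ge0 g_smooth (fun t => Y_segment Y_prox YV Yy0 Yy) (XU x0X).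
have nx : enorm (x' - x1) <= Mx + Mx.
  by apply: le_trans (enormB _ _) _; apply: lerD; exact: hx.
have ny : enorm (y' - y0) <= My + My.
  by apply: le_trans (enormB _ _) _; apply: lerD; exact: hy.
have hg : enorm (gradx g x1 y') <= a.
  have := gradx_lip g_smooth (XU x0X) (XU x0X) (YV Yy0) (YV Yy).
  rewrite subrr enorm0 add0r => h.
  rewrite -[gradx g x1 y'](subrK (gradx g x1 y0)) addrC; apply: le_trans (enormD _ _) _.
  by rewrite lerD2l; apply: le_trans h _; rewrite ler_wpM2l.
have k1 : `|dotv (gradx g x1 y') (x' - x1)| <= a * (Mx + Mx).
  rewrite ler_norml; apply/andP; split.
    rewrite lerNl; apply: le_trans (_ : enorm (gradx g x1 y') * enorm (x' - x1) <= _).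
      by rewrite lerNl dotv_ge.
    by apply: ler_pM; rewrite ?enorm_ge0.
  by apply: le_trans (dotv_le _ _) _; apply: ler_pM; rewrite ?enorm_ge0.
have k2 : `|dotv (grady g x1 y0) (y' - y0)| <= a' * (My + My).
  rewrite ler_norml; apply/andP; split.
    rewrite lerNl; apply: le_trans (_ : enorm (grady g x1 y0) * enorm (y' - y0) <= _).
      by rewrite lerNl dotv_ge.
    by apply: ler_pM; rewrite ?enorm_ge0.
  by apply: le_trans (dotv_le _ _) _; apply: ler_pM; rewrite ?enorm_ge0.
have sq (s M : R) : 0 <= s -> s <= M -> l / 2 * s ^+ 2 <= l / 2 * M ^+ 2.
  move=> s0 sM; rewrite ler_wpM2l ?divr_ge0// ler_pXn2r ?nnegrE//; exact: le_trans s0 sM.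
have k3 := le_trans hb1 (sq _ _ (enorm_ge0 _) nx).
have k4 := le_trans hb2 (sq _ _ (enorm_ge0 _) ny).
have t1 : `|g x' y' - g x1 y'| <= a * (Mx + Mx) + l / 2 * (Mx + Mx) ^+ 2.
  rewrite -[g x' y' - g x1 y'](subrK (dotv (gradx g x1 y') (x' - x1))) addrC.
  by apply: le_trans (ler_normD _ _) _; apply: lerD.
have t2 : `|g x1 y' - g x1 y0| <= a' * (My + My) + l / 2 * (My + My) ^+ 2.
  rewrite -[g x1 y' - g x1 y0](subrK (dotv (grady g x1 y0) (y' - y0))) addrC.
  by apply: le_trans (ler_normD _ _) _; apply: lerD.
have key (r1 r2 r3 m1 m2 : R) : `|r1 - r2| <= m1 -> `|r2 - r3| <= m2 ->
    `|r1| <= `|r3| + m1 + m2.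
  move=> h1 h2; have -> : r1 = r3 + (r1 - r2) + (r2 - r3) by ring.
  apply: le_trans (ler_normD _ _) _; apply: lerD => //.
  by apply: le_trans (ler_normD _ _) _; exact: lerD.
exact: key t1 t2.
Qed.

Lemma PhiE k om : Phi (x k.+1 om) (lam k.+1 om) =
  g (x k.+1 om) (ys (x k.+1 om) (lam k.+1 om))
  - dotv (lam k.+1 om) (res (x k.+1 om) (ys (x k.+1 om) (lam k.+1 om))).
Proof.
exact: (dual_valE XU U_open YV V_open Y_neq0 Y_compact A B c l_ge0 g_smooth
  (lam k.+1 om) (x_in k om)).
Qed.

Lemma L1_Phi k : L1 P (fun om => Phi (x k.+1 om) (lam k.+1 om)).
Proof.
under [fun _ => _]funext do rewrite PhiE.
have [mx _ ml _ _] := state_measurable k; have my := @measurable_argmax k.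
have [M hM] := g_bounded; have [Mr [Mr0 hMr]] := residual_bounded.
have [Ml hMl] := st_bnd (trajectory_state k).
apply: L1B.
  apply: (@L1_bounded _ _ _ _ _ M); last by move=> om; apply: hM; [exact: x_in|exact: argmax_in].
  apply: pair_measurable => // om.
  exact: (smooth_continuous U_open V_open l_ge0 g_smooth (XU (x_in k om)) (YV (argmax_in k om))).
apply: (@L1_bounded _ _ _ _ _ (Ml * Mr)).
  apply: measurable_dotv => //; apply: measurable_vecB; last exact: measurable_vec_cst.
  by apply: measurable_vecD; exact: measurable_vec_mulmx.
move=> om; set u := res _ _; have hu : enorm u <= Mr by apply: hMr; [exact: x_in|exact: argmax_in].
have key : enorm (lam k.+1 om) * enorm u <= Ml * Mr by apply: ler_pM; rewrite ?enorm_ge0.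
rewrite ler_norml; apply/andP; split; last exact: le_trans (dotv_le _ _) key.
by apply: le_trans (dotv_ge _ _); rewrite lerN2.
Qed.

Lemma variance_x k om : adm_x k.+1 ->
  L1 D (fun z => enorm (est G x y theta1 k.+1 om z - Exv D (est G x y theta1 k.+1 om)) ^+ 2) /\
  Ex D (fun z => enorm (est G x y theta1 k.+1 om z - Exv D (est G x y theta1 k.+1 om)) ^+ 2)
    <= delta ^+ 2.
Proof.
move=> ad; rewrite -(est_mean G_L1 om ad).
apply: L1_expectation; last exact: (variance (ltn0Sn k) (x_in k om) (y_in k om)).1.
  apply: measurable_sqr_enorm; apply: measurable_vecB; last exact: measurable_vec_cst.
  by move=> i; apply: L1_measurable; exact: (est_L1 G_L1 om i ad).
by move=> z; exact: sqr_ge0.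
Qed.

Lemma variance_y k om : adm_y k.+1 ->
  let f y x := G x y in
  (L1 D (fun z => enorm (est f y x theta2 k.+1 om z - Exv D (est f y x theta2 k.+1 om)) ^+ 2) /\
  Ex D (fun z => enorm (est f y x theta2 k.+1 om z - Exv D (est f y x theta2 k.+1 om)) ^+ 2)
    <= delta ^+ 2 : Prop).
Proof.
move=> ad f; have f_L1 y x (Vy : V y) (Ux : U x) : L1 D (f y x) := G_L1 Ux Vy.
rewrite -(est_mean f_L1 om ad).
apply: L1_expectation; last exact: (variance (ltn0Sn k) (x_in k om) (y_in k om)).2.
  apply: measurable_sqr_enorm; apply: measurable_vecB; last exact: measurable_vec_cst.
  by move=> i; apply: L1_measurable; exact: (est_L1 f_L1 om i ad).
by move=> z; exact: sqr_ge0.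
Qed.

Lemma state_adm k : adm_x k.+1 /\ adm_y k.+1.
Proof. exact: admissible_state (x_in k) (y_in k). Qed.

Lemma state_adp k : adp_x k /\ adp_y k.
Proof. by have S := trajectory_state k; exact: adapted_state (st_x S) (st_y S) (st_lam S). Qed.

Lemma ex_first : L1 P (fun om => enorm (ex 1 om) ^+ 2) /\
  Ex P (fun om => enorm (ex 1 om) ^+ 2) <= b%:R^-1 * (2 * delta ^+ 2).
Proof.
exact: (@err_first R dO dZ Om Z P D b zeta iid b_gt0 dx dy U V l G U_open V_open l_ge0 G_smooth
  G_L1 x y (fun k om => A^T *m lam k om) v theta1 varrho (zo_varrho0 algo)
  (fun k om => zo_v algo k om) delta variance_x (state_adm 0).1 (state_adp 0).1).
Qed.

Lemma ey_first : L1 P (fun om => enorm (ey 1 om) ^+ 2) /\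
  Ex P (fun om => enorm (ey 1 om) ^+ 2) <= b%:R^-1 * (2 * delta ^+ 2).
Proof.
exact: (@err_first R dO dZ Om Z P D b zeta iid b_gt0 dy dx V U l (fun y x => G x y) V_open U_open
  l_ge0 (fun z => smooth_swap (G_smooth z)) (fun y x Vy Ux => G_L1 Ux Vy)
  y x (fun k om => B^T *m lam k om) w theta2 iota (zo_iota0 algo)
  (fun k om => zo_w algo k om) delta variance_y (state_adm 0).2 (state_adp 0).2).
Qed.

Definition moment n (u : nat -> Om -> 'cV[R]_n) k := Ex P (fun om => enorm (u k om) ^+ 2).

Lemma moment_ge0 n (u : nat -> Om -> 'cV[R]_n) k : 0 <= moment u k.
Proof. by apply: Ex_ge0 => om; exact: sqr_ge0. Qed.

(** The mean of the squared change of the finite-difference estimators in one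
    step. *)
Definition increment k (m : nat) (theta : nat -> R) :=
  6 * l ^+ 2 * eta k ^+ 2 * (moment sx k + moment sy k)
  + 3 / 2 * (m%:R * l ^+ 2 * theta k ^+ 2).

Lemma increment_fun k m theta : exists2 Inc : Om -> R,
  (forall om, Inc om = 6 * l ^+ 2 * (enorm (x k.+2 om - x k.+1 om) ^+ 2
     + enorm (y k.+2 om - y k.+1 om) ^+ 2) + 3 / 2 * (m%:R * l ^+ 2 * theta k.+1 ^+ 2)) &
  (exists M, forall om, Inc om <= M) /\ Ex P Inc = increment k.+1 m theta.
Proof.
have [Mx [Mx0 hx]] := compact_enorm_bounded X_compact.
have [My [My0 hy]] := compact_enorm_bounded Y_compact.
set C := 3 / 2 * _.
exists (fun om => 6 * l ^+ 2 * (enorm (x k.+2 om - x k.+1 om) ^+ 2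
     + enorm (y k.+2 om - y k.+1 om) ^+ 2) + C) => //; split.
  exists (6 * l ^+ 2 * ((Mx + Mx) ^+ 2 + (My + My) ^+ 2) + C) => om.
  rewrite lerD2r ler_wpM2l ?mulr_ge0 ?sqr_ge0//.
  by apply: lerD; rewrite ler_pXn2r ?nnegrE ?enorm_ge0 ?addr_ge0//;
    apply: le_trans (enormB _ _) _; apply: lerD; [exact: hx (x_in _ _)|exact: hx (x_in _ _)
      |exact: hy (y_in _ _)|exact: hy (y_in _ _)].
have -> : (fun om => 6 * l ^+ 2 * (enorm (x k.+2 om - x k.+1 om) ^+ 2
     + enorm (y k.+2 om - y k.+1 om) ^+ 2) + C) =
   (fun om => 6 * l ^+ 2 * eta k.+1 ^+ 2 * (enorm (sx k.+1 om) ^+ 2 + enorm (sy k.+1 om) ^+ 2) + C).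
  by apply/funext => om; rewrite incr_x incr_y !sqr_enormZ; ring.
have h := L1D (L1_sx k) (L1_sy k).
by rewrite (ExD (L1Z _ h) (L1_cst _ _)) (ExZ _ h) (ExD (L1_sx k) (L1_sy k)) Ex_cst.
Qed.

Lemma ex_step k q : L1 P (fun om => enorm (ex k.+1 om) ^+ 2) -> (1 - varrho k.+1) ^+ 2 <= q ->
  L1 P (fun om => enorm (ex k.+2 om) ^+ 2) /\
  moment ex k.+2 <= (1 - varrho k.+1) ^+ 2 * moment ex k.+1
    + b%:R^-1 * (2 * varrho k.+1 ^+ 2 * delta ^+ 2 + 2 * q * increment k.+1 dx theta1).
Proof.
move=> eL1 hq; have [Inc IncE [[M hM] <-]] := increment_fun k dx theta1.
have [t0 _] := theta1_pos (ltn0Sn k.+1); have [_ tt] := theta1_pos (ltn0Sn k).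
exact: (@err_step R dO dZ Om Z P D b zeta iid b_gt0 dx dy U V l G U_open V_open l_ge0 G_smooth
  G_L1 x y (fun k om => A^T *m lam k om) v theta1 varrho (zo_varrho0 algo)
  (fun k om => zo_v algo k om) delta variance_x k q M Inc (state_adm k).1 (state_adp k).1
  (state_adm k.+1).1 (state_adp k.+1).1 (st_v (trajectory_state k)) eL1 hq t0 tt IncE hM).
Qed.

Lemma ey_step k q : L1 P (fun om => enorm (ey k.+1 om) ^+ 2) -> (1 - iota k.+1) ^+ 2 <= q ->
  L1 P (fun om => enorm (ey k.+2 om) ^+ 2) /\
  moment ey k.+2 <= (1 - iota k.+1) ^+ 2 * moment ey k.+1
    + b%:R^-1 * (2 * iota k.+1 ^+ 2 * delta ^+ 2 + 2 * q * increment k.+1 dy theta2).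
Proof.
move=> eL1 hq; have [Inc IncE [[M hM] <-]] := increment_fun k dy theta2.
have [t0 _] := theta2_pos (ltn0Sn k.+1); have [_ tt] := theta2_pos (ltn0Sn k).
have IncE' om : Inc om = 6 * l ^+ 2 * (enorm (y k.+2 om - y k.+1 om) ^+ 2
     + enorm (x k.+2 om - x k.+1 om) ^+ 2) + 3 / 2 * (dy%:R * l ^+ 2 * theta2 k.+1 ^+ 2).
  by rewrite IncE [X in _ * X + _]addrC.
exact: (@err_step R dO dZ Om Z P D b zeta iid b_gt0 dy dx V U l (fun y x => G x y) V_open U_open
  l_ge0 (fun z => smooth_swap (G_smooth z)) (fun y x Vy Ux => G_L1 Ux Vy)
  y x (fun k om => B^T *m lam k om) w theta2 iota (zo_iota0 algo)
  (fun k om => zo_w algo k om) delta variance_y k q M Inc (state_adm k).2 (state_adp k).2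
  (state_adm k.+1).2 (state_adp k.+1).2 (st_w (trajectory_state k)) eL1 hq t0 tt IncE' hM).
Qed.

Lemma L1_ex k : L1 P (fun om => enorm (ex k.+1 om) ^+ 2).
Proof. by elim: k => [|k IH]; [exact: ex_first.1 | exact: (ex_step IH (lexx _)).1]. Qed.

Lemma L1_ey k : L1 P (fun om => enorm (ey k.+1 om) ^+ 2).
Proof. by elim: k => [|k IH]; [exact: ey_first.1 | exact: (ey_step IH (lexx _)).1]. Qed.

Definition mean_dual k := Ex P (fun om => Phi (x k om) (lam k om)).

Lemma bias_x k om : enorm (gradx g (x k.+1 om) (y k.+1 om)
    - zo_gradx (theta1 k.+1) g (x k.+1 om) (y k.+1 om)) ^+ 2
  <= dx%:R * (l * theta1 k.+1 / 2) ^+ 2.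
Proof.
rewrite enormC; have [[_ _ q] _] := ((state_adm k).1 om, tt).
exact: (zo_gradx_error l_ge0 g_smooth (theta1_pos (ltn0Sn k)).1 (YV (y_in k om)) q).
Qed.

Lemma bias_y k om : enorm (grady g (x k.+1 om) (y k.+1 om)
    - zo_grady (theta2 k.+1) g (x k.+1 om) (y k.+1 om)) ^+ 2
  <= dy%:R * (l * theta2 k.+1 / 2) ^+ 2.
Proof.
rewrite enormC; have [[_ _ q] _] := ((state_adm k).2 om, tt).
exact: (zo_grady_error l_ge0 g_smooth (theta2_pos (ltn0Sn k)).1 (XU (x_in k om)) q).
Qed.

(** The function T bounds the terms that are linear in the step. It is left open
    because the general step and the second one bound these terms differently. *)
Lemma expected_step k (T : Om -> R) : eta k.+1 <= 2 / 3 -> L1 P T ->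
  (forall om, dotv (v k.+1 om) (sx k.+1 om)
     - dotv (res (x k.+2 om) (y k.+2 om)) (sl k.+1 om)
     + 3 / 8 * (alpha^-1 * enorm (sx k.+1 om) ^+ 2)
     + 3 / 8 * (gamma^-1 * enorm (sl k.+1 om) ^+ 2) <= T om) ->
  let W := 32 * alpha * L ^+ 2 / (beta * mu) in
  (mean_dual k.+2 + (W - 4 * eta k.+1 * alpha * L ^+ 2) * moment gapy k.+2 <=
   mean_dual k.+1 + (W - 5 * eta k.+1 * alpha * L ^+ 2) * moment gapy k.+1
   + eta k.+1 * (Ex P T
     - 34 * (alpha * L ^+ 2 / (mu * beta)) * moment sy k.+1
     + 2 * alpha * moment ex k.+1 + 4 * alpha * (dx%:R * (l * theta1 k.+1 / 2) ^+ 2)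
     + 320 * (alpha * L ^+ 2 / mu ^+ 2) *
         (moment ey k.+1 + dy%:R * (l * theta2 k.+1 / 2) ^+ 2)))%R : Prop.
Proof.
move=> e23 T1 hT W; have [e0 _] := andP (eta01 (ltn0Sn k)).
set Cy := 34 * _; set Ce := 320 * _; set bx := dx%:R * _; set by_ := dy%:R * _.
set C1 := W - 4 * _ * _ * _; set C0 := W - 5 * _ * _ * _.
have Cy0 : 0 <= Ce.
  apply: mulr_ge0; first exact: ler0n.
  rewrite divr_ge0 ?sqr_ge0// mulr_ge0 ?sqr_ge0//; exact: ltW (ss_alpha sizes).
have i1 := L1_Phi k; have i1' := L1_Phi k.+1; have i2 := L1_gapy k; have i2' := L1_gapy k.+1.
have i3 := L1_sy k; have i4 := L1_ex k; have i5 := L1_ey k.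
have j1 := L1Z C0 i2; have j1' := L1Z C1 i2'.
have j3 := L1Z Cy i3; have j4 := L1Z (2 * alpha) i4; have c1 := L1_cst P (4 * alpha * bx).
have j5' := L1D i5 (L1_cst P by_); have j5 := L1Z Ce j5'.
have s1 := L1B T1 j3; have s2 := L1D s1 j4; have s3 := L1D s2 c1; have s4 := L1D s3 j5.
have s5 := L1Z (eta k.+1) s4; have s0 := L1D i1 j1; have s6 := L1D s0 s5.
have E1 := etrans (ExD i1' j1') (congr1 (+%R _) (ExZ C1 i2')).
have E2 := etrans (ExD i1 j1) (congr1 (+%R _) (ExZ C0 i2)).
have E3 := etrans (ExB T1 j3) (congr1 (fun r => _ - r) (ExZ Cy i3)).
have E4 := etrans (ExD s1 j4) (congr2 +%R E3 (ExZ (2 * alpha) i4)).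
have E5 := etrans (ExD s2 c1) (congr2 +%R E4 (Ex_cst P _)).
have E6 := etrans (ExZ Ce j5') (congr1 ( *%R _) (etrans (ExD i5 (L1_cst P by_))
  (congr1 (+%R _) (Ex_cst P _)))).
have E7 := etrans (ExZ (eta k.+1) s4) (congr1 ( *%R _) (etrans (ExD s3 j5) (congr2 +%R E5 E6))).
have E8 := etrans (ExD s0 s5) (congr2 +%R E2 E7).
rewrite -[leLHS]E1 -[leRHS]E8.
apply: (Ex_le (L1D i1' j1') s6) => om.
clear E1 E2 E3 E4 E5 E6 E7 E8 s6 s5 s4 s3 s2 s1 s0 j1 j1' j3 j4 j5 j5' c1 i1 i1' i2 i2' i3 i4 i5.
have := @one_step R dx dy p X U Y V X_prox XU U_open Y_prox YV V_open Y_neq0 Y_compact A B c g l mu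
  l_ge0 mu_gt0 g_smooth g_concave L alpha beta gamma (eta k.+1) (x k.+1 om) (y k.+1 om)
  (lam k.+1 om) (v k.+1 om) (w k.+1 om)
  (zo_gradx (theta1 k.+1) g (x k.+1 om) (y k.+1 om))
  (zo_grady (theta2 k.+1) g (x k.+1 om) (y k.+1 om)) (lamt k.+2 om)
  sizes lL e0 e23 (x_in k om) (y_in k om).
cbv zeta.
rewrite -xtE -ytE -(zo_x algo om (ltn0Sn k)) -(zo_y algo om (ltn0Sn k)).
rewrite -(zo_lam algo om (ltn0Sn k)) -/W -/C1 -/C0 -/Cy -/Ce.
rewrite -/(sx k.+1 om) -/(sy k.+1 om) -/(sl k.+1 om).
rewrite -/(gapy k.+1 om) -/(gapy k.+2 om) -/(ex k.+1 om) -/(ey k.+1 om) => h.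
apply: le_trans h _; rewrite lerD2l ler_pM2l//.
have hx := ler_wpM2l (_ : 0 <= 4 * alpha) (bias_x k om).
have {}hx := hx (mulr_ge0 (ler0n R 4) (ltW (ss_alpha sizes))).
have hy : Ce * (enorm (ey k.+1 om) ^+ 2 + enorm (grady g (x k.+1 om) (y k.+1 om)
    - zo_grady (theta2 k.+1) g (x k.+1 om) (y k.+1 om)) ^+ 2)
  <= Ce * (enorm (ey k.+1 om) ^+ 2 + by_) by rewrite ler_wpM2l// lerD2l bias_y.
by apply: lerD hy; apply: lerD hx; rewrite lerD2r lerD2r; exact: hT.
Qed.

Let ky := alpha * L ^+ 2 / (mu * beta).
Let km := alpha * L ^+ 2 / mu ^+ 2.
Let bias1 k := dx%:R * (l * theta1 k / 2) ^+ 2.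
Let bias2 k := dy%:R * (l * theta2 k / 2) ^+ 2.

(** Linear combinations of moments are built by adding one summand at a time.
    *)
Lemma Ex_addZ (f h : Om -> R) a : L1 P f -> L1 P h ->
  L1 P (fun om => f om + a * h om) /\ Ex P (fun om => f om + a * h om) = Ex P f + a * Ex P h.
Proof.
by move=> f1 h1; have h1a := L1Z a h1; split; [exact: L1D | rewrite (ExD f1 h1a) (ExZ a h1)].
Qed.

Lemma descent_x k om : dotv (v k.+1 om) (sx k.+1 om) <= - (alpha^-1 * enorm (sx k.+1 om) ^+ 2).
Proof. by rewrite /sx xtE; exact: (prox_descent X_prox (v k.+1 om) (ss_alpha sizes) (x_in k om)). Qed.

Lemma ascent_l k om : gamma^-1 * enorm (sl k.+1 om) ^+ 2 <=
  dotv (res (x k.+2 om) (y k.+2 om)) (sl k.+1 om).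
Proof.
have := prox_descent Lam_prox (- res (x k.+2 om) (y k.+2 om)) (ss_gamma sizes) (lam_in k om).
by rewrite scalerN opprK -lamtE -/(sl k.+1 om) dotvNl lerN2.
Qed.

(** For the bare descent the directions are replaced by their projected steps.
    *)
Lemma plain_step k : eta k.+1 <= 2 / 3 -> let W := 32 * alpha * L ^+ 2 / (beta * mu) in
  (mean_dual k.+2 + (W - 4 * eta k.+1 * alpha * L ^+ 2) * moment gapy k.+2 <=
   mean_dual k.+1 + (W - 5 * eta k.+1 * alpha * L ^+ 2) * moment gapy k.+1
   + eta k.+1 * (0 + - (5 / 8 * alpha^-1) * moment sx k.+1 + - (5 / 8 * gamma^-1) * moment sl k.+1
     - 34 * ky * moment sy k.+1
     + 2 * alpha * moment ex k.+1 + 4 * alpha * bias1 k.+1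
     + 320 * km * (moment ey k.+1 + bias2 k.+1)))%R : Prop.
Proof.
move=> e23 W.
have [l1 E1] := Ex_addZ (- (5 / 8 * alpha^-1)) (L1_cst P 0) (L1_sx k).
have [l2 E2] := Ex_addZ (- (5 / 8 * gamma^-1)) l1 (L1_sl k).
have := expected_step e23 l2; rewrite E2 E1 Ex_cst; apply=> om.
have := descent_x k om; have := ascent_l k om.
move: (dotv _ _) (dotv _ _) (alpha^-1) (gamma^-1) (enorm _ ^+ 2) (enorm _ ^+ 2) => d1 d2 a1 g1 q1 q2.
glra.
Qed.

(** The momentum directions of consecutive steps differ by the change of the
    true gradient, up to the errors and the biases of both steps. *)
Lemma direction_x k om : enorm (v k.+2 om - v k.+1 om) <=
  enorm (ex k.+2 om) + enorm (ex k.+1 om)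
  + (enorm (gradx g (x k.+1 om) (y k.+1 om) - zo_gradx (theta1 k.+1) g (x k.+1 om) (y k.+1 om))
     + enorm (gradx g (x k.+2 om) (y k.+2 om) - zo_gradx (theta1 k.+2) g (x k.+2 om) (y k.+2 om)))
  + eta k.+1 * (L * enorm (sx k.+1 om) + L * enorm (sy k.+1 om) + opnorm A * enorm (sl k.+1 om)).
Proof.
have [e0 _] := andP (eta01 (ltn0Sn k)).
have lipg := gradx_lip g_smooth (XU (x_in k om)) (XU (x_in k.+1 om)) (YV (y_in k om)) (YV (y_in k.+1 om)).
have lA := enorm_trmulmx A (lam k.+2 om - lam k.+1 om).
rewrite incr_x incr_y !enormZ gtr0_norm// in lipg.
rewrite {2}(zo_lam algo om (ltn0Sn k)) [lam k.+1 om + _]addrC addrK enormZ gtr0_norm// in lA.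
set a := gradx g (x k.+1 om) _ in lipg *; set a' := gradx g (x k.+2 om) _ in lipg *.
set h := zo_gradx (theta1 k.+1) _ _ _; set h' := zo_gradx (theta1 k.+2) _ _ _.
have -> : v k.+2 om - v k.+1 om = - ex k.+2 om + ex k.+1 om + ((a - h) - (a' - h'))
    + ((a' - a) - A^T *m (lam k.+2 om - lam k.+1 om)).
  rewrite /ex -/h -/h' mulmxBr; apply/colP => i; rewrite !mxE; ring.
apply: le_trans (enormD _ _) _; apply: lerD.
  apply: le_trans (enormD _ _) _; apply: lerD; last exact: enormB.
  by apply: le_trans (enormD _ _) _; rewrite enormN.
apply: le_trans (enormB _ _) _; rewrite mulrDr; apply: lerD.
  apply: le_trans lipg _; rewrite -!mulrDr mulrCA ler_wpM2l ?(ltW e0)//.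
  by rewrite ler_wpM2r// addr_ge0 ?enorm_ge0.
by apply: le_trans lA _; rewrite mulrCA.
Qed.

(** The drift, which is proportional to the move, is kept apart from the noise
    and the biases, as residual_le requires. *)
Lemma direction_y k om : exists2 u, enorm u <=
    L * enorm (sy k.+1 om) + L * enorm (sx k.+1 om) + opnorm B * enorm (sl k.+1 om) &
  enorm (w k.+2 om - (w k.+1 om + eta k.+1 *: u)) <=
  enorm (ey k.+2 om) + enorm (ey k.+1 om)
  + (enorm (grady g (x k.+1 om) (y k.+1 om) - zo_grady (theta2 k.+1) g (x k.+1 om) (y k.+1 om))
     + enorm (grady g (x k.+2 om) (y k.+2 om) - zo_grady (theta2 k.+2) g (x k.+2 om) (y k.+2 om))).
Proof.
have [e0 _] := andP (eta01 (ltn0Sn k)).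
have lipg := grady_lip g_smooth (XU (x_in k om)) (XU (x_in k.+1 om)) (YV (y_in k om)) (YV (y_in k.+1 om)).
have lB := enorm_trmulmx B (sl k.+1 om).
rewrite incr_x incr_y !enormZ gtr0_norm// in lipg.
set a := grady g (x k.+1 om) _ in lipg *; set a' := grady g (x k.+2 om) _ in lipg *.
set h := zo_grady (theta2 k.+1) _ _ _; set h' := zo_grady (theta2 k.+2) _ _ _.
exists ((eta k.+1)^-1 *: (a' - a) - B^T *m sl k.+1 om).
  apply: le_trans (enormB _ _) _; apply: lerD => //.
  rewrite enormZ gtr0_norm ?invr_gt0// mulrC ler_pdivrMr//; apply: le_trans lipg _.
  rewrite -!mulrDr mulrCA [leRHS]mulrC ler_wpM2l ?(ltW e0)//.
  by rewrite [enorm (sy _ _) + _]addrC ler_wpM2r// addr_ge0 ?enorm_ge0.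
have -> : w k.+2 om - (w k.+1 om + eta k.+1 *: ((eta k.+1)^-1 *: (a' - a) - B^T *m sl k.+1 om))
   = - ey k.+2 om + ey k.+1 om + ((a - h) - (a' - h')).
  have lE : B^T *m lam k.+2 om = B^T *m lam k.+1 om + eta k.+1 *: (B^T *m sl k.+1 om).
    by rewrite (zo_lam algo om (ltn0Sn k)) mulmxDr -scalemxAr.
  rewrite scalerBr scalerA mulfV ?gt_eqF// scale1r /ey -/h -/h' lE.
  by apply/colP => i; rewrite !mxE; ring.
apply: le_trans (enormD _ _) _; apply: lerD; last exact: enormB.
by apply: le_trans (enormD _ _) _; rewrite enormN.
Qed.

Lemma residual_incr k om :
  enorm (res (x k.+2 om) (y k.+2 om) - res (x k.+1 om) (y k.+1 om)) <=
  eta k.+1 * (opnorm A * enorm (sx k.+1 om) + opnorm B * enorm (sy k.+1 om)).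
Proof.
have [e0 _] := andP (eta01 (ltn0Sn k)).
have -> : res (x k.+2 om) (y k.+2 om) - res (x k.+1 om) (y k.+1 om) =
    eta k.+1 *: (A *m sx k.+1 om + B *m sy k.+1 om).
  rewrite scalerDr !scalemxAr -incr_x -incr_y !mulmxBr /residual.
  by apply/colP => i; rewrite !mxE; ring.
rewrite enormZ gtr0_norm// ler_pM2l//; apply: le_trans (enormD _ _) _.
by apply: lerD; exact: enorm_mulmx.
Qed.

(** The estimates of the three blocks, added. *)
Lemma second_pointwise k om : opnorm A <= L -> eta k.+2 <= eta k.+1 ->
  let z := 1 - eta k.+1 in
  (dotv (v k.+2 om) (sx k.+2 om)
     - dotv (res (x k.+3 om) (y k.+3 om)) (sl k.+2 om)
     + 3 / 8 * (alpha^-1 * enorm (sx k.+2 om) ^+ 2)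
     + 3 / 8 * (gamma^-1 * enorm (sl k.+2 om) ^+ 2) <=
   5 * z * (alpha * (bias1 k.+1 + bias1 k.+2)) + 44 * (km * (bias2 k.+1 + bias2 k.+2))
   + - (122 / 1000 * alpha^-1) * enorm (sx k.+2 om) ^+ 2
   + 226 / 10 * ky * enorm (sy k.+2 om) ^+ 2
   + - (keep_x z * alpha^-1) * enorm (sx k.+1 om) ^+ 2
   + - (keep_y z * ky) * enorm (sy k.+1 om) ^+ 2
   + - (keep_l z * gamma^-1) * enorm (sl k.+1 om) ^+ 2
   + 19 / 10 * alpha * enorm (ex k.+2 om) ^+ 2
   + 25 * alpha * enorm (ex k.+1 om) ^+ 2
   + 44 * km * enorm (ey k.+2 om) ^+ 2
   + 44 * km * enorm (ey k.+1 om) ^+ 2)%R : Prop.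
Proof.
move=> AL ee z; have [e0 e1] := andP (eta01 (ltn0Sn k)).
have [e20 _] := andP (eta01 (ltn0Sn k.+1)).
have zE : 1 - z = eta k.+1 by rewrite /z opprB addrC subrK.
have z01 : 0 <= z <= 1 by rewrite /z subr_ge0 e1 lerBlDr lerDl ltW.
have al0 := ss_alpha sizes; have ga0 := ss_gamma sizes.
have be0 := ss_beta sizes.
have shift (n : nat) (u t r : 'cV[R]_n) : r = u + eta k.+1 *: (t - u) -> t - r = z *: (t - u).
  by move=> ->; rewrite /z scalerBl scale1r opprD addrA.
have hx := prox_le X_prox (x k.+2 om) (v k.+2 om) al0 (_ : X (xt k.+2 om)).
have {}hx := hx (ltac:(by rewrite xtE; exact: proj_in)).
rewrite -xtE (shift _ _ _ _ (zo_x algo om (ltn0Sn k))) -/(sx k.+1 om) -/(sx k.+2 om) in hx.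
rewrite sqr_enormZ dotvZr in hx.
have hr : dotv (v k.+2 om) (sx k.+1 om) <= - (enorm (sx k.+1 om) ^+ 2 / alpha)
    + enorm (sx k.+1 om) * enorm (v k.+2 om - v k.+1 om).
  rewrite -[v k.+2 om](subrK (v k.+1 om)) dotvDl addrC [_ / alpha]mulrC; apply: lerD.
    exact: descent_x.
  by rewrite addrK [leRHS]mulrC; exact: dotv_le.
have hd := direction_x k om; rewrite -zE in hd.
have X1 := second_x sizes z01 (opnorm_ge0 A) AL (enorm_ge0 _) (enorm_ge0 _) (enorm_ge0 _) hx hr hd.
have hl := prox_le Lam_prox (lam k.+2 om) (- res (x k.+3 om) (y k.+3 om)) ga0 (_ : Lam (lamt k.+2 om)).
have {}hl := hl (ltac:(by rewrite lamtE; exact: proj_in)).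
rewrite scalerN opprK -lamtE (shift _ _ _ _ (zo_lam algo om (ltn0Sn k))) in hl.
rewrite -/(sl k.+1 om) -/(sl k.+2 om) sqr_enormZ dotvZr !dotvNl mulrN in hl.
have hs : enorm (sl k.+1 om) ^+ 2 / gamma - enorm (sl k.+1 om) *
      enorm (res (x k.+3 om) (y k.+3 om) - res (x k.+2 om) (y k.+2 om))
    <= dotv (res (x k.+3 om) (y k.+3 om)) (sl k.+1 om).
  set r3 := res (x k.+3 om) _; set r2 := res (x k.+2 om) _.
  have -> : dotv r3 (sl k.+1 om) = dotv r2 (sl k.+1 om) + dotv (r3 - r2) (sl k.+1 om).
    by rewrite -dotvDl addrC subrK.
  rewrite [_ / gamma]mulrC; apply: lerD; first exact: ascent_l.
  by rewrite [X in - X]mulrC; exact: dotv_ge.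
have he : 0 <= eta k.+2 <= 1 - z by rewrite zE ee ltW.
have X2 := second_l sizes z01 (opnorm_ge0 A) AL he (enorm_ge0 _) (enorm_ge0 _) (enorm_ge0 _)
  hl hs (residual_incr k.+1 om).
have [u hu hw] := direction_y k om.
have rE : sy k.+1 om = proj Y (y k.+1 om + beta *: w k.+1 om) - y k.+1 om by rewrite -ytE.
have z02 : 0 <= z < 1 by rewrite (andP z01).1 /z ltrBlDr ltrDl.
have hq := residual_le Y_prox u be0 z02 rE; rewrite zE in hq.
have y2E : y k.+2 om = y k.+1 om + eta k.+1 *: sy k.+1 om by rewrite (zo_y algo om (ltn0Sn k)).
rewrite -y2E in hq.
set w' := w k.+1 om + _ in hw hq; set s' := enorm (proj _ _ - _) in hq.
have hs' : s' <= enorm (sy k.+2 om) + beta * enorm (w k.+2 om - w').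
  have -> : s' = enorm (sy k.+2 om - (proj Y (y k.+2 om + beta *: w k.+2 om)
      - proj Y (y k.+2 om + beta *: w'))).
    have alg (q1 q2 q3 : 'cV[R]_dy) : q1 - q3 - (q1 - q2) = q2 - q3.
      by apply/colP => i; rewrite !mxE; ring.
    by rewrite /sy ytE alg.
  apply: le_trans (enormB _ _) _; rewrite lerD2l.
  apply: le_trans (proj_nonexpansive Y_prox _ _) _.
  have -> : y k.+2 om + beta *: w k.+2 om - (y k.+2 om + beta *: w') = beta *: (w k.+2 om - w').
    by apply/colP => i; rewrite !mxE; ring.
  by rewrite enormZ gtr0_norm.
have X3 := second_y sizes z01 (enorm_ge0 _) (enorm_ge0 _) (enorm_ge0 _) (enorm_ge0 _)
  (enorm_ge0 _) (enorm_ge0 _) (enorm_ge0 _) hs' hw hu hq.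
have al5 : 0 <= 5 * z * alpha by rewrite !mulr_ge0 ?(andP z01).1// ltW.
have km44 : 0 <= 44 * km.
  by rewrite mulr_ge0 ?ler0n// divr_ge0 ?sqr_ge0// mulr_ge0 ?sqr_ge0// ltW.
have bx := ler_wpM2l al5 (lerD (bias_x k om) (bias_x k.+1 om)).
have by_ := ler_wpM2l km44 (lerD (bias_y k om) (bias_y k.+1 om)).
rewrite -/(bias1 k.+1) -/(bias1 k.+2) in bx.
rewrite -/(bias2 k.+1) -/(bias2 k.+2) in by_.
rewrite -/ky in X1 X2 X3; rewrite -/km in X3.
have n1 : 0 <= alpha^-1 * enorm (sx k.+1 om) ^+ 2 by rewrite mulr_ge0 ?sqr_ge0// invr_ge0 ltW.
have n2 : 0 <= gamma^-1 * enorm (sl k.+1 om) ^+ 2 by rewrite mulr_ge0 ?sqr_ge0// invr_ge0 ltW.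
have n3 : 0 <= gamma^-1 * enorm (sl k.+2 om) ^+ 2 by rewrite mulr_ge0 ?sqr_ge0// invr_ge0 ltW.
have n4 : 0 <= ky * enorm (sy k.+2 om) ^+ 2.
  by rewrite mulr_ge0 ?sqr_ge0// divr_ge0 ?(mulr_ge0 (ltW mu_gt0) (ltW be0))// mulr_ge0 ?sqr_ge0 ?ltW.
move: X1 X2 X3 bx by_ n1 n2 n3 n4; rewrite /keep_x /keep_y /keep_l.
clear hx hr hd hl hs hq hs' hw hu rE.
move: (dotv _ _) (dotv _ _) => d1 d2.
move: (enorm (gradx g _ _ - _)) (enorm (gradx g _ _ - _)) (enorm (grady g _ _ - _)) (enorm (grady g _ _ - _)).
move: (enorm (sx k.+1 om)) (enorm (sx k.+2 om)) (enorm (sy k.+1 om)) (enorm (sy k.+2 om)).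
move: (enorm (sl k.+1 om)) (enorm (sl k.+2 om)) (enorm (ex k.+1 om)) (enorm (ex k.+2 om)).
move: (enorm (ey k.+1 om)) (enorm (ey k.+2 om)) => q1 q2 q3 q4 q5 q6 q7 q8 q9 q10 q11 q12 q13 q14.
move: (bias1 _) (bias1 _) (bias2 _) (bias2 _) => b1 b2 b3 b4.
move: alpha^-1 gamma^-1 ky km => ia ig ky' km'.
glra.
Qed.

Lemma second_step k : opnorm A <= L -> eta k.+2 <= eta k.+1 -> eta k.+2 <= 2 / 3 ->
  let z := 1 - eta k.+1 in let W := 32 * alpha * L ^+ 2 / (beta * mu) in
  (mean_dual k.+3 + (W - 4 * eta k.+2 * alpha * L ^+ 2) * moment gapy k.+3 <=
   mean_dual k.+2 + (W - 5 * eta k.+2 * alpha * L ^+ 2) * moment gapy k.+2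
   + eta k.+2 * (5 * z * (alpha * (bias1 k.+1 + bias1 k.+2)) + 44 * (km * (bias2 k.+1 + bias2 k.+2))
     + - (122 / 1000 * alpha^-1) * moment sx k.+2 + 226 / 10 * ky * moment sy k.+2
     + - (keep_x z * alpha^-1) * moment sx k.+1 + - (keep_y z * ky) * moment sy k.+1
     + - (keep_l z * gamma^-1) * moment sl k.+1
     + 19 / 10 * alpha * moment ex k.+2 + 25 * alpha * moment ex k.+1
     + 44 * km * moment ey k.+2 + 44 * km * moment ey k.+1
     - 34 * ky * moment sy k.+2
     + 2 * alpha * moment ex k.+2 + 4 * alpha * bias1 k.+2
     + 320 * km * (moment ey k.+2 + bias2 k.+2)))%R : Prop.
Proof.
move=> AL ee e23 z W.
set C0 := 5 * z * _ + _.
have [l1 E1] := Ex_addZ (- (122 / 1000 * alpha^-1)) (L1_cst P C0) (L1_sx k.+1).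
have [l2 E2] := Ex_addZ (226 / 10 * ky) l1 (L1_sy k.+1).
have [l3 E3] := Ex_addZ (- (keep_x z * alpha^-1)) l2 (L1_sx k).
have [l4 E4] := Ex_addZ (- (keep_y z * ky)) l3 (L1_sy k).
have [l5 E5] := Ex_addZ (- (keep_l z * gamma^-1)) l4 (L1_sl k).
have [l6 E6] := Ex_addZ (19 / 10 * alpha) l5 (L1_ex k.+1).
have [l7 E7] := Ex_addZ (25 * alpha) l6 (L1_ex k).
have [l8 E8] := Ex_addZ (44 * km) l7 (L1_ey k.+1).
have [l9 E9] := Ex_addZ (44 * km) l8 (L1_ey k).
have := expected_step e23 l9; rewrite E9 E8 E7 E6 E5 E4 E3 E2 E1 Ex_cst; apply=> om.
exact: second_pointwise AL ee.
Qed.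

Definition gap_at k om := gap X Y Lam Lg alpha beta gamma (x k om) (y k om) (lam k om).

Lemma lagrangian_gradx x' y' lam' : U x' -> V y' ->
  gradient (fun z => Lg z y' lam') x' = gradx g x' y' - A^T *m lam'.
Proof.
move=> Ux Vy; rewrite [LHS](_ : _ = gradient (fun z => g z y' - dotv lam' (A *m z + B *m y' - c)) x')//.
have dl d : is_derive x' d (fun z => dotv lam' (A *m z + B *m y' - c)) (dotv (A^T *m lam') d).
  apply: (@is_derive_quadratic _ _ _ _ _ _ 0 1) => // t _.
  rewrite mul0r normr_le0 !(dotvBr, dotvDr) mulmxDr dotvDr -scalemxAr dotvZr.
  by rewrite [dotv (A^T *m _) _]dotv_mulmx trmxK; apply/eqP; ring.
apply/colP => i; rewrite !mxE.
have := is_deriveB (smooth_gradx g_smooth Ux Vy (basis_vec R i)) (dl (basis_vec R i)).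
by move=> h; rewrite (@derive_val _ _ _ _ _ _ _ h) !dotv_basis !mxE.
Qed.

Lemma lagrangian_grady x' y' lam' : U x' -> V y' ->
  gradient (fun z => Lg x' z lam') y' = grady g x' y' - B^T *m lam'.
Proof.
move=> Ux Vy; rewrite [LHS](_ : _ = gradient (fun z => g x' z - dotv lam' (A *m x' + B *m z - c)) y')//.
have dl d : is_derive y' d (fun z => dotv lam' (A *m x' + B *m z - c)) (dotv (B^T *m lam') d).
  apply: (@is_derive_quadratic _ _ _ _ _ _ 0 1) => // t _.
  rewrite mul0r normr_le0 !(dotvBr, dotvDr) mulmxDr dotvDr -scalemxAr dotvZr.
  by rewrite [dotv (B^T *m _) _]dotv_mulmx trmxK; apply/eqP; ring.
apply/colP => i; rewrite !mxE.
have := is_deriveB (smooth_grady g_smooth Ux Vy (basis_vec R i)) (dl (basis_vec R i)).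
by move=> h; rewrite (@derive_val _ _ _ _ _ _ _ h) !dotv_basis !mxE.
Qed.

Lemma lagrangian_gradl x' y' lam' : gradient (fun z => Lg x' y' z) lam' = - res x' y'.
Proof.
have dl d : is_derive lam' d (fun z => Lg x' y' z) (dotv (- res x' y') d).
  apply: (@is_derive_quadratic _ _ _ _ _ _ 0 1) => // t _.
  rewrite mul0r normr_le0 /lagrangian -/(res x' y') dotvDl dotvZl dotvNl (dotvC d).
  by apply/eqP; ring.
apply/colP => i; rewrite !mxE (@derive_val _ _ _ _ _ _ _ (dl (basis_vec R i))).
by rewrite dotv_basis !mxE.
Qed.

Let gx k om := gradx g (x k om) (y k om) - A^T *m lam k om.
Let gy k om := grady g (x k om) (y k om) - B^T *m lam k om.

(** The partial gradients of the Lagrangian, written out. *)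
Lemma gapE k om : gap_at k.+1 om = col_mx (col_mx
  (alpha^-1 *: (x k.+1 om - proj X (x k.+1 om - alpha *: gx k.+1 om)))
  (beta^-1 *: (y k.+1 om - proj Y (y k.+1 om + beta *: gy k.+1 om))))
  (gamma^-1 *: (lam k.+1 om - proj Lam (lam k.+1 om + gamma *: res (x k.+1 om) (y k.+1 om)))).
Proof.
rewrite /gap_at /gap (lagrangian_gradx _ (XU (x_in k om)) (YV (y_in k om))).
rewrite (lagrangian_grady _ (XU (x_in k om)) (YV (y_in k om))) lagrangian_gradl.
by rewrite scalerN opprK.
Qed.

(** Each block of the gap differs from the step of the algorithm by the
    momentum error, the bias, and, for the multiplier, the move of the primal
    variables. *)
Lemma gap_le k om : enorm (gap_at k.+1 om) ^+ 2 <=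
  3 * (bias1 k.+1 + bias2 k.+1)
  + (3 / alpha ^+ 2 + 3 * opnorm A ^+ 2) * enorm (sx k.+1 om) ^+ 2
  + (3 / beta ^+ 2 + 3 * opnorm B ^+ 2) * enorm (sy k.+1 om) ^+ 2
  + 3 / gamma ^+ 2 * enorm (sl k.+1 om) ^+ 2
  + 3 * enorm (ex k.+1 om) ^+ 2 + 3 * enorm (ey k.+1 om) ^+ 2.
Proof.
have al0 := ss_alpha sizes; have ga0 := ss_gamma sizes; have be0 := ss_beta sizes.
have [e0 e1] := andP (eta01 (ltn0Sn k)).
rewrite gapE !sqr_enorm_col_mx.
set g1 := _ *: (x k.+1 om - _); set g2 := _ *: (y k.+1 om - _); set g3 := _ *: _.
have block (n : nat) (S : set 'cV[R]_n) (a : R) u d d' : proximinal S -> 0 < a ->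
    enorm (a^-1 *: (u - proj S (u + a *: d))) <=
    a^-1 * enorm (proj S (u + a *: d') - u) + enorm (d - d').
  move=> pS a0; rewrite enormZ gtr0_norm ?invr_gt0// -(ler_pM2l a0) mulrDr !mulrA mulfV ?gt_eqF//.
  rewrite !mul1r enormC -[proj S (u + a *: d) - u](subrK (proj S (u + a *: d') - u)) addrC.
  apply: le_trans (enormD _ _) _; rewrite lerD2l.
  rewrite opprB addrA subrK; apply: le_trans (proj_nonexpansive pS _ _) _.
  by rewrite opprD addrACA subrr add0r -scalerBr enormZ gtr0_norm.
have b1 := block _ _ _ (x k.+1 om) (- gx k.+1 om) (- v k.+1 om) X_prox al0.
have b2 := block _ _ _ (y k.+1 om) (gy k.+1 om) (w k.+1 om) Y_prox be0.
have b3 := block _ _ _ (lam k.+1 om) (res (x k.+1 om) (y k.+1 om))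
  (res (x k.+2 om) (y k.+2 om)) Lam_prox ga0.
rewrite !scalerN -xtE -/(sx k.+1 om) -/g1 in b1; rewrite -ytE -/(sy k.+1 om) -/g2 in b2.
rewrite -lamtE -/(sl k.+1 om) -/g3 in b3.
have h1 : enorm g1 ^+ 2 <= 3 * ((alpha^-1 * enorm (sx k.+1 om)) ^+ 2 + enorm (ex k.+1 om) ^+ 2
   + enorm (gradx g (x k.+1 om) (y k.+1 om) - zo_gradx (theta1 k.+1) g (x k.+1 om) (y k.+1 om)) ^+ 2).
  apply: sqr_le_sum3; first exact: enorm_ge0.
  apply: le_trans b1 _; rewrite -[leRHS]addrA lerD2l -opprD enormN.
  rewrite addrC [leRHS]addrC; apply: le_trans (enormD _ _); rewrite le_eqVlt; apply/orP; left; apply/eqP.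
  by congr enorm; rewrite /gx /ex; apply/colP => i; rewrite !mxE; ring.
have h2 : enorm g2 ^+ 2 <= 3 * ((beta^-1 * enorm (sy k.+1 om)) ^+ 2 + enorm (ey k.+1 om) ^+ 2
   + enorm (grady g (x k.+1 om) (y k.+1 om) - zo_grady (theta2 k.+1) g (x k.+1 om) (y k.+1 om)) ^+ 2).
  apply: sqr_le_sum3; first exact: enorm_ge0.
  apply: le_trans b2 _; rewrite -[leRHS]addrA lerD2l [leRHS]addrC.
  apply: le_trans (enormD _ _); rewrite le_eqVlt; apply/orP; left; apply/eqP.
  by congr enorm; rewrite /gy /ey; apply/colP => i; rewrite !mxE; ring.
have h3 : enorm g3 ^+ 2 <= 3 * ((gamma^-1 * enorm (sl k.+1 om)) ^+ 2
   + (opnorm A * enorm (sx k.+1 om)) ^+ 2 + (opnorm B * enorm (sy k.+1 om)) ^+ 2).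
  apply: sqr_le_sum3; first exact: enorm_ge0.
  apply: le_trans b3 _; rewrite -[leRHS]addrA lerD2l enormC; apply: le_trans (residual_incr k om) _.
  by rewrite ler_piMl// addr_ge0// mulr_ge0 ?opnorm_ge0 ?enorm_ge0.
have c1 := bias_x k om; have c2 := bias_y k om.
rewrite -/(bias1 k.+1) in c1; rewrite -/(bias2 k.+1) in c2.
have q (a : R) : (3 / a ^+ 2 = 3 * (a^-1) ^+ 2) by rewrite exprVn.
rewrite !q; move: h1 h2 h3 c1 c2; clear b1 b2 b3 g_concave.
move: alpha^-1 beta^-1 gamma^-1 (bias1 _) (bias2 _) => ia ib ig c1 c2.
move: (enorm g1) (enorm g2) (enorm g3) (enorm (sx _ _)) (enorm (sy _ _)) (enorm (sl _ _)).
move: (enorm (ex _ _)) (enorm (ey _ _)) (enorm (gradx _ _ _ - _)) (enorm (grady _ _ _ - _)).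
move=> q1 q2 q3 q4 q5 q6 q7 q8 q9 q10; glra.
Qed.

(** Gradients are Lipschitz in the iterate and projections non-expansive. *)
Lemma measurable_gap k : measurable_vec (gap_at k.+1).
Proof.
have [mx my ml _ _] := state_measurable k.
have mxy := measurable_col_mx mx my.
have lip_le om om' : l * (enorm (x k.+1 om' - x k.+1 om) + enorm (y k.+1 om' - y k.+1 om)) <=
    l * 2 * enorm (col_mx (x k.+1 om') (y k.+1 om') - col_mx (x k.+1 om) (y k.+1 om)).
  rewrite -mulrA ler_wpM2l// opp_col_mx add_col_mx mulrDl mul1r.
  by apply: lerD; [exact: enorm_col_mxl | exact: enorm_col_mxr].
have mgx : measurable_vec (fun om => gradx g (x k.+1 om) (y k.+1 om)).
  move=> i; apply: (lipschitz_measurable mxy (C := l * 2)) => om om'.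
  apply: le_trans (lip_le om om'); have := enorm_coord (gradx g (x k.+1 om') (y k.+1 om')
    - gradx g (x k.+1 om) (y k.+1 om)) i.
  rewrite !mxE => /le_trans; apply.
  exact: (gradx_lip g_smooth (XU (x_in k om)) (XU (x_in k om')) (YV (y_in k om)) (YV (y_in k om'))).
have mgy : measurable_vec (fun om => grady g (x k.+1 om) (y k.+1 om)).
  move=> i; apply: (lipschitz_measurable mxy (C := l * 2)) => om om'.
  apply: le_trans (lip_le om om'); have := enorm_coord (grady g (x k.+1 om') (y k.+1 om')
    - grady g (x k.+1 om) (y k.+1 om)) i.
  rewrite !mxE => /le_trans; apply.
  exact: (grady_lip g_smooth (XU (x_in k om)) (XU (x_in k om')) (YV (y_in k om)) (YV (y_in k om'))).
have -> : gap_at k.+1 = (fun om => col_mx (col_mx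
  (alpha^-1 *: (x k.+1 om - proj X (x k.+1 om - alpha *: gx k.+1 om)))
  (beta^-1 *: (y k.+1 om - proj Y (y k.+1 om + beta *: gy k.+1 om))))
  (gamma^-1 *: (lam k.+1 om - proj Lam (lam k.+1 om + gamma *: res (x k.+1 om) (y k.+1 om))))).
  by apply/funext => om; exact: gapE.
apply: measurable_col_mx; first apply: measurable_col_mx.
- apply: measurable_vecZ; apply: measurable_vecB => //; apply: measurable_proj => //.
  apply: measurable_vecB => //; apply: measurable_vecZ; apply: measurable_vecB => //.
  exact: measurable_vec_mulmx.
- apply: measurable_vecZ; apply: measurable_vecB => //; apply: measurable_proj => //.
  apply: measurable_vecD => //; apply: measurable_vecZ; apply: measurable_vecB => //.
  exact: measurable_vec_mulmx.
- apply: measurable_vecZ; apply: measurable_vecB => //; apply: measurable_proj => //.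
  apply: measurable_vecD => //; apply: measurable_vecZ.
  apply: measurable_vecB; last exact: measurable_vec_cst.
  by apply: measurable_vecD; exact: measurable_vec_mulmx.
Qed.

Lemma moment_gap k : L1 P (fun om => enorm (gap_at k.+1 om) ^+ 2) /\
  moment gap_at k.+1 <= 3 * (bias1 k.+1 + bias2 k.+1)
  + (3 / alpha ^+ 2 + 3 * opnorm A ^+ 2) * moment sx k.+1
  + (3 / beta ^+ 2 + 3 * opnorm B ^+ 2) * moment sy k.+1
  + 3 / gamma ^+ 2 * moment sl k.+1 + 3 * moment ex k.+1 + 3 * moment ey k.+1.
Proof.
set C0 := 3 * (_ + _).
have [l1 E1] := Ex_addZ (3 / alpha ^+ 2 + 3 * opnorm A ^+ 2) (L1_cst P C0) (L1_sx k).
have [l2 E2] := Ex_addZ (3 / beta ^+ 2 + 3 * opnorm B ^+ 2) l1 (L1_sy k).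
have [l3 E3] := Ex_addZ (3 / gamma ^+ 2) l2 (L1_sl k).
have [l4 E4] := Ex_addZ 3 l3 (L1_ex k).
have [l5 E5] := Ex_addZ 3 l4 (L1_ey k).
have gL : L1 P (fun om => enorm (gap_at k.+1 om) ^+ 2).
  apply: (L1_le _ _ l5) => [|om]; first by apply: measurable_sqr_enorm; exact: measurable_gap.
  by rewrite ger0_norm ?sqr_ge0//; exact: gap_le.
split=> //; move: E5; rewrite E4 E3 E2 E1 Ex_cst => <-.
by apply: Ex_le => // om; exact: gap_le.
Qed.

Section Constraints.
Variable kind : constr_kind.
Hypothesis LamE : Lam = multipliers kind.

(** Where a constraint is violated, the projection onto the multipliers leaves
    the corresponding component of the ascent step unchanged. *)
Lemma violation_le_gap k om i :
  Num.max 0 ((A *m x k.+1 om + B *m y k.+1 om - c) i 0) <= enorm (gap_at k.+1 om).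
Proof.
have ga0 := ss_gamma sizes.
set r := A *m x k.+1 om + _ - c.
rewrite ge_max enorm_ge0/=; have [r0|r0] := ltP (r i 0) 0.
  exact: le_trans (ltW r0) (enorm_ge0 _).
rewrite gapE; apply: le_trans (enorm_col_mxr _ _).
apply: le_trans (enorm_coord _ i); rewrite -[res _ _]/r LamE.
have E (q q' : 'cV[R]_p) : (gamma^-1 *: (q - q')) i 0 = gamma^-1 * (q i 0 - q' i 0).
  by rewrite !mxE.
rewrite E proj_multipliersE.
have E' : (lam k.+1 om + gamma *: r) i 0 = lam k.+1 om i 0 + gamma * r i 0 by rewrite !mxE.
have -> : (if kind is Le_constr then Num.max 0 ((lam k.+1 om + gamma *: r) i 0)
   else (lam k.+1 om + gamma *: r) i 0) = lam k.+1 om i 0 + gamma * r i 0.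
  case: kind LamE => [LE|_]; last by rewrite E'.
  have l0 : 0 <= lam k.+1 om i 0 by have := lam_in k om; rewrite LE; apply.
  by rewrite E' max_r// addr_ge0// mulr_ge0// ltW.
have -> : gamma^-1 * (lam k.+1 om i 0 - (lam k.+1 om i 0 + gamma * r i 0)) = - r i 0.
  by field; rewrite gt_eqF.
by rewrite normrN ler_norm.
Qed.

(** A feasible y makes the penalty term nonpositive, so the dual value is at
    least the minimum of the objective. *)
Lemma dual_lower : (forall x0, X x0 -> exists2 y0, Y y0 & constr kind (A *m x0 + B *m y0) c) ->
  exists M, forall k, M <= mean_dual k.+1.
Proof.
move=> feas; have [M hM] := g_bounded; exists (- M) => k.
rewrite -(Ex_cst P (- M)); apply: Ex_le (L1_cst P _) (L1_Phi k) _ => om.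
have [y0 Yy0 h0] := feas _ (x_in k om).
apply: le_trans (dual_val_ge XU U_open YV V_open Y_neq0 Y_compact A B c l_ge0 g_smooth
  (lam k.+1 om) (x_in k om) Yy0).
have gM := hM _ _ (x_in k om) Yy0; rewrite ler_norml in gM; have [gM' _] := andP gM.
suff h : dotv (lam k.+1 om) (A *m x k.+1 om + B *m y0 - c) <= 0.
  by apply: le_trans gM' _; rewrite /lagrangian lerBrDr gerDl.
have Ll := lam_in k om; rewrite LamE in Ll.
case: kind Ll h0 => /= [Ll h0|_ ->]; last by rewrite subrr dotv0.
apply: sumr_le0 => j _; apply: mulr_ge0_le0; first exact: (Ll j).
by rewrite mxE [(- c) _ _]mxE subr_le0; exact: h0.
Qed.

End Constraints.

Lemma potentialE k W0 d a1 a2 : ('E_P[fun om => (Phi (x k.+1 om) (lam k.+1 om)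
    + W0 * enorm (gapy k.+1 om) ^+ 2 + a1 * enorm (ex k.+1 om) ^+ 2
    + a2 * enorm (ey k.+1 om) ^+ 2)%R]
  - d%:E * 'E_P[fun om => (enorm (gapy k.+1 om) ^+ 2)%R]
  = (mean_dual k.+1 + (W0 - d) * moment gapy k.+1 + a1 * moment ex k.+1
     + a2 * moment ey k.+1)%R%:E)%E.
Proof.
have [l1 E1] := Ex_addZ W0 (L1_Phi k) (L1_gapy k).
have [l2 E2] := Ex_addZ a1 l1 (L1_ex k).
have [l3 E3] := Ex_addZ a2 l2 (L1_ey k).
rewrite (expectation_Ex l3) (expectation_Ex (L1_gapy k)) E3 E2 E1 -EFinM -EFinB.
congr (_%:E); rewrite /mean_dual /moment; ring.
Qed.

(** The smoothing constants are chosen for this: Q is exactly the total weight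
    with which the bias occurs. *)
Lemma bias_budget (d : nat) (t Q D1 eps cc : R) : (0 < d)%N -> 0 < Q -> 0 <= D1 -> 0 < cc ->
  t = eps / (L * cc) * Num.sqrt (D1 / (d%:R * Q)) ->
  4 * cc ^+ 2 * Q * (d%:R * (l * t / 2) ^+ 2) <= eps ^+ 2 * D1.
Proof.
move=> d0 Q0 D0 c0 ->; have L0 : 0 < L := lt_le_trans (ss_mu sizes) (ss_muL sizes).
have dR : 0 < d%:R :> R by rewrite ltr0n.
set s := Num.sqrt _; have s2 : s ^+ 2 = D1 / (d%:R * Q).
  by rewrite sqr_sqrtr// divr_ge0// mulr_ge0 ?ltW.
have -> : 4 * cc ^+ 2 * Q * (d%:R * (l * (eps / (L * cc) * s) / 2) ^+ 2) =
   (l / L) ^+ 2 * (eps ^+ 2 * (d%:R * Q * s ^+ 2)).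
  by field; rewrite !gt_eqF.
rewrite s2 mulrCA [_ * (D1 / _)]mulrC divfK ?gt_eqF ?mulr_gt0//.
rewrite ler_wpM2l ?sqr_ge0// ler_piMl// expr_le1// ?divr_ge0 ?(ltW L0)//.
by rewrite ler_pdivrMr// mul1r.
Qed.

Lemma run_holds A1 A2 A3 A4 A5 D1 eps : (0 < dx)%N -> (0 < dy)%N ->
  opnorm A <= L -> weights L mu alpha beta A1 A2 A3 A4 A5 D1 b%:R -> 0 < eps -> 0 < delta ->
  (forall k, eta k.+1 = A3 / crt k.+3%:R) ->
  (forall k, varrho k.+1 = A4 / crt k.+3%:R ^+ 2) ->
  (forall k, iota k.+1 = A5 / crt k.+3%:R ^+ 2) ->
  (forall k, 0 < varrho k.+1 <= 1) -> (forall k, 0 < iota k.+1 <= 1) ->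
  (forall k, theta1 k.+1 = eps / (L * crt k.+3%:R) *
     Num.sqrt (D1 / (dx%:R * (3 * D1 + 4 * alpha + 12 * A1 / (b%:R * A3 ^+ 2))))) ->
  (forall k, theta2 k.+1 = eps / (L * crt k.+3%:R) *
     Num.sqrt (D1 / (dy%:R * (3 * D1 + 12 * A2 / (b%:R * A3 ^+ 2) + 320 * km)))) ->
  [/\ D1 * (3 / alpha ^+ 2 + 3 * opnorm A ^+ 2) <= 1 / 4 * alpha^-1,
    D1 * (3 / beta ^+ 2 + 3 * opnorm B ^+ 2) <= 2 * ky, D1 * (3 / gamma ^+ 2) <= 1 / 4 * gamma^-1,
    D1 * 3 <= A1 * A4 / (3 * A3 ^+ 2) & D1 * 3 <= A2 * A5 / (3 * A3 ^+ 2)] ->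
  expected_run L l mu alpha beta gamma (opnorm A) (opnorm B) A1 A2 A3 A4 A5 D1 delta eps b%:R
    eta varrho iota bias1 bias2 mean_dual (moment gapy) (moment sx) (moment sy) (moment sl)
    (moment ex) (moment ey) (moment gap_at).
Proof.
move=> dx0 dy0 AL wt eps0 delta0 etaE varrhoE iotaE varrho01 iota01 theta1E theta2E hD1.
have [A10 A20 A30 b0] : [/\ 0 < A1, 0 < A2, 0 < A3 & 0 < b%:R :> R] by case: wt.
have D10 := wt_D1 wt; have al0 := ss_alpha sizes.
have w0 (a : R) : 0 < a -> 0 <= 12 * a / (b%:R * A3 ^+ 2).
  move=> a0; apply: divr_ge0; first exact: mulr_ge0 (ler0n R 12) (ltW a0).
  exact: mulr_ge0 (ltW b0) (sqr_ge0 _).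
have incE k m theta : increment k m theta = 6 * l ^+ 2 * eta k ^+ 2 * (moment sx k + moment sy k)
    + 6 * (m%:R * (l * theta k / 2) ^+ 2).
  by rewrite /increment; congr (_ + _); field.
split=> //.
- by rewrite l_ge0 lL.
- by rewrite opnorm_ge0 AL.
- move=> k; split; try exact: moment_ge0.
  split; try exact: moment_ge0; exact: mulr_ge0 (ler0n _ _) (sqr_ge0 _).
- move=> k; apply: (bias_budget dx0 _ (ltW D10) _ (theta1E k)); last by rewrite crt_gt0.
  rewrite ltr_wpDr ?w0// addr_gt0// mulr_gt0//.
- move=> k; apply: (bias_budget dy0 _ (ltW D10) _ (theta2E k)); last by rewrite crt_gt0.
  apply: ltr_wpDr; last by rewrite ltr_wpDr ?w0// mulr_gt0.
  apply: mulr_ge0; first exact: ler0n.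
  by apply: divr_ge0; rewrite ?sqr_ge0// mulr_ge0 ?sqr_ge0// ltW.
- by move=> k; exact: plain_step.
- by move=> e23 ee; exact: second_step.
- by move=> k q /(ex_step (L1_ex k)) [_]; rewrite incE.
- by move=> k q /(ey_step (L1_ey k)) [_]; rewrite incE.
- by split; [exact: ex_first.2 | exact: ey_first.2].
- by move=> k; exact: (moment_gap k).2.
Qed.

(** The interface between the random trajectory and the deterministic rate: only
    sequences of real numbers are left on the right-hand side. *)
Lemma trajectory_summary kind A1 A2 A3 A4 A5 D1 eps : Lam = multipliers kind ->
  (0 < dx)%N -> (0 < dy)%N ->
  opnorm A <= L -> weights L mu alpha beta A1 A2 A3 A4 A5 D1 b%:R -> 0 < eps -> 0 < delta ->
  (forall k, eta k.+1 = A3 / crt k.+3%:R) ->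
  (forall k, varrho k.+1 = A4 / crt k.+3%:R ^+ 2) ->
  (forall k, iota k.+1 = A5 / crt k.+3%:R ^+ 2) ->
  (forall k, 0 < varrho k.+1 <= 1) -> (forall k, 0 < iota k.+1 <= 1) ->
  (forall k, theta1 k.+1 = eps / (L * crt k.+3%:R) *
     Num.sqrt (D1 / (dx%:R * (3 * D1 + 4 * alpha + 12 * A1 / (b%:R * A3 ^+ 2))))) ->
  (forall k, theta2 k.+1 = eps / (L * crt k.+3%:R) *
     Num.sqrt (D1 / (dy%:R * (3 * D1 + 12 * A2 / (b%:R * A3 ^+ 2) + 320 * km)))) ->
  [/\ D1 * (3 / alpha ^+ 2 + 3 * opnorm A ^+ 2) <= 1 / 4 * alpha^-1,
    D1 * (3 / beta ^+ 2 + 3 * opnorm B ^+ 2) <= 2 * ky, D1 * (3 / gamma ^+ 2) <= 1 / 4 * gamma^-1,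
    D1 * 3 <= A1 * A4 / (3 * A3 ^+ 2) & D1 * 3 <= A2 * A5 / (3 * A3 ^+ 2)] ->
  exists b1 b2 md gy mx my ml mex mey gp : nat -> R,
  [/\ expected_run L l mu alpha beta gamma (opnorm A) (opnorm B) A1 A2 A3 A4 A5 D1 delta eps b%:R
        eta varrho iota b1 b2 md gy mx my ml mex mey gp,
      forall k, ('E_P[fun om => (enorm (gap X Y Lam Lg alpha beta gamma
          (x k.+1 om) (y k.+1 om) (lam k.+1 om)) ^+ 2)%R] = (gp k.+1)%:E)%E,
      forall k r i, 0 <= r -> gp k.+1 <= r ^+ 2 ->
        ('E_P[fun om => (Num.max 0 ((A *m x k.+1 om + B *m y k.+1 om - c) i 0))%R] <= r%:E)%E,
      (forall x0, X x0 -> exists2 y0, Y y0 & constr kind (A *m x0 + B *m y0) c) ->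
        exists M, forall k, M <= md k.+1 &
      forall k, [/\ random_vec_in X (x k.+1), random_vec_in Y (y k.+1), random_vec_in Lam (lam k.+1) &
        forall W0 d a1 a2, ('E_P[fun om => (Phi (x k.+1 om) (lam k.+1 om)
            + W0 * enorm (y k.+1 om - ys (x k.+1 om) (lam k.+1 om)) ^+ 2
            + a1 * enorm (zo_gradx (theta1 k.+1) g (x k.+1 om) (y k.+1 om)
                          - A^T *m lam k.+1 om - v k.+1 om) ^+ 2
            + a2 * enorm (zo_grady (theta2 k.+1) g (x k.+1 om) (y k.+1 om)
                          - B^T *m lam k.+1 om - w k.+1 om) ^+ 2)%R]
          - d%:E * 'E_P[fun om => (enorm (y k.+1 om - ys (x k.+1 om) (lam k.+1 om)) ^+ 2)%R]
          = (md k.+1 + (W0 - d) * gy k.+1 + a1 * mex k.+1 + a2 * mey k.+1)%R%:E)%E]].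
Proof.
move=> LamE dx0 dy0 AL wt eps0 delta0 etaE varrhoE iotaE v01 i01 t1E t2E hD1.
exists bias1, bias2, mean_dual, (moment gapy), (moment sx), (moment sy), (moment sl),
  (moment ex), (moment ey), (moment gap_at).
split.
- exact: run_holds.
- by move=> k; rewrite (expectation_Ex (moment_gap k).1).
- move=> k r i r0 hr; have [gL _] := moment_gap k.
  have [mx my _ _ _] := state_measurable k.
  pose viol om := Num.max 0 ((A *m x k.+1 om + B *m y k.+1 om - c) i 0).
  have mv : measurable_fun setT viol.
    apply: measurable_maxr; first exact: measurable_cst.
    apply: (_ : measurable_vec (fun om => A *m x k.+1 om + B *m y k.+1 om - c)).
    apply: measurable_vecB; last exact: measurable_vec_cst.
    by apply: measurable_vecD; exact: measurable_vec_mulmx.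
  have v0 om : 0 <= viol om by rewrite le_max lexx.
  have v2 om : viol om ^+ 2 <= enorm (gap_at k.+1 om) ^+ 2.
    by rewrite ler_pXn2r ?nnegrE ?enorm_ge0//; exact: (violation_le_gap LamE k om i).
  have L2 : L1 P (fun om => viol om ^+ 2).
    apply: (L1_le _ _ gL) => [|om]; first exact: measurable_funX.
    by rewrite ger0_norm ?sqr_ge0.
  have Lv : L1 P viol.
    apply: (L1_le mv _ (L1D (L1_cst P 1) L2)) => om; rewrite ger0_norm//.
    by have := sqr_ge0 (viol om - 1); move: (viol om) (v0 om) => q q0; rewrite sqrrB expr1n mulr1; nra.
  rewrite [X in (X <= _)%E](expectation_Ex Lv) lee_fin.
  rewrite -(ler_pXn2r (n := 2)) ?nnegrE//; last exact: Ex_ge0.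
  apply: le_trans (sqr_Ex_le Lv L2) _; apply: le_trans hr.
  exact: Ex_le.
- exact: dual_lower LamE.
- move=> k; have [mx my ml _ _] := state_measurable k; split.
  + by split=> // om; exact: x_in.
  + by split=> // om; exact: y_in.
  + by split=> // om; exact: lam_in.
  + by move=> W0 d a1 a2; exact: potentialE.
Qed.

End Trajectory.

(** * From the hypotheses to the step-size conditions *)

Section SizeConditions.
Variable R : realType.
Variables (L mu alpha beta gamma nA nB : R).

(** If B = 0 the extended-real quotient is infinite and the corresponding
    condition holds trivially. *)
Lemma step_sizes_intro : 0 < mu -> mu <= L -> 0 < beta <= 1 / (6 * L) ->
  0 < alpha <= mu ^+ 2 * beta / (64 * L ^+ 2) -> 0 < gamma ->
  (gamma%:E <= Order.min ((2 * alpha * L ^+ 2)%:E / (nB ^+ 2)%:E)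
                 (mu ^+ 4 * beta ^+ 2 / (1280 * L ^+ 4 * alpha))%:E)%E ->
  0 <= nB -> nB <= L -> step_sizes L mu alpha beta gamma nB.
Proof.
move=> mu0 muL /andP[be0 beL] /andP[al0 alL] ga0 gaL nB0 nBL.
have L0 : 0 < L := lt_le_trans mu0 muL.
move: gaL; rewrite le_min lee_fin => /andP[gB gL].
split=> //.
- by move: beL; rewrite invfM mulrA ler_pdivlMr.
- by move: alL; rewrite ler_pdivlMr ?mulr_gt0 ?exprn_gt0// mulrC.
- have [B0|B0] := eqVneq (nB ^+ 2) 0.
    rewrite B0 mulr0; apply: mulr_ge0; last exact: sqr_ge0.
    exact: mulr_ge0 (ler0n R 2) (ltW al0).
  move: gB; rewrite inver (negbTE B0) -EFinM lee_fin ler_pdivlMr//.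
  by rewrite lt_neqAle eq_sym B0 sqr_ge0.
- have d0 : 0 < 1280 * L ^+ 4 * alpha.
    apply: mulr_gt0 al0; apply: mulr_gt0; first exact: ltr0Sn.
    by rewrite exprn_gt0.
  by rewrite (ler_pdivlMr _ _ d0) mulrC in gL.
Qed.

Variables (A1 A2 A3 A4 A5 D1 : R) (b : nat).
Hypothesis sizes : step_sizes L mu alpha beta gamma nB.

Lemma weights_intro : (0 < b)%N -> 0 < A1 -> 0 < A2 -> 0 < A3 -> 0 < D1 -> A3 <= 1 ->
  (3 * A3 ^+ 2 * alpha + A1) / A1 <= A4 ->
  (480 * A3 ^+ 2 * alpha * L ^+ 2 + A2 * mu ^+ 2) / (A2 * mu ^+ 2) <= A5 ->
  A1 <= Num.min (b%:R / (72 * alpha * L ^+ 2))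
          (Num.min (11 * alpha * b%:R / (9 * mu * beta)) (b%:R / (144 * gamma * L ^+ 2))) ->
  A2 <= Num.min (b%:R / (72 * alpha * L ^+ 2))
          (Num.min (11 * alpha * b%:R / (9 * mu * beta)) (b%:R / (144 * gamma * L ^+ 2))) ->
  weights L mu alpha beta A1 A2 A3 A4 A5 D1 b%:R.
Proof.
case: sizes => mu0 muL be0 _ al0 _ _ _ _ _ _; have L0 : 0 < L := lt_le_trans mu0 muL.
move=> b0 A10 A20 A30 D10 A31 h4 h5.
rewrite !le_min => /andP[a1 /andP[a2 _]] /andP[a3 /andP[a4 _]].
have x0 : 0 < 72 * alpha * L ^+ 2.
  by apply: mulr_gt0; [apply: mulr_gt0 => //; exact: ltr0Sn|rewrite exprn_gt0].
have y0 : 0 < 9 * mu * beta by apply: mulr_gt0 => //; apply: mulr_gt0 => //; exact: ltr0Sn.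
have m0 : 0 < mu ^+ 2 by rewrite exprn_gt0.
split=> //; first by rewrite ltr0n.
- by move: a1; rewrite ler_pdivlMr// mulrC.
- by move: a3; rewrite ler_pdivlMr// mulrC.
- by move: a2; rewrite ler_pdivlMr// mulrC.
- by move: a4; rewrite ler_pdivlMr// mulrC.
- by move: h4; rewrite ler_pdivrMr// addrC [A4 * _]mulrC.
- move: h5; rewrite ler_pdivrMr ?mulr_gt0// => h5.
  rewrite -(ler_pM2r m0); apply: le_trans (_ : _ <= A5 * (A2 * mu ^+ 2)) _; last first.
    by rewrite mulrCA mulrA.
  apply: le_trans h5; rewrite le_eqVlt; apply/orP; left; apply/eqP.
  by field; rewrite gt_eqF.
Qed.

(** Each argument of the minimum is compared with the matching argument of the
    maximum. *)
Lemma gap_weight_spec : 0 < A1 -> 0 < A2 -> 0 < A3 -> 0 < A4 -> 0 < A5 ->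
  D1 = Num.min (1 / (4 * alpha))
       (Num.min (2 * alpha * L ^+ 2 / (mu * beta))
         (Num.min (1 / (4 * gamma))
           (Num.min (A1 * A4 / (3 * A3 ^+ 2)) (A2 * A5 / (3 * A3 ^+ 2)))))
     / Num.max (3 / alpha ^+ 2 + 3 * nA ^+ 2)
         (Num.max (3 / beta ^+ 2 + 3 * nB ^+ 2)
           (Num.max (3 / gamma ^+ 2) 3)) ->
  0 < D1 /\ [/\ D1 * (3 / alpha ^+ 2 + 3 * nA ^+ 2) <= 1 / 4 * alpha^-1,
    D1 * (3 / beta ^+ 2 + 3 * nB ^+ 2) <= 2 * (alpha * L ^+ 2 / (mu * beta)),
    D1 * (3 / gamma ^+ 2) <= 1 / 4 * gamma^-1,
    D1 * 3 <= A1 * A4 / (3 * A3 ^+ 2) & D1 * 3 <= A2 * A5 / (3 * A3 ^+ 2)].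
Proof.
case: sizes => mu0 muL be0 _ al0 _ ga0 _ _ _ _; have L0 : 0 < L := lt_le_trans mu0 muL.
move=> A10 A20 A30 A40 A50.
set m := Num.min _ _; set M := Num.max _ _ => D1E.
have A32 : 0 < 3 * A3 ^+ 2 by rewrite mulr_gt0 ?exprn_gt0.
have m0 : 0 < m.
  rewrite !lt_min; apply/and5P; split.
  - by rewrite divr_gt0// mulr_gt0.
  - rewrite divr_gt0//; last exact: mulr_gt0.
    by apply: mulr_gt0; [exact: mulr_gt0|rewrite exprn_gt0].
  - by rewrite divr_gt0// mulr_gt0.
  - by rewrite divr_gt0// mulr_gt0.
  - by rewrite divr_gt0// mulr_gt0.
have M0 : 0 < M by rewrite !lt_max ltr0n !orbT.
have D10 : 0 < D1 by rewrite D1E divr_gt0.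
have DM : D1 * M = m by rewrite D1E divfK// gt_eqF.
have le_m (q r : R) : q <= M -> m <= r -> D1 * q <= r.
  by move=> qM mr; apply: le_trans mr; rewrite -DM ler_pM2l.
have e (r : R) : 0 < r -> 1 / 4 * r^-1 = 1 / (4 * r) by move=> r0; field; rewrite gt_eqF.
split=> //; split; apply: le_m; rewrite /m /M ?le_max ?ge_min ?lexx ?orbT//.
- by rewrite e// lexx.
- by rewrite mulrA mulrA lexx !orbT.
- by rewrite e// lexx !orbT.
Qed.

End SizeConditions.

Theorem theorem3p11
  (R : realType) (dx dy p : nat) (dx_gt0 : (0 < dx)%N) (dy_gt0 : (0 < dy)%N)
  (* problem data *)
  (X : set 'cV[R]_dx) (Y : set 'cV[R]_dy)
  (X_neq0 : X !=set0) (X_convex : convex_set X) (X_compact : compact X)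
  (Y_neq0 : Y !=set0) (Y_convex : convex_set Y) (Y_compact : compact Y)
  (A : 'M[R]_(p, dx)) (B : 'M[R]_(p, dy)) (c : 'cV[R]_p) (kind : constr_kind)
  (Lam : set 'cV[R]_p) (LamE : Lam = multipliers kind)
  (dZ : measure_display) (Z : measurableType dZ) (D : probability Z R)
  (* G lives on an open domain U x V that contains X x Y and all the points at
     which the estimators evaluate G (see H_query) *)
  (U : set 'cV[R]_dx) (V : set 'cV[R]_dy) (U_open : open U) (V_open : open V)
  (XU : X `<=` U) (YV : Y `<=` V)
  (G : 'cV[R]_dx -> 'cV[R]_dy -> Z -> R)
  (G_smooth : forall z x y, U x -> V y ->
     differentiable (fun q : 'cV[R]_dx * 'cV[R]_dy => G q.1 q.2 z) (x, y))
  (G_integrable : forall x y, U x -> V y ->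
     D.-integrable setT (fun z => (G x y z)%:E))
  (g : 'cV[R]_dx -> 'cV[R]_dy -> R)
  (gE : forall x y, g x y = \int[D]_z G x y z)
  (mu : R) (mu_gt0 : 0 < mu)
  (G_concave : forall z x, X x -> strongly_concave_on V mu (fun y => G x y z))
  (* feasibility *)
  (H_feasible : kind = Le_constr -> forall x, X x ->
     exists2 y, relint Y y & constr kind (A *m x + B *m y) c)
  (* Lipschitz gradients *)
  (l L : R) (l_gt0 : 0 < l)
  (H_lipschitz : forall z, lipschitz_gradients U V l (fun x y => G x y z))
  (LE : L = Num.max l (Num.max (opnorm A) (opnorm B)))
  (* algorithm parameters *)
  (alpha beta gamma eps : R) (b : nat) (b_gt0 : (0 < b)%N) (eps_gt0 : 0 < eps)
  (A1 A2 A3 A4 A5 D1 : R)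
  (A1_gt0 : 0 < A1) (A2_gt0 : 0 < A2) (A3_gt0 : 0 < A3)
  (eta varrho iota theta1 theta2 : nat -> R)
  (etaE : forall k, (0 < k)%N -> eta k = A3 / k.+2%:R `^ (1 / 3))
  (varrhoE : forall k, (0 < k)%N -> varrho k = A4 / k.+2%:R `^ (2 / 3))
  (iotaE : forall k, (0 < k)%N -> iota k = A5 / k.+2%:R `^ (2 / 3))
  (theta1E : forall k, (0 < k)%N -> theta1 k =
     eps / (L * k.+2%:R `^ (1 / 3)) *
     Num.sqrt (D1 / (dx%:R * (3 * D1 + 4 * alpha
                               + 12 * A1 / (b%:R * A3 ^+ 2)))))
  (theta2E : forall k, (0 < k)%N -> theta2 k =
     eps / (L * k.+2%:R `^ (1 / 3)) *
     Num.sqrt (D1 / (dy%:R * (3 * D1 + 12 * A2 / (b%:R * A3 ^+ 2)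
                               + 320 * alpha * L ^+ 2 / mu ^+ 2))))
  (D1E : D1 =
     Num.min (1 / (4 * alpha))
       (Num.min (2 * alpha * L ^+ 2 / (mu * beta))
         (Num.min (1 / (4 * gamma))
           (Num.min (A1 * A4 / (3 * A3 ^+ 2)) (A2 * A5 / (3 * A3 ^+ 2)))))
     / Num.max (3 / alpha ^+ 2 + 3 * opnorm A ^+ 2)
         (Num.max (3 / beta ^+ 2 + 3 * opnorm B ^+ 2)
           (Num.max (3 / gamma ^+ 2) 3)))
  (eta_01 : forall k, (0 < k)%N -> 0 < eta k <= 1)
  (varrho_01 : forall k, (0 < k)%N -> 0 < varrho k <= 1)
  (iota_01 : forall k, (0 < k)%N -> 0 < iota k <= 1)
  (A3_le : A3 <= Num.min 1 (Num.min (mu / (8 * alpha * L ^+ 2))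
                                    (mu / (4 * gamma * L ^+ 2))))
  (A4_ge : (3 * A3 ^+ 2 * alpha + A1) / A1 <= A4)
  (A5_ge : (480 * A3 ^+ 2 * alpha * L ^+ 2 + A2 * mu ^+ 2) / (A2 * mu ^+ 2)
           <= A5)
  (A1_le : A1 <= Num.min (b%:R / (72 * alpha * L ^+ 2))
                   (Num.min (11 * alpha * b%:R / (9 * mu * beta))
                            (b%:R / (144 * gamma * L ^+ 2))))
  (A2_le : A2 <= Num.min (b%:R / (72 * alpha * L ^+ 2))
                   (Num.min (11 * alpha * b%:R / (9 * mu * beta))
                            (b%:R / (144 * gamma * L ^+ 2))))
  (beta_bnd : 0 < beta <= 1 / (6 * L))
  (alpha_bnd : 0 < alpha <= mu ^+ 2 * beta / (64 * L ^+ 2))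
  (gamma_gt0 : 0 < gamma)
  (* extended-real quotient: no restriction from the first term if B = 0 *)
  (gamma_le : (gamma%:E <=
     Order.min ((2 * alpha * L ^+ 2)%:E / (opnorm B ^+ 2)%:E)
               (mu ^+ 4 * beta ^+ 2 / (1280 * L ^+ 4 * alpha))%:E)%E)
  (* monotonicity *)
  (H_theta1 : forall k, (0 < k)%N -> 0 <= theta1 k /\ theta1 k.+1 <= theta1 k)
  (H_theta2 : forall k, (0 < k)%N -> 0 <= theta2 k /\ theta2 k.+1 <= theta2 k)
  (H_query : forall k (t : R), (0 < k)%N -> 0 <= t <= 1 ->
     (forall x i, X x -> U (x + (t * theta1 k) *: basis_vec R i)) /\
     (forall y i, Y y -> V (y + (t * theta2 k) *: basis_vec R i)))
  (* variance *)
  (delta : R) (delta_gt0 : 0 < delta)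
  (H_variance : forall k x y, (0 < k)%N -> X x -> Y y ->
     ('E_D[fun z => (enorm (zo_gradx (theta1 k) (fun x' y' => G x' y' z) x y
                           - zo_gradx (theta1 k) g x y) ^+ 2)%R]
        <= (delta ^+ 2)%:E)%E /\
     ('E_D[fun z => (enorm (zo_grady (theta2 k) (fun x' y' => G x' y' z) x y
                           - zo_grady (theta2 k) g x y) ^+ 2)%R]
        <= (delta ^+ 2)%:E)%E)
  (* the sequence generated by the algorithm *)
  (dO : measure_display) (Omega : measurableType dO) (P : probability Omega R)
  (zeta : nat -> 'I_b -> Omega -> Z) (zeta_iid : iid_samples P D zeta)
  (x1 : 'cV[R]_dx) (y1 : 'cV[R]_dy) (lam1 : 'cV[R]_p)
  (x1_in : X x1) (y1_in : Y y1) (lam1_in : Lam lam1)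
  (x xt : nat -> Omega -> 'cV[R]_dx) (y yt : nat -> Omega -> 'cV[R]_dy)
  (lam lamt : nat -> Omega -> 'cV[R]_p)
  (v : nat -> Omega -> 'cV[R]_dx) (w : nat -> Omega -> 'cV[R]_dy)
  (H_algo : zo_rmpdpg X Y Lam A B c G alpha beta gamma
              eta varrho iota theta1 theta2 x1 y1 lam1 zeta
              x xt y yt lam lamt v w)
  (* potential functions, as functionals of random points *)
  (Lg : 'cV[R]_dx -> 'cV[R]_dy -> 'cV[R]_p -> R) (LgE : Lg = lagrangian A B c g)
  (F S : nat -> (Omega -> 'cV[R]_dx) -> (Omega -> 'cV[R]_dy) ->
         (Omega -> 'cV[R]_p) -> \bar R)
  (FE : forall k rx ry rl, (0 < k)%N -> F k.+1 rx ry rl =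
     'E_P[fun om =>
        (dual_val Y Lg (rx om) (rl om)
        + 32 * alpha * L ^+ 2 / (beta * mu)
          * enorm (ry om - dual_argmax Y Lg (rx om) (rl om)) ^+ 2
        + A1 / eta k
          * enorm (zo_gradx (theta1 k.+1) g (rx om) (ry om) - A^T *m rl om
                   - v k.+1 om) ^+ 2
        + A2 / eta k
          * enorm (zo_grady (theta2 k.+1) g (rx om) (ry om) - B^T *m rl om
                   - w k.+1 om) ^+ 2)%R]%E)
  (SE : forall k rx ry rl, (0 < k)%N -> S k.+1 rx ry rl =
     (F k.+1 rx ry rl
      - (4 * eta k * alpha * L ^+ 2)%:E
        * 'E_P[fun om =>
             (enorm (ry om - dual_argmax Y Lg (rx om) (rl om)) ^+ 2)%R])%E)
  (S_inf : \bar R)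
  (S_infE : S_inf = ereal_inf [set s | exists k rx ry rl,
     [/\ (0 < k)%N, random_vec_in X rx, random_vec_in Y ry,
         random_vec_in Lam rl & s = S k.+1 rx ry rl]])
  (* constants of the bound *)
  (sigma_y C2 : R) (C1 : \bar R)
  (sigma_yE : sigma_y = sup [set enorm u | u in Y])
  (C1E : C1 = (S 2%N (x 2%N) (y 2%N) (lam 2%N) - S_inf
               + (16 * alpha * L ^+ 2 * eta 1%N * sigma_y ^+ 2)%:E)%E)
  (C2E : C2 = 2 * delta ^+ 2 * (A4 ^+ 2 * A1 + A5 ^+ 2 * A2) / (b%:R * A3))
  (* squared stationarity gap *)
  (gap2 : nat -> \bar R)
  (gap2E : forall k, gap2 k =
     'E_P[fun om => (enorm (gap X Y Lam Lg alpha beta gamma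
                             (x k om) (y k om) (lam k om)) ^+ 2)%R]%E) :
  ((forall x0, X x0 -> exists2 y0, Y y0 & constr kind (A *m x0 + B *m y0) c) ->
     exists T2, least_index (fun k => (gap2 k <= (eps ^+ 2)%:E)%E) T2)
  /\
  forall T2, least_index (fun k => (gap2 k <= (eps ^+ 2)%:E)%E) T2 ->
    (* extended-real quotient: for T2 = 1 the denominator is 0 and the quotient
       of a positive number by it is +oo *)
    ((eps ^+ 2 / 4)%:E <=
       (C1 + (C2 * ln (T2%:R + 2))%:E)
       / (D1 * A3 * (3 / 2 * (T2%:R + 3) `^ (2 / 3)
                     - 3 * 4 `^ (2 / 3) / 2))%:E)%E
    /\
    forall i : 'I_p,
      ('E_P[fun om => (Num.max 0 ((A *m x T2 om + B *m y T2 om - c) i 0))%R]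
         <= eps%:E)%E.
Proof.
have l_ge0 := ltW l_gt0.
have lL : l <= L by rewrite LE le_max lexx.
have AL : opnorm A <= L by rewrite LE !le_max lexx orbT.
have BL : opnorm B <= L by rewrite LE !le_max lexx !orbT.
have GL1 x0 y0 : U x0 -> V y0 -> L1 D (G x0 y0) := G_integrable x0 y0.
have gm : g = mean_objective D G by apply/funext => x0; apply/funext => y0; exact: gE.
have sG z0 : smooth_pair U V l (fun x0 y0 => G x0 y0 z0).
  exact: differentiable_smooth_pair (G_smooth z0) (H_lipschitz z0).
have gconc x0 : X x0 -> strongly_concave_on V mu (mean_objective D G x0).
  by move=> Xx; apply: (expectation_concave V_open l_ge0 sG GL1 (XU _ Xx)) => z0; exact: G_concave.
have gs : smooth_pair U V l (mean_objective D G).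
  exact: expectation_smooth U_open V_open l_ge0 sG GL1.
have muL : mu <= L.
  apply: le_trans lL; have [x0 Xx0] := X_neq0; have [y0 Yy0] := Y_neq0.
  apply: (strong_concavity_le_lipschitz dy_gt0 V_open (ex_intro _ y0 (YV _ Yy0)) (gconc _ Xx0)).
  move=> y2 y3 Vy2 Vy3.
  by have [_ _ h _] := smooth_lip gs (XU _ Xx0) (XU _ Xx0) (XU _ Xx0) Vy2 Vy2 Vy3.
have sizes : step_sizes L mu alpha beta gamma (opnorm B).
  exact: step_sizes_intro mu_gt0 muL beta_bnd alpha_bnd gamma_gt0 gamma_le (opnorm_ge0 B) BL.
have L_gt0 : 0 < L := lt_le_trans mu_gt0 muL.
have crt_pos k : 0 < crt k.+2%:R :> R by rewrite crt_gt0.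
have varrhoE' k : varrho k.+1 = A4 / crt k.+3%:R ^+ 2 by rewrite varrhoE// powR23.
have iotaE' k : iota k.+1 = A5 / crt k.+3%:R ^+ 2 by rewrite iotaE// powR23.
have A4_gt0 : 0 < A4.
  have /andP[+ _] := varrho_01 1%N isT; rewrite varrhoE'.
  by rewrite pmulr_lgt0// invr_gt0 exprn_gt0.
have A5_gt0 : 0 < A5.
  have /andP[+ _] := iota_01 1%N isT; rewrite iotaE'.
  by rewrite pmulr_lgt0// invr_gt0 exprn_gt0.
have [D1_gt0 D1_le] := gap_weight_spec sizes A1_gt0 A2_gt0 A3_gt0 A4_gt0 A5_gt0 D1E.
have A3_le1 : A3 <= 1 by move: A3_le; rewrite le_min => /andP[].
have wts := weights_intro sizes b_gt0 A1_gt0 A2_gt0 A3_gt0 D1_gt0 A3_le1 A4_ge A5_ge A1_le A2_le.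
have al0 := ss_alpha sizes; have b0 := wt_b wts.
have w_ge0 (a : R) : 0 < a -> 0 <= 12 * a / (b%:R * A3 ^+ 2).
  move=> a0; apply: divr_ge0; first exact: mulr_ge0 (ler0n R 12) (ltW a0).
  exact: mulr_ge0 (ltW b0) (sqr_ge0 _).
have km_ge0 : 0 <= 320 * (alpha * L ^+ 2 / mu ^+ 2).
  apply: mulr_ge0; first exact: ler0n.
  by apply: divr_ge0; [apply: mulr_ge0; [exact: ltW|]|]; exact: sqr_ge0.
have theta_gt0 (d : nat) (Q : R) k : (0 < d)%N -> 0 < Q ->
    0 < eps / (L * k.+3%:R `^ (1 / 3)) * Num.sqrt (D1 / (d%:R * Q)).
  move=> d0 Q0; apply: mulr_gt0; first by rewrite divr_gt0// mulr_gt0// powR_gt0.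
  by rewrite sqrtr_gt0 divr_gt0// mulr_gt0// ltr0n.
have D13 : 0 < 3 * D1 by rewrite mulr_gt0.
have t1_gt0 k : (0 < k)%N -> 0 < theta1 k /\ theta1 k.+1 <= theta1 k.
  case: k => // k k0; split; last exact: (H_theta1 _ k0).2.
  rewrite theta1E//; apply: theta_gt0 => //.
  by rewrite ltr_wpDr ?w_ge0// addr_gt0// mulr_gt0.
have kmE : 320 * alpha * L ^+ 2 / mu ^+ 2 = 320 * (alpha * L ^+ 2 / mu ^+ 2) by rewrite !mulrA.
have t2_gt0 k : (0 < k)%N -> 0 < theta2 k /\ theta2 k.+1 <= theta2 k.
  case: k => // k k0; split; last exact: (H_theta2 _ k0).2.
  rewrite (theta2E k.+1 isT) kmE; apply: theta_gt0; first exact: dy_gt0.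
  by apply: ltr_wpDr km_ge0 _; rewrite ltr_wpDr ?w_ge0.
subst g Lg.
have [b1 [b2 [md [gy [mx [my [ml [mex [mey [gp [run gapEx viol lower pot]]]]]]]]]]] :=
  trajectory_summary zeta_iid b_gt0
  (compact_proximinal X_neq0 X_convex X_compact) XU U_open X_compact
  (compact_proximinal Y_neq0 Y_convex Y_compact) YV V_open Y_neq0 Y_compact
  (ltac:(by rewrite LamE; exact: multipliers_proximinal) : proximinal Lam)
  l_ge0 mu_gt0 sG GL1 gconc sizes lL eta_01 t1_gt0 t2_gt0 H_query H_variance
  x1_in y1_in lam1_in H_algo LamE dx_gt0 dy_gt0 AL wts eps_gt0 delta_gt0
  (fun k => etaE k.+1 isT) varrhoE' iotaE'
  (fun k => varrho_01 k.+1 isT) (fun k => iota_01 k.+1 isT)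
  (fun k => theta1E k.+1 isT)
  (fun k => etrans (theta2E k.+1 isT) (congr1 (fun r => eps / (L * crt k.+3%:R) *
     Num.sqrt (D1 / (dy%:R * (3 * D1 + 12 * A2 / (b%:R * A3 ^+ 2) + r)))) kmE)) D1_le.
have small k : (gap2 k.+1 <= (eps ^+ 2)%:E)%E = (gp k.+1 <= eps ^+ 2).
  by rewrite gap2E gapEx lee_fin.
split.
  move=> /lower [M hM]; have [T T0 hT] := exists_small_gap sizes wts run hM.
  have ex : exists k, (0 < k)%N && (gp k <= eps ^+ 2) by exists T; rewrite T0.
  case: (ex_minnP ex) => m /andP[m0 hm] mmin; exists m; split=> //.
    by case: m m0 hm {mmin} => // m _ hm; rewrite small.
  by case=> // k _; rewrite small => hk; exact: mmin.
move=> T2 [T0 hT Tmin].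
have T2E : T2 = T2.-1.+1 by rewrite prednK.
split; last first.
  move=> i; rewrite T2E; apply: viol; first exact: ltW.
  by rewrite -small -T2E.
pose P_ := potential L mu alpha beta A1 A2 eta md gy mex mey.
have S_real k : S k.+2 (x k.+2) (y k.+2) (lam k.+2) = (P_ k.+2)%:E.
  by rewrite SE// FE//; have [_ _ _ ->] := pot k.+1.
have S_inf_le k : (S_inf <= (P_ k.+2)%:E)%E.
  rewrite S_infE -S_real; apply: ereal_inf_lbound.
  exists k.+1, (x k.+2), (y k.+2), (lam k.+2); have [px py pl _] := pot k.+1.
  by split.
have C2_gt0 : 0 < C2.
  rewrite C2E; apply: divr_gt0; last exact: mulr_gt0.
  apply: mulr_gt0; first by rewrite mulr_gt0 ?exprn_gt0.
  by apply: addr_gt0; rewrite mulr_gt0 ?exprn_gt0.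
set q := 16 * alpha * L ^+ 2 * eta 1%N * sigma_y ^+ 2 in C1E.
have q_ge0 : 0 <= q.
  have /andP[e0 _] := eta_01 1%N isT.
  apply: mulr_ge0; last exact: sqr_ge0.
  apply: mulr_ge0; last exact: ltW.
  apply: mulr_ge0; last exact: sqr_ge0.
  by apply: mulr_ge0; [exact: ler0n|exact: ltW].
(* a real lower bound of the numerator, also when S_inf is infinite *)
have C1_ge k r : ((P_ 2 - P_ k.+2 + r)%:E <= C1 + r%:E)%E.
  rewrite C1E S_real; move: (S_inf_le k); move: (S_inf) => [s||] // hs.
  - rewrite -EFinB -!EFinD lee_fin lerD2r; move: hs; rewrite lee_fin => hs.
    by rewrite -[leLHS]addr0; apply: lerD q_ge0; rewrite lerD2l lerN2.
  - by rewrite /= leey.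
rewrite !powR23; have [T1|T1] := eqVneq T2 1%N.
  have -> : D1 * A3 * (3 / 2 * crt (T2%:R + 3) ^+ 2 - 3 * crt 4 ^+ 2 / 2) = 0.
    have -> : T2%:R + 3 = 4 :> R by rewrite T1; ring.
    by field.
  rewrite inve0 gt0_muley ?leey//; apply: lt_le_trans (C1_ge 0 _).
  rewrite subrr add0r lte_fin mulr_gt0// ln_gt0// ltr_wpDl//.
  by rewrite ltr1n.
have T2_gt1 : (1 < T2)%N by rewrite ltn_neqAle eq_sym T1.
have big k : (0 < k < T2)%N -> eps ^+ 2 < gp k.
  case: k => // k /andP[_ kT]; rewrite ltNge -small; apply/negP => /(Tmin k.+1 isT).
  by rewrite leqNgt kT.
have [k bound] : exists k, eps ^+ 2 / 4
    * (D1 * A3 * (3 / 2 * crt (T2%:R + 3) ^+ 2 - 3 * crt 4 ^+ 2 / 2))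
    <= P_ 2 - P_ k.+2 + C2 * ln (T2%:R + 2).
  have [T22|T22] := eqVneq T2 2.
    exists 1; have -> : T2%:R + 3 = 5 :> R by rewrite T22; ring.
    have -> : T2%:R + 2 = 4 :> R by rewrite T22; ring.
    by rewrite C2E; apply: (rate_2 sizes wts run); apply: big.
  have T2_gt2 : (2 < T2)%N by rewrite ltn_neqAle eq_sym T22.
  exists T2.-2; rewrite C2E.
  have -> : T2.-2.+2 = T2 by case: (T2) T2_gt1 => [|[]].
  apply: (rate_ge3 sizes wts run T2_gt2) => k /andP[k1 kT]; apply: big.
  by rewrite (ltnW k1).
have den_gt0 : 0 < D1 * A3 * (3 / 2 * crt (T2%:R + 3) ^+ 2 - 3 * crt 4 ^+ 2 / 2).
  apply: mulr_gt0; first exact: mulr_gt0.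
  have h : crt 4 ^+ 2 < crt (T2%:R + 3) ^+ 2 :> R.
    have a0 : 0 <= T2%:R + 3 :> R by rewrite addr_ge0.
    rewrite ltr_pXn2r ?nnegrE ?powR_ge0// -(ltr_pXn2r (n := 3)) ?nnegrE ?powR_ge0//.
    by rewrite !crt3// -natrD ltr_nat addn3 !ltnS.
  by move: h; move: (crt 4 ^+ 2 : R) (crt (T2%:R + 3) ^+ 2) => r1 r2; glra.
rewrite inver gt_eqF// lee_pdivlMr// -EFinM; apply: le_trans (C1_ge k _).
by rewrite lee_fin.
Qed.
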